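(* Let $\mu$ be a $3$-uniform measure on $(\mathbb{H},d_H)$. Then $\operatorname{spt}\mu$ is a two-dimensional real analytic variety. If $\operatorname{spt}\mu$ is a vertically ruled real analytic surface, then $\mu$ is proportional to $\mathcal{S}^3\llcorner W$ (the restriction of $\mathcal S^3$ to $W$), where $W$ is an affine vertical plane.
   Context: The first Heisenberg group $\mathbb{H}$ is $\mathbb{R}^3$ with the group law $(x_1,x_2,x_3)*(y_1,y_2,y_3)=(x_1+y_1,\,x_2+y_2,\,x_3+y_3-2x_1y_2+2x_2y_1)$. It is equipped with the Korányi metric $d_H(x,y)=\|x^{-1}*y\|_H$, where $\|(x_1,x_2,x_3)\|_H^4=(x_1^2+x_2^2)^2+x_3^2$. $B_H(x,r)$ is the closed $d_H$-ball with center $x$ and radius $r$. For $s\ge 0$, a nonzero Borel measure $\mu$ on $\mathbb{H}$ is $s$-uniform if there is a constant $c>0$ such that $\mu(B_H(x,r))=cr^s$ for all $x\in\operatorname{spt}\mu$ and all $r>0$. $\mathcal{S}^s$ is the $s$-dimensional spherical Hausdorff measure of $(\mathbb{H},d_H)$: $\mathcal S^s(A)=\lim_{\delta\to0}\inf\{\sum_i(\operatorname{diam}E_i)^s: A\subset\bigcup_i E_i,\ \operatorname{diam}E_i<\delta\}$, where the $E_i$ range over $d_H$-balls. By Łojasiewicz's theorem a real analytic variety is a countable union of real analytic submanifolds; its dimension is the maximal (topological) dimension of these submanifolds. A real analytic surface is a two-dimensional real analytic submanifold of $\mathbb{R}^3$. A surface is vertically ruled if it is locally a level set $\{u=0\}$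 of a defining function $u$ (with nonvanishing gradient) depending only on $x_1$ and $x_2$. An affine vertical plane is a left coset of a subgroup $\{x: ax_1+bx_2=0\}$, $(a,b)\neq(0,0)$, i.e. a set $\{x: ax_1+bx_2=c\}$. *)

(* Defs.v *)
From HB Require Import structures.
From mathcomp Require Import all_boot all_order all_algebra.
From mathcomp Require Import ring.
From mathcomp Require Import all_classical all_reals all_analysis.

Set Implicit Arguments.
Unset Strict Implicit.
Unset Printing Implicit Defensive.
Import Order.TTheory GRing.Theory Num.Theory.
Import numFieldNormedType.Exports.
Local Open Scope classical_set_scope.
Local Open Scope ring_scope.

Section Heisenberg.
Variable R : realType.

Definition heis := 'rV[R]_3.

Definition hx1 (x : heis) : R := x 0 0.
Definition hx2 (x : heis) : R := x 0 1.
Definition hx3 (x : heis) : R := x 0 2.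

Definition hpoint (a b c : R) : heis := \row_(j < 3) [:: a; b; c]`_j.

Definition hmul (x y : heis) : heis :=
  hpoint (hx1 x + hx1 y) (hx2 x + hx2 y)
    (hx3 x + hx3 y - 2 * hx1 x * hx2 y + 2 * hx2 x * hx1 y).

Definition hid : heis := hpoint 0 0 0.

Definition hinv (x : heis) : heis := hpoint (- hx1 x) (- hx2 x) (- hx3 x).

Lemma hpoint1 a b c : hx1 (hpoint a b c) = a.
Proof. by rewrite /hx1 mxE. Qed.

Lemma hpoint2 a b c : hx2 (hpoint a b c) = b.
Proof. by rewrite /hx2 mxE. Qed.

Lemma hpoint3 a b c : hx3 (hpoint a b c) = c.
Proof. by rewrite /hx3 mxE. Qed.

Definition hpointE := (hpoint1, hpoint2, hpoint3).

Lemma heisP (x y : heis) :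
  hx1 x = hx1 y -> hx2 x = hx2 y -> hx3 x = hx3 y -> x = y.
Proof.
move=> e1 e2 e3; apply/rowP => -[[|[|[|//]]] lt_j3].
- by rewrite (_ : Ordinal _ = 0)//; exact/val_inj.
- by rewrite (_ : Ordinal _ = 1)//; exact/val_inj.
- by rewrite (_ : Ordinal _ = 2)//; exact/val_inj.
Qed.

Lemma hmulA : associative hmul.
Proof. by move=> x y z; apply: heisP; rewrite /hmul !hpointE; ring. Qed.

Lemma hmul1x : left_id hid hmul.
Proof. by move=> x; apply: heisP; rewrite /hmul /hid !hpointE; ring. Qed.

Lemma hmulVx : left_inverse hid hinv hmul.
Proof. by move=> x; apply: heisP; rewrite /hmul /hid /hinv !hpointE; ring. Qed.

Definition hnorm (x : heis) : R :=
  ((hx1 x ^+ 2 + hx2 x ^+ 2) ^+ 2 + hx3 x ^+ 2) `^ (4^-1).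

Lemma hnormX4 x :
  hnorm x ^+ 4 = (hx1 x ^+ 2 + hx2 x ^+ 2) ^+ 2 + hx3 x ^+ 2.
Proof.
rewrite -powR_mulrn ?powR_ge0// -powRrM mulVf ?pnatr_eq0// powRr1//.
by rewrite addr_ge0 ?sqr_ge0.
Qed.

Definition hdist (x y : heis) : R := hnorm (hmul (hinv x) y).

Definition hball (x : heis) (r : R) : set heis := [set y | hdist x y <= r].

Definition hdiam (A : set heis) : \bar R :=
  ereal_sup [set (hdist x y)%:E | x in A & y in A].

(* The index set [D] makes finite covers available. *)
Definition spherical_premeasure (s delta : R) (A : set heis) : \bar R :=
  ereal_inf [set t | exists (D : set nat) (x : nat -> heis) (r : nat -> R),
    [/\ forall i, D i -> 0 < r i /\ (hdiam (hball (x i) (r i)) < delta%:E)%E,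
        A `<=` \bigcup_(i in D) hball (x i) (r i) &
        t = \esum_(i in D) poweR (hdiam (hball (x i) (r i))) s]].

Definition spherical_hausdorff (s : R) (A : set heis) : \bar R :=
  lim (spherical_premeasure s delta A @[delta --> 0^'+]).

(* The Korányi metric induces the Euclidean topology, so these are the Borel
   sets of the metric space. *)
Definition heisBorel := g_sigma_algebraType (@open heis).

Definition msupport (mu : set heis -> \bar R) : set heis :=
  [set x | forall r, 0 < r -> (0 < mu (hball x r))%E].

Definition uniform_measure (s : R) (mu : {measure set heisBorel -> \bar R}) :=
  mu setT <> 0%E /\
  exists2 c : R, 0 < c &
    forall x r, msupport mu x -> 0 < r -> mu (hball x r) = (c * r `^ s)%:E.

Definition vertical_subgroup (a b : R) : set heis :=
  [set x | a * hx1 x + b * hx2 x = 0].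

Definition affine_vertical_plane (W : set heis) :=
  exists (a b : R) (p : heis),
    (a, b) <> (0, 0) /\ W = hmul p @` vertical_subgroup a b.

Lemma affine_vertical_planeP (W : set heis) :
  affine_vertical_plane W <->
  exists a b c : R,
    (a, b) <> (0, 0) /\ W = [set x | a * hx1 x + b * hx2 x = c].
Proof.
have linE a b p x : a * hx1 (hmul p x) + b * hx2 (hmul p x) =
    (a * hx1 p + b * hx2 p) + (a * hx1 x + b * hx2 x).
  by rewrite /hmul !hpointE; ring.
have planeE a b p : hmul p @` vertical_subgroup a b =
    [set x | a * hx1 x + b * hx2 x = a * hx1 p + b * hx2 p].
  apply/seteqP; split=> [_ [x x0 <-]|x /= xE].
    by rewrite /= linE x0 addr0.
  have mulK : hmul p (hmul (hinv p) x) = x.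
    by apply: heisP; rewrite /hmul /hinv !hpointE; ring.
  exists (hmul (hinv p) x) => //; rewrite /vertical_subgroup /=.
  by apply: (addrI (a * hx1 p + b * hx2 p)); rewrite -linE mulK addr0.
split=> [[a [b [p [ab0 ->]]]]|[a [b [c [ab0 ->]]]]].
  by exists a, b, (a * hx1 p + b * hx2 p).
have n0 : a ^+ 2 + b ^+ 2 != 0.
  rewrite paddr_eq0 ?sqr_ge0// !sqrf_eq0; apply/negP => /andP[/eqP a0 /eqP b0].
  by apply: ab0; rewrite a0 b0.
exists a, b,
  (hpoint (a * c / (a ^+ 2 + b ^+ 2)) (b * c / (a ^+ 2 + b ^+ 2)) 0).
split=> //; rewrite planeE !hpointE.
by rewrite (_ : a * (a * c / _) + _ = c); last by field.
Qed.

End Heisenberg.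

Section Analytic.
Variable R : realType.

Definition monomial n (a x : 'rV[R]_n) (k : {ffun 'I_n -> nat}) : R :=
  \prod_(i < n) (x 0 i - a 0 i) ^+ k i.

(* The sum of an absolutely convergent family is the difference of the sums of
   its positive and negative parts. *)
Definition analytic_at n (f : 'rV[R]_n -> R) (a : 'rV[R]_n) :=
  exists c : {ffun 'I_n -> nat} -> R, \forall x \near a,
    let t := fun k => (c k * monomial a x k)%:E in
    summable [set: {ffun 'I_n -> nat}] t /\
    ((f x)%:E = \esum_(k in setT) (t^\+ k) - \esum_(k in setT) (t^\- k))%E.

Definition partial n (f : 'rV[R]_n -> R) (j : 'I_n) (x : 'rV[R]_n) : R :=
  'D_(delta_mx 0 j) f x.

Definition gradient n (f : 'rV[R]_n -> R) (x : 'rV[R]_n) : 'rV[R]_n :=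
  \row_j partial f j x.

Definition analytic_submanifold n (d : nat) (M : set 'rV[R]_n) :=
  (d <= n)%N /\
  forall p, M p ->
    exists (U : set 'rV[R]_n) (u : 'I_(n - d) -> 'rV[R]_n -> R),
      [/\ open U /\ U p,
          forall i x, U x -> analytic_at (u i) x,
          forall x, U x -> row_free (\matrix_(i, j) partial (u i) j x) &
          M `&` U = [set x | forall i, u i x = 0] `&` U].

(* A single globally defined function: this is stronger than being locally the
   common zero set of finitely many analytic functions. *)
Definition analytic_variety n (V : set 'rV[R]_n) :=
  exists f : 'rV[R]_n -> R,
    (forall x, analytic_at f x) /\ V = [set x | f x = 0].

(* The pieces are nonempty because the empty set is a submanifold of every
   dimension; in particular the empty variety has no dimension. *)
Definition variety_dim n (V : set 'rV[R]_n) (d : nat) :=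
  exists (M : nat -> set 'rV[R]_n) (k : nat -> nat),
    [/\ forall i, M i !=set0 /\ analytic_submanifold (k i) (M i),
        V = \bigcup_i M i,
        forall i, (k i <= d)%N &
        exists i, k i = d].

Definition analytic_surface (M : set 'rV[R]_3) := analytic_submanifold 2 M.

Definition C1_on n (U : set 'rV[R]_n) (u : 'rV[R]_n -> R) :=
  forall x, U x -> differentiable u x /\ {for x, continuous (gradient u)}.

(* The defining function is only required to be C^1; its domain U need not have
   connected vertical fibers, so dependence on the first two coordinates is not
   expressed by the vanishing of the third partial derivative. *)
Definition vertically_ruled (M : set (heis R)) :=
  forall p, M p ->
    exists (U : set 'rV[R]_3) (u : 'rV[R]_3 -> R),
      [/\ open U /\ U p,
          C1_on U u,
          forall x, U x -> gradient u x <> 0,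
          forall x y, U x -> U y -> hx1 x = hx1 y -> hx2 x = hx2 y ->
            u x = u y &
          M `&` U = [set x | u x = 0] `&` U].

End Analytic.

(* Main.v *)
(* Let G_n(x) be the integral of exp(- n d(x, y)^4) against mu(dy).  By
   uniformity G_n is constant on the support; since d(x, y)^4 is a polynomial,
   f(x) = sum_n (G_n(x) - G_n(x0))^2 / n!, with x0 in the support, is analytic
   on the whole space.  The numbers G_n(x) determine the image of mu under
   d(x, .)^4, so the support is exactly the zero set of f.

   An analytic zero set is stratified by chains of iterated derivatives of f,
   and so is a countable union of submanifolds.  No piece is open, since packing
   too many disjoint balls contradicts the r^3 growth; and the pieces of
   dimension at most 1 do not suffice, since a Lipschitz curve is covered by
   about n^2 balls of radius 1/n and hence is negligible.

   In the ruled case the support is invariant under vertical translations, and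
   so is mu, because two uniform measures with the same support and the same
   masses of balls coincide.  Inverting an Abel transform, the part of mu in a
   horizontal slab of height 1 above a planar disc of radius rho, centered on
   the trace of the support, has mass k rho.  The trace is a C^1 curve, and
   disjoint discs inside a disc have radii adding up to at most its radius; for
   discs along an arc this is possible only if the arc is a segment.  Hence the
   trace is a line and the support a plane W.  The similarities preserving W act
   transitively on it, so the spherical measure on W is uniform as well, and the
   uniqueness argument shows that mu is a multiple of it. *)
From HB Require Import structures.
Require Import Defs.
From mathcomp Require Import all_boot all_order all_algebra.
From mathcomp Require Import ring lra zify.
From mathcomp Require Import all_classical all_reals all_analysis.
From mathcomp Require Import measurable_realfun.
Set Implicit Arguments.
Unset Strict Implicit.
Unset Printing Implicit Defensive.
Import Order.TTheory GRing.Theory Num.Theory.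
Import numFieldNormedType.Exports.
Local Open Scope classical_set_scope.
Local Open Scope ring_scope.

(** * Absolutely convergent sums and power series *)

(** Local analyticity is handled through coefficients that are absolutely summable against the
    weight of a box. In this norm products, exponentials, infinite sums and integrals over a
    parameter reduce to estimates of norms. The obstacle is that the integration variable ranges
    over an unbounded space while one box has to serve for all of it. Moving the center inside a
    small box changes the fourth power of the distance by at most half of one plus itself, and the
    Gaussian decay absorbs that.

    The stratification has to produce countably many pieces, so the functions cutting them out come
    from a countable family, closed under partial derivatives, products and differences. Only
    division by functions with a nonzero partial derivative occurs: a chain grows as long as some
    member of the family vanishes at the point and has a nonzero derivative along the chain.

    In the planar part the defining function is merely C^1, so arcs are controlled by bounds on the
    slopes of chords, and straightness is read off from midpoints of chords. *)

Section NonnegSums.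
Context {R : realType}.
Implicit Types (I J : choiceType).
Local Open Scope ereal_scope.

Lemma ge0_esumZl I (D : set I) (k : R) (a : I -> \bar R) :
  (0 <= k)%R -> (forall i, 0 <= a i) ->
  \esum_(i in D) (k%:E * a i) = k%:E * \esum_(i in D) a i.
Proof.
have le (l : R) (b : I -> \bar R) : (0 <= l)%R -> (forall i, 0 <= b i) ->
    \esum_(i in D) (l%:E * b i) <= l%:E * \esum_(i in D) b i.
  move=> l0 b0; apply: ge_ereal_sup => _ [X [finX XD] <-].
  rewrite -ge0_mule_fsumr//; apply: lee_wpmul2l; first by rewrite lee_fin.
  by apply: ereal_sup_ubound; exists X.
move=> k0 a0; apply/eqP; rewrite eq_le le//=.
have [->|k_neq0] := eqVneq k 0%R.
  by rewrite mul0e; apply: esum_ge0 => i _; rewrite mul0e.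
have k_gt0 : (0 < k)%R by rewrite lt_neqAle eq_sym k_neq0.
have ka0 i : 0 <= k%:E * a i by rewrite mule_ge0.
rewrite (@eq_esum _ _ D a (fun i => k^-1%:E * (k%:E * a i))); last first.
  by move=> i _; rewrite muleA -EFinM mulVf// mul1e.
apply: (@le_trans _ _ (k%:E * (k^-1%:E * \esum_(i in D) (k%:E * a i)))).
  by apply: lee_wpmul2l; rewrite ?lee_fin//; apply: le => //; rewrite invr_ge0.
by rewrite muleA -EFinM mulfV// mul1e.
Qed.

Lemma esum_pair I J (a : I * J -> \bar R) : (forall k, 0 <= a k) ->
  \esum_(k in [set: I * J]) a k =
  \esum_(i in [set: I]) \esum_(j in [set: J]) a (i, j).
Proof.
move=> a0; rewrite esum_esum//; apply: eq_trans; last first.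
  by apply: eq_esum => -[i j] _ /=; reflexivity.
by congr esum; apply/seteqP; split.
Qed.

Lemma esum_le1 I (D : set I) (a : I -> \bar R) i :
  (forall i, 0 <= a i) -> D i -> a i <= \esum_(i in D) a i.
Proof.
move=> a0 Di; apply: esum_ge; exists [set i].
  by split; [exact: finite_set1|move=> _ ->].
by rewrite fsbig_set1.
Qed.

Lemma esum_delta I (i0 : I) (a : \bar R) : 0 <= a ->
  \esum_(i in [set: I]) (if i == i0 then a else 0) = a.
Proof.
move=> a0; rewrite (esumID [set i0]) => [|i _]; last by case: ifP.
rewrite setTI esum_set1 ?eqxx// esum1 ?adde0// => i [_ /= ii0].
by case: eqP.
Qed.

End NonnegSums.

Section RealSums.
Context {R : realType}.
Implicit Types (I J K : choiceType).

Definition asum I (t : I -> R) : \bar R := (\esum_(i in [set: I]) `|t i|%:E)%E.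

Definition summ I (t : I -> R) := (asum t < +oo)%E.

Definition posr I (t : I -> R) i := Num.max (t i) 0.
Definition negr I (t : I -> R) i := Num.max (- t i) 0.

(** Has the form required by [analytic_at]. The value is meaningful only for [summ t]: [fine] sends
    an infinite sum to 0. *)
Definition rsum I (t : I -> R) : R :=
  fine (\esum_(i in [set: I]) (posr t i)%:E)%E -
  fine (\esum_(i in [set: I]) (negr t i)%:E)%E.

Lemma posr_ge0 I (t : I -> R) i : 0 <= posr t i.
Proof. by rewrite /posr le_max lexx orbT. Qed.

Lemma negr_ge0 I (t : I -> R) i : 0 <= negr t i.
Proof. by rewrite /negr le_max lexx orbT. Qed.

Lemma posrBnegr I (t : I -> R) i : posr t i - negr t i = t i.
Proof.
rewrite /posr /negr; case: (boolP (0 <= t i)); rewrite -?ltNge => h.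
  by rewrite max_l// max_r ?oppr_le0// subr0.
by rewrite max_r ?ltW// max_l ?oppr_ge0 ?ltW// sub0r opprK.
Qed.

Lemma posrDnegr I (t : I -> R) i : posr t i + negr t i = `|t i|.
Proof.
rewrite /posr /negr; case: (boolP (0 <= t i)); rewrite -?ltNge => h.
  by rewrite max_l// max_r ?oppr_le0// addr0 ger0_norm.
by rewrite max_r ?ltW// max_l ?oppr_ge0 ?ltW// add0r ltr0_norm.
Qed.

Lemma asum_ge0 I (t : I -> R) : (0 <= asum t)%E.
Proof. by apply: esum_ge0 => i _; rewrite lee_fin. Qed.

Lemma asum_fin I (t : I -> R) : summ t -> asum t \is a fin_num.
Proof. by move=> ?; rewrite ge0_fin_numE ?asum_ge0. Qed.

Lemma le_asum I (t u : I -> R) : (forall i, `|t i| <= `|u i|) ->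
  (asum t <= asum u)%E.
Proof. by move=> tu; apply: le_esum => i _; rewrite lee_fin. Qed.

Lemma le_summ I (t u : I -> R) : (forall i, `|t i| <= `|u i|) ->
  summ u -> summ t.
Proof. by move=> tu; apply: le_lt_trans; exact: le_asum. Qed.

Lemma asumD I (t u : I -> R) : (asum (fun i => t i + u i)%R <= asum t + asum u)%E.
Proof.
rewrite /asum -esumD; try by move=> i _; rewrite lee_fin.
by apply: le_esum => i _; rewrite -EFinD lee_fin ler_normD.
Qed.

Lemma asumZ I k (t : I -> R) : (asum (fun i => k * t i)%R = `|k|%:E * asum t)%E.
Proof.
rewrite /asum -ge0_esumZl//.
by apply: eq_esum => i _; rewrite normrM EFinM.
Qed.

Lemma asum_pair I J (t : I * J -> R) :
  asum t = (\esum_(i in [set: I]) asum (fun j => t (i, j)))%E.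
Proof. by rewrite /asum esum_pair// => k; rewrite lee_fin. Qed.

Lemma summD I (t u : I -> R) : summ t -> summ u -> summ (fun i => t i + u i).
Proof. by move=> ts us; apply: (le_lt_trans (asumD t u)); rewrite lte_add_pinfty. Qed.

Lemma summZ I k (t : I -> R) : summ t -> summ (fun i => k * t i).
Proof.
by move=> ts; rewrite /summ asumZ -(fineK (asum_fin ts)) -EFinM ltry.
Qed.

Lemma summN I (t : I -> R) : summ t -> summ (fun i => - t i).
Proof. by apply: le_summ => i; rewrite normrN. Qed.

Lemma summ_pos I (t : I -> R) : summ t -> summ (posr t).
Proof.
by apply: le_summ => i; rewrite ger0_norm ?posr_ge0// -posrDnegr lerDl negr_ge0.
Qed.

Lemma summ_neg I (t : I -> R) : summ t -> summ (negr t).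
Proof.
by apply: le_summ => i; rewrite ger0_norm ?negr_ge0// -posrDnegr lerDr posr_ge0.
Qed.

Lemma ge0_asum I (p : I -> R) : (forall i, 0 <= p i) ->
  (\esum_(i in [set: I]) (p i)%:E)%E = asum p.
Proof. by move=> p0; apply: eq_esum => i _; rewrite ger0_norm. Qed.

Lemma rsumE I (t : I -> R) : rsum t = fine (asum (posr t)) - fine (asum (negr t)).
Proof. by rewrite /rsum !ge0_asum//; [exact: negr_ge0|exact: posr_ge0]. Qed.

Lemma fine_asumD I (p q : I -> R) : (forall i, 0 <= p i) -> (forall i, 0 <= q i) ->
  summ p -> summ q ->
  fine (asum (fun i => p i + q i)) = fine (asum p) + fine (asum q).
Proof.
move=> p0 q0 ps qs; rewrite -fineD ?asum_fin//; congr fine.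
rewrite -!ge0_asum// -?esumD//; try by move=> i _; rewrite lee_fin.
by move=> i; rewrite addr_ge0.
Qed.

(** Independence of the splitting: any two nonnegative summable families with difference [t] may
    replace the positive and negative parts. Linearity and the iterated sums below are instances. *)
Lemma rsum_sub I (p q t : I -> R) : (forall i, 0 <= p i) -> (forall i, 0 <= q i) ->
  summ p -> summ q -> (forall i, t i = p i - q i) ->
  rsum t = fine (asum p) - fine (asum q).
Proof.
move=> p0 q0 ps qs tE; have ts : summ t.
  apply: (@le_summ _ _ (fun i => p i + - q i)); last exact/summD/summN.
  by move=> i; rewrite tE.
rewrite rsumE; apply/eqP; rewrite subr_eq addrAC eq_sym subr_eq eq_sym; apply/eqP.
rewrite -!fine_asumD ?posr_ge0 ?negr_ge0//; try exact: summ_pos; try exact: summ_neg;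
  try exact: posr_ge0; try exact: negr_ge0.
by congr (fine (asum _)); apply/funext => i; move: (posrBnegr t i) (tE i); lra.
Qed.

Lemma eq_rsum I (t u : I -> R) : t =1 u -> rsum t = rsum u.
Proof. by move=> /funext ->. Qed.

Lemma eq_asum I (t u : I -> R) : t =1 u -> asum t = asum u.
Proof. by move=> /funext ->. Qed.

Lemma rsumD I (t u : I -> R) : summ t -> summ u ->
  rsum (fun i => t i + u i) = rsum t + rsum u.
Proof.
move=> ts us.
rewrite (@rsum_sub _ (fun i => posr t i + posr u i) (fun i => negr t i + negr u i)).
- have ep := fine_asumD (posr_ge0 t) (posr_ge0 u) (summ_pos ts) (summ_pos us).
  have en := fine_asumD (negr_ge0 t) (negr_ge0 u) (summ_neg ts) (summ_neg us).
  by rewrite ep en !rsumE opprD addrACA.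
- by move=> i; rewrite addr_ge0 ?posr_ge0.
- by move=> i; rewrite addr_ge0 ?negr_ge0.
- by apply: summD; exact: summ_pos.
- by apply: summD; exact: summ_neg.
- by move=> i; rewrite -(posrBnegr t i) -(posrBnegr u i); lra.
Qed.

Lemma ge0_rsum I (p : I -> R) : (forall i, 0 <= p i) -> summ p -> rsum p = fine (asum p).
Proof.
move=> p0 ps; rewrite (@rsum_sub _ p (fun=> 0))//; last by move=> i; rewrite subr0.
  by rewrite [X in _ - fine X](_ : _ = 0%E) ?subr0//; apply: esum1 => i _; rewrite normr0.
by apply: le_summ ps => i; rewrite normr0.
Qed.

Lemma rsumN I (t : I -> R) : summ t -> rsum (fun i => - t i) = - rsum t.
Proof.
move=> ts; rewrite (@rsum_sub _ (negr t) (posr t)) ?rsumE; first by lra.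
- exact: negr_ge0.
- exact: posr_ge0.
- exact: summ_neg.
- exact: summ_pos.
- by move=> i; rewrite -(posrBnegr t i); lra.
Qed.

Lemma rsumZ I k (t : I -> R) : summ t -> rsum (fun i => k * t i) = k * rsum t.
Proof.
wlog k0 : k / 0 <= k => [pos|] ts.
  have [k0|/ltW k0] := leP 0 k; first exact: pos.
  rewrite -[k]opprK mulNr -pos ?oppr_ge0// -rsumN; last exact: summZ.
  by apply: eq_rsum => i; rewrite !mulNr.
rewrite (@rsum_sub _ (fun i => k * posr t i) (fun i => k * negr t i)).
- by rewrite !asumZ rsumE ger0_norm// !fineM ?asum_fin ?mulrBr//;
    [exact: summ_neg|exact: summ_pos].
- by move=> i; rewrite mulr_ge0 ?posr_ge0.
- by move=> i; rewrite mulr_ge0 ?negr_ge0.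
- exact/summZ/summ_pos.
- exact/summZ/summ_neg.
- by move=> i; rewrite -mulrBr posrBnegr.
Qed.

Lemma rsumB I (t u : I -> R) : summ t -> summ u ->
  rsum (fun i => t i - u i) = rsum t - rsum u.
Proof. by move=> ts us; rewrite rsumD ?rsumN//; exact: summN. Qed.

Lemma ler_rsum I (t u : I -> R) : summ t -> summ u -> (forall i, t i <= u i) ->
  rsum t <= rsum u.
Proof.
move=> ts us tu; rewrite -subr_ge0 -rsumB// ge0_rsum.
- by rewrite fine_ge0 ?asum_ge0.
- by move=> i; rewrite subr_ge0.
- exact/summD/summN.
Qed.

Lemma ler_norm_rsum I (t : I -> R) : summ t -> `|rsum t| <= fine (asum t).
Proof.
move=> ts; have ats : summ (fun i => `|t i|) by apply: le_summ ts => i; rewrite normr_id.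
have -> : fine (asum t) = rsum (fun i => `|t i|).
  by rewrite ge0_rsum//; congr fine; apply: eq_esum => i _; rewrite normr_id.
by rewrite ler_norml -rsumN// !ler_rsum//; try exact: summN;
  move=> i; rewrite ?ler_norm// lerNl -normrN ler_norm.
Qed.

Lemma rsum0 I : rsum (fun _ : I => 0 : R) = 0.
Proof. by rewrite rsumE /posr /negr oppr0 subrr. Qed.

Lemma asum_fineK I J (t : I * J -> R) : summ t ->
  forall i, summ (fun j => t (i, j)).
Proof.
rewrite /summ asum_pair => ts i; apply: le_lt_trans ts.
exact: (@esum_le1 _ _ _ (fun i => asum (fun j => t (i, j))) i (fun=> asum_ge0 _)).
Qed.

Lemma asum_fine_pair I J (t : I * J -> R) : summ t ->
  asum (fun i => fine (asum (fun j => t (i, j)))) = asum t.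
Proof.
move=> ts; rewrite [RHS]asum_pair; apply: eq_esum => i _.
rewrite ger0_norm ?fine_ge0 ?asum_ge0// fineK//.
exact/asum_fin/asum_fineK.
Qed.

Lemma summ_pair_asum I J (t : I * J -> R) : summ t ->
  summ (fun i => fine (asum (fun j => t (i, j)))).
Proof. by move=> ts; rewrite /summ asum_fine_pair. Qed.

Lemma asum_pair_rsum I J (t : I * J -> R) : summ t ->
  (asum (fun i => rsum (fun j => t (i, j))) <= asum t)%E.
Proof.
move=> ts; rewrite -(asum_fine_pair ts); apply: le_asum => i.
rewrite [leRHS]ger0_norm ?fine_ge0 ?asum_ge0//.
exact/ler_norm_rsum/asum_fineK.
Qed.

Lemma rsum_pair I J (t : I * J -> R) : summ t ->
  rsum t = rsum (fun i => rsum (fun j => t (i, j))).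
Proof.
move=> ts; have ps := summ_pos ts; have ns := summ_neg ts.
rewrite rsumE -(asum_fine_pair ps) -(asum_fine_pair ns); apply/esym/rsum_sub.
- by move=> i; rewrite fine_ge0 ?asum_ge0.
- by move=> i; rewrite fine_ge0 ?asum_ge0.
- exact: summ_pair_asum.
- exact: summ_pair_asum.
- by move=> i; rewrite rsumE.
Qed.

Lemma asum_bij I J (e : I -> J) (t : J -> R) : bijective e ->
  asum (fun i => t (e i)) = asum t.
Proof.
move=> [e' eK e'K]; apply/esym/(reindex_esum setT setT e (fun j => `|t j|%:E)).
split=> [//|x y _ _ /(congr1 e')|y _]; first by rewrite !eK.
by exists (e' y).
Qed.

Lemma rsum_bij I J (e : I -> J) (t : J -> R) : bijective e ->
  rsum (fun i => t (e i)) = rsum t.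
Proof. by move=> be; rewrite !rsumE -!(asum_bij _ be). Qed.

Lemma pair_swap_bij I J : bijective (fun k : I * J => (k.2, k.1)).
Proof. by exists (fun k => (k.2, k.1)); case. Qed.

Lemma asum_exchange I J (t : I * J -> R) :
  (asum t = \esum_(j in [set: J]) asum (fun i => t (i, j)))%E.
Proof. by rewrite -(asum_bij _ (pair_swap_bij J I)) asum_pair. Qed.

Lemma summ_swap I J (t : I * J -> R) : summ t -> summ (fun k : J * I => t (k.2, k.1)).
Proof. by rewrite /summ (asum_bij _ (pair_swap_bij J I)). Qed.

Lemma rsum_exchange I J (t : I * J -> R) : summ t ->
  rsum t = rsum (fun j => rsum (fun i => t (i, j))).
Proof.
move=> ts; rewrite -(rsum_bij _ (pair_swap_bij J I)) rsum_pair//.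
exact: summ_swap.
Qed.

Lemma asum_mul I J (t : I -> R) (u : J -> R) : summ u ->
  (asum (fun k : I * J => t k.1 * u k.2)%R = asum t * asum u)%E.
Proof.
move=> us; rewrite asum_pair /= -(fineK (asum_fin us)) muleC.
rewrite -ge0_esumZl ?fine_ge0 ?asum_ge0//.
apply: eq_esum => i _; rewrite asumZ muleC fineK//; exact: asum_fin.
Qed.

Lemma summ_mul I J (t : I -> R) (u : J -> R) : summ t -> summ u ->
  summ (fun k : I * J => t k.1 * u k.2).
Proof.
move=> ts us; rewrite /summ asum_mul//.
by rewrite -(fineK (asum_fin ts)) -(fineK (asum_fin us)) -EFinM ltry.
Qed.

Lemma rsum_mul I J (t : I -> R) (u : J -> R) : summ t -> summ u ->
  rsum (fun k : I * J => t k.1 * u k.2) = rsum t * rsum u.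
Proof.
move=> ts us; rewrite rsum_pair ?summ_mul//= mulrC -rsumZ//.
by apply: eq_rsum => i; rewrite rsumZ// mulrC.
Qed.

Lemma asum_delta I (i0 : I) (a : R) :
  asum (fun i => if i == i0 then a else 0) = `|a|%:E.
Proof.
rewrite -[RHS](esum_delta i0) ?lee_fin//.
by apply: eq_esum => i _; case: eqP => // _; rewrite normr0.
Qed.

Lemma summ_delta I (i0 : I) (a : R) : summ (fun i => if i == i0 then a else 0).
Proof. by rewrite /summ asum_delta ltry. Qed.

Lemma rsum_delta I (i0 : I) (a : R) : rsum (fun i => if i == i0 then a else 0) = a.
Proof.
have E b : 0 <= b -> rsum (fun i => if i == i0 then b else 0) = b.
  move=> b0; rewrite ge0_rsum ?asum_delta ?ger0_norm//; last exact: summ_delta.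
  by move=> i; case: ifP.
have [/E//|/ltW a0] := leP 0 a.
apply: oppr_inj; rewrite -rsumN ?summ_delta// -[RHS]E ?oppr_ge0//.
by apply: eq_rsum => i; case: ifP; rewrite ?oppr0.
Qed.

Lemma asum_delta_fun I K (phi : I -> K) (t : I -> R) :
  asum (fun k : K * I => if k.1 == phi k.2 then t k.2 else 0) = asum t.
Proof.
rewrite asum_exchange; apply: eq_esum => i _ /=.
exact: (asum_delta (phi i) (t i)).
Qed.

Lemma asum_le1 I (t : I -> R) i : (`|t i|%:E <= asum t)%E.
Proof. exact: (@esum_le1 _ _ _ (fun i => `|t i|%:E) i). Qed.

(** Push-forward of a family along [phi], one fiber at a time. For [phi] the addition of exponents
    it gives the coefficients of a product of power series. *)
Definition regroup I K (phi : I -> K) (t : I -> R) (k : K) : R :=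
  rsum (fun i => if k == phi i then t i else 0).

Section Regroup.
Context {I K : choiceType} (phi : I -> K) (t : I -> R) (W : K -> R).
Hypotheses (W_gt0 : forall k, 0 < W k) (tW : summ (fun i => t i * W (phi i))).

Lemma summ_regroup k : summ (fun i => if k == phi i then t i else 0).
Proof.
have := summZ (W k)^-1 tW; apply: le_summ => i; case: eqP => [->|_].
  by rewrite mulrCA mulVf ?mulr1// gt_eqF.
by rewrite normr0.
Qed.

Lemma regroupZ k m : regroup phi t k * m k =
  rsum (fun i => if k == phi i then t i * m (phi i) else 0).
Proof.
rewrite mulrC -rsumZ; last exact: summ_regroup.
by apply: eq_rsum => i; case: eqP => [->|_]; rewrite ?mulr0// mulrC.
Qed.

Lemma le_asum_regroup :
  (asum (fun k => regroup phi t k * W k)%R <= asum (fun i => t i * W (phi i))%R)%E.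
Proof.
rewrite -(asum_delta_fun phi (fun i => t i * W (phi i))).
under [X in (asum X <= _)%E]eq_fun do rewrite regroupZ.
apply: (@asum_pair_rsum _ _ (fun k : K * I => if k.1 == phi k.2 then t k.2 * W (phi k.2) else 0)).
by rewrite /summ (asum_delta_fun phi (fun i => t i * W (phi i))).
Qed.

Lemma summ_regroupW : summ (fun k => regroup phi t k * W k).
Proof. exact: le_lt_trans le_asum_regroup tW. Qed.

(** Fubini for the family supported on the graph of [phi] in [K * I]: summing over [K] first leaves
    the original family. *)
Lemma rsum_regroup (m : K -> R) : (forall k, `|m k| <= W k) ->
  rsum (fun k => regroup phi t k * m k) = rsum (fun i => t i * m (phi i)).
Proof.
move=> mW; rewrite (eq_rsum (fun k => regroupZ k m)).
have ts : summ (fun i => t i * m (phi i)).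
  by apply: le_summ tW => i; rewrite !normrM ler_wpM2l// (le_trans (mW _))// ler_norm.
have ps : summ (fun k : K * I => if k.1 == phi k.2 then t k.2 * m (phi k.2) else 0).
  by rewrite /summ (asum_delta_fun phi (fun i => t i * m (phi i))).
rewrite -(rsum_pair ps) rsum_exchange//=.
by apply: eq_rsum => i; rewrite rsum_delta.
Qed.

End Regroup.

Lemma rsum_ext_summ I (t u : I -> R) : t =1 u -> summ t -> summ u.
Proof. by move=> /funext ->. Qed.

End RealSums.

(** * Power series with coefficients summable against a weight *)

Section PowerSeries.
Context {R : realType} {n : nat}.
Local Notation T := {ffun 'I_n -> nat}.
Local Notation V := 'rV[R]_n.
Implicit Types (k l : T) (h w : V) (c d : T -> R).

Definition kplus k l : T := [ffun i => (k i + l i)%N].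
Definition k0 : T := [ffun=> 0%N].
Definition ek (j : 'I_n) : T := [ffun i => (i == j) : nat].

Definition mono h k : R := \prod_(i < n) h 0 i ^+ k i.
Definition posw w := forall i, 0 < w 0 i.
Definition inbox w h := forall i, `|h 0 i| <= w 0 i.

(** Weighted l1 norm of the coefficients. For positive [w] it dominates the sum on the whole box,
    see [psum_le], and it is submultiplicative, see [wnorm_conv], so that questions of convergence
    become norm estimates. *)
Definition wnorm w c : \bar R := asum (fun k => c k * mono w k).
Definition wfin w c := summ (fun k => c k * mono w k).
Definition psum c h : R := rsum (fun k => c k * mono h k).

Lemma mono_add h k l : mono h (kplus k l) = mono h k * mono h l.
Proof. by rewrite -big_split; apply: eq_bigr => i _; rewrite ffunE exprD. Qed.

Lemma mono0 h : mono h k0 = 1.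
Proof. by rewrite /mono big1// => i _; rewrite ffunE expr0. Qed.

Lemma mono_e h j : mono h (ek j) = h 0 j.
Proof.
rewrite /mono (bigD1 j)//= big1 ?mulr1 => [|i /negbTE ij].
  by rewrite ffunE eqxx expr1.
by rewrite ffunE ij expr0.
Qed.

Lemma mono_gt0 w k : posw w -> 0 < mono w k.
Proof. by move=> w0; apply: prodr_gt0 => i _; rewrite exprn_gt0. Qed.

Lemma inbox_ge0 w h : inbox w h -> forall i, 0 <= w 0 i.
Proof. by move=> hw i; apply: le_trans (hw i). Qed.

Lemma ler_mono w h k : inbox w h -> `|mono h k| <= mono w k.
Proof.
move=> hw; rewrite normr_prod; apply: ler_prod => i _.
by rewrite normr_ge0/= normrX lerXn2r ?nnegrE ?(inbox_ge0 hw).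
Qed.

Lemma wfin_sub w h c : posw w -> inbox w h -> wfin w c -> wfin h c.
Proof.
move=> w0 hw; apply: le_summ => k; rewrite !normrM ler_wpM2l//.
by rewrite (le_trans (ler_mono _ hw))// ler_norm.
Qed.

Lemma wnorm_le w h c : posw w -> inbox w h -> (wnorm h c <= wnorm w c)%E.
Proof.
move=> w0 hw; apply: le_asum => k; rewrite !normrM ler_wpM2l//.
by rewrite (le_trans (ler_mono _ hw))// ler_norm.
Qed.

Lemma inbox_refl w : posw w -> inbox w w.
Proof. by move=> w0 i; rewrite ger0_norm// ltW. Qed.

Lemma psum_le w h c : posw w -> inbox w h -> wfin w c ->
  `|psum c h| <= fine (wnorm w c).
Proof.
move=> w0 hw wc; apply: (le_trans (ler_norm_rsum (wfin_sub w0 hw wc))).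
by rewrite fine_le ?asum_fin ?wnorm_le//; exact: wfin_sub hw wc.
Qed.

Definition constc (a : R) k : R := if k == k0 then a else 0.
Definition varc (j : 'I_n) k : R := if k == ek j then 1 else 0.

Lemma deltac_termE (l : T) (a : R) h k :
  (if k == l then a else 0) * mono h k = if k == l then a * mono h l else 0.
Proof. by case: eqP => [->|_]; rewrite ?mul0r. Qed.

Lemma wnorm_const w a : wnorm w (constc a) = `|a|%:E.
Proof.
rewrite /wnorm (eq_asum (deltac_termE _ _ _)) asum_delta.
by rewrite mono0 mulr1.
Qed.

Lemma psum_const a h : psum (constc a) h = a.
Proof. by rewrite /psum (eq_rsum (deltac_termE _ _ _)) rsum_delta mono0 mulr1. Qed.

Lemma wnorm_var w j : wnorm w (varc j) = `|w 0 j|%:E.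
Proof.
by rewrite /wnorm (eq_asum (deltac_termE _ _ _)) asum_delta mono_e mul1r.
Qed.

Lemma psum_var j h : psum (varc j) h = h 0 j.
Proof. by rewrite /psum (eq_rsum (deltac_termE _ _ _)) rsum_delta mono_e mul1r. Qed.

Lemma wfin_const w a : wfin w (constc a).
Proof. by rewrite /wfin /summ -/(wnorm _ _) wnorm_const ltry. Qed.

Lemma wfin_var w j : wfin w (varc j).
Proof. by rewrite /wfin /summ -/(wnorm _ _) wnorm_var ltry. Qed.

Lemma wfinD w c d : wfin w c -> wfin w d -> wfin w (fun k => c k + d k).
Proof.
by move=> wc wd; apply: (rsum_ext_summ _ (summD wc wd)) => k; rewrite mulrDl.
Qed.

Lemma psumD w h c d : posw w -> inbox w h -> wfin w c -> wfin w d ->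
  psum (fun k => c k + d k) h = psum c h + psum d h.
Proof.
move=> w0 hw wc wd; rewrite -rsumD; try exact: (wfin_sub w0 hw).
by apply: eq_rsum => k; rewrite mulrDl.
Qed.

Lemma wnormD w c d : (wnorm w (fun k => c k + d k)%R <= wnorm w c + wnorm w d)%E.
Proof.
apply: le_trans (asumD _ _); apply: le_asum => k.
by rewrite mulrDl.
Qed.

Lemma wnormZ w a c : wnorm w (fun k => a * c k) = (`|a|%:E * wnorm w c)%E.
Proof. by rewrite -asumZ; apply: eq_asum => k; rewrite mulrA. Qed.

Lemma wfinZ w a c : wfin w c -> wfin w (fun k => a * c k).
Proof. by move=> wc; apply: (rsum_ext_summ _ (summZ a wc)) => k; rewrite mulrA. Qed.

Lemma psumZ w h a c : posw w -> inbox w h -> wfin w c ->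
  psum (fun k => a * c k) h = a * psum c h.
Proof.
move=> w0 hw wc; rewrite -rsumZ; last exact: (wfin_sub w0 hw).
by apply: eq_rsum => k; rewrite mulrA.
Qed.

Definition convc c d : T -> R :=
  regroup (fun p : T * T => kplus p.1 p.2) (fun p => c p.1 * d p.2).

Section Conv.
Variables (w : V) (c d : T -> R).
Hypotheses (w0 : posw w) (wc : wfin w c) (wd : wfin w d).

Lemma conv_termE h (p : T * T) :
  c p.1 * d p.2 * mono h (kplus p.1 p.2) = (c p.1 * mono h p.1) * (d p.2 * mono h p.2).
Proof. by rewrite mono_add mulrACA. Qed.

Lemma summ_conv : summ (fun p : T * T => c p.1 * d p.2 * mono w (kplus p.1 p.2)).
Proof.
by rewrite /summ (eq_asum (conv_termE w)); exact: (summ_mul wc wd).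
Qed.

Lemma wnorm_conv : (wnorm w (convc c d) <= wnorm w c * wnorm w d)%E.
Proof.
rewrite -(asum_mul (fun k => c k * mono w k) wd) -(eq_asum (conv_termE w)).
apply: le_asum_regroup; last exact: summ_conv.
by move=> k; exact: mono_gt0.
Qed.

Lemma wfin_conv : wfin w (convc c d).
Proof.
apply: summ_regroupW; last exact: summ_conv.
by move=> k; exact: mono_gt0.
Qed.

Lemma psum_conv h : inbox w h -> psum (convc c d) h = psum c h * psum d h.
Proof.
move=> hw; rewrite -rsum_mul; try exact: (wfin_sub w0 hw).
rewrite -(eq_rsum (conv_termE h)); apply: (rsum_regroup _ summ_conv).
  by move=> k; exact: mono_gt0.
by move=> k; exact: ler_mono.
Qed.

End Conv.

Section SumSeries.
Variables (I : choiceType) (w : V) (C : I -> T -> R).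
Hypotheses (w0 : posw w)
  (Cs : summ (fun p : T * I => C p.2 p.1 * mono w p.1)).

Definition sumc : T -> R := fun k => rsum (fun i => C i k).

Lemma summ_sumc k : summ (fun i => C i k).
Proof.
have := summZ (mono w k)^-1 (asum_fineK Cs k); apply: le_summ => i /=.
by rewrite mulrCA mulVf ?mulr1// gt_eqF// mono_gt0.
Qed.

Lemma sumcZ h k : sumc k * mono h k = rsum (fun i => C i k * mono h k).
Proof.
rewrite mulrC -rsumZ; last exact: summ_sumc.
by apply: eq_rsum => i; rewrite mulrC.
Qed.

Lemma wnorm_sumc : (wnorm w sumc <= \esum_(i in [set: I]) wnorm w (C i))%E.
Proof.
rewrite /wnorm -(asum_exchange (fun p : T * I => C p.2 p.1 * mono w p.1)).
rewrite (eq_asum (sumcZ w)).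
exact: (asum_pair_rsum Cs).
Qed.

Lemma wfin_sumc : wfin w sumc.
Proof.
rewrite /wfin /summ (eq_asum (sumcZ w)); exact: le_lt_trans (asum_pair_rsum Cs) Cs.
Qed.

Lemma psum_sumc h : inbox w h -> psum sumc h = rsum (fun i => psum (C i) h).
Proof.
move=> hw; rewrite /psum (eq_rsum (sumcZ h)).
have Hs : summ (fun p : T * I => C p.2 p.1 * mono h p.1).
  apply: le_summ Cs => p; rewrite !normrM ler_wpM2l//.
  by rewrite (le_trans (ler_mono _ hw))// ler_norm.
by rewrite -(rsum_pair Hs) rsum_exchange.
Qed.

End SumSeries.

Lemma summ_family (I : choiceType) w (C : I -> T -> R) :
  (\esum_(i in [set: I]) wnorm w (C i) < +oo)%E ->
  summ (fun p : T * I => C p.2 p.1 * mono w p.1).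
Proof. by rewrite /summ asum_exchange. Qed.

End PowerSeries.

Section NatSums.
Context {R : realType}.

Lemma posr_funepos (I : choiceType) (t : I -> R) i :
  ((fun i => (t i)%:E)^\+ i = (posr t i)%:E)%E.
Proof. by rewrite funeposE /posr EFin_max. Qed.

Lemma negr_funeneg (I : choiceType) (t : I -> R) i :
  ((fun i => (t i)%:E)^\- i = (negr t i)%:E)%E.
Proof. by rewrite funenegE /negr EFin_max. Qed.

Lemma rsum_esumB (I : choiceType) (t : I -> R) : summ t ->
  ((rsum t)%:E = \esum_(i in [set: I]) (fun i => (t i)%:E)^\+ i -
    \esum_(i in [set: I]) (fun i => (t i)%:E)^\- i)%E.
Proof.
move=> ts; rewrite EFinB !fineK.
- by congr (_ - _)%E; apply: eq_esum => i _; rewrite ?posr_funepos ?negr_funeneg.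
- by rewrite ge0_asum ?asum_fin//; [exact: summ_neg|exact: negr_ge0].
- by rewrite ge0_asum ?asum_fin//; [exact: summ_pos|exact: posr_ge0].
Qed.

Lemma summ_summable (I : choiceType) (t : I -> R) :
  summ t <-> summable [set: I] (fun i => (t i)%:E).
Proof. by rewrite /summable /summ /asum; split. Qed.

Lemma rsum_series (t : nat -> R) : summ t -> cvgn (series t) ->
  limn (series t) = rsum t.
Proof.
move=> ts tc; apply: EFin_inj; rewrite rsum_esumB//.
have st : summable [set: nat] (fun i => (t i)%:E) by exact/summ_summable.
have sE : [set: nat] = (fun x => is_true (xpredT x)) by apply/seteqP; split.
rewrite sE in st *; rewrite -(summable_eseries_esum st) -EFin_lim//.
  by congr (limn _); apply/funext => k /=; rewrite /series/= -sumEFin.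
Qed.

Lemma asum_series (t : nat -> R) : (forall i, 0 <= t i) -> cvgn (series t) ->
  asum t = (limn (series t))%:E.
Proof.
move=> t0 tc; rewrite -ge0_asum// -nneseries_esumT => [|i]; last by rewrite lee_fin.
rewrite -EFin_lim//; congr (limn _); apply/funext => k /=.
by rewrite /series/= -sumEFin.
Qed.

Lemma asum_exp_coeff (x : R) : 0 <= x ->
  asum (fun m => x ^+ m / m`!%:R) = (expR x)%:E.
Proof.
move=> x0; have -> : (fun m => x ^+ m / m`!%:R) = exp_coeff x by [].
rewrite /expR; apply: asum_series; last exact: is_cvg_series_exp_coeff.
by move=> i; rewrite divr_ge0 ?exprn_ge0.
Qed.

Lemma summ_exp_coeff (x : R) : summ (fun m => x ^+ m / m`!%:R).
Proof.
have : summ (fun m => `|x| ^+ m / m`!%:R) by rewrite /summ asum_exp_coeff ?ltry.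
by apply: le_summ => i; rewrite !normrM normrX normrX normr_id.
Qed.

Lemma rsum_exp_coeff (x : R) : rsum (fun m => x ^+ m / m`!%:R) = expR x.
Proof.
rewrite -(@rsum_series (fun m => x ^+ m / m`!%:R))//; first exact: summ_exp_coeff.
exact: is_cvg_series_exp_coeff.
Qed.

End NatSums.

Section ExpSeries.
Context {R : realType} {n : nat}.
Local Notation T := {ffun 'I_n -> nat}.
Local Notation V := 'rV[R]_n.
Variables (w : V) (c : T -> R).
Hypotheses (w0 : posw w) (wc : wfin w c).

Definition powc (m : nat) : T -> R := iter m (convc c) (constc 1).
Definition expc : T -> R := sumc (fun m k => m`!%:R^-1 * powc m k).

Lemma wfin_pow m : wfin w (powc m).
Proof.
by elim: m => [|m IH]; [exact: wfin_const|exact: wfin_conv].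
Qed.

Lemma wnorm_pow m : (wnorm w (powc m) <= (fine (wnorm w c) ^+ m)%:E)%E.
Proof.
elim: m => [|m IH]; first by rewrite wnorm_const normr1.
apply: (le_trans (wnorm_conv w0 wc (wfin_pow m))).
rewrite exprS EFinM fineK ?asum_fin// lee_wpmul2l ?asum_ge0//.
Qed.

Lemma psum_pow m h : inbox w h -> psum (powc m) h = psum c h ^+ m.
Proof.
move=> hw; elim: m => [|m IH]; first by rewrite psum_const.
by rewrite [LHS](psum_conv w0 wc (wfin_pow m))// IH exprS.
Qed.

Lemma esum_wnorm_exp :
  (\esum_(m in [set: nat]) wnorm w (fun k => m`!%:R^-1 * powc m k)%R <=
   (expR (fine (wnorm w c)))%:E)%E.
Proof.
rewrite -asum_exp_coeff ?fine_ge0 ?asum_ge0//.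
apply: le_esum => m _; rewrite wnormZ normrM muleC.
rewrite [X in (_ <= X%:E)%E](_ : _ = fine (wnorm w c) ^+ m * `|m`!%:R^-1|).
  by rewrite EFinM lee_wpmul2r// wnorm_pow.
by rewrite ger0_norm// exprn_ge0// fine_ge0 ?asum_ge0.
Qed.

Lemma summ_exp : summ (fun p : T * nat => p.2`!%:R^-1 * powc p.2 p.1 * mono w p.1).
Proof.
apply: (@summ_family _ _ _ w (fun m k => m`!%:R^-1 * powc m k)).
exact: le_lt_trans esum_wnorm_exp (ltry _).
Qed.

Lemma wnorm_exp : (wnorm w expc <= (expR (fine (wnorm w c)))%:E)%E.
Proof.
exact: le_trans (wnorm_sumc w0 summ_exp) esum_wnorm_exp.
Qed.

Lemma wfin_exp : wfin w expc.
Proof. exact: le_lt_trans wnorm_exp (ltry _). Qed.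

Lemma psum_exp h : inbox w h -> psum expc h = expR (psum c h).
Proof.
move=> hw; rewrite (psum_sumc w0 summ_exp)// -rsum_exp_coeff.
apply: eq_rsum => m; rewrite (psumZ _ w0 hw (wfin_pow m)) psum_pow//.
by rewrite mulrC.
Qed.

End ExpSeries.

Section Injection.
Context {R : realType}.

Lemma asum_inj (I J : choiceType) (e : I -> J) (t : J -> R) : injective e ->
  (forall j, (forall i, j <> e i) -> t j = 0) ->
  asum (fun i => t (e i)) = asum t.
Proof.
move=> ei t0; rewrite /asum [RHS](esumID (range e)) => [|j _]; last by rewrite lee_fin.
rewrite setTI setTI [X in (_ + X)%E]esum1 ?adde0 => [|j /= je].
  by rewrite esum_image// => x y _ _; exact: ei.
by rewrite t0 ?normr0// => i ij; apply: je; exists i.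
Qed.

Lemma rsum_inj (I J : choiceType) (e : I -> J) (t : J -> R) : injective e ->
  (forall j, (forall i, j <> e i) -> t j = 0) ->
  rsum (fun i => t (e i)) = rsum t.
Proof.
move=> ei t0; rewrite !rsumE -(asum_inj (t := posr t) ei) -1?(asum_inj (t := negr t) ei)//.
  by move=> j /t0 tj; rewrite /negr tj oppr0 maxxx.
by move=> j /t0 tj; rewrite /posr tj maxxx.
Qed.

End Injection.

Section PowerBounds.
Context {R : realFieldType}.
Implicit Types (u v t rho d : R).

(** The left side is one term of the binomial expansion. This is how differentiation is paid for:
    the factor [m] is traded for a loss [d] in the radius. *)
Lemma natr_exp_bound m rho d : 0 <= rho -> 0 <= d ->
  m%:R * rho ^+ m.-1 * d <= (rho + d) ^+ m.
Proof.
move=> r0 d0; elim: m => [|[|m] IH]; first by rewrite !mul0r expr0.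
  by rewrite !expr1 expr0 !mul1r lerDr.
rewrite [leRHS]exprS [leRHS]mulrDl -[m.+2%:R]natr1 !mulrDl mul1r lerD//.
  by rewrite /= exprS [_ * (rho * _)]mulrCA -mulrA ler_wpM2l.
by rewrite mulrC ler_wpM2l// lerXn2r ?nnegrE ?addr_ge0// lerDl.
Qed.

(** Second-order Taylor remainder of a power, controlled by a loss of radius instead of the factor
    m(m-1). The remainder for [m.+1] is [u + t] times the remainder for [m] plus [t ^+ 2] times the
    derivative, which drives the induction. *)
Lemma ler_exp_taylor m u t rho d : `|u| <= rho -> `|u + t| <= rho -> 0 <= d ->
  `|(u + t) ^+ m - u ^+ m - t * (m%:R * u ^+ m.-1)| * d ^+ 2 <= t ^+ 2 * (rho + d) ^+ m.
Proof.
move=> ur vr d0; have r0 : 0 <= rho by apply: le_trans ur.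
elim: m => [|m IH].
  by rewrite !expr0 subrr mul0r mulr0 subr0 normr0 mul0r mulr_ge0 ?sqr_ge0.
have -> : (u + t) ^+ m.+1 - u ^+ m.+1 - t * (m.+1%:R * u ^+ m) =
    (u + t) * ((u + t) ^+ m - u ^+ m - t * (m%:R * u ^+ m.-1)) +
    t ^+ 2 * (m%:R * u ^+ m.-1).
  case: m {IH} => [|m]; first by rewrite !expr1 !expr0; ring.
  by rewrite !exprS /= -!natr1; ring.
set e := (_ ^+ m - _ - _) in IH *.
apply: (@le_trans _ _ ((rho * `|e| + t ^+ 2 * (m%:R * rho ^+ m.-1)) * d ^+ 2)).
  rewrite ler_wpM2r ?exprn_ge0// (le_trans (ler_normD _ _))// !normrM lerD ?ler_wpM2r//.
  rewrite -expr2 real_normK ?num_real// ler_wpM2l ?sqr_ge0// normr_nat ler_wpM2l//.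
  by rewrite normrX lerXn2r ?nnegrE.
rewrite mulrDl [(rho + d) ^+ m.+1]exprS mulrDl mulrDr lerD//.
  by rewrite -mulrA [leRHS]mulrCA ler_wpM2l.
rewrite -mulrA ler_wpM2l ?sqr_ge0// expr2 mulrA [d * _]mulrC ler_wpM2r//.
exact: natr_exp_bound.
Qed.

End PowerBounds.

(** * Termwise differentiation *)

Section TermwiseDerivative.
Context {R : realType} {n : nat}.
Local Notation T := {ffun 'I_n -> nat}.
Local Notation V := 'rV[R]_n.
Implicit Types (k l : T) (h w : V) (c d : T -> R) (j : 'I_n).

Definition rest h j k : R := \prod_(i < n | i != j) h 0 i ^+ k i.
Definition dmono j h k : R := rest h j k * ((k j)%:R * h 0 j ^+ (k j).-1).
Definition derc j c k : R := (k j).+1%:R * c (kplus k (ek j)).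

Lemma monoE h j k : mono h k = rest h j k * h 0 j ^+ k j.
Proof. by rewrite /mono (bigD1 j)//= mulrC. Qed.

Lemma kplus_ekj k j : kplus k (ek j) j = (k j).+1.
Proof. by rewrite !ffunE eqxx addn1. Qed.

Lemma dmono_e j h k : dmono j h (kplus k (ek j)) = (k j).+1%:R * mono h k.
Proof.
rewrite /dmono kplus_ekj /= (monoE _ j) mulrCA; congr (_ * (_ * _)).
by apply: eq_bigr => i /negbTE ij; rewrite !ffunE ij addn0.
Qed.

Lemma kplus_e_inj j : injective (fun k => kplus k (ek j)).
Proof.
move=> k l /ffunP kl; apply/ffunP => i; move: (kl i); rewrite !ffunE.
by move/eqP; rewrite eqn_add2r => /eqP.
Qed.

Lemma kplus_e_codom j k : (0 < k j)%N -> exists l, k = kplus l (ek j).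
Proof.
move=> kj; exists [ffun i => (k i - (i == j))%N]; apply/ffunP => i.
by rewrite !ffunE; case: eqP => [->|_]; rewrite ?subnK ?subn0 ?addn0.
Qed.

Lemma derc_termE j c h k :
  derc j c k * mono h k = c (kplus k (ek j)) * dmono j h (kplus k (ek j)).
Proof. by rewrite dmono_e /derc; ring. Qed.

Lemma dmono0 j h k : (forall l, k <> kplus l (ek j)) -> dmono j h k = 0.
Proof.
move=> kl; rewrite /dmono; case: (posnP (k j)) => [->|]; first by rewrite mul0r mulr0.
by move=> /kplus_e_codom[l /kl].
Qed.

Lemma psum_derc j c h : psum (derc j c) h = rsum (fun k => c k * dmono j h k).
Proof.
rewrite /psum (eq_rsum (derc_termE j c h)).
apply: (rsum_inj (t := fun k => c k * dmono j h k) (@kplus_e_inj j)).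
by move=> k /dmono0 ->; rewrite mulr0.
Qed.

Lemma asum_derc j c h : wnorm h (derc j c) = asum (fun k => c k * dmono j h k).
Proof.
rewrite /wnorm (eq_asum (derc_termE j c h)).
apply: (asum_inj (t := fun k => c k * dmono j h k) (@kplus_e_inj j)).
by move=> k /dmono0 ->; rewrite mulr0.
Qed.

Section Bounds.
Variables (w w' : V) (dl : R).
Hypotheses (w0 : posw w) (w'0 : posw w') (w'w : inbox w w') (dl0 : 0 < dl).
Variable j : 'I_n.
Hypothesis (wj : w' 0 j + dl <= w 0 j).

Lemma rest_le h k : inbox w' h -> `|rest h j k| <= rest w j k.
Proof.
move=> hw; rewrite normr_prod; apply: ler_prod => i _.
rewrite normr_ge0 normrX lerXn2r ?nnegrE//; first exact: inbox_ge0 w'w i.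
by rewrite (le_trans (hw i))// (le_trans (ler_norm _) (w'w i)).
Qed.

Lemma dmono_le h k : inbox w' h -> `|dmono j h k| * dl <= mono w k.
Proof.
move=> hw; rewrite (monoE _ j) normrM -mulrA ler_pM ?mulr_ge0 ?rest_le//; first exact: ltW.
have hj := hw j; have wj0 := ltW (w'0 j).
apply: le_trans (_ : (w' 0 j + dl) ^+ k j <= _).
  apply: le_trans (natr_exp_bound (k j) wj0 (ltW dl0)).
  rewrite ler_wpM2r ?(ltW dl0)// normrM ger0_norm// ler_wpM2l// normrX lerXn2r ?nnegrE//.
by rewrite lerXn2r ?nnegrE// ?addr_ge0// ltW.
Qed.

Lemma wfin_derc c : wfin w c -> wfin w' (derc j c).
Proof.
move=> wc; rewrite /wfin /summ -/(wnorm _ _) asum_derc.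
apply: le_summ (summZ dl^-1 wc) => k.
rewrite normrM [leRHS]normrM [`|c k * mono w k|]normrM [leRHS]mulrCA ler_wpM2l// [`|dl^-1|]gtr0_norm ?invr_gt0// ler_pdivlMl//.
rewrite mulrC (le_trans (dmono_le k (inbox_refl w'0)))// ler_norm//.
Qed.

Lemma rest_shift h t k : rest (h + t *: delta_mx 0 j) j k = rest h j k.
Proof.
by apply: eq_bigr => i /negbTE ij; rewrite !mxE ij andbF mulr0 addr0.
Qed.

Lemma mono_taylor h t k : inbox w' h -> inbox w' (h + t *: delta_mx 0 j) ->
  `|mono (h + t *: delta_mx 0 j) k - mono h k - t * dmono j h k| * dl ^+ 2 <=
  t ^+ 2 * mono w k.
Proof.
move=> hw htw; rewrite !(monoE _ j) rest_shift /dmono.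
have := htw j; rewrite !mxE !eqxx mulr1 => htj.
set u := h 0 j in htj *; rewrite [X in `|X|](_ : _ = rest h j k *
  ((u + t) ^+ k j - u ^+ k j - t * ((k j)%:R * u ^+ (k j).-1))); last by ring.
rewrite normrM -mulrA [leRHS]mulrCA ler_pM ?mulr_ge0 ?sqr_ge0 ?rest_le ?(ltW dl0)//.
apply: (le_trans (ler_exp_taylor (k j) (hw j) htj (ltW dl0))).
by rewrite ler_wpM2l ?sqr_ge0// lerXn2r ?nnegrE// ?addr_ge0// ltW.
Qed.

(** The bound of [mono_taylor] is uniform in the exponent, so it can be summed. A remainder
    quadratic in [t] identifies the derivative of the sum without any interchange of limits. *)
Lemma psum_taylor c h t : wfin w c ->
  inbox w' h -> inbox w' (h + t *: delta_mx 0 j) ->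
  `|psum c (h + t *: delta_mx 0 j) - psum c h - t * psum (derc j c) h| <=
  t ^+ 2 * (dl ^- 2 * fine (wnorm w c)).
Proof.
move=> wc hw htw.
have sub g : inbox w' g -> wfin g c.
  move=> gw; apply: (wfin_sub w0 _ wc) => i.
  exact: le_trans (gw i) (le_trans (ler_norm _) (w'w i)).
have ds : summ (fun k => c k * dmono j h k).
  apply: le_summ (summZ dl^-1 wc) => k.
  rewrite normrM [leRHS]normrM [`|c k * mono w k|]normrM [leRHS]mulrCA ler_wpM2l// [`|dl^-1|]gtr0_norm ?invr_gt0// ler_pdivlMl//.
  by rewrite mulrC (le_trans (dmono_le k hw))// ler_norm.
have s1 := sub _ hw; have s2 := sub _ htw.
have -> : psum c (h + t *: delta_mx 0 j) - psum c h - t * psum (derc j c) h =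
    rsum (fun k => c k * mono (h + t *: delta_mx 0 j) k - c k * mono h k -
      t * (c k * dmono j h k)).
  rewrite psum_derc rsumB; [|exact/summD/summN|exact: summZ].
  by rewrite rsumZ// rsumB.
have le k : `|c k * mono (h + t *: delta_mx 0 j) k - c k * mono h k -
    t * (c k * dmono j h k)| <= `|t ^+ 2 / dl ^+ 2 * (c k * mono w k)|.
  rewrite (_ : _ - _ = c k * (mono (h + t *: delta_mx 0 j) k - mono h k -
    t * dmono j h k)); last by ring.
  rewrite [X in _ <= `|X|]mulrCA [leLHS]normrM [leRHS]normrM ler_wpM2l// [leRHS]normrM.
  rewrite [`|t ^+ 2 / _|]ger0_norm ?divr_ge0 ?sqr_ge0// mulrAC.
  rewrite ler_pdivlMr ?exprn_gt0//.
  apply: (le_trans (mono_taylor _ hw htw)).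
  by rewrite ler_wpM2l ?sqr_ge0// ler_norm.
have s3 := summZ (t ^+ 2 / dl ^+ 2) wc.
apply: (le_trans (ler_norm_rsum (le_summ le s3))).
apply: (@le_trans _ _ (fine (asum (fun k => t ^+ 2 / dl ^+ 2 * (c k * mono w k))))).
  apply: fine_le; rewrite ?asum_fin//; first exact: le_summ le s3.
  exact: le_asum.
rewrite asumZ fineM ?asum_fin// ger0_norm ?divr_ge0 ?sqr_ge0//=.
by rewrite mulrA.
Qed.

End Bounds.
End TermwiseDerivative.

(** * Germs of analytic functions *)

Section Germs.
Context {R : realType} {n : nat}.
Local Notation T := {ffun 'I_n -> nat}.
Local Notation V := 'rV[R]_n.
Implicit Types (k l : T) (h w a x : V) (c d : T -> R) (j : 'I_n) (D : {set 'I_n})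
  (f g : V -> R).

Definition supp D c := forall k i, i \in D -> k i != 0%N -> c k = 0.

(** With [D] empty this is analyticity at [a]; a larger [D] records the variables that have been
    eliminated. *)
Definition psat D a f := exists w c,
  [/\ posw w, wfin w c, supp D c & forall h, inbox w h -> f (a + h) = psum c h].

Definition wmin w1 w2 : V := \row_i Num.min (w1 0 i) (w2 0 i).

Lemma posw_min w1 w2 : posw w1 -> posw w2 -> posw (wmin w1 w2).
Proof. by move=> p1 p2 i; rewrite mxE lt_min p1 p2. Qed.

Lemma inbox_minl w1 w2 h : inbox (wmin w1 w2) h -> inbox w1 h.
Proof. by move=> hw i; have := hw i; rewrite mxE le_min => /andP[]. Qed.

Lemma inbox_minr w1 w2 h : inbox (wmin w1 w2) h -> inbox w2 h.
Proof. by move=> hw i; have := hw i; rewrite mxE le_min => /andP[]. Qed.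

Lemma near_boxP a (P : set V) :
  (\forall x \near a, P x) <->
  exists2 e : R, 0 < e & forall h, inbox (const_mx e) h -> P (a + h).
Proof.
split=> [/nbhs_ballP[e /= e0 aP]|[e e0 aP]].
  exists (e / 2); first by rewrite divr_gt0.
  move=> h hw; apply: aP; split=> // i i'; rewrite ord1 !mxE /ball/= opprD addrA subrr sub0r.
  rewrite normrN (le_lt_trans (hw i'))// mxE ltr_pdivrMr// mulr_natr mulr2n ltrDl//.
apply/nbhs_ballP; exists e => //= x [_ xe].
rewrite -[x](subrK a) addrC; apply: aP => i; rewrite !mxE.
have := xe 0 i; rewrite /ball/= => xi; rewrite distrC; exact: ltW.
Qed.

Lemma nbhs_box a w : posw w -> \forall x \near a, inbox w (x - a).
Proof.
move=> w0; apply/near_boxP.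
exists (\big[Num.min/1]_(i < n) w 0 i).
  by elim/big_ind: _ => // u v u0 v0; rewrite lt_min u0.
move=> h hw i; rewrite addrC addKr; apply: (le_trans (hw i)); rewrite mxE.
by rewrite (bigD1 i)//= ge_min lexx.
Qed.

Lemma near_posw a (P : set V) : (\forall x \near a, P x) ->
  exists2 w, posw w & forall h, inbox w h -> P (a + h).
Proof.
move=> /near_boxP[e e0 aP]; exists (const_mx e) => //.
by move=> i; rewrite mxE.
Qed.

Lemma inbox_trans w w' h : inbox w w' -> inbox w' h -> inbox w h.
Proof.
by move=> ww hw i; rewrite (le_trans (hw i))// (le_trans (ler_norm _) (ww i)).
Qed.

Lemma inbox_wmin w w' : posw w -> posw w' -> inbox w (wmin w w') /\ inbox w' (wmin w w').
Proof.
move=> w0 w'0; split=> i; rewrite mxE ger0_norm ?le_min ?(ltW (w0 i)) ?(ltW (w'0 i))//.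
  by rewrite ge_min lexx.
by rewrite ge_min lexx orbT.
Qed.

Lemma psat_near D a f g : (\forall x \near a, f x = g x) -> psat D a f -> psat D a g.
Proof.
move=> /near_posw[w' w'0 fg] [w [c [w0 wc sc fE]]].
exists (wmin w w'), c; split=> //; first exact: posw_min.
  apply: (wfin_sub w0 _ wc); by case: (inbox_wmin w0 w'0).
by move=> h hw; rewrite -fg ?fE//; [exact: inbox_minl hw|exact: inbox_minr hw].
Qed.

Lemma psat_sub D D' a f : D' \subset D -> psat D a f -> psat D' a f.
Proof.
move=> /fintype.subsetP DD [w [c [w0 wc sc fE]]]; exists w, c; split=> //.
by move=> k i /DD; exact: sc.
Qed.

Lemma posw1 : posw (const_mx 1 : V).
Proof. by move=> i; rewrite mxE. Qed.

Lemma psat_const D a (b : R) : psat D a (fun=> b).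
Proof.
exists (const_mx 1), (constc b); split; [exact: posw1|exact: wfin_const| |].
  by move=> k i _ ki; rewrite /constc; case: eqP => // k0E; rewrite k0E ffunE in ki.
by move=> h _; rewrite psum_const.
Qed.

Lemma psat_add D a f g : psat D a f -> psat D a g -> psat D a (fun x => f x + g x).
Proof.
move=> [w [c [w0 wc sc fE]]] [w' [c' [w'0 wc' sc' gE]]].
have [i1 i2] := inbox_wmin w0 w'0; have m0 := posw_min w0 w'0.
have mc := wfin_sub w0 i1 wc; have mc' := wfin_sub w'0 i2 wc'.
exists (wmin w w'), (fun k => c k + c' k); split=> //; first exact: wfinD.
  by move=> k i iD ki; rewrite (sc _ i)// (sc' _ i)// addr0.
move=> h hw; rewrite (psumD m0 hw)// fE ?gE//; [exact: inbox_minr hw|exact: inbox_minl hw].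
Qed.

Lemma supp_conv D c c' : supp D c -> supp D c' -> supp D (convc c c').
Proof.
move=> sc sc' k i iD ki; rewrite /convc /regroup -[RHS](@rsum0 R (T * T)%type).
apply: eq_rsum => -[p q] /=; case: eqP => // kpq.
move: ki; rewrite kpq ffunE addn_eq0 negb_and => /orP[pi|qi].
  by rewrite (sc p i)// mul0r.
by rewrite (sc' q i)// mulr0.
Qed.

Lemma psat_mul D a f g : psat D a f -> psat D a g -> psat D a (fun x => f x * g x).
Proof.
move=> [w [c [w0 wc sc fE]]] [w' [c' [w'0 wc' sc' gE]]].
have [i1 i2] := inbox_wmin w0 w'0; have m0 := posw_min w0 w'0.
have mc := wfin_sub w0 i1 wc; have mc' := wfin_sub w'0 i2 wc'.
exists (wmin w w'), (convc c c'); split=> //; first exact: wfin_conv.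
  exact: supp_conv.
move=> h hw; rewrite (psum_conv m0 mc mc' hw) fE ?gE//;
  [exact: inbox_minr hw|exact: inbox_minl hw].
Qed.

Lemma psat_scale D a (b : R) f : psat D a f -> psat D a (fun x => b * f x).
Proof. by move=> df; apply: psat_mul => //; exact: psat_const. Qed.

Lemma psat_opp D a f : psat D a f -> psat D a (fun x => - f x).
Proof.
move=> df; apply: (psat_near _ (psat_scale (-1) df)).
by near=> x; rewrite mulN1r.
Unshelve. all: by end_near. Qed.

Lemma psat_subr D a f g : psat D a f -> psat D a g -> psat D a (fun x => f x - g x).
Proof. by move=> df dg; apply: psat_add => //; exact: psat_opp. Qed.

Definition half_w w : V := \row_i (w 0 i / 2).
Definition quarter_w w : V := \row_i (w 0 i / 4).

Lemma is_derive_quad (f : V -> R) x v (L K e : R) : 0 < e -> 0 <= K ->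
  (forall t, `|t| <= e -> `|f (x + t *: v) - f x - t * L| <= t ^+ 2 * K) ->
  is_derive x v f L.
Proof.
move=> e0 K0 fL; have cv : (fun s : R => s^-1 *: ((f \o shift x) (s *: v) - f x)) @ 0^' --> L.
  apply/cvgrPdist_le => eps eps0; near=> t.
  have t0 : t != 0 by near: t; exact: nbhs_dnbhs_neq.
  have te : `|t| <= e by near: t; apply: dnbhs0_le.
  have teps : `|t| <= eps / (K + 1) by near: t; apply: dnbhs0_le; rewrite divr_gt0// ltr_wpDl.
  rewrite distrC /= [t *: v + x]addrC -(@ler_pM2l _ `|t|) ?normr_gt0// -normrM.
  have -> : t * (t^-1 *: (f (x + t *: v) - f x) - L) = f (x + t *: v) - f x - t * L.
    by rewrite mulrBr; congr (_ - _); rewrite /GRing.scale/= mulrA divff// mul1r.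
  apply: (le_trans (fL t te)); rewrite -(real_normK (num_real t)) expr2 -mulrA ler_wpM2l//.
  rewrite ler_pdivlMr ?ltr_wpDl// in teps; apply: le_trans teps.
  by rewrite ler_wpM2l// lerDl.
apply: DeriveDef; first by apply/cvg_ex; exists L.
exact: cvg_lim cv.
Unshelve. all: by end_near. Qed.

Lemma psum_is_derive a f w c j : posw w -> wfin w c ->
  (forall h, inbox w h -> f (a + h) = psum c h) -> exists w',
  [/\ posw w', wfin w' (derc j c), inbox w w' &
  (forall h, inbox w' h -> is_derive (a + h) (delta_mx 0 j) f (psum (derc j c) h))].
Proof.
move=> w0 wc fE.
pose w' := half_w w; pose w'' := quarter_w w.
have w'0 : posw w' by move=> i; rewrite mxE divr_gt0.
have w''0 : posw w'' by move=> i; rewrite mxE divr_gt0.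
have w'w : inbox w w' by move=> i; have wi := w0 i; rewrite mxE ger0_norm; lra.
have w''w' : inbox w' w'' by move=> i; have wi := w0 i; rewrite !mxE ger0_norm; lra.
have w''w := inbox_trans w'w w''w'.
have d0 : 0 < w 0 j / 2 by rewrite divr_gt0.
have wj : w' 0 j + w 0 j / 2 <= w 0 j by rewrite mxE; lra.
exists w''; split=> //.
  apply: (wfin_sub w'0 w''w'); exact: (wfin_derc w0 w'0 w'w d0 wj).
move=> h hw; apply: (@is_derive_quad _ _ _ _ ((w 0 j / 2) ^- 2 * fine (wnorm w c)) (w 0 j / 4)).
- by rewrite divr_gt0.
- by rewrite mulr_ge0 ?fine_ge0 ?asum_ge0// invr_ge0 exprn_ge0// ltW.
move=> t te.
have hw' : inbox w' h by exact: inbox_trans hw.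
have htw' : inbox w' (h + t *: delta_mx 0 j).
  move=> i; rewrite !mxE eqxx /=; have := hw i; rewrite mxE => hi.
  have := ltW (w0 i); have [->|_] := eqVneq i j; rewrite ?mulr1 ?mulr0 ?addr0.
    by move=> wi; rewrite (le_trans (ler_normD _ _))//; move: (hw j) te; rewrite mxE; lra.
  by move=> wi; move: hi; lra.
rewrite -[a + h + _]addrA (fE _ (inbox_trans w'w htw')) (fE h (inbox_trans w''w hw)).
exact: (psum_taylor w0 w'0 w'w d0 wj).
Qed.

Lemma psat_is_derive D a f j : psat D a f -> exists w c, [/\ posw w, wfin w (derc j c),
  supp D c, (forall h, inbox w h -> f (a + h) = psum c h) &
  (forall h, inbox w h -> is_derive (a + h) (delta_mx 0 j) f (psum (derc j c) h))].
Proof.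
move=> [w [c [w0 wc sc fE]]]; have [w' [w'0 w'c ww' df]] := psum_is_derive j w0 wc fE.
exists w', c; split=> // h hw; apply: fE; exact: inbox_trans hw.
Qed.

Lemma psat_partial D a f j : psat D a f -> psat D a (partial f j).
Proof.
move=> /psat_is_derive-/(_ j)[w [c [w0 wc sc _ df]]].
exists w, (derc j c); split=> //.
  move=> k i iD ki; rewrite /derc (sc _ i)// ?mulr0// ffunE addn_eq0 negb_and.
  by rewrite ki.
by move=> h /df [_ <-].
Qed.

Lemma psat_derivable D a f j : psat D a f ->
  \forall x \near a, derivable f x (delta_mx 0 j).
Proof.
move=> /psat_is_derive-/(_ j)[w [c [w0 wc sc _ df]]].
near=> x; have [] := df (x - a); last by rewrite addrC subrK.
by near: x; exact: nbhs_box.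
Unshelve. all: by end_near. Qed.

Lemma psat_partial_indep D a f j : j \in D -> psat D a f ->
  \forall x \near a, partial f j x = 0.
Proof.
move=> jD /psat_is_derive-/(_ j)[w [c [w0 wc sc _ df]]].
near=> x; have [] := df (x - a); first by near: x; exact: nbhs_box.
rewrite addrC subrK => _; rewrite /partial => ->.
rewrite /psum -[RHS](@rsum0 R T); apply: eq_rsum => k.
by rewrite /derc (sc _ j)// ?mulr0 ?mul0r// kplus_ekj.
Unshelve. all: by end_near. Qed.

Lemma psum_at0 c : psum c 0 = c k0.
Proof.
rewrite -[RHS](@rsum_delta R T k0 (c k0)) /psum; apply: eq_rsum => k.
case: eqP => [->|/eqP kN0]; first by rewrite mono0 mulr1.
have /existsP[i ki] : [exists i, k i != 0%N].
  apply: contraNT kN0; rewrite negb_exists => /forallP k0E.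
  by apply/eqP/ffunP => i; rewrite ffunE; apply/eqP; have := k0E i; rewrite negbK.
by rewrite /mono (bigD1 i)//= mxE expr0n (negbTE ki) mul0r mulr0.
Qed.

Lemma mono_scale w h k (t : R) : 0 <= t <= 1 -> (forall i, `|h 0 i| <= t * w 0 i) ->
  posw w -> k != k0 -> `|mono h k| <= t * mono w k.
Proof.
move=> /andP[t0 t1] ht w0 kN0.
have /existsP[i ki] : [exists i, k i != 0%N].
  apply: contraNT kN0; rewrite negb_exists => /forallP k0E.
  by apply/eqP/ffunP => i; rewrite ffunE; apply/eqP; have := k0E i; rewrite negbK.
rewrite /mono normr_prod (bigD1 i)//= [X in t * X](bigD1 i)//= mulrA.
apply: ler_pM => //; first exact: prodr_ge0.
  rewrite normrX (@le_trans _ _ ((t * w 0 i) ^+ k i))//.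
    by rewrite lerXn2r ?nnegrE// mulr_ge0// ltW.
  rewrite exprMn ler_wpM2r ?exprn_ge0//; first exact: ltW.
  rewrite -[leRHS]expr1; apply: ler_wiXn2l => //; by rewrite lt0n.
apply: ler_prod => l _; rewrite normr_ge0 normrX lerXn2r ?nnegrE//; first exact: ltW.
by rewrite (le_trans (ht l))// ler_piMl// ltW.
Qed.

Lemma psat_continuous D a f : psat D a f -> {for a, continuous f}.
Proof.
move=> [w [c [w0 wc _ fE]]]; apply/(@cvgrPdist_le _ _ _ (nbhs a) (nbhs_filter a)) => e e0.
set M := fine (wnorm w c); have M0 : 0 <= M by rewrite fine_ge0// asum_ge0.
pose t := Num.min 1 (e / (M + 1)).
have t01 : 0 < t by rewrite lt_min ltr01 divr_gt0// ltr_wpDl.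
near=> x; rewrite distrC.
have xw : inbox w (x - a) by near: x; exact: nbhs_box.
have xtw : inbox (t *: w) (x - a).
  by near: x; apply: nbhs_box => i; rewrite mxE mulr_gt0.
have -> : f x = psum c (x - a) by rewrite -fE// addrC subrK.
have -> : f a = psum c 0.
  by rewrite -fE ?addr0// => i; rewrite mxE normr0 ltW.
rewrite /psum -rsumB; last 2 first.
- exact: (wfin_sub w0).
- by apply: (wfin_sub w0) => // i; rewrite mxE normr0 ltW.
have le k : `|c k * mono (x - a) k - c k * mono 0 k| <= `|t * (c k * mono w k)|.
  rewrite -mulrBr mulrCA normrM [leRHS]normrM ler_wpM2l//.
  have [->|kN0] := eqVneq k k0; first by rewrite !mono0 subrr normr0.
  have -> : mono 0 k = 0 :> R.
    have : `|mono (0 : V) k| <= 0 * mono w k.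
      apply: mono_scale => //; first by rewrite lexx ler01.
      by move=> i; rewrite mxE normr0 mul0r.
    by rewrite mul0r normr_le0 => /eqP.
  rewrite subr0 (le_trans _ (ler_norm _))//; apply: mono_scale => //.
    by rewrite ltW//= ge_min lexx.
  by move=> i; rewrite (le_trans (xtw i))// mxE.
have s := summZ t wc.
apply: (le_trans (ler_norm_rsum (le_summ le s))).
apply: (@le_trans _ _ (fine (asum (fun k => t * (c k * mono w k))))).
  by apply: fine_le; rewrite ?asum_fin//; [exact: le_summ le s|exact: le_asum].
rewrite asumZ fineM ?asum_fin//= ger0_norm ?(ltW t01)// -/M.
apply: (@le_trans _ _ (e / (M + 1) * M)).
  by rewrite ler_wpM2r// ge_min lexx orbT.
rewrite mulrAC ler_pdivrMr ?ltr_wpDl// ler_wpM2l ?(ltW e0)// lerDl//.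
Unshelve. all: by end_near. Qed.

End Germs.

Section GermCalculus.
Context {R : realType} {n : nat}.
Local Notation T := {ffun 'I_n -> nat}.
Local Notation V := 'rV[R]_n.
Implicit Types (k l : T) (h w a x : V) (c d : T -> R) (j : 'I_n) (D : {set 'I_n})
  (f g : V -> R).

Lemma near_eq_sym a f g : (\forall x \near a, f x = g x) -> \forall x \near a, g x = f x.
Proof. by apply: filterS => x ->. Qed.

Lemma near_partial a f g j : (\forall x \near a, f x = g x) ->
  \forall x \near a, partial f j x = partial g j x.
Proof. by move=> /nbhs_interior; apply: filterS => x; exact: near_eq_derive. Qed.

Lemma partial_mul D a f g j : psat D a f -> psat D a g ->
  \forall x \near a, partial (fun x => f x * g x) j x =
    f x * partial g j x + g x * partial f j x.
Proof.
move=> /(psat_derivable j) df /(psat_derivable j) dg.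
by apply: filterS (filterI df dg) => x [dfx dgx]; exact: (deriveM dfx dgx).
Qed.

Lemma partial_sub D a f g j : psat D a f -> psat D a g ->
  \forall x \near a, partial (fun x => f x - g x) j x = partial f j x - partial g j x.
Proof.
move=> /(psat_derivable j) df /(psat_derivable j) dg.
by apply: filterS (filterI df dg) => x [dfx dgx]; exact: (deriveB dfx dgx).
Qed.

Lemma partial_add D a f g j : psat D a f -> psat D a g ->
  \forall x \near a, partial (fun x => f x + g x) j x = partial f j x + partial g j x.
Proof.
move=> /(psat_derivable j) df /(psat_derivable j) dg.
by apply: filterS (filterI df dg) => x [dfx dgx]; exact: (deriveD dfx dgx).
Qed.

Fixpoint flat m a f : Prop :=
  f a = 0 /\ if m is m'.+1 then forall j, flat m' a (partial f j) else True.

Lemma flatW m a f : flat m.+1 a f -> flat m a f.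
Proof.
by elim: m f => [|m IH] f [fa df]; split=> // j; apply: IH.
Qed.

Lemma flat_near m a f g : (\forall x \near a, f x = g x) -> flat m a f -> flat m a g.
Proof.
elim: m f g => [|m IH] f g fg [fa df].
  by split=> //; rewrite -(nbhs_singleton fg).
split=> [|j]; first by rewrite -(nbhs_singleton fg).
exact: IH (near_partial j fg) (df j).
Qed.

Lemma flat_add m a f g : psat finset.set0 a f -> psat finset.set0 a g ->
  flat m a f -> flat m a g -> flat m a (fun x => f x + g x).
Proof.
elim: m f g => [|m IH] f g pf pg [fa df] [ga dg].
  by split=> //; rewrite fa ga addr0.
split=> [|j]; first by rewrite fa ga addr0.
apply: (flat_near (near_eq_sym (partial_add j pf pg))).
by apply: IH; [exact: psat_partial|exact: psat_partial|exact: df|exact: dg].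
Qed.

Lemma flat_mul m a f g : psat finset.set0 a f -> psat finset.set0 a g ->
  flat m a g -> flat m a (fun x => f x * g x).
Proof.
elim: m f g => [|m IH] f g pf pg; first by move=> [ga _]; split=> //; rewrite ga mulr0.
move=> fg; have fmg := flatW fg; case: fg => ga dg; split=> [|j]; first by rewrite ga mulr0.
apply: (flat_near (near_eq_sym (partial_mul j pf pg))).
have pdf := psat_partial j pf; have pdg := psat_partial j pg.
apply: flat_add; [exact: psat_mul|exact: psat_mul|by apply: IH => //; exact: dg|].
apply: (@flat_near m a (fun x => partial f j x * g x)).
  by near=> x; rewrite mulrC.
exact: IH.
Unshelve. all: by end_near. Qed.

(** A unit does not affect flatness. Write [f] times a derivative of [g] as the derivative of the
    product minus [g] times the derivative of [f]: the first term is flat by hypothesis, the second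
    because the induction has already made [g] flat. *)
Lemma flat_div m a f g : psat finset.set0 a f -> psat finset.set0 a g -> f a != 0 ->
  flat m a (fun x => f x * g x) -> flat m a g.
Proof.
elim: m g => [|m IH] g pf pg fa0.
  by move=> [/eqP]; rewrite mulf_eq0 (negbTE fa0)/= => /eqP ga _; split.
move=> fg; have gm := IH _ pf pg fa0 (flatW fg).
case: fg => /eqP; rewrite mulf_eq0 (negbTE fa0)/= => /eqP ga dg; split=> // j.
have pdf := psat_partial j pf; have pdg := psat_partial j pg.
apply: IH => //.
apply: (@flat_near m a (fun x => partial (fun x => f x * g x) j x +
    (- partial f j x) * g x)).
  have := partial_mul j pf pg; apply: filterS => x ->; ring.
have p1 : psat finset.set0 a (partial (fun x => f x * g x) j) by apply/psat_partial/psat_mul.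
apply: flat_add => //; [by apply: psat_mul => //; exact: psat_opp|exact: dg|].
by apply: flat_mul => //; exact: psat_opp.
Qed.

(** Induction on the order: a coefficient with [k j] positive is, up to a nonzero factor, a
    coefficient of lower degree of the partial derivative along [j]. *)
Lemma flat_coef m a f w c k : posw w -> wfin w c ->
  (forall h, inbox w h -> f (a + h) = psum c h) -> flat m a f ->
  (\sum_(i < n) k i <= m)%N -> c k = 0.
Proof.
elim: m f w c k => [|m IH] f w c k w0 wc fE [fa df] km.
  have -> : k = k0.
    apply/ffunP => i; rewrite ffunE; apply/eqP; move: km; rewrite leqn0 sum_nat_eq0.
    by move=> /forallP/(_ i).
  by rewrite -psum_at0 -fE ?addr0// => i; rewrite mxE normr0 ltW.
have [->|kN0] := eqVneq k k0.
  by rewrite -psum_at0 -fE ?addr0// => i; rewrite mxE normr0 ltW.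
have /existsP[j kj] : [exists j, k j != 0%N].
  apply: contraNT kN0; rewrite negb_exists => /forallP k0E.
  by apply/eqP/ffunP => i; rewrite ffunE; apply/eqP; have := k0E i; rewrite negbK.
have [l' kE] := kplus_e_codom (etrans (lt0n _) kj).
have [w' [w'0 w'c ww' dc]] := psum_is_derive j w0 wc fE.
have : derc j c l' = 0.
  apply: (IH (partial f j) w') => //; [by move=> h /dc [_ <-]|exact: df|].
  move: km; rewrite kE (eq_bigr (fun i => l' i + (i == j))%N) => [|i _]; last by rewrite !ffunE.
  rewrite big_split/= [X in (_ + X)%N](bigD1 j)//= eqxx [X in (_ + (_ + X))%N]big1 ?addn0 ?addn1//.
  by move=> i /negbTE ->.
by rewrite /derc -kE => /eqP; rewrite mulf_eq0 pnatr_eq0/= => /eqP.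
Qed.

Lemma flat_eq0 D a f : psat D a f -> (forall m, flat m a f) -> \forall x \near a, f x = 0.
Proof.
move=> [w [c [w0 wc _ fE]]] fl; near=> x.
have -> : f x = psum c (x - a).
  by rewrite -fE; [rewrite addrC subrK|near: x; exact: nbhs_box].
rewrite /psum -[RHS](@rsum0 R T); apply: eq_rsum => k.
by rewrite (flat_coef w0 wc fE (fl _) (leqnn _)) mul0r.
Unshelve. all: by end_near. Qed.

End GermCalculus.

(** * Division by a function with a nonzero partial derivative *)

Section Division.
Context {R : realType} {n : nat}.
Local Notation T := {ffun 'I_n -> nat}.
Local Notation V := 'rV[R]_n.
Implicit Types (k l : T) (h w a x : V) (c d : T -> R) (j : 'I_n) (D : {set 'I_n})
  (f g : V -> R).

(** The quotient of the series by the [j]-th variable; the monomials free of that variable form the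
    remainder, see [psum_split]. The norm grows at most by the factor [1 / w 0 j]. *)
Definition shc j c k : R := c (kplus k (ek j)).

Lemma asum_inj_le (I J : choiceType) (e : I -> J) (t : J -> R) : injective e ->
  (asum (fun i => t (e i)) <= asum t)%E.
Proof.
move=> ei; rewrite /asum [leRHS](esumID (range e)) => [|j _]; last by rewrite lee_fin.
rewrite setTI setTI [leLHS](_ : _ = \esum_(i in range e) `|t i|%:E)%E.
  by rewrite leeDl// esum_ge0// => i _; rewrite lee_fin.
by rewrite esum_image// => x y _ _; exact: ei.
Qed.

Lemma wnorm_shc w j c : posw w -> ((w 0 j)%:E * wnorm w (shc j c) <= wnorm w c)%E.
Proof.
move=> w0; have := asum_inj_le (fun k => c k * mono w k) (@kplus_e_inj _ j).
apply: le_trans; rewrite -[w 0 j]gtr0_norm// -asumZ.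
apply: le_asum => k; rewrite mono_add mono_e /shc le_eqVlt; apply/orP; left.
by apply/eqP; congr `|_|; ring.
Qed.

Lemma wfin_shc w j c : posw w -> wfin w c -> wfin w (shc j c).
Proof.
move=> w0 wc; have := wnorm_shc j c w0; rewrite /wfin /summ -/(wnorm _ _).
rewrite -lee_pdivlMl// => /le_lt_trans; apply.
by rewrite -[wnorm w c]fineK ?asum_fin// -EFinM ltry.
Qed.

Lemma psum_split w j c h : posw w -> wfin w c -> inbox w h ->
  psum c h = psum (fun k => if k j == 0%N then c k else 0) h + h 0 j * psum (shc j c) h.
Proof.
move=> w0 wc hw; have hc := wfin_sub w0 hw wc.
rewrite -rsumZ; last exact: wfin_sub w0 hw (wfin_shc j w0 wc).
pose t k := if k j == 0%N then 0 else c k * mono h k.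
have -> : rsum (fun k => h 0 j * (shc j c k * mono h k)) = rsum t.
  rewrite -(rsum_inj (t := t) (@kplus_e_inj _ j)) => [|k kl]; last first.
    rewrite /t; case: (k j =P 0%N) => // /eqP; rewrite -lt0n => /kplus_e_codom[l kE].
    by case: (kl l).
  by apply: eq_rsum => k; rewrite /t kplus_ekj/= mono_add mono_e /shc; ring.
rewrite -rsumD.
- apply: eq_rsum => k; rewrite /t; case: eqP => _; first by rewrite addr0.
  by rewrite mul0r add0r.
- by apply: le_summ hc => k; case: eqP => // _; rewrite mul0r normr0.
- by apply: le_summ hc => k; rewrite /t; case: eqP => // _; rewrite normr0.
Qed.

Lemma rsum_telescope (t : nat -> R) : summ t -> rsum t - rsum (fun m => t m.+1) = t 0%N.
Proof.
move=> ts; pose u m := if m == 0%N then 0 else t m.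
have us : summ u by apply: le_summ ts => m; rewrite /u; case: eqP => // _; rewrite normr0.
have -> : rsum (fun m => t m.+1) = rsum u.
  rewrite -(rsum_inj (t := u) (e := S))//; first exact: succn_inj.
  by case=> // m /(_ m).
rewrite -rsumB// -[RHS](@rsum_delta _ _ 0%N (t 0%N)); apply: eq_rsum => m.
by rewrite /u; case: eqP => [->|_]; rewrite ?subr0 ?subrr.
Qed.

Section Neumann.
Variables (w : V) (j : 'I_n) (de cf : T -> R) (D : {set 'I_n}).
Hypotheses (w0 : posw w) (wde : wfin w de) (wcf : wfin w cf).
Hypothesis small : fine (wnorm w de) <= w 0 j / 2.

(** Dividing by [h_j - de] amounts to solving [H - de * shc j H = cf]: since [H] is its part free of
    [h_j] plus [h_j] times [shc j H], this reads [cf = (h_j - de) * shc j H + remainder]. The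
    hypothesis [small] makes the step a contraction by 1/2, and [H] is the sum of its iterates. *)
Definition dstep c := convc de (shc j c).
Definition diter (m : nat) : T -> R := iter m dstep cf.

Lemma wfin_diter m : wfin w (diter m).
Proof. by elim: m => // m IH; apply: wfin_conv => //; exact: wfin_shc. Qed.

Lemma wnorm_diter m : (wnorm w (diter m) <= ((1/2) ^+ m * fine (wnorm w cf))%:E)%E.
Proof.
elim: m => [|m IH]; first by rewrite expr0 mul1r fineK// asum_fin.
have ws := wfin_shc j w0 (wfin_diter m).
apply: (le_trans (wnorm_conv w0 wde ws)).
have h1 := wnorm_shc j (diter m) w0.
have := le_trans h1 IH; rewrite -[wnorm w (shc _ _)]fineK ?asum_fin//.
rewrite -[wnorm w de]fineK ?asum_fin// -!EFinM !lee_fin exprS => h2.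
apply: (@le_trans _ _ (w 0 j / 2 * fine (wnorm w (shc j (diter m))))).
  by rewrite ler_wpM2r ?fine_ge0 ?asum_ge0.
by rewrite mulrAC -mulrA mulrC -mulrA [X in _ <= X]mulrAC -mulrA mulrC -!mulrA;
  move: h2; lra.
Qed.

Lemma diter_esum : (\esum_(m in [set: nat]) wnorm w (diter m) < +oo)%E.
Proof.
apply: (@le_lt_trans _ _ (asum (fun m => fine (wnorm w cf) * (1/2 : R) ^+ m))).
  apply: le_esum => m _; apply: (le_trans (wnorm_diter m)); rewrite mulrC.
  by rewrite lee_fin ler_norm.
rewrite asum_series ?ltry//.
  by move=> m; rewrite mulr_ge0 ?exprn_ge0// ?fine_ge0 ?asum_ge0// divr_ge0.
by apply/is_cvg_geometric_series; rewrite ger0_norm; lra.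
Qed.

Lemma diter_shc_esum : (\esum_(m in [set: nat]) wnorm w (shc j (diter m)) < +oo)%E.
Proof.
apply: (@le_lt_trans _ _ (\esum_(m in [set: nat]) ((w 0 j)^-1%:E * wnorm w (diter m)))%E).
  by apply: le_esum => m _; rewrite lee_pdivlMl// wnorm_shc.
rewrite ge0_esumZl ?invr_ge0 ?ltW// => [|m]; last exact: asum_ge0.
have := diter_esum; rewrite ltey_eq => /orP[/fineK <-|/eqP ->]; first by rewrite -EFinM ltry.
by rewrite gt0_muleNy ?ltNyr// lte_fin invr_gt0.
Qed.

Definition dsum := sumc diter.

Lemma wfin_dsum : wfin w dsum.
Proof. exact: (wfin_sumc w0 (summ_family diter_esum)). Qed.

Lemma dsumE h : inbox w h -> psum dsum h - psum de h * psum (shc j dsum) h = psum cf h.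
Proof.
move=> hw; rewrite (psum_sumc w0 (summ_family diter_esum) hw).
have -> : psum (shc j dsum) h = rsum (fun m => psum (shc j (diter m)) h).
  exact: (psum_sumc w0 (summ_family diter_shc_esum) hw).
have sm (C : nat -> T -> R) : (\esum_(m in [set: nat]) wnorm w (C m) < +oo)%E ->
    summ (fun m => psum (C m) h).
  move=> CW; apply: le_lt_trans CW; apply: le_esum => m _.
  have [Cf|] := boolP (wnorm w (C m) < +oo)%E; last by rewrite -leNgt leye_eq => /eqP ->; rewrite leey.
  by rewrite -[leRHS]fineK ?asum_fin// lee_fin (psum_le w0).
rewrite -rsumZ; last exact/sm/diter_shc_esum.
rewrite [X in _ - X](eq_rsum (u := fun m => psum (diter m.+1) h)) => [|m]; last first.
  exact/esym/(psum_conv w0 wde (wfin_shc j w0 (wfin_diter m)) hw).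
exact: (rsum_telescope (sm _ diter_esum)).
Qed.

Lemma supp_dsum : supp D de -> supp D cf -> supp D dsum.
Proof.
move=> sd sc; have si m : supp D (diter m).
  elim: m => // m IH; apply: supp_conv => // k i iD ki.
  by apply: (IH _ i iD); rewrite ffunE addn_eq0 negb_and ki.
move=> k i iD ki; rewrite /dsum /sumc -[RHS](@rsum0 R nat).
by apply: eq_rsum => m; rewrite (si m k i).
Qed.

End Neumann.

(** The other linear coefficients of [de] need not be small, so shrinking a cube would not help:
    both sides of [small] scale to first order. On a box of width [s] along [j] and [s ^+ 2] in the
    other directions every surviving monomial gains [s ^+ 2], while the width along [j] is only of
    order [s]. *)
Lemma wnorm_scaled w0 j (s : R) de : posw w0 -> 0 < s <= 1 ->
  de k0 = 0 -> de (ek j) = 0 ->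
  (wnorm (\row_i (if i == j then s * w0 0 i else s ^+ 2 * w0 0 i))%R de <=
   (s ^+ 2)%R%:E * wnorm w0 de)%E.
Proof.
move=> p0 /andP[s0 s1] d0 dj; set w := (\row_i _)%R.
have -> : (s ^+ 2)%R%:E = `|s ^+ 2|%:E by rewrite ger0_norm ?sqr_ge0.
rewrite -asumZ.
apply: le_asum => k; have [->|kN0] := eqVneq k k0.
  by rewrite d0 !mul0r mulr0.
have [->|kNj] := eqVneq k (ek j); first by rewrite dj !mul0r mulr0.
rewrite [X in _ <= `|X|]mulrCA normrM [leRHS]normrM ler_wpM2l//.
have wi i : 0 <= s * w0 0 i by rewrite mulr_ge0// ltW.
have w2i i : 0 <= s ^+ 2 * w0 0 i by rewrite mulr_ge0 ?sqr_ge0// ltW.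
have wE i : w 0 i = if i == j then s * w0 0 i else s ^+ 2 * w0 0 i by rewrite mxE.
have w_ge0 i : 0 <= w 0 i by rewrite wE; case: ifP.
have mw0 : 0 <= mono w0 k by rewrite ltW// mono_gt0.
rewrite ger0_norm; last by apply: prodr_ge0 => i _; rewrite exprn_ge0.
rewrite ger0_norm; last by rewrite mulr_ge0 ?sqr_ge0.
pose m := (\sum_(i < n) (if i == j then k i else 2 * k i))%N.
have -> : mono w k = s ^+ m * mono w0 k.
  rewrite /mono /m -prodrXr -big_split/=; apply: eq_bigr => i _; rewrite wE.
  by case: eqP => _; rewrite exprMn// exprM.
rewrite ler_wpM2r// ler_wiXn2l ?(ltW s0)//.
rewrite /m (bigD1 j)//= eqxx.
have [[i ij ki]|noi] := pselect (exists2 i, i != j & k i != 0%N).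
  rewrite (bigD1 i)//= (negbTE ij); move: ki; rewrite -lt0n => ki.
  by rewrite (leq_trans _ (leq_addl _ _))// (leq_trans _ (leq_addr _ _))//; rewrite leq_pmulr.
have kj i : i != j -> k i = 0%N.
  by move=> ij; apply/eqP/negPn/negP => ki; apply: noi; exists i.
rewrite (leq_trans _ (leq_addr _ _))//.
have : k j != 0%N.
  apply: contraNneq kN0 => kj0; apply/eqP/ffunP => i; rewrite ffunE.
  by have [->//|/kj] := eqVneq i j.
have : k j != 1%N.
  apply: contraNneq kNj => kj1; apply/eqP/ffunP => i; rewrite ffunE.
  by have [->//|/kj] := eqVneq i j.
by case: (k j) => [|[|]].
Qed.

(** Weierstrass division in the case of order one. Quotient and remainder inherit the independence
    of the variables in [D], which allows variables to be eliminated one after another. *)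
Lemma psat_div D a f g j : j \notin D -> psat D a g -> g a = 0 -> partial g j a != 0 ->
  psat D a f -> exists q r, [/\ psat D a q, psat (j |: D)%SET a r &
    \forall x \near a, f x = q x * g x + r x].
Proof.
move=> jD [wg [cg [wg0 wcg sg gE]]] ga u0 [wf [cf [wf0 wcf sf fE]]].
set u := partial g j a in u0.
have cg0 : cg k0 = 0 by rewrite -psum_at0 -gE ?addr0// => i; rewrite mxE normr0 ltW.
have cgj : cg (ek j) = u.
  have [w' [w'0 _ _ dg]] := psum_is_derive j wg0 wcg gE.
  have [] := dg 0; first by move=> i; rewrite mxE normr0 ltW.
  rewrite addr0 /u /partial => _ ->; rewrite psum_at0 /derc ffunE mul1r; congr cg.
  by apply/ffunP => i; rewrite !ffunE.
have [ig if_] := inbox_wmin wg0 wf0; have m0 := posw_min wg0 wf0.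
set w0 := wmin wg wf in ig if_ m0.
have w0g := wfin_sub wg0 ig wcg; have w0f := wfin_sub wf0 if_ wcf.
pose de k := varc j k + (- u^-1) * cg k.
have w0d : wfin w0 de by apply: wfinD; [exact: wfin_var|exact: wfinZ].
have d0 : de k0 = 0.
  rewrite /de cg0 mulr0 addr0 /varc; case: eqP => // /ffunP/(_ j).
  by rewrite !ffunE eqxx.
have dj : de (ek j) = 0 by rewrite /de cgj /varc eqxx mulNr mulVf// subrr.
have sd : supp D de.
  move=> k i iD ki; rewrite /de (sg k i)// mulr0 addr0 /varc; case: eqP => // kE.
  have ij : i != j by apply: contraNneq jD => <-.
  by move: ki; rewrite kE ffunE (negbTE ij).
set M := fine (wnorm w0 de); have M0 : 0 <= M by rewrite fine_ge0// asum_ge0.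
(* With this choice [s ^+ 2 * M] is at most half of [s * w0 0 j], the width of the new box along
   [j]; [M + 1] keeps the denominator positive. *)
pose s := Num.min 1 (w0 0 j / 2 / (M + 1)).
have s0 : 0 < s by rewrite lt_min ltr01 !divr_gt0// ltr_wpDl.
have s1 : s <= 1 by rewrite ge_min lexx.
pose w : V := \row_i (if i == j then s * w0 0 i else s ^+ 2 * w0 0 i).
have wp : posw w by move=> i; rewrite mxE; case: ifP => _; rewrite mulr_gt0 ?exprn_gt0.
have ww0 : inbox w0 w.
  move=> i; rewrite ger0_norm ?(ltW (wp i))// mxE; case: ifP => _.
    by rewrite ler_piMl// ltW.
  by rewrite ler_piMl ?(ltW (m0 i))// exprn_ile1// ltW.
have wd := wfin_sub m0 ww0 w0d; have wcf' := wfin_sub m0 ww0 w0f.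
have wcg' := wfin_sub m0 ww0 w0g.
have small : fine (wnorm w de) <= w 0 j / 2.
  have := @wnorm_scaled w0 j s de m0 _ d0 dj; rewrite s0 s1 => /(_ isT).
  rewrite -/w -[wnorm w de]fineK ?asum_fin// -[wnorm w0 de]fineK ?asum_fin//.
  rewrite -EFinM lee_fin -/M => /le_trans; apply.
  rewrite mxE eqxx expr2 -!mulrA ler_wpM2l ?(ltW s0)//.
  apply: (@le_trans _ _ (w0 0 j / 2 / (M + 1) * M)).
    by rewrite ler_wpM2r// ge_min lexx orbT.
  rewrite mulrAC ler_pdivrMr ?ltr_wpDl// ler_wpM2l ?lerDl//.
  by rewrite divr_ge0// ltW.
pose H := dsum j de cf.
have wH : wfin w H by exact: wfin_dsum.
have sH : supp D H by exact: supp_dsum.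
have wsH := wfin_shc j wp wH.
pose q x := u^-1 * psum (shc j H) (x - a).
pose r x := psum (fun k => if k j == 0%N then H k else 0) (x - a).
exists q, r; split.
- apply: psat_scale; exists w, (shc j H); split=> //.
    by move=> k i iD ki; rewrite /shc (sH _ i)// ffunE addn_eq0 negb_and ki.
  by move=> h _; rewrite addrC addKr.
- exists w, (fun k => if k j == 0%N then H k else 0); split=> //.
  + by apply: le_summ wH => k; case: eqP => // _; rewrite mul0r normr0.
  + move=> k i; rewrite !inE => /orP[/eqP ->|iD] ki; first by rewrite (negbTE ki).
    by case: eqP => // _; exact: sH ki.
  + by move=> h _; rewrite /r addrC addKr.
near=> x.
have xw : inbox w (x - a) by near: x; exact: nbhs_box.
have xw0 := inbox_trans ww0 xw.
have aK : a + (x - a) = x by rewrite addrC subrK.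
have fx : f x = psum cf (x - a) by rewrite -{1}aK fE//; exact: inbox_minr xw0.
have gx : g x = psum cg (x - a) by rewrite -{1}aK gE//; exact: inbox_minl xw0.
rewrite fx -(dsumE wp wd wcf' small xw) -/H (psum_split j wp wH xw) -/(r x).
have -> : psum de (x - a) = (x - a) 0 j - u^-1 * g x.
  rewrite (psumD wp xw (wfin_var _ _) (wfinZ _ wcg')) psum_var.
  by rewrite (psumZ _ wp xw wcg') gx mulNr.
by rewrite /q; ring.
Unshelve. all: by end_near. Qed.

End Division.

(** * Stratification of analytic sets *)

Section Chains.
Context {R : realType} {n : nat}.
Local Notation V := 'rV[R]_n.
Implicit Types (x y z a : V) (j d : 'I_n) (f g h p q s : V -> R)
  (l : seq ((V -> R) * 'I_n)).

(* [chainD l j] is a derivation that kills the functions of the chain [l]; it is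
   obtained from the partial derivatives by eliminating one function at a time. *)
Fixpoint chainD l j h : V -> R :=
  if l is (g, d) :: l' then
    fun x => chainD l' d g x * chainD l' j h x - chainD l' j g x * chainD l' d h x
  else partial h j.

(** The product of the pivots. On functions of the remaining variables [chainD l j] is this factor
    times the partial derivative, see [chainD_indep]; where it does not vanish, the gradients of the
    chain are independent, see [chain_free]. *)
Fixpoint chainU l : V -> R :=
  if l is (g, d) :: l' then fun x => chainD l' d g x * chainU l' x else fun=> 1.

Definition chain_vars l : {set 'I_n} := [set j | j \in map snd l]%SET.

Fixpoint chainP (P : (V -> R) -> Prop) l : Prop :=
  if l is (g, d) :: l' then P g /\ chainP P l' else True.

Lemma chain_vars_cons g d l : chain_vars ((g, d) :: l) = (d |: chain_vars l)%SET.
Proof. by apply/setP => i; rewrite !inE. Qed.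

Lemma chainD_linear l j x : exists v : 'I_n -> R,
  forall h, chainD l j h x = \sum_(i < n) v i * partial h i x.
Proof.
elim: l j => [|[g d] l IH] j.
  exists (fun i => (i == j)%:R) => h /=; rewrite (bigD1 j)//= eqxx mul1r big1 ?addr0//.
  by move=> i /negbTE ->; rewrite mul0r.
have [v vE] := IH j; have [w wE] := IH d.
exists (fun i => chainD l d g x * v i - chainD l j g x * w i) => h /=.
rewrite (vE h) (wE h) !mulr_sumr -sumrB.
by apply: eq_bigr => i _; rewrite mulrBl !mulrA.
Qed.

(** If [g] is the head, the two products of the elimination step agree; if it occurs further down,
    both derivations that are combined kill it already. The disjunction spares the induction from
    locating [g]. *)
Lemma chainD_kill l j g : chainP (fun p => p <> g) l \/ forall x, chainD l j g x = 0.
Proof.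
elim: l j => [|[p d] l IH] j; first by left.
have [pg|pg] := pselect (p = g); first by right=> x /=; rewrite pg mulrC subrr.
have [L|Hj] := IH j; first by left; split.
have [L|Hd] := IH d; first by left; split.
by right=> x /=; rewrite Hj Hd !mulr0 subrr.
Qed.

Lemma chainD_mem l j i : (i < size l)%N ->
  forall x, chainD l j (nth ((fun=> 0), j) l i).1 x = 0.
Proof.
move=> il; have [ne|//] := chainD_kill l j (nth ((fun=> 0), j) l i).1.
exfalso; move: {1}j ne => j0; elim: l i il => // -[g d] l IH [|i] /= il [] // _.
exact: IH.
Qed.

(** Apply the derivation [chainD l d] of the tail to the linear relation: it kills the tail and
    takes the head to its pivot, so the coefficient of the head vanishes, and the tail is handled by
    induction. *)
Lemma chain_free l z (c : nat -> R) d0 : chainU l z != 0 ->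
  (forall j, \sum_(i < size l) c i * partial (nth ((fun=> 0), d0) l i).1 j z = 0) ->
  forall i, (i < size l)%N -> c i = 0.
Proof.
elim: l c => // -[g d] l IH c /=; rewrite mulf_eq0 negb_or => /andP[gd0 ul] cE.
have c0 : c 0%N = 0.
  have [v vE] := chainD_linear l d z.
  have : \sum_(j < n) v j * \sum_(i < (size l).+1)
      c i * partial (nth (fun=> 0, d0) ((g, d) :: l) i).1 j z = 0.
    by rewrite big1// => j _; rewrite cE mulr0.
  rewrite (eq_bigr (fun j => \sum_(i < (size l).+1) c i *
      (v j * partial (nth (fun=> 0, d0) ((g, d) :: l) i).1 j z))); last first.
    by move=> j _; rewrite mulr_sumr; apply: eq_bigr => i _; rewrite mulrCA.
  rewrite exchange_big/= big_ord_recl/= -mulr_sumr -vE.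
  rewrite big1 ?addr0 => [/eqP|i _]; first by rewrite mulf_eq0 (negbTE gd0) orbF => /eqP.
  rewrite -mulr_sumr -vE (set_nth_default ((fun=> 0), d))//.
    by rewrite add0n chainD_mem ?mulr0.
  by rewrite add0n.
move=> [//|i]; rewrite ltnS => il; apply: (IH (fun i => c i.+1)) => // j.
by have := cE j; rewrite big_ord_recl/= c0 mul0r add0r.
Qed.

Section AtPoint.
Variable a : V.
Local Notation psat0 := (psat finset.set0 a).

Lemma psat_chainD l j h : chainP psat0 l -> psat0 h -> psat0 (chainD l j h).
Proof.
elim: l j h => [|[g d] l IH] j h /=; first by move=> _; exact: psat_partial.
by move=> [pg pl] ph; apply: psat_subr; apply: psat_mul; exact: IH.
Qed.

Lemma psat_chainU l : chainP psat0 l -> psat0 (chainU l).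
Proof.
elim: l => [|[g d] l IH] /=; first by move=> _; exact: psat_const.
by move=> [pg pl]; apply: psat_mul; [exact: psat_chainD|exact: IH].
Qed.

Lemma chainD_near l j p q : (\forall x \near a, p x = q x) ->
  \forall x \near a, chainD l j p x = chainD l j q x.
Proof.
elim: l j => [|[g d] l IH] j pq /=; first exact: near_partial.
by apply: filterS2 (IH j pq) (IH d pq) => x -> ->.
Qed.

Lemma chainD_mul l j p q : psat0 p -> psat0 q ->
  \forall x \near a, chainD l j (fun x => p x * q x) x =
    p x * chainD l j q x + q x * chainD l j p x.
Proof.
elim: l j => [|[g d] l IH] j pp pq /=; first exact: (partial_mul j pp pq).
near=> x.
have -> : chainD l j (fun x => p x * q x) x = p x * chainD l j q x + q x * chainD l j p x.
  by near: x; exact: IH.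
have -> : chainD l d (fun x => p x * q x) x = p x * chainD l d q x + q x * chainD l d p x.
  by near: x; exact: IH.
ring.
Unshelve. all: by end_near. Qed.

Lemma chainD_sub l j p q : psat0 p -> psat0 q ->
  \forall x \near a, chainD l j (fun x => p x - q x) x = chainD l j p x - chainD l j q x.
Proof.
elim: l j => [|[g d] l IH] j pp pq /=; first exact: (partial_sub j pp pq).
near=> x.
have -> : chainD l j (fun x => p x - q x) x = chainD l j p x - chainD l j q x.
  by near: x; exact: IH.
have -> : chainD l d (fun x => p x - q x) x = chainD l d p x - chainD l d q x.
  by near: x; exact: IH.
ring.
Unshelve. all: by end_near. Qed.

(** Of the two products in the elimination step the second contains the derivative of [s] along the
    eliminated variable, which is zero. *)
Lemma chainD_indep l j s : uniq (map snd l) -> psat (chain_vars l) a s ->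
  j \notin chain_vars l ->
  \forall x \near a, chainD l j s x = chainU l x * partial s j x.
Proof.
elim: l j => [|[g d] l IH] j /=.
  by move=> _ _ _; near=> x; rewrite mul1r.
move=> /andP[dl ul] ps; rewrite chain_vars_cons !inE negb_or => /andP[jd jl].
have ps' : psat (chain_vars l) a s.
  by apply: psat_sub ps; rewrite chain_vars_cons finset.subsetUr.
have dl' : d \notin chain_vars l by rewrite inE.
have jl' : j \notin chain_vars l by rewrite inE.
near=> x.
have -> : chainD l j s x = chainU l x * partial s j x by near: x; exact: IH.
have -> : chainD l d s x = chainU l x * partial s d x by near: x; exact: IH.
have -> : partial s d x = 0.
  near: x; apply: (psat_partial_indep _ ps).
  by rewrite chain_vars_cons !inE eqxx.
by rewrite mulr0 mulr0 subr0 mulrA.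
Unshelve. all: by end_near. Qed.

(** Membership in the ideal of germs at [a] generated by the chain, with one quotient for each
    generator in turn. *)
Fixpoint in_ideal l h : Prop :=
  if l is (g, d) :: l' then
    exists2 q, psat0 q & in_ideal l' (fun x => h x - q x * g x)
  else \forall x \near a, h x = 0.

Lemma in_ideal_near l p q : (\forall x \near a, p x = q x) -> in_ideal l p -> in_ideal l q.
Proof.
elim: l p q => [|[g d] l IH] p q pq /=.
  by apply: filterS2 pq => x ->.
move=> [r pr rl]; exists r => //; apply: IH rl.
by apply: filterS pq => x ->.
Qed.

Lemma in_ideal_comb l p q r : psat0 r -> in_ideal l p -> in_ideal l q ->
  in_ideal l (fun x => p x - r x * q x).
Proof.
move=> pr; elim: l p q => [|[g d] l IH] p q /=.
  by apply: filterS2 => x -> ->; rewrite mulr0 subr0.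
move=> [p1 pp1 Ip] [q1 pq1 Iq]; exists (fun x => p1 x - r x * q1 x).
  by apply: psat_subr => //; exact: psat_mul.
by apply: in_ideal_near (IH _ _ Ip Iq); near=> x; ring.
Unshelve. all: by end_near. Qed.

Lemma in_ideal_vanish l h : in_ideal l h ->
  \forall x \near a, chainP (fun g => g x = 0) l -> h x = 0.
Proof.
elim: l h => [|[g d] l IH] h /=; first by apply: filterS.
move=> [q _ /IH]; apply: filterS => x hx [gx xl].
by have := hx xl; rewrite gx mulr0 subr0.
Qed.

(** By the Leibniz rule a derivation that kills the generators maps their ideal to itself; only the
    quotients get differentiated. *)
Lemma in_ideal_chainD L j l h : chainP psat0 L -> chainP psat0 l -> psat0 h ->
  chainP (fun g => forall x, chainD L j g x = 0) l ->
  in_ideal l h -> in_ideal l (chainD L j h).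
Proof.
move=> pL; elim: l h => [|[g d] l IH] h /=.
  move=> _ _ _ h0.
  apply: (@in_ideal_near [::] (chainD L j (fun x => h x - h x))).
    apply: filterS (chainD_near L j (_ : \forall x \near a, h x - h x = h x)) => //.
    by apply: filterS h0 => x ->; rewrite subr0.
  move: h0 => /nbhs_interior; apply: filterS => x hx /=.
  have [v ->] := chainD_linear L j x; rewrite big1// => i _.
  rewrite /partial (near_eq_derive (g := cst 0)) ?derive_cst ?mulr0//.
  by apply: filterS hx => y ->; rewrite subrr.
move=> [pg pl] ph [gL lL] [q pq Ih]; exists (chainD L j q); first exact: psat_chainD.
have pqg : psat0 (fun x => q x * g x) by exact: psat_mul.
apply: in_ideal_near (IH _ pl (psat_subr ph pqg) lL Ih).
near=> x.
have -> : chainD L j (fun x => h x - q x * g x) x =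
    chainD L j h x - chainD L j (fun x => q x * g x) x.
  by near: x; exact: chainD_sub.
have -> : chainD L j (fun x => q x * g x) x = q x * chainD L j g x + g x * chainD L j q x.
  by near: x; exact: chainD_mul.
by rewrite gL mulr0 add0r [g x * _]mulrC.
Unshelve. all: by end_near. Qed.

Lemma chainD_killall l j : chainP (fun g => forall x, chainD l j g x = 0) l.
Proof.
(* The derivation stays attached to the whole chain [L] while the induction removes members from
   [l']. *)
suff H L l' : (forall i, (i < size l')%N -> exists2 i', (i' < size L)%N &
    (nth ((fun=> 0), j) l' i).1 = (nth ((fun=> 0), j) L i').1) ->
    chainP (fun g => forall x, chainD L j g x = 0) l'.
  by apply: H => i il; exists i.
elim: l' => // -[g d] l' IH sub /=; split.
  by have [i' iL /= ->] := sub 0%N isT => x; exact: chainD_mem.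
by apply: IH => i il; exact: (sub i.+1).
Qed.

Fixpoint chain_at l : Prop :=
  if l is (g, d) :: l' then
    [/\ psat0 g, g a = 0, chainD l' d g a != 0, d \notin chain_vars l' & chain_at l']
  else True.

Lemma chain_at_psat l : chain_at l -> chainP psat0 l.
Proof. by elim: l => // -[g d] l IH /= [? _ _ _ /IH]. Qed.

Lemma chain_at_zero l : chain_at l -> chainP (fun g => g a = 0) l.
Proof. by elim: l => // -[g d] l IH /= [_ ? _ _ /IH]. Qed.

Lemma chain_at_U l : chain_at l -> chainU l a != 0.
Proof.
elim: l => [_|[g d] l IH /= [_ _ gd _ /IH lU]] /=; first exact: oner_neq0.
by rewrite mulf_neq0.
Qed.

Lemma chain_at_uniq l : chain_at l -> uniq (map snd l).
Proof. by elim: l => // -[g d] l IH /= [_ _ _ dl /IH ->]; rewrite andbT; rewrite inE in dl. Qed.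

(** The implicit function theorem in algebraic form. The head [g] and the germ [h] are first reduced
    modulo the tail to germs [t] and [s] in the variables left. At [a] the pivot of [g] is [chainU]
    of the tail times the partial derivative of [t] along [d], so [s] can be divided by [t]. *)
Lemma chain_elim l h : chain_at l -> psat0 h ->
  exists2 s, psat (chain_vars l) a s & in_ideal l (fun x => h x - s x).
Proof.
elim: l h => [|[g d] l IH] h /=.
  move=> _ ph; exists h; last by near=> x; rewrite subrr.
  by apply: psat_sub ph; apply/fintype.subsetP => i; rewrite inE.
move=> [pg ga gd dl la] ph.
have [s ps Is] := IH _ la ph; have [t pt It] := IH _ la pg.
have pl := chain_at_psat la.
have z0 := chain_at_zero la.
have ps0 : psat0 s by apply: psat_sub ps; exact: finset.sub0set.
have pt0 : psat0 t by apply: psat_sub pt; exact: finset.sub0set.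
have ta : t a = 0.
  have := nbhs_singleton (in_ideal_vanish It) z0; rewrite ga sub0r => /eqP.
  by rewrite oppr_eq0 => /eqP.
have td : partial t d a != 0.
  have Id := in_ideal_chainD pl pl (psat_subr pg pt0) (chainD_killall l d) It.
  have := nbhs_singleton (in_ideal_vanish Id) z0.
  rewrite (nbhs_singleton (chainD_sub l d pg pt0)).
  rewrite (nbhs_singleton (chainD_indep (chain_at_uniq la) pt dl)) => /eqP.
  rewrite subr_eq0 => /eqP gE; apply: contra_neq gd => td0.
  by rewrite gE td0 mulr0.
have [q [r [pq pr sE]]] := psat_div dl pt ta td ps.
exists r; first by rewrite chain_vars_cons.
have pq0 : psat0 q by apply: psat_sub pq; exact: finset.sub0set.
exists q => //; apply: in_ideal_near (in_ideal_comb pq0 Is It).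
by apply: filterS sE => x ->; ring.
Unshelve. all: by end_near. Qed.

Lemma flat_zero m p : (\forall x \near a, p x = 0) -> flat m a p.
Proof.
elim: m p => [|m IH] p p0; split; rewrite ?(nbhs_singleton p0)// => j.
apply: IH; have := near_partial j (p0 : \forall x \near a, p x = cst 0 x).
by apply: filterS => x ->; rewrite /partial derive_cst.
Qed.

Section Maximal.
Variables (A : set (V -> R)) (l : seq ((V -> R) * 'I_n)).
Hypotheses (Apsat : forall h, A h -> psat0 h)
  (AD : forall j h, A h -> A (chainD l j h)) (la : chain_at l)
  (max : forall j h, A h -> h a = 0 -> j \notin chain_vars l -> chainD l j h a = 0).

(** Maximality of the chain makes the reduced germ [s] flat: modulo the ideal, [chainU l] times a
    partial derivative of [s] equals [chainD l j h], which lies in [A] and vanishes at [a], so that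
    the induction applies to it. *)
Lemma chain_flat m h s : A h -> h a = 0 -> psat (chain_vars l) a s ->
  in_ideal l (fun x => h x - s x) -> flat m a s.
Proof.
have pl := chain_at_psat la; have z0 := chain_at_zero la.
have value h' s' : h' a = 0 -> in_ideal l (fun x => h' x - s' x) -> s' a = 0.
  move=> ha Is; have := nbhs_singleton (in_ideal_vanish Is) z0; rewrite ha sub0r => /eqP.
  by rewrite oppr_eq0 => /eqP.
elim: m h s => [|m IH] h s Ah ha ps Is; split=> //; try exact: value Is.
move=> j; have [jl|jl] := boolP (j \in chain_vars l).
  exact: flat_zero (psat_partial_indep jl ps).
have ps0 : psat0 s by apply: psat_sub ps; exact: finset.sub0set.
have ph := Apsat Ah.
have pU := psat_chainU pl.
(* [chainU] itself may involve the eliminated variables; its reduction [de] does not, and has the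
   same nonzero value at [a]. *)
have [de pde Ide] := chain_elim la pU.
have pde0 : psat0 de by apply: psat_sub pde; exact: finset.sub0set.
have pds := psat_partial j ps; have pds0 := psat_partial j ps0.
have deU : de a = chainU l a.
  by have /eqP := nbhs_singleton (in_ideal_vanish Ide) z0; rewrite subr_eq0 => /eqP.
apply: (flat_div pde0 pds0); first by rewrite deU chain_at_U.
apply: (IH (chainD l j h)); [exact: AD|exact: max|exact: psat_mul|].
have Ix := in_ideal_chainD pl pl (psat_subr ph ps0) (chainD_killall l j) Is.
have pmds : psat0 (fun x => - partial s j x) by exact: psat_opp.
apply: in_ideal_near (in_ideal_comb pmds Ix Ide).
near=> x.
have -> : chainD l j (fun x => h x - s x) x = chainD l j h x - chainD l j s x.
  by near: x; exact: chainD_sub.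
have -> : chainD l j s x = chainU l x * partial s j x.
  by near: x; exact: (chainD_indep (chain_at_uniq la)).
ring.
Unshelve. all: by end_near. Qed.

(** The reduction of [f] is flat of every order, hence zero near [a], so [f] lies in the ideal of
    the chain. *)
Lemma chain_vanish f : A f -> f a = 0 ->
  \forall x \near a, chainP (fun g => g x = 0) l -> f x = 0.
Proof.
move=> Af fa; have [s ps Is] := chain_elim la (Apsat Af).
have s0 := flat_eq0 ps (fun m => chain_flat m Af fa ps Is).
near=> x => xl.
have : f x - s x = 0 by move: xl; near: x; exact: in_ideal_vanish.
have -> : s x = 0 by near: x.
by rewrite subr0.
Unshelve. all: by end_near. Qed.

End Maximal.
End AtPoint.
End Chains.

(** Syntax for the functions obtained from a single one by partial derivatives, products and
    differences. They are closed under [chainD], and the syntax is countable, so there are countably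
    many chains. Directions are stored as natural numbers to keep the type independent of the
    dimension. *)
Inductive dterm := DVar | DPart of nat & dterm | DMul of dterm & dterm | DSub of dterm & dterm.

Fixpoint dterm_code (t : dterm) : GenTree.tree nat :=
  match t with
  | DVar => GenTree.Leaf 0
  | DPart j t => GenTree.Node 0 [:: GenTree.Leaf j; dterm_code t]
  | DMul t u => GenTree.Node 1 [:: dterm_code t; dterm_code u]
  | DSub t u => GenTree.Node 2 [:: dterm_code t; dterm_code u]
  end.

Fixpoint dterm_decode (t : GenTree.tree nat) : option dterm :=
  match t with
  | GenTree.Leaf 0 => Some DVar
  | GenTree.Node 0 [:: GenTree.Leaf j; t] => omap (DPart j) (dterm_decode t)
  | GenTree.Node 1 [:: t; u] =>
      obind (fun t => omap (DMul t) (dterm_decode u)) (dterm_decode t)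
  | GenTree.Node 2 [:: t; u] =>
      obind (fun t => omap (DSub t) (dterm_decode u)) (dterm_decode t)
  | _ => None
  end.

Lemma dterm_codeK : pcancel dterm_code dterm_decode. 
Proof.
by elim=> [|j t IH|t IHt u IHu|t IHt u IHu] //=; rewrite ?IH ?IHt ?IHu.
Qed.

HB.instance Definition _ := Countable.copy dterm (pcan_type dterm_codeK).

Section AnalyticAt.
Context {R : realType} {n : nat}.
Local Notation V := 'rV[R]_n.

Lemma psat_analytic D a (f : V -> R) : psat D a f -> analytic_at f a.
Proof.
move=> [w [c [w0 wc _ fE]]]; exists c.
near=> x => /=.
have xw : inbox w (x - a) by near: x; exact: nbhs_box.
have sm : summ (fun k => c k * mono (x - a) k) by exact: wfin_sub w0 xw wc.
have mE : (fun k => c k * monomial a x k) = fun k => c k * mono (x - a) k.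
  by apply/funext => k; congr (_ * _); apply: eq_bigr => i _; rewrite !mxE.
have tE : (fun k => (c k * monomial a x k)%:E) = fun k => (c k * mono (x - a) k)%:E.
  by apply/funext => k; rewrite -[c k * monomial a x k]/((fun k => c k * monomial a x k) k) mE.
rewrite tE; split; first exact/summ_summable.
by rewrite -rsum_esumB// -[x in f x](subrK a) addrC fE.
Unshelve. all: by end_near. Qed.

End AnalyticAt.

(** * Countable decomposition of a zero set into submanifolds *)

Section Stratification.
Context {R : realType} {m : nat}.
Local Notation n := m.+1.
Local Notation V := 'rV[R]_n.
Variable f : V -> R.
Hypothesis f_an : forall x, psat finset.set0 x f.

Fixpoint dterm_eval (t : dterm) : V -> R :=
  match t with
  | DVar => f
  | DPart j t => partial (dterm_eval t) (inord j)
  | DMul t u => fun x => dterm_eval t x * dterm_eval u x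
  | DSub t u => fun x => dterm_eval t x - dterm_eval u x
  end.

Lemma psat_dterm t x : psat finset.set0 x (dterm_eval t).
Proof.
elim: t => [|j t IH|t IHt u IHu|t IHt u IHu] /=; first exact: f_an.
- exact: psat_partial.
- exact: psat_mul.
- exact: psat_subr.
Qed.

Definition code_chain (l : seq (dterm * 'I_n)) := [seq (dterm_eval p.1, p.2) | p <- l].

Lemma chainD_dterm l j t :
  exists u, chainD (code_chain l) j (dterm_eval t) = dterm_eval u.
Proof.
elim: l j t => [|[g d] l IH] j t /=.
  by exists (DPart j t); rewrite /= inord_val.
have [u1 E1] := IH d g; have [u2 E2] := IH j t; have [u3 E3] := IH j g.
have [u4 E4] := IH d t.
by exists (DSub (DMul u1 u2) (DMul u3 u4)); rewrite E1 E2 E3 E4.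
Qed.

Lemma code_chain_psat l x : chainP (psat finset.set0 x) (code_chain l).
Proof. by elim: l => //= -[t d] l IH; split=> //; exact: psat_dterm. Qed.

(** The last clause is what maximality of a chain provides: near [y] the zero set of the chain is
    contained in that of [f]. It makes the piece relatively open in the zero set of the chain. *)
Definition piece (l : seq (dterm * 'I_n)) : set V := [set y |
  [/\ chainP (fun g => g y = 0) (code_chain l), chainU (code_chain l) y != 0 &
      \forall z \near y, chainP (fun g => g z = 0) (code_chain l) -> f z = 0]].

Lemma size_code_chain l : size (code_chain l) = size l.
Proof. exact: size_map. Qed.

Lemma code_chain_vars l : map snd (code_chain l) = map snd l.
Proof. by rewrite -map_comp. Qed.

Lemma uniq_size l : uniq (map snd l) -> (size (l : seq (dterm * 'I_n)) <= n)%N.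
Proof.
by move=> /card_uniqP; rewrite size_map => <-; rewrite -[leqRHS]card_ord max_card.
Qed.

Lemma chainP_nth (P : (V -> R) -> Prop) l d0 : chainP P l <->
  forall i, (i < size l)%N -> P (nth ((fun=> 0), d0) l i).1.
Proof.
elim: l => [|[g d] l [IH1 IH2]] /=; first by split.
split=> [[Pg /IH1 Pl] [|i] //= il|Pl]; first exact: Pl.
by split; [exact: (Pl 0%N)|apply: IH2 => i il; exact: (Pl i.+1)].
Qed.

Lemma piece_submanifold l : uniq (map snd l) ->
  analytic_submanifold (n - size l) (piece l).
Proof.
move=> ul; split; first exact: leq_subr.
move=> p [pz pU pf].
have sz : (n - (n - size l))%N = size l by rewrite subKn// uniq_size.
pose O : set V := [set z | chainU (code_chain l) z != 0 /\
  (chainP (fun g => g z = 0) (code_chain l) -> f z = 0)].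
pose u (i : 'I_(n - (n - size l))) : V -> R := (nth ((fun=> 0), ord0) (code_chain l) i).1.
have uP z : (forall i, u i z = 0) <-> chainP (fun g => g z = 0) (code_chain l).
  rewrite (chainP_nth _ _ ord0) size_code_chain; split=> [uz i il|lz i].
    have il' : (i < n - (n - size l))%N by rewrite sz.
    exact: (uz (Ordinal il')).
  exact/lz/(leq_trans (ltn_ord i) (eq_leq sz)).
exists O°, u; split.
- split; first exact: open_interior.
  have cU := psat_continuous (psat_chainU (code_chain_psat l p)).
  near=> z; split; last by near: z.
  near: z; apply: (cU [set r | r != 0]).
  by apply: open_nbhs_nbhs; split=> //; exact: open_neq.
- move=> i x _; apply: (@psat_analytic _ _ finset.set0).
  have : chainP (psat finset.set0 x) (code_chain l) by exact: code_chain_psat.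
  by move/(chainP_nth _ _ ord0); apply; rewrite size_code_chain; exact: leq_trans (ltn_ord i) (eq_leq sz).
- move=> x /nbhs_singleton[Ux _].
  rewrite -kermx_eq0; apply/rowV0P => v /sub_kermxP vA.
  (* The row vector is extended by 0, as [chain_free] takes coefficients indexed by natural
     numbers. *)
  pose c i := if insub i is Some i' then v 0 (i' : 'I_(n - (n - size l))) else 0.
  apply/rowP => i; rewrite mxE.
  have -> : v 0 i = c i by rewrite /c valK.
  have il : (i < size (code_chain l))%N.
    by rewrite size_code_chain; exact: leq_trans (ltn_ord i) (eq_leq sz).
  apply: (@chain_free _ _ (code_chain l) x c ord0 Ux _ i il) => j.
  have := congr1 (fun M : 'rV_n => M 0 j) vA; rewrite mxE [RHS]mxE; apply: etrans.
  pose F i := c i * partial (nth (fun=> 0, ord0) (code_chain l) i).1 j x.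
  rewrite -(big_mkord xpredT F) size_code_chain.
  rewrite [LHS](_ : _ = \sum_(0 <= i < n - (n - size l)) F i); last by rewrite sz.
  by rewrite big_mkord; apply: eq_bigr => k _; rewrite mxE /F /c valK.
- apply/seteqP; split=> z [] /=.
    by move=> [/uP uz _ _] Oz.
  move=> uz Oz; split=> //; split; first exact/uP.
    by have [] := nbhs_singleton Oz.
  by apply: filterS Oz => y [_].
Unshelve. all: by end_near. Qed.

Lemma piece_cover x : f x = 0 -> exists l, uniq (map snd l) /\ piece l x.
Proof.
move=> fx; pose A : set (V -> R) := range dterm_eval.
suff H k l : (n - size l <= k)%N -> chain_at x (code_chain l) ->
    exists l, uniq (map snd l) /\ piece l x by exact: (H n [::]).
elim: k l => [|k IH] l lk lx.
  all: have := chain_at_uniq lx; rewrite code_chain_vars => ul.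
  all: have [max|nmax] := pselect (forall j h, A h -> h x = 0 ->
    j \notin chain_vars (code_chain l) -> chainD (code_chain l) j h x = 0).
- exists l; split=> //; split; [exact: chain_at_zero|exact: chain_at_U|].
  apply: (chain_vanish (A := A)) => //; last by exists DVar.
    by move=> _ [t _ <-]; exact: psat_dterm.
  by move=> j _ [t _ <-]; have [u ->] := chainD_dterm l j t; exists u.
(* With no variable left the chain is maximal for lack of directions. *)
- exfalso; apply: nmax => j h _ _; rewrite inE code_chain_vars.
  have szl : size (map snd l) = n.
    by apply/eqP; rewrite size_map eqn_leq uniq_size//= -subn_eq0 -leqn0.
  have /card_uniqP c := ul.
  have /(_ j) : map snd l =i predT.
    by apply/subset_cardP; [rewrite c szl card_ord|exact/fintype.subsetP].
  by move=> -> .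
- exists l; split=> //; split; [exact: chain_at_zero|exact: chain_at_U|].
  apply: (chain_vanish (A := A)) => //; last by exists DVar.
    by move=> _ [t _ <-]; exact: psat_dterm.
  by move=> j _ [t _ <-]; have [u ->] := chainD_dterm l j t; exists u.
- have [j [t [hx jl jx]]] : exists j t, [/\ dterm_eval t x = 0,
      j \notin chain_vars (code_chain l) & chainD (code_chain l) j (dterm_eval t) x != 0].
    apply: contrapT => no; apply: nmax => j _ [t _ <-] tx jl.
    by apply/eqP/negPn/negP => ne; apply: no; exists j, t.
  apply: (IH ((t, j) :: l)); first by rewrite /= subnS -ltnS; case: (n - size l)%N lk.
  by split=> //; exact: psat_dterm.
Qed.

Lemma piece_sub l x : piece l x -> f x = 0.
Proof. by move=> [xl _ /nbhs_singleton]; exact. Qed.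

Hypothesis thin : forall x, f x = 0 -> ~ \forall y \near x, f y = 0.
Hypothesis fat : forall G : nat -> (V -> R) * (V -> R),
  (forall i x, psat finset.set0 x (G i).1 /\ psat finset.set0 x (G i).2) ->
  ~ (forall x, f x = 0 -> exists i, [/\ (G i).1 x = 0, (G i).2 x = 0 &
     forall a b : R, (forall j, a * partial (G i).1 j x + b * partial (G i).2 j x = 0) ->
       a = 0 /\ b = 0]).

(** The piece of the empty chain is the interior of the zero set, excluded by [thin]. By [fat] the
    chains of length at least two do not cover the zero set, which yields a nonempty piece of
    codimension one. *)
Lemma stratification : variety_dim [set x | f x = 0] n.-1.
Proof.
have ne0 x l : piece l x -> l <> [::].
  by move=> xl l0; apply: (thin (piece_sub xl)); move: xl; rewrite l0 => -[_ _]; apply: filterS => y; apply.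
have [l1 [ul1 s1 M1]] : exists l, [/\ uniq (map snd l), size l = 1%N & piece l !=set0].
  apply: contrapT => no.
  pose G i := match (unpickle i : option (seq (dterm * 'I_n))) with
    | Some ((t, _) :: (u, _) :: _) => (dterm_eval t, dterm_eval u)
    | _ => (f, f) end.
  apply: (fat (G := G)) => [i x|x fx].
    by rewrite /G; case: unpickle => [[|[t d] [|[u e] l]]|]; split=> //; exact: psat_dterm.
  have [l [ul xl]] := piece_cover fx.
  case: l ul xl (ne0 x l) => [|[t d] [|[u e] l]] ul xl nl.
  - by have := nl xl.
  - by exfalso; apply: no; exists [:: (t, d)]; split=> //; exists x.
  - exists (pickle ((t, d) :: (u, e) :: l)); rewrite /G pickleK.
    have [/= [tx [ux _]] U0 _] := xl; split=> // a b ab.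
    pose c (i : nat) : R := match i with 0%N => a | 1%N => b | _ => 0 end.
    have H := @chain_free _ _ (code_chain ((t, d) :: (u, e) :: l)) x c ord0 U0.
    suff E j : \sum_(i < size (code_chain ((t, d) :: (u, e) :: l))) c i *
        partial (nth (fun=> 0, ord0) (code_chain ((t, d) :: (u, e) :: l)) i).1 j x = 0.
      by split; [exact: (H E 0%N)|exact: (H E 1%N)].
    rewrite /= !big_ord_recl/= big1 ?addr0 ?ab// => i _.
    by rewrite mul0r.
pose good l := [/\ uniq (map snd l), l <> [::] & piece l !=set0].
(* [variety_dim] asks for a sequence of nonempty pieces; indices that code no good chain receive the
   default [l1]. *)
pose L i := if unpickle i is Some l then if pselect (good l) then l else l1 else l1.
have g1 : good l1 by split=> // l10; move: s1; rewrite l10.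
have gL i : good (L i).
  by rewrite /L; case: unpickle => [l|//]; case: pselect.
exists (fun i => piece (L i)), (fun i => (n - size (L i))%N); split.
- by move=> i; have [ui _ ?] := gL i; split=> //; exact: piece_submanifold.
- apply/seteqP; split=> [x /piece_cover[l [ul xl]]|x [i _] /piece_sub//].
  exists (pickle l) => //; rewrite /L pickleK; case: pselect => // -[].
  by split=> //; [exact: ne0 xl|exists x].
- move=> i; have [_ + _] := gL i; case: (L i) => // p l _ /=.
  by rewrite subSS leq_subr.
- exists (pickle l1); suff -> : L (pickle l1) = l1 by rewrite s1 subn1.
  by rewrite /L pickleK; case: pselect.
Qed.

End Stratification.

(** * The Korányi metric *)

Section KoranyiMetric.
Context {R : realType}.
Implicit Types (x y z g : heis R) (r : R).
Local Notation H := (heis R).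

Lemma ler_X4 (a b : R) : 0 <= a -> 0 <= b -> a ^+ 4 <= b ^+ 4 -> a <= b.
Proof. by move=> a0 b0; rewrite ler_pXn2r. Qed.

Lemma hnorm_ge0 x : 0 <= hnorm x. Proof. exact: powR_ge0. Qed.

Lemma hdist_ge0 x y : 0 <= hdist x y. Proof. exact: hnorm_ge0. Qed.

Lemma hdistX4 x y : hdist x y ^+ 4 =
  ((hx1 y - hx1 x) ^+ 2 + (hx2 y - hx2 x) ^+ 2) ^+ 2 +
  (hx3 y - hx3 x + 2 * hx1 x * hx2 y - 2 * hx2 x * hx1 y) ^+ 2.
Proof. by rewrite hnormX4 /hmul /hinv !hpointE; ring. Qed.

Lemma eq_hdist x y x' y' : hdist x y ^+ 4 = hdist x' y' ^+ 4 -> hdist x y = hdist x' y'.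
Proof.
move=> e; have h0 := hdist_ge0 x y; have h0' := hdist_ge0 x' y'.
apply/eqP; rewrite eq_le; apply/andP; split; apply: ler_X4 => //; rewrite e; exact: lexx.
Qed.

Lemma hdistC x y : hdist x y = hdist y x.
Proof. by apply: eq_hdist; rewrite !hdistX4; ring. Qed.

Lemma hdistxx x : hdist x x = 0.
Proof.
apply/eqP; rewrite eq_le hdist_ge0 andbT; apply: ler_X4; rewrite ?hdist_ge0//.
by rewrite hdistX4 expr0n/= le_eqVlt; apply/orP; left; apply/eqP; ring.
Qed.

Lemma hdist_mull g x y : hdist (hmul g x) (hmul g y) = hdist x y.
Proof. by apply: eq_hdist; rewrite !hdistX4 /hmul !hpointE; ring. Qed.

(** Minkowski's inequality in the plane, without square roots. *)
Lemma sqr_norm_add (a b c d A B : R) : 0 <= A -> 0 <= B ->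
  a ^+ 2 + b ^+ 2 <= A ^+ 2 -> c ^+ 2 + d ^+ 2 <= B ^+ 2 ->
  (a + c) ^+ 2 + (b + d) ^+ 2 <= (A + B) ^+ 2.
Proof.
move=> A0 B0 h1 h2.
have cs : a * c + b * d <= A * B.
  apply: le_trans (ler_norm _) _; rewrite -(@ler_pXn2r _ 2) ?nnegrE ?mulr_ge0//.
  rewrite real_normK ?num_real//.
  apply: (@le_trans _ _ ((a ^+ 2 + b ^+ 2) * (c ^+ 2 + d ^+ 2))).
    rewrite -subr_ge0 (_ : _ - _ = (a * d - b * c) ^+ 2) ?sqr_ge0//; ring.
  by rewrite exprMn ler_pM// addr_ge0 ?sqr_ge0.
nra.
Qed.

(** Attach to a point with horizontal part [z] the plane vector [(|z|^2, x3)], whose length is the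
    square of the norm. The vector of a product is the sum of the two vectors and of a mixed one,
    [(2 z.w, 2 (x2 y1 - x1 y2))], of length at most [2 a b]. Minkowski's inequality bounds the total
    length by [(a + b)^2]. *)
Lemma hnorm_mul x y : hnorm (hmul x y) <= hnorm x + hnorm y.
Proof.
set a := hnorm x; set b := hnorm y.
have a0 : 0 <= a := hnorm_ge0 _; have b0 : 0 <= b := hnorm_ge0 _.
have ha := hnormX4 x; have hb := hnormX4 y; rewrite -/a in ha; rewrite -/b in hb.
apply: ler_X4; rewrite ?hnorm_ge0 ?addr_ge0// hnormX4 /hmul !hpointE.
set x1 := hx1 x in ha *; set x2 := hx2 x in ha *; set x3 := hx3 x in ha *.
set y1 := hx1 y in hb *; set y2 := hx2 y in hb *; set y3 := hx3 y in hb *.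
have zx : x1 ^+ 2 + x2 ^+ 2 <= a ^+ 2.
  rewrite -(@ler_pXn2r _ 2) ?nnegrE ?addr_ge0 ?sqr_ge0// -exprM ha lerDl sqr_ge0//.
have zy : y1 ^+ 2 + y2 ^+ 2 <= b ^+ 2.
  rewrite -(@ler_pXn2r _ 2) ?nnegrE ?addr_ge0 ?sqr_ge0// -exprM hb lerDl sqr_ge0//.
have hxy : (x1 ^+ 2 + x2 ^+ 2 + (y1 ^+ 2 + y2 ^+ 2)) ^+ 2 + (x3 + y3) ^+ 2 <=
    (a ^+ 2 + b ^+ 2) ^+ 2.
  by apply: sqr_norm_add; rewrite ?sqr_ge0// -exprM ?ha ?hb.
have hp : (2 * (x1 * y1 + x2 * y2)) ^+ 2 + (2 * (x2 * y1 - x1 * y2)) ^+ 2 <=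
    (2 * (a * b)) ^+ 2.
  rewrite (_ : _ + _ = 4 * ((x1 ^+ 2 + x2 ^+ 2) * (y1 ^+ 2 + y2 ^+ 2))); last by ring.
  rewrite (_ : (2 * _) ^+ 2 = 4 * (a ^+ 2 * b ^+ 2)); last by ring.
  by rewrite ler_wpM2l// ler_pM// addr_ge0 ?sqr_ge0.
have := sqr_norm_add _ _ hxy hp.
rewrite addr_ge0 ?sqr_ge0// mulr_ge0 ?mulr_ge0// => /(_ isT isT).
set L := (X in X <= _ -> _); set L' := (X in _ -> X <= _).
have -> : L' = L by rewrite /L /L'; ring.
have -> : (a ^+ 2 + b ^+ 2 + 2 * (a * b)) ^+ 2 = (a + b) ^+ 4 by ring.
by [].
Qed.

Lemma hdist_triangle y x z : hdist x z <= hdist x y + hdist y z.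
Proof.
rewrite /hdist; apply: le_trans (hnorm_mul _ _); rewrite le_eqVlt; apply/orP; left.
by apply/eqP; congr hnorm; apply: heisP; rewrite /hmul /hinv !hpointE; ring.
Qed.

Lemma hballP x r y : 0 <= r -> hball x r y <-> hdist x y ^+ 4 <= r ^+ 4.
Proof. by move=> r0; rewrite /hball/= ler_pXn2r// nnegrE ?hdist_ge0. Qed.

Lemma hball_lt0 x r : r < 0 -> hball x r = set0.
Proof.
move=> r0; apply/seteqP; split=> // y /=; rewrite /hball /= => yr.
by have := le_lt_trans yr r0; rewrite ltNge hdist_ge0.
Qed.

Lemma hballxx x r : 0 <= r -> hball x r x.
Proof. by rewrite /hball/= hdistxx. Qed.

Lemma hball_sub x y r s : hdist x y + s <= r -> hball y s `<=` hball x r.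
Proof.
by move=> h z; rewrite /hball/= => yz; rewrite (le_trans (hdist_triangle y _ _))// (le_trans _ h)// lerD2l.
Qed.

Lemma continuous_hx1 : continuous (@hx1 R).
Proof. by move=> x; exact: coord_continuous. Qed.
Lemma continuous_hx2 : continuous (@hx2 R).
Proof. by move=> x; exact: coord_continuous. Qed.
Lemma continuous_hx3 : continuous (@hx3 R).
Proof. by move=> x; exact: coord_continuous. Qed.

Lemma continuous_hdistX4 x : continuous (fun y : H => hdist x y ^+ 4).
Proof.
move=> y; rewrite (_ : (fun y => _) = fun y : H =>
  ((hx1 y - hx1 x) ^+ 2 + (hx2 y - hx2 x) ^+ 2) ^+ 2 +
  (hx3 y - hx3 x + 2 * hx1 x * hx2 y - 2 * hx2 x * hx1 y) ^+ 2); last first.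
  by apply/funext => z; rewrite hdistX4.
have c1 : {for y, continuous (@hx1 R)} := @continuous_hx1 y.
have c2 : {for y, continuous (@hx2 R)} := @continuous_hx2 y.
have c3 : {for y, continuous (@hx3 R)} := @continuous_hx3 y.
have sq (f : H -> R) : {for y, continuous f} -> {for y, continuous (fun z => f z ^+ 2)}.
  move=> cf; rewrite (_ : (fun z => _) = fun z => f z * f z); first exact: continuousM.
  by apply/funext => z; rewrite expr2.
have cst_cont (a : R) : {for y, continuous (fun _ : H => a)} by exact: cst_continuous.
apply: (@continuousD _ _ _ (fun z : H => ((hx1 z - hx1 x) ^+ 2 + (hx2 z - hx2 x) ^+ 2) ^+ 2)).
  apply: (sq _); apply: (@continuousD _ _ _ (fun z : H => (hx1 z - hx1 x) ^+ 2)); apply: (sq _).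
    exact: (@continuousB _ _ _ (@hx1 R)).
  exact: (@continuousB _ _ _ (@hx2 R)).
apply: (sq _); apply: (@continuousB _ _ _ (fun z : H => hx3 z - hx3 x + 2 * hx1 x * hx2 z)).
  apply: (@continuousD _ _ _ (fun z : H => hx3 z - hx3 x)).
    exact: (@continuousB _ _ _ (@hx3 R)).
  exact: (@continuousM _ _ (fun=> _) (@hx2 R)).
exact: (@continuousM _ _ (fun=> _) (@hx1 R)).
Qed.

Lemma closed_hball x r : closed (hball x r).
Proof.
have [r0|r0] := ltP r 0; first by rewrite hball_lt0//; exact: closed0.
have -> : hball x r = (fun y : H => hdist x y ^+ 4) @^-1` [set t | t <= r ^+ 4].
  by apply/seteqP; split=> y; rewrite /preimage/= => /(hballP _ _ r0).
by apply: closed_comp; [move=> y _; exact: continuous_hdistX4|exact: closed_le].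
Qed.

Lemma nbhs_hball x r : 0 < r -> nbhs x (hball x r).
Proof.
move=> r0; have := @continuous_hdistX4 x x; rewrite /continuous_at.
have -> : hdist x x ^+ 4 = 0 by rewrite hdistxx expr0n.
move=> /(_ [set t | t < r ^+ 4]) c.
have {c}c : nbhs x [set y : H | hdist x y ^+ 4 < r ^+ 4].
  by apply: c; apply: open_nbhs_nbhs; split=> /=; [exact: open_lt|rewrite exprn_gt0].
by apply: filterS c => y /= /ltW xy; apply/hballP => //; exact: ltW.
Qed.

Lemma hball_coords x r y : 0 <= r <= 1 -> hball x r y ->
  [/\ `|hx1 y - hx1 x| <= r, `|hx2 y - hx2 x| <= r &
      `|hx3 y - hx3 x| <= (1 + 2 * `|hx1 x| + 2 * `|hx2 x|) * r].
Proof.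
move=> /andP[r0 r1] /hballP-/(_ r0); rewrite hdistX4.
set u := hx1 y - hx1 x; set v := hx2 y - hx2 x.
set w := _ + _ - _ => h.
have uv : u ^+ 2 + v ^+ 2 <= r ^+ 2.
  rewrite -(@ler_pXn2r _ 2) ?nnegrE ?addr_ge0 ?sqr_ge0// -exprM.
  by apply: le_trans h; rewrite lerDl sqr_ge0.
have ur : `|u| <= r.
  rewrite -(@ler_pXn2r _ 2) ?nnegrE// real_normK ?num_real//.
  by apply: le_trans uv; rewrite lerDl sqr_ge0.
have vr : `|v| <= r.
  rewrite -(@ler_pXn2r _ 2) ?nnegrE// real_normK ?num_real//.
  by apply: le_trans uv; rewrite lerDr sqr_ge0.
have wr : `|w| <= r.
  apply: (@le_trans _ _ (r ^+ 2)).
    rewrite -(@ler_pXn2r _ 2) ?nnegrE ?sqr_ge0// real_normK ?num_real// -exprM.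
    by apply: le_trans h; rewrite lerDr sqr_ge0.
  by rewrite expr2 ler_piMl.
split=> //; have -> : hx3 y - hx3 x = w - 2 * hx1 x * v + 2 * hx2 x * u.
  by rewrite /w /u /v; ring.
rewrite (le_trans (ler_normD _ _))// [leRHS]mulrDl lerD//.
  rewrite (le_trans (ler_normB _ _))// [leRHS]mulrDl mul1r lerD// !normrM normr_nat.
  by rewrite ler_wpM2l ?mulr_ge0.
by rewrite !normrM normr_nat ler_wpM2l ?mulr_ge0.
Qed.

Lemma rV3_forall (P : 'I_3 -> Prop) : P 0 -> P 1 -> P 2 -> forall i, P i.
Proof.
move=> p0 p1 p2 [[|[|[|//]]] lt_j3].
- by rewrite (_ : Ordinal _ = 0)//; exact/val_inj.
- by rewrite (_ : Ordinal _ = 1)//; exact/val_inj.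
- by rewrite (_ : Ordinal _ = 2)//; exact/val_inj.
Qed.

Lemma open_hball_sub (U : set H) x : open U -> U x ->
  exists2 r, 0 < r & forall s, s <= r -> hball x s `<=` U.
Proof.
move=> oU Ux; have /nbhs_ballP[e /= e0 eU] : nbhs x U by exact: open_nbhs_nbhs.
set K := 1 + 2 * `|hx1 x| + 2 * `|hx2 x|.
have K1 : 1 <= K by rewrite /K -addrA lerDl addr_ge0// mulr_ge0.
have K0 : 0 < K by apply: lt_le_trans K1.
exists (Num.min 1 (e / 2 / K)); first by rewrite lt_min ltr01 !divr_gt0.
move=> s sr y; have [s0|s0] := ltP s 0; first by rewrite hball_lt0.
have s1 : s <= 1 by rewrite (le_trans sr)// ge_min lexx.
have sK : K * s <= e / 2.
  rewrite mulrC -ler_pdivlMr//; apply: (le_trans sr); by rewrite ge_min lexx orbT.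
have se : s <= e / 2 by apply: le_trans sK; rewrite ler_peMl.
have e2 : e / 2 < e by rewrite ltr_pdivrMr// mulr_natr mulr2n ltrDl.
move=> /hball_coords; rewrite s0 s1 => /(_ isT)[h1 h2 h3].
apply: eU; split=> // i j; rewrite ord1 /ball/= distrC; apply: le_lt_trans e2.
move: j; apply: rV3_forall; [exact: le_trans h1 se|exact: le_trans h2 se|].
exact: le_trans h3 sK.
Qed.

Lemma hdiam_hball x r : 0 < r -> hdiam (hball x r) = (2 * r)%:E.
Proof.
move=> r0; apply/eqP; rewrite eq_le; apply/andP; split.
  apply: ge_ereal_sup => _ [y xy [z xz <-]]; rewrite lee_fin.
  rewrite (le_trans (hdist_triangle x _ _))// hdistC mulr_natl mulr2n lerD//.
apply: ereal_sup_ubound.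
(* The diameter is realized by the translates of [x] by [(r, 0, 0)] and [(-r, 0, 0)]. *)
have d4 (s : R) : hdist x (hmul x (hpoint s 0 0)) ^+ 4 = s ^+ 4.
  by rewrite hdistX4 /hmul !hpointE; ring.
have hb (s : R) : s ^+ 4 = r ^+ 4 -> hball x r (hmul x (hpoint s 0 0)).
  by move=> sr; apply/hballP; rewrite ?d4 ?sr// ltW.
exists (hmul x (hpoint r 0 0)); first exact: hb.
exists (hmul x (hpoint (- r) 0 0)); first by apply: hb; ring.
congr (_%:E); apply/eqP; rewrite -(@eqrXn2 _ 4) ?hdist_ge0 ?mulr_ge0 ?(ltW r0)//.
by rewrite hdistX4 /hmul !hpointE; apply/eqP; ring.
Qed.

End KoranyiMetric.

(** * Borel measures and supports *)

(** Bundles a measure with a proof of sigma-finiteness, the form in which Fubini's theorem accepts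
    it. *)
Definition sfinite_of d (T : measurableType d) (R : realType)
    (mu : {measure set T -> \bar R}) (H : sigma_finite setT mu) :
    {sigma_finite_measure set T -> \bar R} :=
  HB.pack (Measure.sort mu)
    (@isSFinite.Build d T R (Measure.sort mu) (sfinite_measure_sigma_finite H))
    (@isSigmaFinite.Build d T R (Measure.sort mu) H).

Definition image_measure d d' (T : measurableType d) (T' : measurableType d')
    (R : realType) (mu : {measure set T -> \bar R}) (f : T -> T')
    (mf : measurable_fun setT f) : {measure set T' -> \bar R} :=
  measure_function_pushforward__canonical__measure_function_Measure mu mf.

Lemma nbhs_open (T : topologicalType) (U : set T) : (forall x, U x -> nbhs x U) -> open U.
Proof. by rewrite openE. Qed.

Section HeisBorel.
Context {R : realType}.
Local Notation H := (heis R).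
Local Notation HB := (heisBorel R).

Lemma open_measurable_heis (U : set H) : open U -> measurable (U : set HB).
Proof. by move=> oU; exact: sub_sigma_algebra. Qed.

Lemma closed_measurable_heis (U : set H) : closed U -> measurable (U : set HB).
Proof.
move=> cU; rewrite -[U]setCK; apply: measurableC; apply: open_measurable_heis.
exact: closed_openC.
Qed.

Lemma measurable_hball (x : H) r : measurable (hball x r : set HB).
Proof. by apply: closed_measurable_heis; exact: closed_hball. Qed.

Lemma continuous_measurable_heis (f : H -> R) : continuous f ->
  measurable_fun setT (f : HB -> R).
Proof.
move=> cf; apply: (measurability _ (measurable_realfun.RGenOInfty.measurableE R)) => _ [_ [x ->] <-].
rewrite setTI; apply: open_measurable_heis; apply: open_comp; last by rewrite set_itvE; exact: open_gt.
by move=> y _; exact: cf.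
Qed.

Lemma measurable_self_map (f : H -> H) : continuous f ->
  measurable_fun setT (f : HB -> HB).
Proof.
move=> cf; apply: (@measurability _ _ HB HB setT f (@open H)) => // _ [U oU <-].
rewrite setTI; apply: open_measurable_heis; apply: open_comp oU => y _; exact: cf.
Qed.

Lemma measurable_hdistX4 (x : H) : measurable_fun setT ((fun y => hdist x y ^+ 4) : HB -> R).
Proof. by apply: continuous_measurable_heis; exact: continuous_hdistX4. Qed.

Definition ratbox (p : rat * rat * rat * rat) : set H :=
  [set y | [/\ `|hx1 y - ratr p.1.1.1| < ratr p.2, `|hx2 y - ratr p.1.1.2| < ratr p.2 &
     `|hx3 y - ratr p.1.2| < ratr p.2]].

Lemma ratbox_nbhs (x : H) (U : set H) : nbhs x U -> exists2 p, ratbox p x & ratbox p `<=` U.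
Proof.
move=> /nbhs_ballP[e /= e0 eU].
have near_rat (a : R) : exists q : rat, `|a - ratr q| < e / 4.
  have [|q] := @rat_in_itvoo R (a - e / 4) (a + e / 4); first by lra.
  by rewrite in_itv/= => /andP[h1 h2]; exists q; rewrite ltr_norml; lra.
have [q1 h1] := near_rat (hx1 x); have [q2 h2] := near_rat (hx2 x).
have [q3 h3] := near_rat (hx3 x).
have [|s] := @rat_in_itvoo R (e / 4) (e / 2); first by lra.
rewrite in_itv/= => /andP[s1 s2].
exists (q1, q2, q3, s); first by rewrite /ratbox/=; split; lra.
move=> y [/= y1 y2 y3]; apply: eU; split=> // i j; rewrite ord1 /ball/=.
have tri (a b q : R) : `|a - q| < e / 4 -> `|b - q| < ratr s -> `|a - b| < e.
  by move: s2; rewrite !ltr_norml; lra.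
by move: j; apply: rV3_forall; [exact: tri h1 y1|exact: tri h2 y2|exact: tri h3 y3].
Qed.

(** A Lindelöf argument: every neighborhood of a point contains one of the countably many rational
    boxes around it, and the boxes in which [A] is negligible cover [A]. *)
Lemma negligible_local (mu : {measure set HB -> \bar R}) (A : set H) :
  (forall x, A x -> exists2 U, nbhs x U & mu.-negligible (A `&` U : set HB)) ->
  mu.-negligible (A : set HB).
Proof.
move=> Aloc.
(* The clause on negligibility does not mention [y], so the set is empty for the boxes where it
   fails. *)
pose F i : set HB := if unpickle i is Some p then
  [set y | mu.-negligible (A `&` ratbox p : set HB) /\ (A `&` ratbox p) y] else set0.
apply: (@negligibleS _ _ _ mu (\bigcup_i F i)); last first.
  apply: negligible_bigcup => i; rewrite /F; case: unpickle => [p|]; last exact: negligible_set0.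
  have [np|np] := pselect (mu.-negligible (A `&` ratbox p : set HB)).
    by apply: negligibleS np => y [].
  by apply: negligibleS (negligible_set0 mu) => y [].
move=> x Ax; have [U xU nU] := Aloc x Ax; have [p px pU] := ratbox_nbhs xU.
exists (pickle p); first exact: I.
rewrite /F pickleK; split; last by split.
by apply: negligibleS nU => y [Ay py]; split=> //; exact: pU.
Qed.

End HeisBorel.

Section UniformBasics.
Context {R : realType}.
Local Notation H := (heis R).
Local Notation HB := (heisBorel R).
Variable mu : {measure set HB -> \bar R}.
Implicit Types (x y : H) (r : R).

Lemma closed_msupport : closed (msupport mu).
Proof.
rewrite -[msupport mu]setCK; apply: open_closedC; apply: nbhs_open => x /= nx.
have [r r0 xr] : exists2 r, 0 < r & (mu (hball x r) <= 0)%E.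
  apply: contrapT => no; apply: nx => r r0; rewrite ltNge; apply/negP => xr.
  by apply: no; exists r.
have r2 : 0 < r / 2 by rewrite divr_gt0.
apply: filterS (nbhs_hball x r2) => y xy sy; have := sy _ r2.
rewrite ltNge => /negP; apply; apply: le_trans xr.
apply: le_measure; rewrite ?inE; [exact: measurable_hball|exact: measurable_hball|].
apply: hball_sub; move: xy; rewrite /hball/=; lra.
Qed.

Lemma measurable_msupport : measurable (msupport mu : set HB).
Proof. by apply: closed_measurable_heis; exact: closed_msupport. Qed.

Lemma msupport_full : mu (~` (msupport mu : set HB)) = 0%E.
Proof.
apply/negligibleP; first by apply: measurableC; exact: measurable_msupport.
apply: negligible_local => x nx.
have [r r0 xr] : exists2 r, 0 < r & (mu (hball x r) <= 0)%E.
  apply: contrapT => no; apply: nx => r r0; rewrite ltNge; apply/negP => xr.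
  by apply: no; exists r.
exists (hball x r); first exact: nbhs_hball.
apply: (@negligibleS _ _ _ mu (hball x r)); first by move=> y [].
apply/negligibleP; first exact: measurable_hball.
by apply/eqP; rewrite -measure_le0.
Qed.

Lemma measure_msupportI (A : set HB) : measurable A -> mu A = mu (A `&` msupport mu).
Proof.
move=> mA; apply/eqP; rewrite eq_le; apply/andP; split; last first.
  apply: le_measure; rewrite ?inE//; first exact: measurableI _ _ mA measurable_msupport.
have mI := measurableI _ _ mA measurable_msupport.
have mC := measurableC measurable_msupport.
apply: (@le_trans _ _ (mu (A `&` msupport mu) + mu (~` (msupport mu : set HB)))%E).
  apply: (@le_trans _ _ (mu ((A `&` msupport mu) `|` ~` (msupport mu : set HB)))); last first.
    exact: measureU2.
  apply: le_measure; rewrite ?inE//; first exact: measurableU.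
  by move=> x Ax; have [sx|sx] := pselect (msupport mu x); [left|right].
by rewrite msupport_full adde0.
Qed.

Variable c : R.
Hypotheses (c_gt0 : 0 < c) (mu_neq0 : mu setT <> 0%E).
Hypothesis mu_ball : forall x r, msupport mu x -> 0 < r -> mu (hball x r) = (c * r ^+ 3)%:E.

Lemma msupport_neq0 : msupport mu !=set0.
Proof.
apply: contrapT => /forallNP sp0; apply: mu_neq0.
rewrite -msupport_full; congr (mu _); apply/seteqP; split=> // x _; exact: sp0.
Qed.

Lemma mu_hball_lty x r : (mu (hball x r) < +oo)%E.
Proof.
have [x0 sx0] := msupport_neq0.
have r0 : 0 < hdist x0 x + `|r| + 1 by rewrite ltr_wpDl// addr_ge0// hdist_ge0.
apply: (@le_lt_trans _ _ (mu (hball x0 (hdist x0 x + `|r| + 1)))).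
  apply: le_measure; rewrite ?inE; [exact: measurable_hball|exact: measurable_hball|].
  apply: hball_sub; rewrite -addrA lerD2l.
  by rewrite (le_trans (ler_norm _))// lerDl.
by rewrite mu_ball// ltry.
Qed.

(** The center need not lie in the support: a ball that meets it is contained in a ball of twice the
    radius about a point of the support. *)
Lemma mu_hball_le x r : 0 < r -> (mu (hball x r) <= (c * (2 * r) ^+ 3)%:E)%E.
Proof.
move=> r0; have [sx|nsx] := pselect (exists2 y, msupport mu y & hball x r y).
  case: sx => y sy xy; have r2 : 0 < 2 * r by rewrite mulr_gt0.
  rewrite -(mu_ball sy r2).
  apply: le_measure; rewrite ?inE; [exact: measurable_hball|exact: measurable_hball|].
  by apply: hball_sub; move: xy; rewrite /hball/= hdistC; lra.
rewrite measure_msupportI; last exact: measurable_hball.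
have -> : hball x r `&` msupport mu = set0.
  by apply/seteqP; split=> // y [xy sy]; apply: nsx; exists y.
have r2 : 0 <= 2 * r by rewrite mulr_ge0// ltW.
by rewrite measure0 lee_fin mulr_ge0 ?exprn_ge0// ltW.
Qed.

Lemma sigma_finite_mu : sigma_finite setT mu.
Proof.
exists (fun n => hball 0 n%:R) => [|n].
  apply/seteqP; split=> // x _; exists (Num.bound (hdist 0 x)) => //.
  by rewrite /hball/= ltW// archi_boundP// hdist_ge0.
by split; [exact: measurable_hball|exact: mu_hball_lty].
Qed.

End UniformBasics.

(** * Analyticity of integrals depending on parameters *)

Section MeasurableSums.
Context d {Y : measurableType d} {R : realType}.
Implicit Types (I : countType).

(** Extension by 0 along [pickle], turning a sum over a countable type into a series. *)
Definition natext I (a : I -> \bar R) (n : nat) : \bar R :=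
  if pickle_inv n is Some i then a i else 0%E.

Lemma esum_natext I (a : I -> \bar R) : (forall i, 0 <= a i)%E ->
  (\esum_(i in [set: I]) a i = \sum_(n <oo) natext a n)%E.
Proof.
move=> a0; have n0 n : (0 <= natext a n)%E by rewrite /natext; case: pickle_inv.
rewrite nneseries_esumT// (esumID (range (@pickle I)))//.
rewrite !setTI [X in (_ + X)%E]esum1 ?adde0 => [|n /= nr]; last first.
  rewrite /natext; case E : (pickle_inv n) => [i|//].
  by exfalso; apply: nr; exists i => //; have := @pickle_invK I n; rewrite /= E.
rewrite esum_image; last by move=> x y _ _; exact: (pcan_inj (@pickleK_inv I)).
by apply: eq_esum => i _; rewrite /natext pickleK_inv.
Qed.

Lemma measurable_natext I (a : I -> Y -> \bar R) n :
  (forall i, measurable_fun setT (a i)) ->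
  measurable_fun setT (fun y => natext (a^~ y) n).
Proof. by move=> ma; rewrite /natext; case: pickle_inv. Qed.

Lemma measurable_esum I (a : I -> Y -> \bar R) :
  (forall i y, 0 <= a i y)%E -> (forall i, measurable_fun setT (a i)) ->
  measurable_fun setT (fun y => \esum_(i in [set: I]) a i y)%E.
Proof.
move=> a0 ma; rewrite (_ : (fun y => _) = fun y => (\sum_(n <oo) natext (a^~ y) n)%E).
  apply: ge0_emeasurable_sum; last by move=> n _; exact: measurable_natext.
  by move=> n y _ _; rewrite /natext; case: pickle_inv.
by apply/funext => y; rewrite esum_natext.
Qed.

Lemma integral_esum (mu : {measure set Y -> \bar R}) I (a : I -> Y -> \bar R) :
  (forall i y, 0 <= a i y)%E -> (forall i, measurable_fun setT (a i)) ->
  (\int[mu]_y (\esum_(i in [set: I]) a i y) = \esum_(i in [set: I]) \int[mu]_y a i y)%E.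
Proof.
move=> a0 ma; under eq_integral => y _ do rewrite esum_natext//.
rewrite integral_nneseries//.
- rewrite esum_natext => [|i]; last exact: integral_ge0.
  congr (limn _); apply/funext => N; apply: eq_bigr => n _; rewrite /natext.
  by case: pickle_inv => //; rewrite integral0.
- by move=> n; exact: measurable_natext.
- by move=> n y _; rewrite /natext; case: pickle_inv.
Qed.

Lemma measurable_asum I (t : I -> Y -> R) : (forall i, measurable_fun setT (t i)) ->
  measurable_fun setT (fun y => asum (t^~ y)).
Proof.
move=> mt; apply: (@measurable_esum I (fun i y => `|t i y|%:E)) => [i y|i].
  by rewrite lee_fin.
by apply/measurable_EFinP; exact: measurableT_comp.
Qed.

Lemma measurable_pos (g : Y -> R) : measurable_fun setT g ->
  measurable_fun setT (fun y => Num.max (g y) 0).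
Proof. by move=> mg; apply: measurable_maxr => //; exact: measurable_cst. Qed.

Lemma measurable_neg (g : Y -> R) : measurable_fun setT g ->
  measurable_fun setT (fun y => Num.max (- g y) 0).
Proof. by move=> mg; apply: measurable_pos; exact: measurable_funN. Qed.

Lemma measurable_rsum I (t : I -> Y -> R) : (forall i, measurable_fun setT (t i)) ->
  measurable_fun setT (fun y => rsum (t^~ y)).
Proof.
move=> mt; rewrite (_ : (fun y => _) = fun y =>
  fine (asum (posr (t^~ y))) - fine (asum (negr (t^~ y)))); last first.
  by apply/funext => y; rewrite rsumE.
apply: measurable_funB.
  apply: measurableT_comp; first exact: fine_measurable.
  by apply: (@measurable_asum _ (fun i y => Num.max (t i y) 0)) => i; exact: measurable_pos.
apply: measurableT_comp; first exact: fine_measurable.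
by apply: (@measurable_asum _ (fun i y => Num.max (- t i y) 0)) => i; exact: measurable_neg.
Qed.

Variable mu : {measure set Y -> \bar R}.
Implicit Types (g p q : Y -> R).

Definition mint g : \bar R := (\int[mu]_y `|g y|%:E)%E.
Definition rint g : R :=
  fine (\int[mu]_y (Num.max (g y) 0)%:E)%E - fine (\int[mu]_y (Num.max (- g y) 0)%:E)%E.

Lemma mint_ge0 g : (0 <= mint g)%E.
Proof. by apply: integral_ge0 => y _; rewrite lee_fin. Qed.

Lemma mint_fin g : (mint g < +oo)%E -> mint g \is a fin_num.
Proof. by move=> ?; rewrite ge0_fin_numE ?mint_ge0. Qed.

Lemma measurable_norm g : measurable_fun setT g -> measurable_fun setT (fun y => `|g y|%:E).
Proof. by move=> mg; apply/measurable_EFinP; exact: measurableT_comp. Qed.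

Lemma le_mint p q : measurable_fun setT p -> measurable_fun setT q ->
  (forall y, `|p y| <= `|q y|) -> (mint p <= mint q)%E.
Proof.
move=> mp mq pq; apply: ge0_le_integral => //.
- exact: measurable_norm.
- exact: measurable_norm.
- by move=> y _; rewrite lee_fin.
Qed.

Lemma ge0_mint p : (forall y, 0 <= p y) -> (\int[mu]_y (p y)%:E)%E = mint p.
Proof. by move=> p0; apply: eq_integral => y _; rewrite ger0_norm. Qed.

Lemma mintD p q : measurable_fun setT p -> measurable_fun setT q ->
  (forall y, 0 <= p y) -> (forall y, 0 <= q y) ->
  mint (fun y => p y + q y) = (mint p + mint q)%E.
Proof.
move=> mp mq p0 q0; rewrite -!ge0_mint//; last by move=> y; rewrite addr_ge0.
rewrite -ge0_integralD//; try by move=> y _; rewrite lee_fin.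
- by apply/measurable_EFinP.
- by apply/measurable_EFinP.
Qed.

Lemma max_sub (a : R) : Num.max a 0 - Num.max (- a) 0 = a.
Proof. exact: (posrBnegr (fun _ : unit => a) tt). Qed.

Lemma max_add (a : R) : Num.max a 0 + Num.max (- a) 0 = `|a|.
Proof. exact: (posrDnegr (fun _ : unit => a) tt). Qed.

Lemma max_ge0 (a : R) : 0 <= Num.max a 0. Proof. by rewrite le_max lexx orbT. Qed.

Lemma rintE g : rint g = fine (mint (fun y => Num.max (g y) 0)) -
  fine (mint (fun y => Num.max (- g y) 0)).
Proof. by rewrite /rint !ge0_mint// => y; exact: max_ge0. Qed.

Lemma mint_pos g : measurable_fun setT g -> (mint g < +oo)%E ->
  (mint (fun y => Num.max (g y) 0)%R < +oo)%E.
Proof.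
move=> mg; apply: le_lt_trans; apply: le_mint => // [|y]; first exact: measurable_pos.
by rewrite ger0_norm ?max_ge0// -max_add lerDl max_ge0.
Qed.

Lemma mint_neg g : measurable_fun setT g -> (mint g < +oo)%E ->
  (mint (fun y => Num.max (- g y) 0)%R < +oo)%E.
Proof.
move=> mg; apply: le_lt_trans; apply: le_mint => // [|y]; first exact: measurable_neg.
by rewrite ger0_norm ?max_ge0// -max_add lerDr max_ge0.
Qed.

Lemma rint_sub g p q : measurable_fun setT p -> measurable_fun setT q ->
  (forall y, 0 <= p y) -> (forall y, 0 <= q y) ->
  (mint p < +oo)%E -> (mint q < +oo)%E -> (forall y, g y = p y - q y) ->
  rint g = fine (mint p) - fine (mint q).
Proof.
move=> mp mq p0 q0 pf qf gE.
have mg : measurable_fun setT g.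
  by rewrite (_ : g = fun y => p y - q y); [exact: measurable_funB|exact/funext].
have gf : (mint g < +oo)%E.
  apply: (@le_lt_trans _ _ (mint (fun y => p y + q y))).
    apply: le_mint => // [|y]; first exact: measurable_funD.
    rewrite gE (le_trans (ler_normB _ _))// [leRHS]ger0_norm ?addr_ge0//.
    by rewrite !ger0_norm.
  by rewrite mintD// lte_add_pinfty.
rewrite rintE; apply/eqP; rewrite subr_eq addrAC eq_sym subr_eq eq_sym; apply/eqP.
have mgp := measurable_pos mg; have mgn := measurable_neg mg.
have fgp := mint_pos mg gf; have fgn := mint_neg mg gf.
rewrite -!fineD ?mint_fin// -!mintD//; try by move=> y; exact: max_ge0.
congr (fine (mint _)); apply/funext => y; move: (max_sub (g y)) (gE y); lra.
Qed.

Lemma ge0_rint g : (forall y, 0 <= g y) -> rint g = fine (mint g).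
Proof.
move=> g0; rewrite rintE (_ : (fun y => Num.max (g y) 0) = g); last first.
  by apply/funext => y; rewrite max_l.
rewrite (_ : (fun y => Num.max (- g y) 0) = fun=> 0); last first.
  by apply/funext => y; rewrite max_r// oppr_le0.
by rewrite [X in _ - fine X](_ : _ = 0%E) ?subr0// /mint normr0 integral0.
Qed.

Lemma mintZ (k : R) g : measurable_fun setT g ->
  mint (fun y => k * g y) = (`|k|%:E * mint g)%E.
Proof.
move=> mg; rewrite /mint -ge0_integralZl_EFin//; last exact: measurable_norm.
by apply: eq_integral => y _; rewrite normrM EFinM.
Qed.

Lemma rintN g : rint (fun y => - g y) = - rint g.
Proof.
rewrite /rint opprB; congr (_ - fine _).
by apply: eq_integral => y _; rewrite opprK.
Qed.

Lemma rintZ (k : R) g : measurable_fun setT g -> (mint g < +oo)%E ->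
  rint (fun y => k * g y) = k * rint g.
Proof.
move=> mg gf; wlog k0 : k / 0 <= k => [pos|].
  have [k0|/ltW k0] := leP 0 k; first exact: pos.
  rewrite -[k]opprK mulNr -pos ?oppr_ge0// -rintN.
  by congr rint; apply/funext => y; rewrite !mulNr.
have mgp := measurable_pos mg; have mgn := measurable_neg mg.
have fgp := mint_pos mg gf; have fgn := mint_neg mg gf.
rewrite (@rint_sub _ (fun y => k * Num.max (g y) 0) (fun y => k * Num.max (- g y) 0)).
- by rewrite !mintZ// rintE ger0_norm// !fineM ?mint_fin// mulrBr.
- exact: measurable_funM.
- exact: measurable_funM.
- by move=> y; rewrite mulr_ge0 ?max_ge0.
- by move=> y; rewrite mulr_ge0 ?max_ge0.
- by rewrite mintZ// -(fineK (mint_fin fgp)) -EFinM ltry.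
- by rewrite mintZ// -(fineK (mint_fin fgn)) -EFinM ltry.
- by move=> y; rewrite -mulrBr max_sub.
Qed.

Lemma ler_norm_rint g : measurable_fun setT g -> (mint g < +oo)%E ->
  (`|rint g|%:E <= mint g)%E.
Proof.
move=> mg gf; have fgp := mint_pos mg gf; have fgn := mint_neg mg gf.
rewrite rintE; apply: (@le_trans _ _ (mint (fun y => Num.max (g y) 0)%R +
    mint (fun y => Num.max (- g y) 0)%R)%E).
  rewrite -[X in (_ <= X + _)%E]fineK ?mint_fin// -[X in (_ <= _ + X)%E]fineK ?mint_fin//.
  rewrite -EFinD lee_fin (le_trans (ler_normB _ _))//.
  by rewrite !ger0_norm// fine_ge0// mint_ge0.
rewrite -(mintD (measurable_pos mg) (measurable_neg mg) (fun y => max_ge0 _) (fun y => max_ge0 _)).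
rewrite le_eqVlt; apply/orP; left; apply/eqP.
by apply: eq_integral => y _; rewrite max_add normr_id.
Qed.

Section IntegralOfSum.
Variables (I : countType) (t : I -> Y -> R).
Hypotheses (mt : forall i, measurable_fun setT (t i))
  (ts : forall y, summ (t^~ y)) (tf : (\int[mu]_y asum (t^~ y) < +oo)%E).

Lemma integral_asum : (\int[mu]_y asum (t^~ y) = \esum_(i in [set: I]) mint (t i))%E.
Proof.
apply: integral_esum => [i y|i]; first by rewrite lee_fin.
exact: measurable_norm.
Qed.

Lemma mint_term i : (mint (t i) < +oo)%E.
Proof.
apply: le_lt_trans tf; rewrite integral_asum.
exact: (@esum_le1 _ _ _ (fun i => mint (t i)) i (fun i => mint_ge0 _)).
Qed.

Lemma asum_rint : (asum (fun i => rint (t i)) <= \int[mu]_y asum (t^~ y))%E.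
Proof.
rewrite integral_asum; apply: le_esum => i _.
by apply: ler_norm_rint => //; exact: mint_term.
Qed.

End IntegralOfSum.

(** Sum and integral are exchanged for the positive and the negative parts separately; integrability
    of [asum] keeps both finite. *)
Lemma rint_rsum (I : countType) (t : I -> Y -> R) :
  (forall i, measurable_fun setT (t i)) ->
  (forall y, summ (t^~ y)) -> (\int[mu]_y asum (t^~ y) < +oo)%E ->
  rint (fun y => rsum (t^~ y)) = rsum (fun i => rint (t i)).
Proof.
move=> mt ts tf.
have pos (u : I -> Y -> R) : (forall i y, 0 <= u i y) -> (forall i y, u i y <= `|t i y|) ->
   (forall i, measurable_fun setT (u i)) ->
   [/\ measurable_fun setT (fun y => fine (asum (u^~ y))),
       (mint (fun y => fine (asum (u^~ y))) < +oo)%E,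
       summ (fun i => fine (mint (u i))),
       (forall i, mint (u i) < +oo)%E &
       mint (fun y => fine (asum (u^~ y))) = asum (fun i => fine (mint (u i)))].
  move=> u0 ut mu_.
  have us y : summ (u^~ y).
    by apply: le_summ (ts y) => i; rewrite ger0_norm.
  have uE : mint (fun y => fine (asum (u^~ y))) = (\int[mu]_y asum (u^~ y))%E.
    apply: eq_integral => y _; rewrite ger0_norm ?fine_ge0 ?asum_ge0//.
    by rewrite fineK// asum_fin.
  have uf : (\int[mu]_y asum (u^~ y) < +oo)%E.
    apply: le_lt_trans tf; apply: ge0_le_integral => //.
    - by move=> y _; exact: asum_ge0.
    - exact: measurable_asum.
    - exact: measurable_asum.
    - by move=> y _; apply: le_asum => i; rewrite ger0_norm.
  have ui i : (mint (u i) < +oo)%E by exact: mint_term.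
  have sE : (\int[mu]_y asum (u^~ y))%E = asum (fun i => fine (mint (u i))).
    rewrite integral_asum//; apply: eq_esum => i _.
    by rewrite ger0_norm ?fine_ge0 ?mint_ge0// fineK// mint_fin.
  split=> //.
  - by apply: measurableT_comp; [exact: fine_measurable|exact: measurable_asum].
  - by rewrite uE.
  - by rewrite /summ -sE.
  - by rewrite uE.
have le1 i y : Num.max (t i y) 0 <= `|t i y| by rewrite -max_add lerDl max_ge0.
have le2 i y : Num.max (- t i y) 0 <= `|t i y| by rewrite -max_add lerDr max_ge0.
have [m1 f1 s1 t1 e1] := pos (fun i y => Num.max (t i y) 0) (fun i y => max_ge0 _) le1
  (fun i => measurable_pos (mt i)).
have [m2 f2 s2 t2 e2] := pos (fun i y => Num.max (- t i y) 0) (fun i y => max_ge0 _) le2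
  (fun i => measurable_neg (mt i)).
rewrite (rint_sub m1 m2 _ _ f1 f2) => [|y|y|y].
- rewrite e1 e2 (@rsum_sub _ _ (fun i => fine (mint (fun y => Num.max (t i y) 0)))
    (fun i => fine (mint (fun y => Num.max (- t i y) 0))))// => i.
  + by rewrite fine_ge0 ?mint_ge0.
  + by rewrite fine_ge0 ?mint_ge0.
  + by rewrite rintE.
- by rewrite fine_ge0 ?asum_ge0.
- by rewrite fine_ge0 ?asum_ge0.
- by rewrite rsumE.
Qed.

End MeasurableSums.

Section ParametricSeries.
Context d {Y : measurableType d} {R : realType} {n : nat}.
Local Notation T := {ffun 'I_n -> nat}.
Local Notation V := 'rV[R]_n.
Implicit Types (w h : V) (C D : Y -> T -> R).

Definition mcoef C := forall k, measurable_fun setT (fun y => C y k).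

Lemma mcoef_cst (c : T -> R) : mcoef (fun=> c).
Proof. by move=> k; exact: measurable_cst. Qed.

Lemma mcoef_conv C D : mcoef C -> mcoef D -> mcoef (fun y => convc (C y) (D y)).
Proof.
move=> mC mD k.
apply: (@measurable_rsum _ _ _ (T * T)%type
  (fun i y => if k == kplus i.1 i.2 then C y i.1 * D y i.2 else 0)) => i.
case: eqP => _; last exact: measurable_cst.
exact: measurable_funM.
Qed.

Lemma mcoef_pow C m : mcoef C -> mcoef (fun y => powc (C y) m).
Proof.
move=> mC; elim: m => [|m IH]; first exact: mcoef_cst.
exact: (mcoef_conv mC IH).
Qed.

Lemma mcoef_exp C : mcoef C -> mcoef (fun y => expc (C y)).
Proof.
move=> mC k.
apply: (@measurable_rsum _ _ _ nat (fun m y => m`!%:R^-1 * powc (C y) m k)) => m.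
apply: measurable_funM; first exact: measurable_cst.
exact: mcoef_pow.
Qed.

Variable mu : {measure set Y -> \bar R}.

Section Integral.
Variables (w : V) (C : Y -> T -> R).
Hypotheses (w0 : posw w) (mC : mcoef C) (wC : forall y, wfin w (C y))
  (fC : (\int[mu]_y wnorm w (C y) < +oo)%E).

Definition intc (k : T) : R := rint mu (fun y => C y k).

Let mt h k : measurable_fun setT (fun y => C y k * mono h k).
Proof. by apply: measurable_funM; [exact: mC|exact: measurable_cst]. Qed.

Lemma mint_coef k : (mint mu (fun y => C y k) < +oo)%E.
Proof.
have := @mint_term _ _ _ mu T (fun k y => C y k * mono w k) (mt w) fC k.
have -> : (fun y => C y k) = (fun y => (mono w k)^-1 * (C y k * mono w k)).
  by apply/funext => y; rewrite mulrCA mulVf ?mulr1// gt_eqF// mono_gt0.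
move=> h; rewrite mintZ// -(fineK (mint_fin h)) -EFinM ltry//.
Qed.

Lemma intcZ h k : intc k * mono h k = rint mu (fun y => C y k * mono h k).
Proof.
rewrite mulrC -rintZ//; last exact: mint_coef.
by congr rint; apply/funext => y; rewrite mulrC.
Qed.

Lemma wnorm_intc : (wnorm w intc <= \int[mu]_y wnorm w (C y))%E.
Proof.
rewrite /wnorm (eq_asum (intcZ w)).
exact: (@asum_rint _ _ _ mu T (fun k y => C y k * mono w k) (mt w) fC).
Qed.

Lemma wfin_intc : wfin w intc.
Proof. exact: le_lt_trans wnorm_intc fC. Qed.

Lemma psum_intc h : inbox w h -> psum intc h = rint mu (fun y => psum (C y) h).
Proof.
move=> hw; rewrite /psum (eq_rsum (intcZ h)).
apply/esym/(@rint_rsum _ _ _ mu T (fun k y => C y k * mono h k)).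
- exact: mt.
- by move=> y; exact: wfin_sub w0 hw (wC y).
apply: le_lt_trans fC; apply: ge0_le_integral => //.
- by move=> y _; exact: asum_ge0.
- exact: measurable_asum.
- by apply: measurable_asum; exact: mt.
- by move=> y _; exact: wnorm_le.
Qed.

End Integral.
End ParametricSeries.

(** * Expansion of the fourth power of the distance in its center *)

Section QuarticExpansion.
Context {R : realType}.
Local Notation T := {ffun 'I_3 -> nat}.
Local Notation V := 'rV[R]_3.
Implicit Types (c d : T -> R).

Section Norm.
Variables (w : V) (w0 : posw w).

Definition nrm c := fine (wnorm w c).

Lemma nrm_ge0 c : 0 <= nrm c. Proof. by rewrite fine_ge0 ?asum_ge0. Qed.

Lemma nrmE c : wfin w c -> wnorm w c = (nrm c)%:E.
Proof. by move=> wc; rewrite fineK// asum_fin. Qed.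

Lemma nrmD c d : wfin w c -> wfin w d -> nrm (fun k => c k + d k) <= nrm c + nrm d.
Proof.
move=> wc wd; rewrite -lee_fin EFinD -!nrmE ?wnormD//; exact: wfinD.
Qed.

Lemma nrmZ a c : nrm (fun k => a * c k) = `|a| * nrm c.
Proof.
rewrite /nrm wnormZ; have := asum_ge0 (fun k => c k * mono w k); rewrite -/(wnorm w c).
have [-> _|a0] := eqVneq a 0; first by rewrite normr0 mul0e mul0r.
case: (wnorm w c) => [r|_|//]; first by [].
by rewrite gt0_muley ?lte_fin ?normr_gt0//= mulr0.
Qed.

Lemma nrm_conv c d : wfin w c -> wfin w d -> nrm (convc c d) <= nrm c * nrm d.
Proof.
move=> wc wd; rewrite -lee_fin EFinM -!nrmE//; first exact: wnorm_conv.
exact: wfin_conv.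
Qed.

Lemma nrm_var j : nrm (varc j) = w 0 j.
Proof. by rewrite /nrm wnorm_var/= ger0_norm// ltW. Qed.

End Norm.

Variable a : V.

Definition qu1 (y : V) := hx1 y - hx1 a.
Definition qu2 (y : V) := hx2 y - hx2 a.
Definition qt (y : V) := hx3 y - hx3 a + 2 * hx1 a * hx2 y - 2 * hx2 a * hx1 y.
Definition qm (y : V) := qu1 y ^+ 2 + qu2 y ^+ 2.

Definition v1 : T -> R := varc 0.
Definition v2 : T -> R := varc 1.
Definition v3 : T -> R := varc 2.

(** When the center moves from [a] by [h], the polynomial [qA] is added to [qm] and [qL] to [qt];
    [qQ] is the resulting increment of [hdist a y ^+ 4], which is [qm ^+ 2 + qt ^+ 2]. *)
Definition qA (y : V) : T -> R := fun k =>
  ((-2) * qu1 y) * v1 k + (convc v1 v1 k + (((-2) * qu2 y) * v2 k + convc v2 v2 k)).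
Definition qL (y : V) : T -> R := fun k =>
  (-1) * v3 k + ((2 * hx2 y) * v1 k + ((-2) * hx1 y) * v2 k).
Definition qQ (y : V) : T -> R := fun k =>
  (2 * qm y) * qA y k + (convc (qA y) (qA y) k +
  ((2 * qt y) * qL y k + convc (qL y) (qL y) k)).

Section Weight.
Variable w : V.
Hypothesis w0 : posw w.

Lemma wfin_qA y : wfin w (qA y).
Proof.
by rewrite /qA; apply: wfinD; [exact/wfinZ/wfin_var|apply: wfinD;
  [apply: wfin_conv => //; exact: wfin_var|apply: wfinD;
    [exact/wfinZ/wfin_var|apply: wfin_conv => //; exact: wfin_var]]].
Qed.

Lemma wfin_qL y : wfin w (qL y).
Proof.
by rewrite /qL; apply: wfinD; [exact/wfinZ/wfin_var|apply: wfinD; exact/wfinZ/wfin_var].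
Qed.

Lemma wfin_qQ y : wfin w (qQ y).
Proof.
have wA := wfin_qA y; have wL := wfin_qL y.
rewrite /qQ; apply: wfinD; first exact: wfinZ.
apply: wfinD; first exact: wfin_conv.
by apply: wfinD; [exact: wfinZ|exact: wfin_conv].
Qed.

Lemma psum_qA y h : inbox w h -> psum (qA y) h =
  (-2) * qu1 y * h 0 0 + (h 0 0 ^+ 2 + ((-2) * qu2 y * h 0 1 + h 0 1 ^+ 2)).
Proof.
move=> hw; have wv j := @wfin_var R 3 w j.
have wvv j : wfin w (convc (varc j) (varc j)) := wfin_conv w0 (wv j) (wv j).
have wz b j : wfin w (fun k => b * varc j k) := wfinZ b (wv j).
have s1 := wfinD (wz ((-2) * qu2 y) 1) (wvv 1); have s2 := wfinD (wvv 0) s1.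
rewrite /qA /v1 /v2 (psumD w0 hw (wz _ _) s2) (psumD w0 hw (wvv 0) s1).
rewrite (psumD w0 hw (wz _ _) (wvv 1)) !(psumZ _ w0 hw (wv _)).
by rewrite !(psum_conv w0 (wv _) (wv _) hw) !psum_var !expr2.
Qed.

Lemma psum_qL y h : inbox w h -> psum (qL y) h =
  (-1) * h 0 2 + (2 * hx2 y * h 0 0 + (-2) * hx1 y * h 0 1).
Proof.
move=> hw; have wv j := @wfin_var R 3 w j.
have wz b j : wfin w (fun k => b * varc j k) by exact: wfinZ.
have s1 := wfinD (wz (2 * hx2 y) 0) (wz ((-2) * hx1 y) 1).
rewrite /qL /v1 /v2 /v3 (psumD w0 hw (wz _ _) s1) (psumD w0 hw (wz _ _) (wz _ _)).
by rewrite !(psumZ _ w0 hw (wv _)) !psum_var.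
Qed.

Lemma psum_qQ y h : inbox w h ->
  psum (qQ y) h = hdist (a + h) y ^+ 4 - hdist a y ^+ 4.
Proof.
move=> hw; have wA := wfin_qA y; have wL := wfin_qL y.
have wAA := wfin_conv w0 wA wA; have wLL := wfin_conv w0 wL wL.
have zA b : wfin w (fun k => b * qA y k) by exact: wfinZ.
have zL b : wfin w (fun k => b * qL y k) by exact: wfinZ.
have s1 := wfinD (zL (2 * qt y)) wLL; have s2 := wfinD wAA s1.
rewrite /qQ (psumD w0 hw (zA _) s2) (psumD w0 hw wAA s1) (psumD w0 hw (zL _) wLL).
rewrite !(psumZ _ w0 hw)// !(psum_conv w0 _ _ hw)// psum_qA// psum_qL//.
rewrite /hdist !hnormX4 /hmul /hinv !hpointE /qm /qt /qu1 /qu2.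
have -> : hx1 (a + h) = hx1 a + h 0 0 by rewrite /hx1 !mxE.
have -> : hx2 (a + h) = hx2 a + h 0 1 by rewrite /hx2 !mxE.
have -> : hx3 (a + h) = hx3 a + h 0 2 by rewrite /hx3 !mxE.
ring.
Qed.

End Weight.

Definition qK := 3 + 2 * `|hx1 a| + 2 * `|hx2 a|.
(** Half the reciprocal of [56 + 4 * qK ^+ 2], a bound for the constants collected at the end of
    [nrm_qQ]. It depends on [a] but not on [y]. *)
Definition qdelta : R := (2 * (56 + 4 * qK ^+ 2))^-1.
Definition qw : V := const_mx qdelta.

Lemma qK_ge3 : 3 <= qK.
Proof. by rewrite /qK -addrA lerDl addr_ge0// mulr_ge0. Qed.

Lemma qdelta_gt0 : 0 < qdelta.
Proof. by rewrite invr_gt0 mulr_gt0// ltr_wpDr// mulr_ge0// sqr_ge0. Qed.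

Lemma posw_qw : posw qw.
Proof. by move=> i; rewrite mxE qdelta_gt0. Qed.

(** The increment is small relative to the fourth power of the distance itself, on one box for all
    [y]. The factor 1/2 leaves half of the Gaussian exponent for integrability. *)
Lemma nrm_qQ y : nrm qw (qQ y) <= 2^-1 * (1 + hdist a y ^+ 4).
Proof.
have w0 := posw_qw; set de := qdelta; have de0 : 0 < de := qdelta_gt0.
have K3 := qK_ge3.
have de1 : de <= 1.
  rewrite invf_le1 ?mulr_gt0//; last by rewrite ltr_wpDr// mulr_ge0// sqr_ge0.
  by have := sqr_ge0 qK; lra.
have wv j := @wfin_var R 3 qw j.
have nv j : nrm qw (varc j) = de by rewrite nrm_var// mxE.
have wvv j : wfin qw (convc (varc j) (varc j)) by exact: wfin_conv.
have nvv j : nrm qw (convc (varc j) (varc j)) <= de * de.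
  by apply: le_trans (nrm_conv w0 (wv j) (wv j)) _; rewrite nv.
have wz b j : wfin qw (fun k => b * varc j k) by exact: wfinZ.
have wA := wfin_qA w0 y; have wL := wfin_qL qw y.
set u1 := qu1 y; set u2 := qu2 y; set t := qt y; set m := qm y.
have m0 : 0 <= m by rewrite addr_ge0 ?sqr_ge0.
have a1 : 2 * `|u1| <= 1 + u1 ^+ 2.
  by rewrite -(real_normK (num_real u1)); have := sqr_ge0 (1 - `|u1|); nra.
have a2 : 2 * `|u2| <= 1 + u2 ^+ 2.
  by rewrite -(real_normK (num_real u2)); have := sqr_ge0 (1 - `|u2|); nra.
have mE : m = u1 ^+ 2 + u2 ^+ 2 by [].
have nA : nrm qw (qA y) <= 2 * de * (2 + m).
  have s1 := wfinD (wz ((-2) * u2) 1) (wvv 1); have s2 := wfinD (wvv 0) s1.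
  rewrite /qA /v1 /v2; apply: (le_trans (nrmD (wz _ _) s2)).
  rewrite nrmZ nv normrM normrN normr_nat.
  have h2 : nrm qw (fun k => convc (varc 0) (varc 0) k + ((-2) * u2 * varc 1 k +
      convc (varc 1) (varc 1) k)) <= de * de + (2 * `|u2| * de + de * de).
    apply: (le_trans (nrmD (wvv 0) s1)).
    apply: lerD (nvv 0) _; apply: (le_trans (nrmD (wz _ _) (wvv 1))).
    by rewrite nrmZ nv normrM normrN normr_nat; apply: lerD (lexx _) (nvv 1).
  apply: (le_trans (lerD (lexx _) h2)); rewrite -/u1.
  have dd : de * de <= de by rewrite ler_piMr// ltW.
  have e1 : 2 * `|u1| * de <= (1 + u1 ^+ 2) * de by rewrite ler_wpM2r// ltW.
  have e2 : 2 * `|u2| * de <= (1 + u2 ^+ 2) * de by rewrite ler_wpM2r// ltW.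
  by rewrite mE; nra.
have y1 : `|hx1 y| <= `|u1| + `|hx1 a|.
  by rewrite -[hx1 y](subrK (hx1 a)) ler_normD.
have y2 : `|hx2 y| <= `|u2| + `|hx2 a|.
  by rewrite -[hx2 y](subrK (hx2 a)) ler_normD.
have nL : nrm qw (qL y) <= de * (qK + m).
  have s1 := wfinD (wz (2 * hx2 y) 0) (wz ((-2) * hx1 y) 1).
  rewrite /qL /v1 /v2 /v3; apply: (le_trans (nrmD (wz _ _) s1)).
  rewrite nrmZ nv normrN normr1 mul1r.
  have h2 : nrm qw (fun k => 2 * hx2 y * varc 0 k + (-2) * hx1 y * varc 1 k) <=
      2 * `|hx2 y| * de + 2 * `|hx1 y| * de.
    apply: (le_trans (nrmD (wz _ _) (wz _ _))).
    rewrite !nrmZ !nv !normrM normrN !normr_nat; exact: lexx.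
  apply: (le_trans (lerD (lexx _) h2)).
  rewrite (_ : de + _ = de * (1 + 2 * `|hx2 y| + 2 * `|hx1 y|)); last by ring.
  by rewrite ler_wpM2l ?(ltW de0)// /qK mE; lra.
have P4 : hdist a y ^+ 4 = m ^+ 2 + t ^+ 2 by rewrite hdistX4.
have wAA := wfin_conv w0 wA wA; have wLL := wfin_conv w0 wL wL.
have zA b : wfin qw (fun k => b * qA y k) by exact: wfinZ.
have zL b : wfin qw (fun k => b * qL y k) by exact: wfinZ.
have s1 := wfinD (zL (2 * t)) wLL; have s2 := wfinD wAA s1.
have nAA := nrm_conv w0 wA wA; have nLL := nrm_conv w0 wL wL.
have nA0 := nrm_ge0 qw (qA y); have nL0 := nrm_ge0 qw (qL y).
have nQ : nrm qw (qQ y) <= 2 * m * nrm qw (qA y) + (nrm qw (qA y) ^+ 2 +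
    (2 * `|t| * nrm qw (qL y) + nrm qw (qL y) ^+ 2)).
  rewrite /qQ; apply: (le_trans (nrmD (zA _) s2)).
  rewrite nrmZ ger0_norm ?mulr_ge0//; apply: lerD (lexx _) _.
  apply: (le_trans (nrmD wAA s1)); rewrite [_ ^+ 2]expr2; apply: lerD nAA _.
  apply: (le_trans (nrmD (zL _) wLL)); rewrite [_ ^+ 2]expr2; apply: lerD _ nLL.
  rewrite nrmZ normrM normr_nat; exact: lexx.
apply: (le_trans nQ).
set al := 2 * de * (2 + m) in nA; set la := de * (qK + m) in nL.
have al0 : 0 <= al.
  by apply: mulr_ge0; [apply: mulr_ge0 => //; exact: ltW|apply: addr_ge0].
have la0 : 0 <= la by apply: mulr_ge0; [exact: ltW|apply: addr_ge0 => //; apply: le_trans K3].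
apply: (@le_trans _ _ (2 * m * al + (al ^+ 2 + (2 * `|t| * la + la ^+ 2)))).
  have sq (x z : R) : 0 <= x -> x <= z -> x ^+ 2 <= z ^+ 2.
    by move=> x0 xz; rewrite lerXn2r ?nnegrE// (le_trans x0).
  apply: lerD; first by apply: ler_wpM2l nA; rewrite mulr_ge0.
  apply: lerD; first exact: sq.
  apply: lerD; last exact: sq.
  by apply: ler_wpM2l nL; rewrite mulr_ge0.
have b1 : 2 * m * al <= de * (8 * (1 + m ^+ 2)).
  rewrite (_ : 2 * m * al = de * (8 * m + 4 * m ^+ 2)); last by rewrite /al; ring.
  by rewrite ler_wpM2l ?(ltW de0)//; have := sqr_ge0 (m - 1); nra.
have dele (z : R) : 0 <= z -> de * (de * z) <= de * z.
  by move=> z0; rewrite ler_piMl// mulr_ge0// ltW.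
have b2 : al ^+ 2 <= de * (32 * (1 + m ^+ 2)).
  rewrite (_ : al ^+ 2 = de * (de * (4 * (2 + m) ^+ 2))); last by rewrite /al; ring.
  apply: (le_trans (dele _ _)); first by rewrite mulr_ge0 ?sqr_ge0.
  by apply: ler_wpM2l; [exact: ltW|have := sqr_ge0 (m - 2); nra].
have sqK : (qK + m) ^+ 2 <= 2 * qK ^+ 2 + 2 * m ^+ 2 by have := sqr_ge0 (qK - m); nra.
have b3 : 2 * `|t| * la <= de * (t ^+ 2 + (2 * qK ^+ 2 + 2 * m ^+ 2)).
  rewrite (_ : 2 * `|t| * la = de * (2 * `|t| * (qK + m))); last by rewrite /la; ring.
  rewrite ler_wpM2l ?(ltW de0)// -(real_normK (num_real t)).
  by have := sqr_ge0 (`|t| - (qK + m)); nra.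
have b4 : la ^+ 2 <= de * (2 * qK ^+ 2 + 2 * m ^+ 2).
  rewrite (_ : la ^+ 2 = de * (de * (qK + m) ^+ 2)); last by rewrite /la; ring.
  apply: (le_trans (dele _ _)); first exact: sqr_ge0.
  by apply: ler_wpM2l sqK; exact: ltW.
have deE : de * (56 + 4 * qK ^+ 2) = 2^-1.
  by rewrite /de /qdelta invfM -mulrA mulVf ?mulr1// gt_eqF// ltr_wpDr// mulr_ge0// sqr_ge0.
rewrite P4 -deE -[leRHS]mulrA.
have fin : de * (8 * (1 + m ^+ 2)) + (de * (32 * (1 + m ^+ 2)) +
   (de * (t ^+ 2 + (2 * qK ^+ 2 + 2 * m ^+ 2)) + de * (2 * qK ^+ 2 + 2 * m ^+ 2))) <=
   de * ((56 + 4 * qK ^+ 2) * (1 + (m ^+ 2 + t ^+ 2))).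
  rewrite -!mulrDr ler_wpM2l ?(ltW de0)//.
  have k0 := sqr_ge0 qK; have mm := sqr_ge0 m; have tt := sqr_ge0 t.
  have km : 0 <= qK ^+ 2 * (m ^+ 2 + t ^+ 2) by rewrite mulr_ge0 ?addr_ge0.
  by nra.
apply: le_trans fin; apply: lerD b1 _; apply: lerD b2 _; exact: lerD b3 b4.
Qed.

End QuarticExpansion.

Section ExpBounds.
Context {R : realType}.

Lemma expR_ge_term (x : R) m : 0 <= x -> x ^+ m / m`!%:R <= expR x.
Proof.
move=> x0; rewrite -lee_fin -asum_exp_coeff//.
by apply: le_trans (asum_le1 _ m); rewrite lee_fin ler_norm.
Qed.

(** The cubic term of the exponential series at [(k + 1) / 4], with [384 = 3! * 4 ^ 3]. *)
Lemma cube_le_exp (k : nat) : (k.+1%:R ^+ 3 : R) <= 384 * expR (4^-1) * expR (4^-1) ^+ k.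
Proof.
have := @expR_ge_term (k.+1%:R / 4) 3 (divr_ge0 (ler0n _ _) (ler0n _ _)).
rewrite -expRM_natr -mulrA -expRD (_ : 4^-1 + 4^-1 * k%:R = k.+1%:R / 4); last first.
  by rewrite -natr1; field.
rewrite exprMn (_ : 3`!%:R = 6 :> R)// => h.
have -> : (k.+1%:R ^+ 3 : R) = 384 * (k.+1%:R ^+ 3 * 4^-1 ^+ 3 / 6) by field.
exact: (ler_wpM2l (ler0n R 384) h).
Qed.

End ExpBounds.

Section HeisMeasurable.
Context {R : realType}.
Local Notation H := (heis R).
Local Notation HB := (heisBorel R).

Lemma measurable_hx1 : measurable_fun setT (@hx1 R : HB -> R).
Proof. by apply: continuous_measurable_heis; exact: continuous_hx1. Qed.

Lemma measurable_hx2 : measurable_fun setT (@hx2 R : HB -> R).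
Proof. by apply: continuous_measurable_heis; exact: continuous_hx2. Qed.

Lemma measurable_hx3 : measurable_fun setT (@hx3 R : HB -> R).
Proof. by apply: continuous_measurable_heis; exact: continuous_hx3. Qed.

Lemma hdist_powR (x y : H) : hdist x y = (hdist x y ^+ 4) `^ (4^-1).
Proof. by rewrite {2}/hdist hnormX4. Qed.

Lemma measurable_hdist (x : H) : measurable_fun setT ((fun y => hdist x y) : HB -> R).
Proof.
rewrite (_ : (fun y => _) = fun y => (hdist x y ^+ 4) `^ (4^-1)); last first.
  by apply/funext => y; rewrite -hdist_powR.
apply: (measurableT_comp (measurable_powR _)); exact: measurable_hdistX4.
Qed.

Variable a : H.

Lemma measurable_qu1 : measurable_fun setT (qu1 a : HB -> R).
Proof. by apply: measurable_funB; [exact: measurable_hx1|exact: measurable_cst]. Qed.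

Lemma measurable_qu2 : measurable_fun setT (qu2 a : HB -> R).
Proof. by apply: measurable_funB; [exact: measurable_hx2|exact: measurable_cst]. Qed.

Lemma measurable_qt : measurable_fun setT (qt a : HB -> R).
Proof.
apply: measurable_funB.
  apply: measurable_funD; first by apply: measurable_funB;
    [exact: measurable_hx3|exact: measurable_cst].
  by apply: measurable_funM; [exact: measurable_cst|exact: measurable_hx2].
by apply: measurable_funM; [exact: measurable_cst|exact: measurable_hx1].
Qed.

Lemma measurable_qm : measurable_fun setT (qm a : HB -> R).
Proof.
apply: measurable_funD; apply: measurable_funX; first exact: measurable_qu1.
exact: measurable_qu2.
Qed.

Lemma mcoef_qA : @mcoef _ HB R 3 (qA a).
Proof.
move=> k; rewrite /qA; apply: measurable_funD.
  apply: measurable_funM; last exact: measurable_cst.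
  by apply: measurable_funM; [exact: measurable_cst|exact: measurable_qu1].
apply: measurable_funD; first exact: measurable_cst.
apply: measurable_funD; last exact: measurable_cst.
apply: measurable_funM; last exact: measurable_cst.
by apply: measurable_funM; [exact: measurable_cst|exact: measurable_qu2].
Qed.

Lemma mcoef_qL : @mcoef _ HB R 3 (@qL R).
Proof.
move=> k; rewrite /qL; apply: measurable_funD; first exact: measurable_cst.
apply: measurable_funD; apply: measurable_funM; try exact: measurable_cst.
  by apply: measurable_funM; [exact: measurable_cst|exact: measurable_hx2].
by apply: measurable_funM; [exact: measurable_cst|exact: measurable_hx1].
Qed.

Lemma mcoef_qQ : @mcoef _ HB R 3 (qQ a).
Proof.
move=> k; rewrite /qQ; apply: measurable_funD.
  apply: measurable_funM; last exact: mcoef_qA.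
  by apply: measurable_funM; [exact: measurable_cst|exact: measurable_qm].
apply: measurable_funD; first exact: (mcoef_conv mcoef_qA mcoef_qA).
apply: measurable_funD; last exact: (mcoef_conv mcoef_qL mcoef_qL).
apply: measurable_funM; last exact: mcoef_qL.
by apply: measurable_funM; [exact: measurable_cst|exact: measurable_qt].
Qed.

Lemma measurable_gauss r :
  measurable_fun setT ((fun y => expR (- (r * hdist a y ^+ 4))) : HB -> R).
Proof.
have mN : measurable_fun setT ((fun y => - (r * hdist a y ^+ 4)) : HB -> R).
  apply: measurable_funN; apply: measurable_funM; first exact: measurable_cst.
  exact: measurable_hdistX4.
exact: (measurableT_comp (@measurable_expR R) mN).
Qed.

(** The kernel centered at [a] times the exponential of its increment, as a power series in the
    displacement of the center. *)
Definition gaussc (r : R) (y : H) : {ffun 'I_3 -> nat} -> R := fun k =>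
  expR (- (r * hdist a y ^+ 4)) * expc (fun k => (- r) * qQ a y k) k.

Lemma mcoef_gaussc r : @mcoef _ HB R 3 (gaussc r).
Proof.
move=> k; rewrite /gaussc; apply: measurable_funM.
  exact: measurable_gauss.
have mr : @mcoef _ HB R 3 (fun y k => (- r) * qQ a y k).
  move=> l; apply: measurable_funM; first exact: measurable_cst.
  exact: mcoef_qQ.
exact: (mcoef_exp mr k).
Qed.

Lemma wfin_gaussc r y : wfin (qw a) (gaussc r y).
Proof.
have w0 := posw_qw a; apply: wfinZ; apply: wfin_exp => //; apply: wfinZ.
exact: wfin_qQ.
Qed.

Lemma psum_gaussc r y h : inbox (qw a) h ->
  psum (gaussc r y) h = expR (- (r * hdist (a + h) y ^+ 4)).
Proof.
move=> hw; have w0 := posw_qw a; have wQ := wfin_qQ a w0 y.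
have wrQ := wfinZ (- r) wQ.
rewrite /gaussc (psumZ _ w0 hw (wfin_exp w0 wrQ)) (psum_exp w0 wrQ hw).
rewrite (psumZ _ w0 hw wQ) (psum_qQ a w0 y hw) -expRD; congr expR; ring.
Qed.

Lemma wnorm_gaussc r y : 1 <= r ->
  (wnorm (qw a) (gaussc r y) <= (expR (r / 2) * expR (- (hdist a y ^+ 4 / 2)))%:E)%E.
Proof.
move=> r1; have w0 := posw_qw a; have wQ := wfin_qQ a w0 y.
have r0 : 0 <= r by apply: le_trans r1.
have wrQ := wfinZ (- r) wQ.
rewrite /gaussc wnormZ gtr0_norm ?expR_gt0//.
apply: (@le_trans _ _ ((expR (- (r * hdist a y ^+ 4)))%:E *
   (expR (nrm (qw a) (fun k => (- r) * qQ a y k)))%:E)%E).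
  by apply: lee_wpmul2l; [rewrite lee_fin expR_ge0|exact: wnorm_exp].
rewrite -EFinM lee_fin -!expRD ler_expR nrmZ normrN ger0_norm//.
have P0 : 0 <= hdist a y ^+ 4 by rewrite exprn_ge0 ?hdist_ge0.
have h : r * nrm (qw a) (qQ a y) <= r * (2^-1 * (1 + hdist a y ^+ 4)).
  by apply: ler_wpM2l => //; exact: nrm_qQ.
have h2 : hdist a y ^+ 4 <= r * hdist a y ^+ 4 by rewrite ler_peMl.
move: h h2; lra.
Qed.

End HeisMeasurable.

(** * Gaussian integrals of the measure *)

Section AnalyticDescription.
Context {R : realType}.
Local Notation H := (heis R).
Local Notation HB := (heisBorel R).
Variables (mu : {measure set HB -> \bar R}) (c : R).
Hypotheses (c_gt0 : 0 < c) (mu_neq0 : mu setT <> 0%E).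
Hypothesis mu_ball : forall x r, msupport mu x -> 0 < r -> mu (hball x r) = (c * r ^+ 3)%:E.

Lemma gauss_lty (a : H) : (\int[mu]_y (expR (- (hdist a y ^+ 4 / 2)))%:E < +oo)%E.
Proof.
have mgh : measurable_fun setT ((fun y => expR (- (hdist a y ^+ 4 / 2))) : HB -> R).
  rewrite (_ : (fun y => _) = fun y => expR (- (2^-1 * hdist a y ^+ 4))); last first.
    by apply/funext => y; rewrite mulrC.
  exact: measurable_gauss.
(* The space is cut according to the integer part [k] of the distance. There the integrand is at
   most [expR (- k / 2) = q ^ (2 k)], the mass is at most [8 c (k + 1)^3], and one factor [q ^ k]
   absorbs the cube. *)
pose q : R := expR (- 4^-1).
have q0 : 0 < q by exact: expR_gt0.
have q1 : q < 1 by rewrite /q expR_lt1; lra.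
have qE : expR (- 2^-1) = q ^+ 2 :> R by rewrite -expRM_natl; congr expR; field.
have eq1 : expR (4^-1) * q = 1 :> R by rewrite -expRD addrN expR0.
pose t (k : nat) (y : HB) : \bar R :=
  (((q ^+ 2) ^+ k)%:E * (\1_(hball a k.+1%:R : set HB) y)%:E)%E.
have t0 k y : (0 <= t k y)%E.
  rewrite /t indicE -EFinM lee_fin; apply: mulr_ge0; last exact: ler0n.
  by apply: exprn_ge0; exact: sqr_ge0.
have mt k : measurable_fun setT (t k).
  apply: emeasurable_funM; first exact: measurable_cst.
  by apply/measurable_EFinP; apply: measurable_indic; exact: measurable_hball.
have le1 : (\int[mu]_y (expR (- (hdist a y ^+ 4 / 2)))%:E <=
    \int[mu]_y \esum_(k in [set: nat]) t k y)%E.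
  apply: ge0_le_integral => //.
  - by apply/measurable_EFinP; exact: mgh.
  - exact: measurable_esum.
  move=> y _; have d0 := hdist_ge0 a y; pose k := Num.truncn (hdist a y).
  have /andP[k1 k2] : (k%:R <= hdist a y < k.+1%:R) by rewrite /k truncn_itv.
  apply: (le_trans _ (esum_le1 (i := k) _ _)) => //.
  rewrite /t indicE mem_set; last by rewrite /hball/= ltW.
  rewrite mule1 lee_fin -qE -expRM_natr ler_expR.
  have kk : (k%:R : R) <= k%:R ^+ 4.
    by rewrite -natrX ler_nat; case: (k) => // m; rewrite -[leqLHS]expn1 leq_pexp2l.
  have : k%:R ^+ 4 <= hdist a y ^+ 4 by rewrite lerXn2r ?nnegrE.
  move: kk; lra.
apply: (le_lt_trans le1); rewrite integral_esum//.
have le2 : (\esum_(k in [set: nat]) \int[mu]_y t k y <=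
    asum (fun k : nat => (8 * c * (384 * expR (4^-1))) * q ^+ k)%R)%E.
  apply: le_esum => k _; rewrite /t.
  have mi : measurable_fun setT (fun y : HB => (\1_(hball a k.+1%:R : set HB) y)%:E : \bar R).
    by apply/measurable_EFinP; apply: measurable_indic; exact: measurable_hball.
  rewrite (ge0_integralZl_EFin _ _ _ mi) //; last first.
    by apply: exprn_ge0; exact: sqr_ge0.
  rewrite integral_indic//; last exact: measurable_hball.
  rewrite setIT.
  apply: (@le_trans _ _ (((q ^+ 2) ^+ k)%:E * (c * (2 * k.+1%:R) ^+ 3)%:E)%E).
    apply: lee_wpmul2l; first by rewrite lee_fin exprn_ge0 ?sqr_ge0.
    exact: (mu_hball_le c_gt0 mu_ball).
  rewrite -EFinM lee_fin; apply: le_trans (ler_norm _).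
  have c0 : 0 <= (q ^+ 2) ^+ k * (8 * c).
    by apply: mulr_ge0; [apply: exprn_ge0; exact: sqr_ge0|apply: mulr_ge0; rewrite ?ler0n// ltW].
  have h := ler_wpM2l c0 (@cube_le_exp R k).
  have -> : (q ^+ 2) ^+ k * (c * (2 * k.+1%:R) ^+ 3) =
    (q ^+ 2) ^+ k * (8 * c) * k.+1%:R ^+ 3 by ring.
  apply: (le_trans h); rewrite le_eqVlt; apply/orP; left; apply/eqP.
  have -> : q ^+ 2 ^+ k = q ^+ k * q ^+ k by rewrite -exprM mulnC exprM expr2.
  have e1 : expR (4^-1) ^+ k * q ^+ k = 1 :> R by rewrite -exprMn eq1 expr1n.
  rewrite -[q ^+ k in RHS]mulr1 -[X in _ = _ * (_ * X)]e1; ring.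
apply: (le_lt_trans le2); rewrite asumZ asum_series ?ltry//.
- by move=> k; rewrite exprn_ge0// ltW.
- have := is_cvg_geometric_series (a := 1) (z := q); rewrite gtr0_norm// => /(_ q1).
  by congr (cvgn (series _)); apply/funext => k /=; rewrite mul1r.
Qed.

Definition gauss (r : R) (x : H) : R := rint mu (fun y => expR (- (r * hdist x y ^+ 4))).

Lemma gauss_mint r x : 1 <= r ->
  (mint mu (fun y => expR (- (r * hdist x y ^+ 4))) < +oo)%E.
Proof.
move=> r1; apply: le_lt_trans (gauss_lty x); apply: ge0_le_integral => //.
- by apply: measurable_norm; exact: measurable_gauss.
- apply/measurable_EFinP; rewrite (_ : (fun y => expR (- (hdist x y ^+ 4 / 2))) =
    fun y => expR (- (2^-1 * hdist x y ^+ 4))); first exact: measurable_gauss.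
  by apply/funext => y; rewrite mulrC.
- move=> y _; rewrite ger0_norm ?expR_ge0// lee_fin ler_expR lerN2.
  have P0 : 0 <= hdist x y ^+ 4 by rewrite exprn_ge0 ?hdist_ge0.
  have : hdist x y ^+ 4 <= r * hdist x y ^+ 4 by rewrite ler_peMl.
  move: P0; lra.
Qed.

Lemma gaussE r x : gauss r x = fine (mint mu (fun y => expR (- (r * hdist x y ^+ 4)))).
Proof. by rewrite /gauss ge0_rint// => y; exact: expR_ge0. Qed.

Lemma gauss_ge0 r x : 0 <= gauss r x.
Proof. by rewrite gaussE fine_ge0// mint_ge0. Qed.

(** Uniformity prescribes the image of the measure under the distance from a support point on
    half-lines, and half-lines generate the Borel sets. *)
Lemma integral_dist_support (x0 x : H) (phi : R -> \bar R) :
  msupport mu x0 -> msupport mu x -> measurable_fun setT phi -> (forall t, 0 <= phi t)%E ->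
  (\int[mu]_y phi (hdist x y) = \int[mu]_y phi (hdist x0 y))%E.
Proof.
move=> sx0 sx mphi phi0.
pose m z : {measure set R -> \bar R} := image_measure mu (measurable_hdist z).
have mE z t : msupport mu z -> m z `]-oo, t[%classic =
    (if 0 < t then (c * t ^+ 3)%:E else 0%E).
  move=> sz; have -> : m z `]-oo, t[%classic = mu [set y | hdist z y < t].
    by rewrite /m/= /pushforward; congr (mu _); apply/seteqP; split=> y /=; rewrite in_itv.
  case: ltP => [t0|t0]; last first.
    rewrite [X in mu X](_ : _ = set0) ?measure0//; apply/seteqP; split=> // y /=.
    by rewrite ltNge (le_trans t0)// hdist_ge0.
  have mo : measurable ([set y | hdist z y < t] : set HB).
    have := measurable_hdist z measurableT (measurable_itv `]-oo, t[).
    rewrite setTI; congr (measurable _); apply/seteqP; split=> y /=; by rewrite in_itv.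
  apply/eqP; rewrite eq_le; apply/andP; split.
    rewrite -(@mu_ball _ _ sz t0); apply: le_measure; rewrite ?inE//; first exact: measurable_hball.
    by move=> y /= /ltW.
  apply/lee_addgt0Pr => e e0.
  (* The open ball is approximated from inside by closed ones: the second entry makes
     [c * (t ^+ 3 - s ^+ 3)] at most [e], the first keeps [s] positive. *)
  pose s := Num.max (t / 2) (t - e / (3 * c * t ^+ 2)).
  have cpos : 0 < 3 * c * t ^+ 2 by rewrite !mulr_gt0 ?exprn_gt0.
  have s0 : 0 < s by rewrite lt_max divr_gt0.
  have st : s < t.
    by rewrite gt_max ltr_pdivrMr// mulr_natr mulr2n ltrDl t0/= ltrBlDr ltrDl divr_gt0.
  apply: (@le_trans _ _ (mu (hball z s) + e%:E)%E); last first.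
    apply: leeD => //; apply: le_measure; rewrite ?inE//; first exact: measurable_hball.
    by move=> y /= /le_lt_trans; apply.
  rewrite (@mu_ball _ _ sz s0) -EFinD lee_fin.
  have se : (t - s) * (3 * c * t ^+ 2) <= e.
    by rewrite -ler_pdivlMr// lerBlDl -lerBlDr le_max lexx orbT.
  have : t ^+ 3 - s ^+ 3 <= (t - s) * (3 * t ^+ 2).
    rewrite (_ : t ^+ 3 - s ^+ 3 = (t - s) * (t ^+ 2 + t * s + s ^+ 2)); last by ring.
    apply: ler_wpM2l; first by rewrite subr_ge0 ltW.
    have : s * s <= t * t by rewrite ler_pM// ltW.
    have : t * s <= t * t by rewrite ler_wpM2l// ltW.
    rewrite !expr2; lra.
  move=> h; have := ler_wpM2l (ltW c_gt0) h; lra.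
have mm : forall A, measurable A -> m x A = m x0 A.
  apply: (measure_unique (@RGenInftyO.G R) (fun n => `]-oo, n%:R[%classic)).
  - exact: RGenInftyO.measurableE.
  - move=> _ _ [u ->] [v ->]; exists (Num.min u v).
    by apply/seteqP; split=> z /=; rewrite !in_itv/= lt_min => /andP.
  - by move=> n; exists n%:R.
  - apply/seteqP; split=> // z _; exists (Num.bound `|z|) => //=; rewrite in_itv/=.
    exact: (le_lt_trans (ler_norm z) (archi_boundP (normr_ge0 z))).
  - by move=> _ [u ->]; rewrite !mE.
  - by move=> n; rewrite mE//; case: ifP => _; exact: ltry.
have step z : (\int[mu]_y phi (hdist z y) = \int[m z]_t phi t)%E.
  rewrite [RHS](ge0_integral_pushforward (measurable_hdist z))//.
by rewrite !step; apply: eq_measure_integral => A mA _; exact: mm.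
Qed.

End AnalyticDescription.

(** * The support as an analytic variety *)

Section SupportFunction.
Context {R : realType}.
Local Notation H := (heis R).
Local Notation HB := (heisBorel R).
Local Notation T := {ffun 'I_3 -> nat}.
Variables (mu : {measure set HB -> \bar R}) (c : R).
Hypotheses (c_gt0 : 0 < c) (mu_neq0 : mu setT <> 0%E).
Hypothesis mu_ball : forall x r, msupport mu x -> 0 < r -> mu (hball x r) = (c * r ^+ 3)%:E.
Variable x0 : H.
Hypothesis sx0 : msupport mu x0.

Let g n : R := gauss mu n.+1%:R x0.

(** The exponents start at 1 because the integrability estimates need [1 <= r]. The norms of the
    coefficient series grow at most like [expR (n / 2)], so the factorials make the series of the
    squares converge on a whole box. *)
Definition support_fun (x : H) : R :=
  rsum (fun n : nat => n`!%:R^-1 * (gauss mu n.+1%:R x - g n) ^+ 2).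

Let I (a : H) : R := fine (\int[mu]_y (expR (- (hdist a y ^+ 4 / 2)))%:E)%E.

Let IE a : (\int[mu]_y (expR (- (hdist a y ^+ 4 / 2)))%:E)%E = (I a)%:E.
Proof.
rewrite fineK// ge0_fin_numE; first exact: (gauss_lty c_gt0 mu_ball).
by apply: integral_ge0 => y _; rewrite lee_fin expR_ge0.
Qed.

Let I_ge0 a : 0 <= I a.
Proof. by apply: fine_ge0; apply: integral_ge0 => y _; rewrite lee_fin expR_ge0. Qed.

Let meas_half a :
  measurable_fun setT ((fun y => expR (- (hdist a y ^+ 4 / 2))) : HB -> R).
Proof.
rewrite (_ : (fun y => _) = fun y => expR (- (2^-1 * hdist a y ^+ 4))); last first.
  by apply/funext => y; rewrite mulrC.
exact: measurable_gauss.
Qed.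

Let ler1n (n : nat) : (1 : R) <= n.+1%:R.
Proof. by rewrite ler1n. Qed.

Let gauss_le n a : gauss mu n.+1%:R a <= I a.
Proof.
rewrite gaussE -lee_fin -IE fineK; last first.
  by apply: mint_fin; apply: (gauss_mint c_gt0 mu_ball); exact: ler1n.
rewrite (ge0_mint mu (p := fun y => expR (- (hdist a y ^+ 4 / 2)))); last first.
  by move=> y; exact: expR_ge0.
apply: le_mint; [exact: measurable_gauss|exact: meas_half|].
move=> y; rewrite !ger0_norm ?expR_ge0// ler_expR lerN2.
have P0 : 0 <= hdist a y ^+ 4 by rewrite exprn_ge0 ?hdist_ge0.
have : hdist a y ^+ 4 <= n.+1%:R * hdist a y ^+ 4 by rewrite ler_peMl.
by move: P0 => P0 h; lra.
Qed.

Section At.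
Variable a : H.

Let w0 := posw_qw a.

Let mG n := @mcoef_gaussc R a n.+1%:R.

Let wG n := @wfin_gaussc R a n.+1%:R.

Let int_wnorm n : (\int[mu]_y wnorm (qw a) (gaussc a n.+1%:R y) <=
  (expR (n.+1%:R / 2) * I a)%:E)%E.
Proof.
have e0 : 0 <= expR (n.+1%:R / 2) :> R by exact: expR_ge0.
rewrite EFinM -IE -ge0_integralZl_EFin//; last first.
  by apply/measurable_EFinP; exact: meas_half.
apply: ge0_le_integral => //.
- by move=> y _; exact: asum_ge0.
- apply: measurable_asum => k; apply: measurable_funM; last exact: measurable_cst.
  exact: mG.
- by apply/measurable_EFinP; apply: measurable_funM; [exact: measurable_cst|exact: meas_half].
- by move=> y _; rewrite -EFinM; apply: wnorm_gaussc; exact: ler1n.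
Qed.

Let fG n : (\int[mu]_y wnorm (qw a) (gaussc a n.+1%:R y) < +oo)%E.
Proof. by apply: le_lt_trans (int_wnorm n) _; rewrite ltry. Qed.

Let Dn n : T -> R := fun k => intc mu (gaussc a n.+1%:R) k + constc (- g n) k.

Let wD n : wfin (qw a) (Dn n).
Proof.
by apply: wfinD; [exact: (wfin_intc w0 (mG n) (fG n))|exact: wfin_const].
Qed.

Let psumDn n h : inbox (qw a) h -> psum (Dn n) h = gauss mu n.+1%:R (a + h) - g n.
Proof.
move=> hw; rewrite (psumD w0 hw (wfin_intc w0 (mG n) (fG n)) (wfin_const _ _)) psum_const.
rewrite (psum_intc w0 (mG n) (wG n) (fG n) hw); congr (_ - _); rewrite /gauss; congr rint.
by apply/funext => y; apply: psum_gaussc.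
Qed.

Let K := I a + I x0.

Let wnormDn n : (wnorm (qw a) (Dn n) <= (expR (n.+1%:R / 2) * K)%:E)%E.
Proof.
apply: (le_trans (wnormD _ _ _)); rewrite wnorm_const normrN ger0_norm; last exact: gauss_ge0.
have h1 := le_trans (wnorm_intc w0 (mG n) (fG n)) (int_wnorm n).
have h2 : ((g n)%:E <= (expR (n.+1%:R / 2) * I x0)%:E)%E.
  rewrite lee_fin; apply: (le_trans (gauss_le n x0)); apply: ler_peMl; first exact: I_ge0.
  by rewrite -[leLHS]expR0 ler_expR divr_ge0 ?ler0n.
by rewrite /K mulrDr EFinD; exact: (leeD h1 h2).
Qed.

Let Cn n : T -> R := fun k => n`!%:R^-1 * convc (Dn n) (Dn n) k.

Let summC : summ (fun p : T * nat => Cn p.2 p.1 * mono (qw a) p.1).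
Proof.
apply: summ_family.
apply: (@le_lt_trans _ _ (asum (fun n : nat => (expR 1 * K ^+ 2) * (expR 1 ^+ n / n`!%:R)))).
  apply: le_esum => n _; rewrite /Cn wnormZ.
  have K0 : 0 <= expR (n.+1%:R / 2) * K by rewrite mulr_ge0 ?expR_ge0 ?addr_ge0.
  have f0 : 0 <= (n`!%:R^-1 : R) by rewrite invr_ge0 ler0n.
  rewrite (ger0_norm f0).
  apply: (@le_trans _ _ ((n`!%:R^-1)%:E * ((expR (n.+1%:R / 2) * K) ^+ 2)%:E)%E).
    apply: lee_wpmul2l; first by rewrite lee_fin.
    apply: (le_trans (wnorm_conv w0 (wD n) (wD n))).
    rewrite expr2 EFinM; apply: lee_pmul; by [exact: asum_ge0|exact: wnormDn].
  rewrite -EFinM lee_fin; apply: le_trans (ler_norm _).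
  have -> : (expR (n.+1%:R / 2) * K) ^+ 2 = expR 1 * expR 1 ^+ n * K ^+ 2.
    have e2 : expR (n.+1%:R / 2) ^+ 2 = expR n.+1%:R :> R.
      by rewrite -expRM_natl; congr expR; field.
    by rewrite exprMn e2 -exprS -expRM_natl mulr1.
  by rewrite le_eqVlt; apply/orP; left; apply/eqP; ring.
by rewrite asumZ asum_exp_coeff ?expR_ge0// ltry.
Qed.

Let psumC n h : inbox (qw a) h ->
  psum (Cn n) h = n`!%:R^-1 * (gauss mu n.+1%:R (a + h) - g n) ^+ 2.
Proof.
move=> hw; rewrite (psumZ _ w0 hw (wfin_conv w0 (wD n) (wD n))).
by rewrite (psum_conv w0 (wD n) (wD n) hw) (psumDn n hw) expr2.
Qed.

Lemma psat_support_fun : psat finset.set0 a support_fun.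
Proof.
exists (qw a), (sumc Cn); split; [exact: w0|exact: (wfin_sumc w0 summC)|by move=> k i; rewrite inE|].
move=> h hw; rewrite (psum_sumc w0 summC hw); apply: eq_rsum => n.
by rewrite psumC.
Qed.

Lemma summ_support_fun :
  summ (fun n : nat => n`!%:R^-1 * (gauss mu n.+1%:R a - g n) ^+ 2).
Proof.
have h0 : inbox (qw a) (0 : H) by move=> i; rewrite mxE normr0 ltW.
have := summC; rewrite /summ asum_exchange => h; apply: le_lt_trans h.
apply: le_esum => n _; have wC : wfin (qw a) (Cn n) by apply: wfinZ; exact: (wfin_conv w0 (wD n) (wD n)).
have := psum_le w0 h0 wC; rewrite psumC// addr0 => hh.
by rewrite -[leRHS](fineK (asum_fin wC)) lee_fin.
Qed.

End At.

Lemma gauss_support x n : msupport mu x -> gauss mu n.+1%:R x = g n.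
Proof.
move=> sx; pose phi (t : R) : \bar R := (expR (- (n.+1%:R * t ^+ 4)))%:E.
have E z : mint mu (fun y => expR (- (n.+1%:R * hdist z y ^+ 4))) =
    (\int[mu]_y phi (hdist z y))%E.
  exact: (esym (ge0_mint mu (fun y => expR_ge0 _))).
have step z : gauss mu n.+1%:R z = fine (\int[mu]_y phi (hdist z y))%E.
  exact: (etrans (gaussE mu _ z) (congr1 fine (E z))).
rewrite (step x) /g (step x0); apply: (congr1 fine).
apply: (integral_dist_support c_gt0 mu_ball (phi := phi) sx0 sx); last first.
  by move=> t; rewrite /phi lee_fin expR_ge0.
apply/measurable_EFinP.
have mN : measurable_fun setT (fun t : R => - (n.+1%:R * t ^+ 4)).
  apply: measurable_funN; apply: measurable_funM; first exact: measurable_cst.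
  by apply: measurable_funX; exact: measurable_id.
exact: (measurableT_comp (@measurable_expR R) mN).
Qed.

(** On the ball of radius [1 / (n + 1)] about [x0] the exponent is at least -1. *)
Lemma gauss_lower n : c * expR (- 1) / n.+1%:R ^+ 3 <= g n.
Proof.
set rho : R := n.+1%:R^-1; have n0 : (0 : R) < n.+1%:R by rewrite ltr0n.
have rho0 : 0 < rho by rewrite invr_gt0.
have rho1 : n.+1%:R * rho ^+ 4 <= 1.
  rewrite exprS mulrA divff ?gt_eqF// mul1r; apply: exprn_ile1; first exact: ltW.
  by rewrite /rho invf_le1//; exact: ler1n.
rewrite /g gaussE -lee_fin fineK; last first.
  by apply: mint_fin; apply: (gauss_mint c_gt0 mu_ball); exact: ler1n.
rewrite -ge0_mint; last by move=> y; exact: expR_ge0.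
have mi : measurable_fun setT (fun y : HB => (\1_(hball x0 rho : set HB) y)%:E : \bar R).
  by apply/measurable_EFinP; apply: measurable_indic; exact: measurable_hball.
apply: (@le_trans _ _ (\int[mu]_y ((expR (- 1))%:E * (\1_(hball x0 rho : set HB) y)%:E)%E)%E).
  rewrite (ge0_integralZl_EFin _ _ _ mi) ?expR_ge0//.
  rewrite integral_indic//; last exact: measurable_hball.
  rewrite setIT (@mu_ball _ _ sx0 rho0) -EFinM lee_fin /rho exprVn.
  by rewrite le_eqVlt; apply/orP; left; apply/eqP; ring.
apply: ge0_le_integral => //.
- by apply: emeasurable_funM; [exact: measurable_cst|exact: mi].
- by apply/measurable_EFinP; exact: measurable_gauss.
move=> y _; rewrite indicE -EFinM lee_fin.
have [yb|_] := boolP (y \in _); last by rewrite mulr0 expR_ge0.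
rewrite mulr1 ler_expR lerN2; apply: le_trans rho1; apply: ler_wpM2l; first exact: ltW.
by apply: lerXn2r; rewrite ?nnegrE ?hdist_ge0 ?(ltW rho0)//; move: yb; rewrite inE.
Qed.

(** Of the [n + 1] copies of the fourth power in the exponent, [n] provide the decay off the null
    ball and the last one the integrable majorant. *)
Lemma gauss_upper (x : H) d n : 0 < d -> mu (hball x d) = 0%E ->
  gauss mu n.+1%:R x <= expR (- (n%:R * d ^+ 4)) * I x.
Proof.
move=> d0 mu0; rewrite gaussE -lee_fin fineK; last first.
  by apply: mint_fin; apply: (gauss_mint c_gt0 mu_ball); exact: ler1n.
rewrite -ge0_mint; last by move=> y; exact: expR_ge0.
rewrite EFinM -IE -ge0_integralZl_EFin ?expR_ge0//; last first.
  by apply/measurable_EFinP; exact: meas_half.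
apply: ae_ge0_le_integral => //.
- by apply/measurable_EFinP; exact: measurable_gauss.
- by apply/measurable_EFinP; apply: measurable_funM; [exact: measurable_cst|exact: meas_half].
exists (hball x d); split=> //; first exact: measurable_hball.
move=> y /= yN; apply: contrapT => /negP; rewrite /hball /= -ltNge => dy; apply: yN => _.
rewrite -EFinM lee_fin -expRD ler_expR -opprD lerN2.
have P0 : 0 <= hdist x y ^+ 4 by rewrite exprn_ge0 ?hdist_ge0.
have h1 : d ^+ 4 <= hdist x y ^+ 4 by rewrite lerXn2r ?nnegrE ?hdist_ge0 ?ltW.
have h2 : n%:R * d ^+ 4 <= n%:R * hdist x y ^+ 4 by rewrite ler_wpM2l.
by rewrite -[n.+1%:R]natr1 mulrDl mul1r; apply: lerD => //; move: P0 => P0'; lra.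
Qed.

(** If the sum vanishes, all Gaussian integrals at [x] agree with those at [x0], which are bounded
    below by a multiple of [1 / (n + 1)^3]; a ball of measure zero about [x] would force exponential
    decay. *)
Lemma support_funP x : (support_fun x = 0) <-> msupport mu x.
Proof.
split=> [f0|sx]; last first.
  rewrite /support_fun -[RHS](@rsum0 R nat); apply: eq_rsum => n.
  by rewrite gauss_support// subrr expr0n mulr0.
have gE n : gauss mu n.+1%:R x = g n.
  have p0 m : 0 <= m`!%:R^-1 * (gauss mu m.+1%:R x - g m) ^+ 2.
    by rewrite mulr_ge0 ?invr_ge0 ?ler0n ?sqr_ge0.
  have S := summ_support_fun x.
  have e0 := ge0_rsum p0 S; rewrite -/(support_fun x) f0 in e0.
  have := asum_le1 (fun m : nat => m`!%:R^-1 * (gauss mu m.+1%:R x - g m) ^+ 2) n.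
  rewrite -[X in (_ <= X)%E](fineK (asum_fin S)) -e0 lee_fin normr_le0.
  rewrite mulf_eq0 invr_eq0 pnatr_eq0 (gtn_eqF (fact_gt0 n)) orFb.
  by rewrite sqrf_eq0 subr_eq0 => /eqP.
move=> d d0; rewrite lt0e measure_ge0 andbT; apply/eqP => mu0.
set k := d ^+ 4; have k0 : 0 < k by exact: exprn_gt0.
have b n : c * expR (- 1) * expR (n%:R * k) <= I x * n.+1%:R ^+ 3.
  have n3 : 0 < (n.+1%:R ^+ 3 : R) by rewrite exprn_gt0 ?ltr0n.
  have hu := gauss_upper n d0 mu0; rewrite gE in hu.
  have := le_trans (gauss_lower n) hu.
  rewrite ler_pdivrMr// -/k => h; have := ler_wpM2r (expR_ge0 (n%:R * k)) h.
  have ee : expR (- (n%:R * k)) * expR (n%:R * k) = 1 by rewrite -expRD addNr expR0.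
  rewrite [X in _ <= X](_ : _ = I x * n.+1%:R ^+ 3 *
    (expR (- (n%:R * k)) * expR (n%:R * k))); last by ring.
  by rewrite ee mulr1.
(* Only the term of order 4 of the exponential is kept, one power more than the cube. Here
   [192 = 4! * 8], where 8 bounds [((n + 2) / (n + 1))^3]. *)
have b2 n : c * expR (- 1) * k ^+ 4 * n.+1%:R <= I x * 192.
  have h1 := @expR_ge_term R (n.+1%:R * k) 4 (mulr_ge0 (ler0n _ _) (ltW k0)).
  have ce : 0 <= c * expR (- 1) by rewrite mulr_ge0 ?expR_ge0 ?(ltW c_gt0).
  have h2 := le_trans (ler_wpM2l ce h1) (b n.+1).
  have h3 : (n.+2%:R : R) ^+ 3 <= 8 * n.+1%:R ^+ 3.
    rewrite -natrX -[8]/(8%:R) -natrX -natrM ler_nat.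
    rewrite (_ : 8 = 2 ^ 3)%N// -expnMn leq_exp2r//; lia.
  have h4 := le_trans h2 (ler_wpM2l (I_ge0 x) h3).
  have n3 : 0 < (n.+1%:R ^+ 3 : R) by rewrite exprn_gt0 ?ltr0n.
  rewrite -(ler_pM2r n3) -(ler_pM2r (_ : 0 < 24^-1 :> R)) ?invr_gt0//.
  rewrite (_ : 4`!%:R = 24 :> R) // in h4.
  move: h4; congr (_ <= _); first by rewrite exprMn exprSr; ring.
  by field.
have p0 : 0 < c * expR (- 1) * k ^+ 4 by rewrite !mulr_gt0 ?expR_gt0 ?exprn_gt0.
have := b2 (Num.bound (I x * 192 / (c * expR (- 1) * k ^+ 4))).
rewrite mulrC -ler_pdivlMr//; apply/negP; rewrite -ltNge.
have := archi_boundP (divr_ge0 (mulr_ge0 (I_ge0 x) (ler0n R 192)) (ltW p0)).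
by move=> /lt_trans; apply; rewrite ltr_nat.
Qed.

Lemma support_analytic : analytic_variety (msupport mu).
Proof.
exists support_fun; split=> [x|]; first exact: (psat_analytic (psat_support_fun x)).
by apply/seteqP; split=> x /= /support_funP.
Qed.

End SupportFunction.

(** * The dimension of the support *)

Section Packing.
Context {R : realType}.
Local Notation H := (heis R).
Local Notation HB := (heisBorel R).

Lemma hball_disjoint (x y z : H) (r : R) :
  2 * r < hdist x y -> hball x r z -> hball y r z -> False.
Proof.
rewrite /hball/= => rxy xz yz; have := hdist_triangle z x y.
by rewrite (hdistC z); move: rxy xz yz; lra.
Qed.

Variables (mu : {measure set HB -> \bar R}) (c : R).
Hypotheses (c_gt0 : 0 < c) (mu_neq0 : mu setT <> 0%E).
Hypothesis mu_ball : forall x r, msupport mu x -> 0 < r -> mu (hball x r) = (c * r ^+ 3)%:E.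

Let grid n := ('I_n * 'I_n * 'I_(n ^ 2))%type.

(** A grid adapted to the dilations, with steps [s] in the horizontal directions and [s ^+ 2] in the
    vertical one. It has [n ^ 4] points, in accordance with the homogeneous dimension 4 of the
    group. *)
Let pt n (x : H) (s : R) (i : grid n) : H :=
  hmul x (hpoint (i.1.1%:R * s) (i.1.2%:R * s) (i.2%:R * s ^+ 2)).

Let natr_gap (i j : nat) : i != j -> 1 <= ((i%:R - j%:R) ^+ 2 : R).
Proof.
move=> ij; rewrite -(real_normK (num_real (i%:R - j%:R))) -{1}(expr1n R 2) lerXn2r ?nnegrE//.
have [lt|lt|e] := ltngtP i j; last by rewrite e eqxx in ij.
  by rewrite distrC -natrB 1?ltnW// ger0_norm// ler1n subn_gt0.
by rewrite -natrB 1?ltnW// ger0_norm// ler1n subn_gt0.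
Qed.

Let pt_gap n (x : H) s (i j : grid n) : 0 < s -> i != j -> s <= hdist (pt x s i) (pt x s j).
Proof.
move=> s0 ij; apply: ler_X4; [exact: ltW|exact: hdist_ge0|].
rewrite /pt hdist_mull hdistX4 !hpointE.
set a := (_ - _); set b := (_ - _); set t := (_ + _ - _).
have s4 : 0 <= s ^+ 4 by rewrite exprn_ge0// ltW.
have [e1|e1] := eqVneq (i.1.1 : nat) j.1.1; last first.
  have h := natr_gap e1.
  have ha : s ^+ 2 <= a ^+ 2.
    rewrite (_ : a ^+ 2 = (i.1.1%:R - j.1.1%:R) ^+ 2 * s ^+ 2); last by rewrite /a; ring.
    by rewrite ler_peMl// sqr_ge0.
  have -> : s ^+ 4 = s ^+ 2 * s ^+ 2 by ring.
  have hs : 0 <= s ^+ 2 by rewrite sqr_ge0.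
  have hab : s ^+ 2 <= a ^+ 2 + b ^+ 2 by rewrite (le_trans ha)// lerDl sqr_ge0.
  rewrite (le_trans (ler_pM hs hs hab hab))// -expr2 lerDl sqr_ge0//.
have [e2|e2] := eqVneq (i.1.2 : nat) j.1.2; last first.
  have h := natr_gap e2.
  have hb : s ^+ 2 <= b ^+ 2.
    rewrite (_ : b ^+ 2 = (i.1.2%:R - j.1.2%:R) ^+ 2 * s ^+ 2); last by rewrite /b; ring.
    by rewrite ler_peMl// sqr_ge0.
  have -> : s ^+ 4 = s ^+ 2 * s ^+ 2 by ring.
  have hs : 0 <= s ^+ 2 by rewrite sqr_ge0.
  have hab : s ^+ 2 <= a ^+ 2 + b ^+ 2 by rewrite (le_trans hb)// lerDr sqr_ge0.
  rewrite (le_trans (ler_pM hs hs hab hab))// -expr2 lerDl sqr_ge0//.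
have e3 : (i.2 : nat) != j.2.
  apply: contra_neq ij => e3; case: i j e1 e2 e3 {a b t} => [[i1 i2] i3] [[j1 j2] j3] /=.
  by move=> /val_inj -> /val_inj -> /val_inj ->.
have h := natr_gap e3.
rewrite (_ : t = - ((i.2%:R - j.2%:R) * s ^+ 2)); last by rewrite /t e1 e2; ring.
rewrite sqrrN exprMn -exprM (le_trans (_ : _ <= (i.2%:R - j.2%:R) ^+ 2 * s ^+ 4))//.
  by rewrite ler_peMl.
by rewrite lerDr sqr_ge0.
Qed.

Let pt_near n (x : H) d (i : grid n) : 0 < d -> hdist x (pt x (d / n%:R) i) <= 2 * d.
Proof.
move=> d0; have n0 : (0 < n)%N by exact: leq_ltn_trans (leq0n _) (ltn_ord i.1.1).
have nR : (0 : R) < n%:R by rewrite ltr0n.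
apply: ler_X4; [exact: hdist_ge0|by rewrite mulr_ge0// ltW|].
have xE : hmul x (hid R) = x by apply: heisP; rewrite /hmul /hid !hpointE; ring.
rewrite -{1}xE.
rewrite /pt hdist_mull hdistX4 /hid !hpointE.
have b1 (k : 'I_n) : (k%:R * (d / n%:R)) ^+ 2 <= d ^+ 2.
  rewrite lerXn2r ?nnegrE ?mulr_ge0 ?divr_ge0 ?ler0n ?(ltW d0)//.
  by rewrite mulrA ler_pdivrMr// mulrC ler_pM2l// ler_nat ltnW.
have b2 : (i.2%:R * (d / n%:R) ^+ 2) ^+ 2 <= d ^+ 4.
  have -> : d ^+ 4 = (d ^+ 2) ^+ 2 by ring.
  have q1 : 0 <= i.2%:R * (d / n%:R) ^+ 2 by rewrite mulr_ge0// sqr_ge0.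
  have q2 : 0 <= d ^+ 2 by exact: sqr_ge0.
  apply: lerXn2r; rewrite ?nnegrE//.
  rewrite exprMn exprVn mulrA ler_pdivrMr ?exprn_gt0// mulrC ler_pM2l ?exprn_gt0//.
  by rewrite -natrX ler_nat ltnW.
have b12 := lerD (b1 i.1.1) (b1 i.1.2).
set u := _ * _ in b12; set v := _ * _ in b12; set w := _ * _ in b2.
have b3 : (u ^+ 2 + v ^+ 2) ^+ 2 <= (d ^+ 2 + d ^+ 2) ^+ 2.
  by rewrite lerXn2r ?nnegrE ?addr_ge0 ?sqr_ge0.
rewrite !subr0 !mulr0 !mul0r subr0 addr0.
have -> : (2 * d) ^+ 4 = (d ^+ 2 + d ^+ 2) ^+ 2 + d ^+ 4 + 11 * d ^+ 4 by ring.
have d4 : 0 <= d ^+ 4 by rewrite exprn_ge0// ltW.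
by apply: (le_trans (lerD b3 b2)); rewrite lerDl mulr_ge0.
Qed.

(** An interior point would allow [n ^ 4] disjoint balls of radius [d / (3 n)] with centers in the
    support inside a ball of radius [3 d]; comparing masses gives [n / 27 <= 27]. *)
Lemma msupport_thin x : msupport mu x -> ~ \forall y \near x, msupport mu y.
Proof.
move=> sx xA; have [n n27] : exists n, 27 * 27 < n%:R :> R.
  by exists (Num.bound (27 * 27 : R)); apply: archi_boundP; rewrite mulr_ge0.
have [r r0 rs] := open_hball_sub (@open_interior _ _) (nbhs_singleton (nbhs_interior xA)).
pose d := r / 2; have d0 : 0 < d by rewrite divr_gt0.
have nR : (0 : R) < n%:R by apply: le_lt_trans n27; rewrite mulr_ge0.
have n1 : (1 : R) <= n%:R by rewrite ler1n -(ltr0n R).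
pose s := d / n%:R; have s0 : 0 < s by rewrite divr_gt0.
have {rs} rs y : hdist x y <= r -> msupport mu y.
  by move=> xy; apply: interior_subset; exact: (rs r).
pose B (k : 'I_#|{: grid n}|) : set HB := hball (pt x s (enum_val k)) (s / 3).
have s3 : 0 < s / 3 by rewrite divr_gt0.
have Bm k : measurable (B k) by exact: measurable_hball.
have tB : trivIset setT B.
  move=> k l _ _ [y [yk yl]]; apply: contrapT => /eqP kl.
  have ij : enum_val k != enum_val l :> grid n by rewrite (inj_eq enum_val_inj).
  apply: (hball_disjoint _ yk yl); apply: lt_le_trans (pt_gap x s0 ij).
  by rewrite mulrA ltr_pdivrMr// mulrC ltr_pM2l// ltr_nat.
have muB k : mu (B k) = (c * (s / 3) ^+ 3)%:E.
  apply: (@mu_ball _ _ _ s3); apply: rs; apply: (le_trans (pt_near x _ d0)).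
  by rewrite /d mulrC divfK.
have := measure_bigsetU_ord mu xpredT Bm tB.
rewrite (eq_bigr _ (fun k _ => muB k)) sumEFin sumr_const card_ord => e.
have : (mu (\big[setU/set0]_(k < #|{: grid n}|) B k) <= mu (hball x (3 * d)))%E.
  apply: le_measure; rewrite ?inE; [exact: bigsetU_measurable|exact: measurable_hball|].
  elim/big_ind: _ => [//|A A' A1 A2 y [/A1|/A2]//|k _ y yk].
  have := hdist_triangle (pt x s (enum_val k)) x y.
  have := pt_near x (enum_val k) d0; have : s <= d by rewrite /s ler_pdivrMr// ler_peMr// ltW.
  by move: yk d0; rewrite /B /hball/= -/s; lra.
apply/negP; rewrite e (mu_ball sx) ?mulr_gt0// lee_fin !card_prod !card_ord.
rewrite -[X in ~~ (X <= _)]mulr_natl !natrM /s.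
have -> : n%:R * n%:R * (n%:R * n%:R) * (c * (d / n%:R / 3) ^+ 3) = c * d ^+ 3 * (n%:R / 27).
  by field; rewrite gt_eqF.
have -> : c * (3 * d) ^+ 3 = c * d ^+ 3 * 27 by ring.
rewrite ler_pM2l ?mulr_gt0 ?exprn_gt0// ler_pdivrMr//.
by rewrite -ltNge.
Qed.

End Packing.

(** * Strict differentiability and Lipschitz curves *)

Section StrictDifferentiability.
Context {R : realType}.
Local Notation H := (heis R).
Implicit Types f : H -> R.

Lemma is_derive_line f (i : 'I_3) (z : H) (t : R) :
  derivable f (z + t *: delta_mx 0 i) (delta_mx 0 i) ->
  is_derive t 1 (fun s => f (z + s *: delta_mx 0 i)) (partial f i (z + t *: delta_mx 0 i)).
Proof.
set v := delta_mx 0 i; set y := z + t *: v => dy.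
have E : (fun h : R => h^-1 *: (((fun s => f (z + s *: v)) \o shift t) (h *: 1) - f y)) =
    (fun h : R => h^-1 *: ((f \o shift y) (h *: v) - f y)).
  apply/funext => h /=; congr (_ *: (f _ - _)).
  have -> : h%:A = h :> R by rewrite /GRing.scale /= mulr1.
  by rewrite /y scalerDl addrCA.
by split; [rewrite /derivable -/y E|rewrite /derive -/y E].
Qed.

Lemma mvt_line f (i : 'I_3) (z : H) (s : R) :
  (forall t, `|t| <= `|s| -> derivable f (z + t *: delta_mx 0 i) (delta_mx 0 i)) ->
  exists2 t, `|t| <= `|s| &
  f (z + s *: delta_mx 0 i) - f z = partial f i (z + t *: delta_mx 0 i) * s.
Proof.
move=> df; pose g (u : R) := f (z + u *: delta_mx 0 i).
pose dg (u : R) := partial f i (z + u *: delta_mx 0 i).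
have dgP u : `|u| <= `|s| -> is_derive u (1 : R) g (dg u).
  by move=> us; apply: is_derive_line; exact: df.
have cg a b : (forall u, a <= u <= b -> `|u| <= `|s|) -> {within `[a, b], continuous g}.
  move=> ab; apply: derivable_within_continuous => u; rewrite in_itv/= => uab.
  by case: (dgP u (ab _ uab)).
have g0 : g 0 = f z by rewrite /g scale0r addr0.
have [s0|s0] := leP 0 s.
  have hs u : 0 <= u <= s -> `|u| <= `|s| by move=> /andP[u0 us]; rewrite !ger0_norm.
  have dg0 u : u \in `]0, s[ -> is_derive u (1 : R) g (dg u).
    by rewrite in_itv/= => /andP[u0 us]; apply/dgP/hs; rewrite !ltW.
  have [t + e] := MVT_segment s0 dg0 (cg 0 s hs).
  by rewrite in_itv/= => t0s; exists t; [exact: hs|rewrite -g0 -/(g s) e subr0].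
have hs u : s <= u <= 0 -> `|u| <= `|s| by move=> /andP[su u0]; rewrite !ler0_norm ?lerN2// ltW.
have dg0 u : u \in `]s, 0[ -> is_derive u (1 : R) g (dg u).
  by rewrite in_itv/= => /andP[u0 us]; apply/dgP/hs; rewrite !ltW.
have [t + e] := MVT_segment (ltW s0) dg0 (cg s 0 hs).
rewrite in_itv/= => st; exists t; first exact: hs.
by rewrite -g0 -/(g s) -/(dg t); move: e; rewrite sub0r; lra.
Qed.

Definition norm1 (v : H) : R := `|v 0 0| + `|v 0 1| + `|v 0 2|.

Lemma norm1_ge0 (v : H) : 0 <= norm1 v.
Proof. by rewrite !addr_ge0. Qed.

Lemma norm1E (v : H) : norm1 v = \sum_l `|v 0 l|.
Proof.
rewrite !big_ord_recl big_ord0 addr0 addrA /norm1.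
by congr (_ + `|v 0 _| + `|v 0 _|); exact/val_inj.
Qed.

Lemma norm1_coord (v : H) i : `|v 0 i| <= norm1 v.
Proof.
rewrite /norm1; move: i; apply: rV3_forall.
- by rewrite -addrA lerDl addr_ge0.
- by rewrite addrAC lerDr addr_ge0.
- by rewrite lerDr addr_ge0.
Qed.

(** The two points are joined by three segments parallel to the axes, with the mean value theorem on
    each. Only partial derivatives near [p], continuous at [p], enter, so the lemma serves analytic
    and C^1 functions alike. *)
Lemma strictly_differentiable f (p : H) (e : R) :
  (forall i, \forall x \near p, derivable f x (delta_mx 0 i)) ->
  (forall i, {for p, continuous (partial f i)}) -> 0 < e -> exists2 eta : R, 0 < eta &
  forall z z' : H, (forall l, `|z 0 l - p 0 l| <= eta) -> (forall l, `|z' 0 l - p 0 l| <= eta) ->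
  `|f z - f z' - \sum_l partial f l p * (z - z') 0 l| <= e * norm1 (z - z').
Proof.
move=> df cf e0; pose Q x i := derivable f x (delta_mx 0 i) /\ `|partial f i p - partial f i x| <= e.
have ci (i : 'I_3) : \forall x \near p, Q x i.
  apply: filterI (df i) _; have c := cf i.
  by move/(@cvgrPdist_le _ _ _ (nbhs p) (nbhs_filter p)) : c; apply.
have /near_boxP[d d0 dP'] : \forall x \near p, forall i, Q x i.
  apply: filterS (filterI (ci 0) (filterI (ci 1) (ci 2))) => x [h0 [h1 h2]].
  exact: (rV3_forall (P := Q x)).
have dP (y : H) i : (forall l, `|y 0 l - p 0 l| <= d) -> Q y i.
  move=> yd; have -> : y = p + (y - p) by rewrite addrC subrK.
  by apply: dP' => l; rewrite !mxE; exact: yd.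
(* Along the path a coordinate differs from that of [z'] by at most [2 * d / 3], which together with
   [d / 3] stays within [d]. *)
exists (d / 3); first by rewrite divr_gt0.
move=> z z' zp z'p; pose v i := (z - z') 0 i.
pose z1 := z' + v 0 *: delta_mx 0 0; pose z2 := z1 + v 1 *: delta_mx 0 1.
have vE i : v i = z 0 i - z' 0 i by rewrite /v !mxE.
have zE : z = z2 + v 2 *: delta_mx 0 2.
  apply/rowP; apply: rV3_forall; rewrite /z2 /z1 !mxE /= !vE; ring.
have vb i : `|v i| <= d / 3 + d / 3.
  rewrite vE (_ : _ - _ = (z 0 i - p 0 i) - (z' 0 i - p 0 i)); last by ring.
  by rewrite (le_trans (ler_normB _ _))// lerD.
have key i (y : H) : (forall l, `|y 0 l - p 0 l| <= d) ->
    `|partial f i y * v i - partial f i p * v i| <= e * `|v i|.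
  by move=> yd; rewrite -mulrBl normrM ler_wpM2r// distrC; have [_] := dP y i yd.
have bnd (a b w : R) : `|a| <= d / 3 -> `|b| <= `|w| -> `|w| <= d / 3 + d / 3 -> `|a + b| <= d.
  move=> h1 h2 h3; apply: (le_trans (ler_normD _ _)); apply: (le_trans (lerD h1 (le_trans h2 h3))).
  by rewrite le_eqVlt; apply/orP; left; apply/eqP; field.
have d3 : d / 3 <= d by rewrite ler_pdivrMr// ler_peMr ?(ltW d0)// ler1n.
have k0 t : `|t| <= `|v 0| -> forall l, `|(z' + t *: delta_mx 0 0) 0 l - p 0 l| <= d.
  move=> ht; apply: rV3_forall; rewrite !mxE /= ?mulr0 ?mulr1 ?addr0 ?(le_trans (z'p _))//.
  by rewrite addrAC (bnd _ _ (v 0)).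
have k1 t : `|t| <= `|v 1| -> forall l, `|(z1 + t *: delta_mx 0 1) 0 l - p 0 l| <= d.
  move=> ht; apply: rV3_forall; rewrite !mxE /= ?mulr0 ?mulr1 ?addr0.
  - by rewrite vE (_ : _ - _ = z 0 0 - p 0 0) ?(le_trans (zp _))//; ring.
  - by rewrite addrAC (bnd _ _ (v 1)).
  - exact: (le_trans (z'p _)).
have k2 t : `|t| <= `|v 2| -> forall l, `|(z2 + t *: delta_mx 0 2) 0 l - p 0 l| <= d.
  move=> ht; apply: rV3_forall; rewrite !mxE /= ?mulr0 ?mulr1 ?addr0.
  - by rewrite vE (_ : _ - _ = z 0 0 - p 0 0) ?(le_trans (zp _))//; ring.
  - by rewrite vE (_ : _ - _ = z 0 1 - p 0 1) ?(le_trans (zp _))//; ring.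
  - by rewrite addrAC (bnd _ _ (v 2)).
have [t0 /k0/key{}k0 e1] := mvt_line (fun t ht => proj1 (dP _ 0 (k0 t ht))).
have [t1 /k1/key{}k1 e2] := mvt_line (fun t ht => proj1 (dP _ 1 (k1 t ht))).
have [t2 /k2/key{}k2 e3] := mvt_line (fun t ht => proj1 (dP _ 2 (k2 t ht))).
have -> : f z - f z' = (f (z2 + v 2 *: delta_mx 0 2) - f z2) + (f z2 - f z1) + (f z1 - f z').
  by rewrite {1}zE; ring.
rewrite e3 [f z2 - f z1]e2 [f z1 - f z']e1 !big_ord_recl big_ord0 addr0.
rewrite (_ : lift ord0 ord0 = 1)//; last exact/val_inj.
rewrite (_ : lift ord0 (lift ord0 ord0) = 2)//; last exact/val_inj.
rewrite -/(v _) -/(v _) -/(v _) /norm1 -/(v 0) -/(v 1) -/(v 2) !mulrDr.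
have split3 (A B C A' B' C' : R) :
  A + B + C - (C' + (B' + A')) = (C - C') + (B - B') + (A - A') by ring.
rewrite split3.
by rewrite (le_trans (ler_normD _ _))// lerD// (le_trans (ler_normD _ _))// lerD.
Qed.

Lemma analytic_strictly_differentiable f (p : H) (e : R) :
  (forall x, psat finset.set0 x f) -> 0 < e -> exists2 eta : R, 0 < eta &
  forall z z' : H, (forall l, `|z 0 l - p 0 l| <= eta) -> (forall l, `|z' 0 l - p 0 l| <= eta) ->
  `|f z - f z' - \sum_l partial f l p * (z - z') 0 l| <= e * norm1 (z - z').
Proof.
move=> f_an; apply: strictly_differentiable => i; first exact: psat_derivable (f_an p).
exact: psat_continuous (psat_partial i (f_an p)).
Qed.

End StrictDifferentiability.

Section Cone.
Context {R : realType}.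

(** Two linear equations that hold up to the error [e * N] determine [v i] and [v j] from [v k] by
    Cramer's rule, and the bound on [e] lets the left side absorb the error. Applied to differences
    of common zeros of two functions, it exhibits them locally as a Lipschitz graph over the [k]-th
    coordinate. *)
Lemma cone_bound (al be v : 'I_3 -> R) (i j k : 'I_3) (M e N : R) :
  (forall F : 'I_3 -> R, \sum_l F l = F i + F j + F k) ->
  let D := be i * al j - al i * be j in
  (forall l, `|al l| <= M) -> (forall l, `|be l| <= M) ->
  N = `|v i| + `|v j| + `|v k| ->
  4 * M * e <= `|D| / 2 ->
  `|\sum_l al l * v l| <= e * N -> `|\sum_l be l * v l| <= e * N ->
  `|D| * N <= 2 * (4 * M ^+ 2 + `|D|) * `|v k|.
Proof.
move=> sE D aM bM NE eD; rewrite !sE; set a := (_ + _ + _); set b := (_ + _ + _) => ha hb.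
have M0 : 0 <= M by rewrite (le_trans _ (aM i)).
have N0 : 0 <= N by rewrite NE !addr_ge0.
have mn (x y X Y : R) : `|x| <= X -> `|y| <= Y -> `|x * y| <= X * Y.
  by move=> hx hy; rewrite normrM ler_pM.
have tri (l : 'I_3) (w : R) : `|be l * a - al l * b - w| <= 2 * M * (e * N) + `|w|.
  rewrite (le_trans (ler_normB _ _))// lerD2r (le_trans (ler_normB _ _))//.
  have := mn _ _ _ _ (bM l) ha; have := mn _ _ _ _ (aM l) hb; lra.
have cr (l : 'I_3) : `|(be l * al k - al l * be k) * v k| <= 2 * M ^+ 2 * `|v k|.
  rewrite normrM ler_wpM2r// (le_trans (ler_normB _ _))//.
  have := mn _ _ _ _ (bM l) (aM k); have := mn _ _ _ _ (aM l) (bM k); rewrite expr2; lra.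
have hj : `|D| * `|v j| <= 2 * M * (e * N) + 2 * M ^+ 2 * `|v k|.
  rewrite -normrM (_ : D * v j = be i * a - al i * b - (be i * al k - al i * be k) * v k).
    by rewrite (le_trans (tri _ _))// lerD2l cr.
  by rewrite /D /a /b; ring.
have hi : `|D| * `|v i| <= 2 * M * (e * N) + 2 * M ^+ 2 * `|v k|.
  rewrite -normrM -[leLHS]normrN.
  rewrite (_ : - (D * v i) = be j * a - al j * b - (be j * al k - al j * be k) * v k).
    by rewrite (le_trans (tri _ _))// lerD2l cr.
  by rewrite /D /a /b; ring.
have := ler_wpM2r N0 eD; rewrite {2 3}NE !mulrDr.
by move: hi hj; lra.
Qed.

Lemma third_index (i j : 'I_3) : i != j ->
  exists k, forall F : 'I_3 -> R, \sum_l F l = F i + F j + F k.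
Proof.
have E (F : 'I_3 -> R) : \sum_l F l = F 0 + F 1 + F 2.
  rewrite !big_ord_recl big_ord0 addr0 addrA.
  by congr (_ + F _ + F _); exact/val_inj.
move: i; apply: rV3_forall; move: j; apply: rV3_forall => // _.
- by exists 2 => F; rewrite E; ring.
- by exists 1 => F; rewrite E; ring.
- by exists 2 => F; rewrite E; ring.
- by exists 0 => F; rewrite E; ring.
- by exists 1 => F; rewrite E; ring.
- by exists 0 => F; rewrite E; ring.
Qed.

Lemma independent_minor (al be : 'I_3 -> R) :
  (forall a b, (forall l, a * al l + b * be l = 0) -> a = 0 /\ b = 0) ->
  exists i j, be i * al j - al i * be j != 0.
Proof.
move=> ind; apply: contrapT => no.
have no' i j : be i * al j - al i * be j = 0.
  by apply/eqP/negPn/negP => h; apply: no; exists i, j.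
have a0 i : al i = 0.
  have [l|_ /eqP] := ind (be i) (- al i); last by rewrite oppr_eq0 => /eqP.
  by rewrite mulNr no'.
have [l|/eqP] := ind 1 0; first by rewrite a0 mulr0 mul0r addr0.
by rewrite oner_eq0.
Qed.

End Cone.

Section CurvesNegligible.
Context {R : realType}.
Local Notation H := (heis R).
Local Notation HB := (heisBorel R).
Variables (mu : {measure set HB -> \bar R}) (c : R).
Hypotheses (c_gt0 : 0 < c) (mu_neq0 : mu setT <> 0%E).
Hypothesis mu_ball : forall x r, msupport mu x -> 0 < r -> mu (hball x r) = (c * r ^+ 3)%:E.

(* A Lipschitz curve is covered by about n^2 Korányi balls of radius about 1/n,
   the Korányi distance being at worst the square root of the Euclidean one. *)
Lemma lipschitz_curve_negligible (A : set H) (p : H) (k : 'I_3) (L B eta : R) :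
  0 <= L -> 0 <= B -> 0 < eta ->
  (forall z, A z -> [/\ `|hx1 z| <= B, `|hx2 z| <= B & `|z 0 k - p 0 k| <= eta]) ->
  (forall z z', A z -> A z' -> norm1 (z - z') <= L * `|z 0 k - z' 0 k|) ->
  mu.-negligible (A : set HB).
Proof.
move=> L0 B0 eta0 Ab AL.
pose W := 2 * eta * L; have W0 : 0 <= W by rewrite !mulr_ge0// ltW.
pose Q := (W + (1 + 4 * B)) * L.
have B4 : 0 <= 1 + 4 * B by rewrite addr_ge0// mulr_ge0.
have Q0 : 0 <= Q by rewrite mulr_ge0// addr_ge0.
pose K := 2 * eta * Q + 1.
have K1 : 1 <= K by rewrite /K lerDr mulr_ge0// mulr_ge0// ltW.
have K0 : 0 < K by apply: lt_le_trans K1.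
have dist z z' s : A z -> A z' -> `|z' 0 k - z 0 k| <= s -> s <= 2 * eta ->
    hdist z z' ^+ 4 <= (Q * s) ^+ 2.
  move=> Az Az' zs s2; have := AL _ _ Az' Az; set w := norm1 _ => wL.
  have w0 : 0 <= w by exact: norm1_ge0.
  have {wL} wL : w <= L * s by apply: (le_trans wL); rewrite ler_wpM2l.
  have [b1 b2 _] := Ab _ Az.
  have h1 : `|hx1 z' - hx1 z| <= w by have := norm1_coord (z' - z) 0; rewrite !mxE.
  have h2 : `|hx2 z' - hx2 z| <= w by have := norm1_coord (z' - z) 1; rewrite !mxE.
  have h3 : `|hx3 z' - hx3 z| <= w by have := norm1_coord (z' - z) 2; rewrite !mxE.
  have wW : w <= W by apply: (le_trans wL); rewrite /W mulrC ler_wpM2r.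
  rewrite hdistX4.
  have i1 : (hx1 z' - hx1 z) ^+ 2 + (hx2 z' - hx2 z) ^+ 2 <= w ^+ 2.
    have ab : `|hx1 z' - hx1 z| + `|hx2 z' - hx2 z| <= w.
      by rewrite /w /norm1 !mxE lerDl.
    apply: (@le_trans _ _ ((`|hx1 z' - hx1 z| + `|hx2 z' - hx2 z|) ^+ 2)); last first.
      by rewrite lerXn2r ?nnegrE ?addr_ge0.
    have sqn (a : R) : a ^+ 2 = `|a| ^+ 2 by rewrite -normrX ger0_norm ?sqr_ge0.
    by rewrite !(sqn (_ - _)) sqrrD addrAC lerDl mulrn_wge0// mulr_ge0.
  set t := (_ + _ - _).
  have i2 : `|t| <= (1 + 4 * B) * w.
    rewrite (_ : t = (hx3 z' - hx3 z) + 2 * (hx1 z * (hx2 z' - hx2 z)) -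
      2 * (hx2 z * (hx1 z' - hx1 z))); last by rewrite /t; ring.
    have n2 (a b : R) : `|a| <= B -> `|b| <= w -> `|2 * (a * b)| <= 2 * (B * w).
      by move=> ha hb; rewrite normrM (ger0_norm (ler0n _ 2)) ler_wpM2l// normrM ler_pM.
    rewrite (le_trans (ler_normB _ _))//.
    have := ler_normD (hx3 z' - hx3 z) (2 * (hx1 z * (hx2 z' - hx2 z))).
    have := n2 _ _ b1 h2; have := n2 _ _ b2 h1; move: h3; lra.
  have j1 : ((hx1 z' - hx1 z) ^+ 2 + (hx2 z' - hx2 z) ^+ 2) ^+ 2 <= (W * w) ^+ 2.
    have Ww : 0 <= W * w by exact: mulr_ge0.
    have sq : 0 <= (hx1 z' - hx1 z) ^+ 2 + (hx2 z' - hx2 z) ^+ 2.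
      by rewrite addr_ge0 ?sqr_ge0.
    apply: lerXn2r; rewrite ?nnegrE//; apply: (le_trans i1).
    by rewrite expr2; exact: ler_wpM2r.
  have j2 : t ^+ 2 <= ((1 + 4 * B) * w) ^+ 2.
    by rewrite -(real_normK (num_real t)) lerXn2r ?nnegrE ?mulr_ge0.
  apply: (le_trans (lerD j1 j2)).
  have j3 : (W + (1 + 4 * B)) * w <= Q * s.
    rewrite /Q -mulrA; apply: ler_wpM2l wL; exact: addr_ge0.
  apply: (@le_trans _ _ (((W + (1 + 4 * B)) * w) ^+ 2)).
    have a1 : 0 <= W * w by exact: mulr_ge0.
    have a2 : 0 <= (1 + 4 * B) * w by exact: mulr_ge0.
    by rewrite [(W + _) * w]mulrDl sqrrD [X in _ <= X]addrAC lerDl mulrn_wge0// mulr_ge0.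
  have w4 : 0 <= (W + (1 + 4 * B)) * w by rewrite mulr_ge0// addr_ge0.
  by rewrite lerXn2r ?nnegrE// (le_trans w4).
pose s m : R := 2 * eta / m.+1%:R ^+ 2.
have m0 m : 0 < (m.+1%:R ^+ 2 : R) by rewrite exprn_gt0// ltr0n.
have s0 m : 0 < s m by rewrite divr_gt0// mulr_gt0.
have s2 m : s m <= 2 * eta.
  by rewrite ler_pdivrMr// ler_peMr ?mulr_ge0 ?(ltW eta0)// -natrX ler1n expn_gt0.
pose lab m (z : H) := Num.truncn ((z 0 k - p 0 k + eta) / s m).
pose ctr m q : H := xget p [set z | A z /\ lab m z = q].
(* Labels run up to [m.+1 ^ 2] inclusive, because the right endpoint of the parameter interval has a
   label of its own. The total mass is at most [2 (m + 1)^2] times [8 c K^3 / (m + 1)^3]. *)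
pose E m := \big[setU/set0]_(q < (m.+1 ^ 2).+1) (hball (ctr m q) (K / m.+1%:R) : set HB).
have Em m : measurable (E m) by apply: bigsetU_measurable => q _; exact: measurable_hball.
have rK m : 0 < K / m.+1%:R by rewrite divr_gt0// ltr0n.
have AE m : A `<=` E m.
  move=> z Az; have [_ _ zk] := Ab _ Az.
  have z0 : 0 <= z 0 k - p 0 k + eta by move: zk; rewrite ler_norml => /andP[]; lra.
  have z1 : z 0 k - p 0 k + eta <= 2 * eta by move: zk; rewrite ler_norml => /andP[]; lra.
  have labE y : A y -> (lab m y)%:R * s m <= y 0 k - p 0 k + eta < (lab m y).+1%:R * s m.
    move=> Ay; have [_ _] := Ab _ Ay; rewrite ler_norml => /andP[y0 _].
    rewrite -ler_pdivlMr// -ltr_pdivrMr//; apply: truncn_itv.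
    by rewrite divr_ge0 ?(ltW (s0 m))//; lra.
  have lz : (lab m z < (m.+1 ^ 2).+1)%N.
    rewrite ltnS -(ler_nat R) natrX.
    have /andP[h _] := labE _ Az; have := le_trans h z1.
    by rewrite /s mulrA ler_pdivrMr// [_ * (2 * eta)]mulrC ler_pM2l ?mulr_gt0.
  rewrite /E -(bigcup_mkord _ (fun q => hball (ctr m q) (K / m.+1%:R) : set HB)).
  exists (lab m z) => //.
  have [Ac lc] : [set y | A y /\ lab m y = lab m z] (ctr m (lab m z)).
    by apply: xgetPex; exists z.
  apply/hballP; first exact: ltW.
  have /andP[u1 u2] := labE _ Az; have /andP[v1 v2] := labE _ Ac; rewrite lc in v1 v2.
  have zs : `|z 0 k - (ctr m (lab m z)) 0 k| <= s m.
    move: u1 u2 v1 v2; rewrite -natr1 mulrDl mul1r ler_norml => *; apply/andP; split; lra.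
  apply: (le_trans (dist _ _ _ Ac Az zs (s2 m))).
  have qs : Q * s m <= (K / m.+1%:R) ^+ 2.
    rewrite /s exprMn exprVn mulrA ler_pM2r ?invr_gt0//.
    have KK : K <= K ^+ 2 by rewrite expr2 ler_peMr// ltW.
    by move: KK; rewrite {1}/K; lra.
  rewrite (_ : 4 = 2 * 2)%N// exprM lerXn2r ?nnegrE ?exprn_ge0 ?(ltW (rK m))//.
  by rewrite mulr_ge0// ltW.
pose C := 16 * c * K ^+ 3.
have muE m : (mu (E m) <= (C / m.+1%:R)%:E)%E.
  have mB q : (q < (m.+1 ^ 2).+1)%N -> measurable (hball (ctr m q) (K / m.+1%:R) : set HB).
    by move=> _; exact: measurable_hball.
  apply: (le_trans (Boole_inequality mu mB)).
  apply: (@le_trans _ _ (\sum_(q < (m.+1 ^ 2).+1) (c * (2 * (K / m.+1%:R)) ^+ 3)%:E)%E).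
    by apply: lee_sum => q _; exact: (mu_hball_le c_gt0 mu_ball).
  rewrite sumEFin lee_fin sumr_const card_ord -[leLHS]mulr_natl.
  have h : ((m.+1 ^ 2).+1%:R : R) <= 2 * m.+1%:R ^+ 2.
    by rewrite -natrX -natrM ler_nat mul2n -addnn -addn1 leq_add2l expn_gt0.
  have h0 : 0 <= c * (2 * (K / m.+1%:R)) ^+ 3.
    by rewrite mulr_ge0 ?(ltW c_gt0)// exprn_ge0// mulr_ge0// ltW.
  apply: (le_trans (ler_wpM2r h0 h)); rewrite le_eqVlt; apply/orP; left; apply/eqP.
  have M0 : (m.+1%:R : R) != 0 by rewrite pnatr_eq0.
  by rewrite /C; move: M0; generalize (m.+1%:R : R) => M M0; field.
exists (\bigcap_m E m); split; first exact: bigcapT_measurable.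
- apply/eqP; rewrite eq_le measure_ge0 andbT; apply/lee_addgt0Pr => e e0; rewrite add0e.
  pose m := Num.bound (C / e).
  have C0 : 0 <= C by rewrite !mulr_ge0 ?exprn_ge0 ?(ltW c_gt0) ?(ltW K0).
  apply: (@le_trans _ _ (mu (E m))).
    apply: le_measure; rewrite ?inE//; first exact: bigcapT_measurable.
    by move=> y; apply.
  apply: (le_trans (muE m)); rewrite lee_fin ler_pdivrMr ?ltr0n// mulrC -ler_pdivrMr//.
  have := archi_boundP (divr_ge0 C0 (ltW e0)); rewrite -/m => /ltW/le_trans; apply.
  by rewrite ler_nat.
- by move=> z Az m _; exact: AE.
Qed.

End CurvesNegligible.

Section SupportDimension.
Context {R : realType}.
Local Notation H := (heis R).
Local Notation HB := (heisBorel R).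
Variables (mu : {measure set HB -> \bar R}) (c : R).
Hypotheses (c_gt0 : 0 < c) (mu_neq0 : mu setT <> 0%E).
Hypothesis mu_ball : forall x r, msupport mu x -> 0 < r -> mu (hball x r) = (c * r ^+ 3)%:E.

Lemma independent_zeros_negligible (g h : H -> R) (p : H) :
  (forall x, psat finset.set0 x g) -> (forall x, psat finset.set0 x h) ->
  (forall a b, (forall l, a * partial g l p + b * partial h l p = 0) -> a = 0 /\ b = 0) ->
  exists2 U, nbhs p U & mu.-negligible ([set z | g z = 0 /\ h z = 0] `&` U : set HB).
Proof.
move=> g_an h_an ind; pose al l := partial g l p; pose be l := partial h l p.
have [i [j D0]] := independent_minor ind.
have ij : i != j by apply: contra_neq D0 => ->; rewrite mulrC subrr.
have [k sE] := @third_index R i j ij.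
set D := (_ - _) in D0; have D1 : 0 < `|D| by rewrite normr_gt0.
pose M := \sum_l `|al l| + \sum_l `|be l|.
have M0 : 0 <= M by rewrite addr_ge0// sumr_ge0.
have single (F : 'I_3 -> R) l : `|F l| <= \sum_l `|F l|.
  by rewrite (bigD1 l)//= lerDl sumr_ge0.
have aM l : `|al l| <= M by rewrite (le_trans (single al l))// lerDl sumr_ge0.
have bM l : `|be l| <= M by rewrite (le_trans (single be l))// lerDr sumr_ge0.
pose e := `|D| / (8 * (M + 1)).
have M1 : 0 < 8 * (M + 1) by rewrite mulr_gt0// ltr_wpDl.
have e0 : 0 < e by rewrite divr_gt0.
have eD : 4 * M * e <= `|D| / 2.
  rewrite /e mulrA ler_pdivrMr// (_ : `|D| / 2 * (8 * (M + 1)) = `|D| * (4 * M + 4)); last by field.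
  by rewrite mulrC ler_wpM2l// lerDl.
have [e1 e10 H1] := analytic_strictly_differentiable p g_an e0.
have [e2 e20 H2] := analytic_strictly_differentiable p h_an e0.
pose eta := Num.min e1 e2; have eta0 : 0 < eta by rewrite lt_min e10.
have et1 : eta <= e1 by rewrite ge_min lexx.
have et2 : eta <= e2 by rewrite ge_min lexx orbT.
exists [set z : H | forall l, `|z 0 l - p 0 l| <= eta].
  have w0 : posw (const_mx eta : H) by move=> l; rewrite mxE.
  by apply: filterS (nbhs_box p w0) => z zp l; have := zp l; rewrite !mxE.
pose L := 2 * (4 * M ^+ 2 + `|D|) / `|D|; pose B := `|hx1 p| + `|hx2 p| + eta.
apply: (lipschitz_curve_negligible c_gt0 mu_ball (p := p) (k := k) (L := L) (B := B) (eta := eta)) => //.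
- by rewrite /L divr_ge0// mulr_ge0// addr_ge0// mulr_ge0// sqr_ge0.
- by rewrite /B !addr_ge0// ltW.
- move=> z [_ zp]; have coord (l : 'I_3) : `|z 0 l| <= `|p 0 l| + eta.
    rewrite -[z 0 l](subrK (p 0 l)) addrC (le_trans (ler_normD _ _))// lerD2l.
    exact: zp.
  split; last exact: zp.
    by rewrite (le_trans (coord 0))// /B addrAC lerDl.
  by rewrite (le_trans (coord 1))// /B -addrA lerDr.
move=> z z' [[gz hz] zp] [[gz' hz'] zp'].
pose v (l : 'I_3) := (z - z') 0 l.
have NE : norm1 (z - z') = `|v i| + `|v j| + `|v k| by rewrite norm1E (sE (fun l => `|v l|)).
have ha : `|\sum_l al l * v l| <= e * norm1 (z - z').
  have := H1 z z' (fun l => le_trans (zp l) et1) (fun l => le_trans (zp' l) et1).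
  by rewrite gz gz' subrr sub0r normrN.
have hb : `|\sum_l be l * v l| <= e * norm1 (z - z').
  have := H2 z z' (fun l => le_trans (zp l) et2) (fun l => le_trans (zp' l) et2).
  by rewrite hz hz' subrr sub0r normrN.
have := cone_bound sE aM bM NE eD ha hb; rewrite -/D => hc.
rewrite /L mulrAC ler_pdivlMr// [leLHS]mulrC; apply: (le_trans hc).
by rewrite /v !mxE.
Qed.

Lemma msupport_fat (G : nat -> (H -> R) * (H -> R)) :
  (forall i x, psat finset.set0 x (G i).1 /\ psat finset.set0 x (G i).2) ->
  ~ (forall x, msupport mu x -> exists i, [/\ (G i).1 x = 0, (G i).2 x = 0 &
     forall a b : R, (forall j, a * partial (G i).1 j x + b * partial (G i).2 j x = 0) ->
       a = 0 /\ b = 0]).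
Proof.
move=> G_an cov; apply: mu_neq0.
have ns : mu.-negligible (msupport mu : set HB).
  pose S i : set HB := [set x | [/\ (G i).1 x = 0, (G i).2 x = 0 &
    forall a b : R, (forall j, a * partial (G i).1 j x + b * partial (G i).2 j x = 0) ->
       a = 0 /\ b = 0]].
  apply: (@negligibleS _ _ _ mu (\bigcup_i S i)).
    by move=> x /cov[i Si]; exists i.
  apply: negligible_bigcup => i; apply: negligible_local => x [_ _ ind].
  have [U xU nU] := independent_zeros_negligible (fun x => (G_an i x).1) (fun x => (G_an i x).2) ind.
  by exists U => //; apply: negligibleS nU => y [[gy hy _] Uy].
rewrite (measure_msupportI mu measurableT) setTI.
by apply/negligibleP => //; exact: measurable_msupport.
Qed.

Lemma support_variety_dim : variety_dim (msupport mu) 2.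
Proof.
have [x0 sx0] := msupport_neq0 mu_neq0.
have fP := support_funP c_gt0 mu_ball sx0.
have -> : msupport mu = [set x | support_fun mu x0 x = 0].
  by apply/seteqP; split=> x /= /fP.
apply: (@stratification R 2) => //.
- by move=> x; exact: (psat_support_fun c_gt0 mu_ball).
- move=> x /fP sx h; apply: (msupport_thin c_gt0 mu_ball sx).
  by apply: filterS h => y /fP.
- move=> G G_an cov; apply: (msupport_fat G_an) => x /fP sx; exact: cov.
Qed.

End SupportDimension.

(** * Uniqueness of uniform measures and the spherical measure *)

Section Christensen.
Context {R : realType}.
Local Notation H := (heis R).
Local Notation HB := (heisBorel R).

Lemma measurable_hdistX4_pair :
  measurable_fun setT (fun z : HB * HB => hdist z.1 z.2 ^+ 4).
Proof.
have m1 (f : HB -> R) : measurable_fun setT f -> measurable_fun setT (fun z : HB * HB => f z.1).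
  by move=> mf; exact: (measurableT_comp mf measurable_fst).
have m2 (f : HB -> R) : measurable_fun setT f -> measurable_fun setT (fun z : HB * HB => f z.2).
  by move=> mf; exact: (measurableT_comp mf measurable_snd).
rewrite (_ : (fun z => _) = fun z : HB * HB =>
  ((hx1 z.2 - hx1 z.1) ^+ 2 + (hx2 z.2 - hx2 z.1) ^+ 2) ^+ 2 +
  (hx3 z.2 - hx3 z.1 + 2 * hx1 z.1 * hx2 z.2 - 2 * hx2 z.1 * hx1 z.2) ^+ 2); last first.
  by apply/funext => z; rewrite hdistX4.
have a1 := m1 _ measurable_hx1; have a2 := m1 _ measurable_hx2; have a3 := m1 _ measurable_hx3.
have b1 := m2 _ measurable_hx1; have b2 := m2 _ measurable_hx2; have b3 := m2 _ measurable_hx3.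
apply: measurable_funD; apply: measurable_funX.
  by apply: measurable_funD; apply: measurable_funX; exact: measurable_funB.
apply: measurable_funB.
  apply: measurable_funD; first exact: measurable_funB.
  by apply: measurable_funM => //; apply: measurable_funM => //; exact: measurable_cst.
by apply: measurable_funM => //; apply: measurable_funM => //; exact: measurable_cst.
Qed.

Lemma measurable_near_diagonal (r : R) : 0 <= r ->
  measurable [set z : HB * HB | hdist z.1 z.2 <= r].
Proof.
move=> r0; have := measurable_hdistX4_pair measurableT (measurable_itv `]-oo, r ^+ 4]).
rewrite setTI; congr (measurable _); apply/seteqP; split=> z /=; rewrite in_itv/=.
  by move=> h; apply: ler_X4 => //; exact: hdist_ge0.
by move=> h; rewrite lerXn2r ?nnegrE ?hdist_ge0.
Qed.

(** The strict inequality makes this set open, while every point within [r] of it still lies in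
    [U]. *)
Definition inner_part (U : set H) (r : R) : set H :=
  [set x | exists2 s, r < s & hball x s `<=` U].

Lemma open_inner_part U r : 0 <= r -> open (inner_part U r).
Proof.
move=> r0; apply: nbhs_open => x [s rs sU]; pose e := (s - r) / 2.
have e0 : 0 < e by rewrite divr_gt0// subr_gt0.
have se : s = r + e + e by rewrite /e; field.
apply: filterS (nbhs_hball x e0) => y xy; exists (r + e); first by rewrite ltrDl.
move=> z yz; apply: sU; rewrite /hball/= se (le_trans (hdist_triangle y _ _))// addrC.
by apply: lerD.
Qed.

Lemma inner_part_sub U r : 0 < r -> inner_part U r `<=` U.
Proof. by move=> r0 x [s rs]; apply; apply: hballxx; rewrite ltW// (lt_trans r0). Qed.

Section Compare.
Variables (mu nu : {measure set HB -> \bar R}) (E : set HB) (h : R -> R).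
Hypotheses (mE : measurable E)
  (muE : forall A, measurable A -> mu A = mu (A `&` E))
  (nuE : forall A, measurable A -> nu A = nu (A `&` E))
  (mu_sf : sigma_finite setT mu) (nu_sf : sigma_finite setT nu)
  (h_gt0 : forall r, 0 < r -> 0 < h r)
  (mu_h : forall x r, E x -> 0 < r -> mu (hball x r) = (h r)%:E)
  (nu_h : forall x r, E x -> 0 < r -> nu (hball x r) = (h r)%:E).

(** Christensen's argument: the indicator of the pairs at distance at most [r] is integrated in both
    orders. For fixed [x] in the inner part the slice has [nu]-mass [h r]; for fixed [y] it has
    [mu]-mass at most [h r] and is empty unless [y] lies in [U]. *)
Let inner_le U r : open U -> 0 < r -> (mu (inner_part U r) <= nu U)%E.
Proof.
move=> oU r0; have r0' := ltW r0.
have mV : measurable (inner_part U r : set HB).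
  by apply: open_measurable_heis; exact: open_inner_part.
have mU : measurable (U : set HB) by exact: open_measurable_heis.
set V : set HB := inner_part U r.
pose A : set (HB * HB) := ((V `&` E) `*` E) `&` [set z : HB * HB | hdist z.1 z.2 <= r].
have mA : measurable A.
  apply: measurableI; last exact: measurable_near_diagonal.
  by apply: measurableX => //; exact: measurableI.
have mf : measurable_fun setT (fun z : HB * HB => (\1_A z)%:E : \bar R).
  by apply/measurable_EFinP; exact: measurable_indic.
have f0 (z : HB * HB) : (0 <= (\1_A z)%:E :> \bar R)%E by rewrite lee_fin.
have := @sfinite_Fubini _ _ _ _ _ (sfinite_of mu_sf) (sfinite_of nu_sf) _ f0 mf.
rewrite /= => fub.
have hr := h_gt0 r0.
have low : ((h r)%:E * mu V <= \int[mu]_x \int[nu]_y (\1_A (x, y))%:E)%E.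
  rewrite (muE mV) -(setIT (V `&` E)) -integral_indic//; last exact: measurableI.
  rewrite -ge0_integralZl_EFin//; last 2 first.
  - by apply/measurable_EFinP; apply: measurable_indic; exact: measurableI.
  - exact: ltW.
  apply: ge0_le_integral => //.
  - by move=> x _; rewrite mule_ge0// lee_fin ltW.
  - apply: emeasurable_funM; first exact: measurable_cst.
    by apply/measurable_EFinP; apply: measurable_indic; exact: measurableI.
  - have mFF := measurable_fun_fubini_tonelli_F (m2 := sfinite_of nu_sf) _ mf f0.
    exact mFF.
  move=> x _; rewrite indicE; have [|_] := boolP (x \in V `&` E); last first.
    by rewrite mule0; apply: integral_ge0 => y _; rewrite lee_fin.
  rewrite inE => -[Vx Ex]; rewrite mule1.
  have mB : measurable (hball x r : set HB) by exact: measurable_hball.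
  rewrite -(nu_h Ex r0) (nuE mB) -(setIT (_ `&` E)) -integral_indic//; last exact: measurableI.
  apply: ge0_le_integral => //.
  - by apply/measurable_EFinP; apply: measurable_indic; exact: measurableI.
  - exact: (measurable_fun_pair2 x mf).
  move=> y _; rewrite lee_fin !indicE; have [|//] := boolP (y \in _ `&` E).
  by rewrite inE => -[xy Ey]; rewrite mem_set.
have up : (\int[nu]_y \int[mu]_x (\1_A (x, y))%:E <= (h r)%:E * nu U)%E.
  rewrite -(setIT U) -integral_indic// -ge0_integralZl_EFin//; last 2 first.
  - by apply/measurable_EFinP; exact: measurable_indic.
  - exact: ltW.
  apply: ge0_le_integral => //.
  - by move=> y _; apply: integral_ge0 => x _; rewrite lee_fin.
  - have mGG := measurable_fun_fubini_tonelli_G (m1 := sfinite_of mu_sf) _ mf f0.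
    exact mGG.
  - apply: emeasurable_funM; first exact: measurable_cst.
    by apply/measurable_EFinP; exact: measurable_indic.
  move=> y _; have [[Uy Ey]|no] := pselect (U y /\ E y); last first.
    rewrite integral0_eq; first by rewrite mule_ge0// lee_fin ?ltW.
    move=> x _; rewrite indicE memNset// => -[[[Vx Ex] /= Ey] xy]; apply: no; split=> //.
    by case: Vx => s rs; apply; rewrite /hball/= (le_trans xy)// ltW.
  rewrite indicE mem_set// mule1 -(mu_h Ey r0).
  have mB : measurable (hball y r : set HB) by exact: measurable_hball.
  rewrite -(setIT (hball y r)) -integral_indic//.
  apply: ge0_le_integral => //.
  - exact: (measurable_fun_pair1 y mf).
  - by apply/measurable_EFinP; exact: measurable_indic.
  move=> x _; rewrite lee_fin !indicE; have [|//] := boolP ((x, y) \in A).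
  by rewrite inE => -[_ /= xy]; rewrite mem_set// /hball/= hdistC.
rewrite fub in low; have := le_trans low up.
by rewrite lee_pmul2l// lte_fin.
Qed.

Lemma open_measure_le U : open U -> (mu U <= nu U)%E.
Proof.
move=> oU; pose F n : set HB := inner_part U n.+1%:R^-1.
have n0 n : (0 : R) < n.+1%:R^-1 by rewrite invr_gt0 ltr0n.
have UF : U = \bigcup_n F n.
  apply/seteqP; split=> [x Ux|x [n _]]; last exact: inner_part_sub.
  have [s s0 sU] := open_hball_sub oU Ux.
  exists (Num.bound s^-1) => //; exists s; last exact: sU.
  rewrite -[ltRHS]invrK ltf_pV2 ?posrE ?invr_gt0 ?ltr0n//.
  rewrite (lt_trans (archi_boundP _)) ?ltr_nat// invr_ge0 ltW//.
have mF n : measurable (F n).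
  by apply: open_measurable_heis; apply: open_inner_part; exact: ltW.
rewrite UF.
have ndF : nondecreasing_seq F.
  move=> m n mn; apply/subsetPset => x [s ms sU]; exists s => //.
  by apply: le_lt_trans ms; rewrite lef_pV2 ?posrE ?ltr0n// ler_nat.
have cv := nondecreasing_cvg_mu (mu := mu) mF (bigcupT_measurable _ mF) ndF.
rewrite -(cvg_lim _ cv)//; apply: lime_le; first by apply/cvg_ex; exists (mu (\bigcup_n F n)).
by apply: nearW => n; rewrite -UF; exact: inner_le.
Qed.

End Compare.

(** The comparison on open sets works in both directions, and these form a generating family closed
    under intersection and exhausted by balls of finite mass. *)
Theorem uniform_measure_unique (mu nu : {measure set HB -> \bar R}) (E : set HB) (h : R -> R) :
  measurable E ->
  (forall A, measurable A -> mu A = mu (A `&` E)) ->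
  (forall A, measurable A -> nu A = nu (A `&` E)) ->
  (forall x r, (mu (hball x r) < +oo)%E) -> (forall x r, (nu (hball x r) < +oo)%E) ->
  (forall r, 0 < r -> 0 < h r) ->
  (forall x r, E x -> 0 < r -> mu (hball x r) = (h r)%:E) ->
  (forall x r, E x -> 0 < r -> nu (hball x r) = (h r)%:E) ->
  forall A, measurable A -> mu A = nu A.
Proof.
move=> mE muE nuE mu_fin nu_fin h0 mu_h nu_h.
pose B n : set HB := hball (hid R) n%:R.
have mB n : measurable (B n) by exact: measurable_hball.
have cB : setT = \bigcup_n B n.
  apply/seteqP; split=> // x _; exists (Num.bound (hdist (hid R) x)) => //.
  by rewrite /B /hball/= ltW// archi_boundP// hdist_ge0.
have sf (m : {measure set HB -> \bar R}) : (forall x r, (m (hball x r) < +oo)%E) ->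
    sigma_finite setT m by move=> mf; exists B => // n; split=> //; exact: mf.
pose O n : set HB := [set y | hdist (hid R) y ^+ 4 < n%:R ^+ 4].
have oO n : open (O n : set H).
  apply: (@open_comp H R (fun y => hdist (hid R) y ^+ 4) [set t | t < n%:R ^+ 4]).
    by move=> y _; exact: continuous_hdistX4.
  exact: open_lt.
apply: (@measure_unique _ R HB (@open H) O _ _ oO _ mu nu) => //.
- exact: openI.
- apply/seteqP; split=> // x _; exists (Num.bound (hdist (hid R) x)) => //.
  have h1 := archi_boundP (hdist_ge0 (hid R) x).
  by rewrite /O/= ltrXn2r// ?nnegrE ?hdist_ge0.
- move=> U oU; apply/eqP; rewrite eq_le; apply/andP; split.
    exact: (open_measure_le mE muE nuE (sf _ mu_fin) (sf _ nu_fin) h0 mu_h nu_h oU).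
  exact: (open_measure_le mE nuE muE (sf _ nu_fin) (sf _ mu_fin) h0 nu_h mu_h oU).
- move=> n; apply: le_lt_trans (mu_fin (hid R) n%:R); apply: le_measure; rewrite ?inE//.
    by apply: open_measurable_heis; exact: oO.
    exact: measurable_hball.
  by move=> y /ltW; rewrite /hball/= => hy; apply: ler_X4 => //; exact: hdist_ge0.
Qed.

End Christensen.

(** * The spherical measure as a Borel measure *)

Section SphericalMeasure.
Context {R : realType}.
Local Notation H := (heis R).
Local Notation HB := (heisBorel R).
Variable s : R.
Implicit Types (A B : set H) (d e : R).
Local Notation P := (@spherical_premeasure R s).
Local Notation S := (@spherical_hausdorff R s).

Let ballpow (r : R) : \bar R := ((2 * r) `^ s)%:E.

Let poweR_hdiam x r : 0 < r -> poweR (hdiam (hball x r)) s = ballpow r.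
Proof. by move=> r0; rewrite hdiam_hball. Qed.

Lemma premeasure_ge0 d A : (0 <= P d A)%E.
Proof.
by apply: le_ereal_inf_tmp => _ [D [x [r [_ _ ->]]]]; apply: esum_ge0 => i _; exact: poweR_ge0.
Qed.

Lemma premeasure_le_cover d A (D : set nat) (x : nat -> H) (r : nat -> R) :
  (forall i, D i -> 0 < r i /\ 2 * r i < d) -> A `<=` \bigcup_(i in D) hball (x i) (r i) ->
  (P d A <= \esum_(i in D) ((2 * r i) `^ s)%:E)%E.
Proof.
move=> Dr cov; apply: ereal_inf_lbound; exists D, x, r; split=> //.
  by move=> i /Dr[r0 rd]; split=> //; rewrite hdiam_hball// lte_fin.
by apply: eq_esum => i /Dr[r0 _]; rewrite poweR_hdiam.
Qed.

Lemma le_premeasure d A (M : \bar R) :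
  (forall (D : set nat) (x : nat -> H) (r : nat -> R),
    (forall i, D i -> 0 < r i /\ 2 * r i < d) -> A `<=` \bigcup_(i in D) hball (x i) (r i) ->
    (M <= \esum_(i in D) ((2 * r i) `^ s)%:E)%E) ->
  (M <= P d A)%E.
Proof.
move=> h; apply: le_ereal_inf_tmp => _ [D [x [r [Dr cov ->]]]].
have Dr0 i : D i -> 0 < r i by move=> /Dr[].
rewrite (eq_esum (b := fun i => ballpow (r i))); last by move=> i /Dr0 r0; rewrite poweR_hdiam.
apply: (h D x r) => // i Di; have [r0] := Dr i Di.
by rewrite hdiam_hball// lte_fin.
Qed.

Lemma premeasure_mono d A B : A `<=` B -> (P d A <= P d B)%E.
Proof.
move=> AB; apply: le_premeasure => D x r Dr cov; apply: premeasure_le_cover => //.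
exact: subset_trans cov.
Qed.

Lemma premeasure_nincr d e A : d <= e -> (P e A <= P d A)%E.
Proof.
move=> de; apply: le_premeasure => D x r Dr cov.
apply: (premeasure_le_cover (x := x)) => // i Di; have [r0 rd] := Dr i Di.
by split=> //; apply: lt_le_trans de.
Qed.

Lemma spherical_sup A : S A = ereal_sup [set P d A | d in [set d | 0 < d]].
Proof.
have h : {in Interval (BRight (0 : R)) (BInfty R false) &, nonincreasing_fun (fun d => P d A)}.
  by move=> d e _ _ de; exact: premeasure_nincr.
have := @nonincreasing_at_right_cvge R (fun d => P d A) 0 (BInfty R false) isT h.
move=> /cvg_lim; rewrite /spherical_hausdorff => ->//.
congr ereal_sup; apply/seteqP; split=> _ [d d0 <-]; exists d => //.
  by move: d0; rewrite /= in_itv/= andbT.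
by rewrite /= in_itv/= andbT.
Qed.

Lemma spherical_ge d A : 0 < d -> (P d A <= S A)%E.
Proof. by move=> d0; rewrite spherical_sup; apply: ereal_sup_ubound; exists d. Qed.

Lemma spherical_le A M : (forall d, 0 < d -> (P d A <= M)%E) -> (S A <= M)%E.
Proof. by move=> h; rewrite spherical_sup; apply: ge_ereal_sup => _ [d d0 <-]; exact: h. Qed.

Lemma spherical_ge0 A : (0 <= S A)%E.
Proof. by apply: le_trans (spherical_ge A ltr01); exact: premeasure_ge0. Qed.

Lemma spherical_mono A B : A `<=` B -> (S A <= S B)%E.
Proof.
move=> AB; apply: spherical_le => d d0; apply: le_trans (spherical_ge B d0).
exact: premeasure_mono.
Qed.

Lemma spherical0 : S set0 = 0%E.
Proof.
apply/eqP; rewrite eq_le spherical_ge0 andbT; apply: spherical_le => d d0.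
apply: (le_trans (premeasure_le_cover (D := set0) (x := fun=> hid R) (r := fun=> 0) _ _)) => //.
by rewrite esum_set0.
Qed.

Lemma spherical_sigma_subadditive : sigma_subadditive S.
Proof.
move=> A; apply: spherical_le => d d0.
have [fin|] := pselect (forall n, (S (A n) < +oo)%E); last first.
  move=> /existsNP[n /negP]; rewrite -leNgt leye_eq => /eqP An.
  rewrite nneseries_esumT; last by move=> k; exact: spherical_ge0.
  apply: (@le_trans _ _ (S (A n))); first by rewrite An leey.
  by apply: (esum_le1 (a := fun k => S (A k))) => // k; exact: spherical_ge0.
apply/lee_addgt0Pr => e e0.
have ex n : exists c : set nat * (nat -> H) * (nat -> R),
    [/\ forall i, c.1.1 i -> 0 < c.2 i /\ 2 * c.2 i < d,
        A n `<=` \bigcup_(i in c.1.1) hball (c.1.2 i) (c.2 i) &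
        (\esum_(i in c.1.1) ((2 * c.2 i) `^ s)%:E <= S (A n) + (e / (2 ^ n.+1)%:R)%:E)%E].
  have en : 0 < e / (2 ^ n.+1)%:R by rewrite divr_gt0// ltr0n expn_gt0.
  have Pfin : P d (A n) \is a fin_num.
    rewrite ge0_fin_numE ?premeasure_ge0//; apply: le_lt_trans (fin n); exact: spherical_ge.
  have [_ [D [x [r [Dr cov ->]]]] lt] := lb_ereal_inf_adherent en Pfin.
  have Dr' i : D i -> 0 < r i /\ 2 * r i < d.
    by move=> Di; have [r0] := Dr i Di; rewrite hdiam_hball// lte_fin.
  exists (D, x, r); split=> //=; apply: (@le_trans _ _ (P d (A n) + (e / (2 ^ n.+1)%:R)%:E)%E).
    apply: ltW; apply: le_lt_trans lt; rewrite le_eqVlt; apply/orP; left; apply/eqP.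
    by apply: eq_esum => i /Dr'[r0 _]; rewrite poweR_hdiam.
  by apply: leeD => //; exact: spherical_ge.
have [c cP] := choice ex.
pose D := [set pickle p | p in [set p : nat * nat | (c p.1).1.1 p.2]].
pose x k := if (unpickle k : option (nat * nat)) is Some p then (c p.1).1.2 p.2 else hid R.
pose r k := if (unpickle k : option (nat * nat)) is Some p then (c p.1).2 p.2 else 0.
apply: (@le_trans _ _ (\esum_(k in D) ((2 * r k) `^ s)%:E)%E).
  apply: (premeasure_le_cover (x := x)).
    by move=> _ [p pD <-]; rewrite /r pickleK; have [h _ _] := cP p.1; exact: h.
  move=> y [n _ Any]; have [_ h _] := cP n; have [i Di yi] := h _ Any.
  by exists (pickle (n, i)); [exists (n, i)|rewrite /x /r pickleK].
rewrite (@reindex_esum _ _ _ [set p : nat * nat | (c p.1).1.1 p.2] _ (@pickle _)); last first.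
  split.
  - by move=> p pD; exists p.
  - by move=> p q _ _ /(congr1 (@unpickle (nat * nat)%type)); rewrite !pickleK => -[].
  - by move=> _ [p pD <-]; exists p.
rewrite (eq_esum (b := fun p : nat * nat => ((2 * (c p.1).2 p.2) `^ s)%:E)); last first.
  by move=> p _; rewrite /r pickleK.
rewrite (_ : [set p : nat * nat | _] = [set: nat] `*`` (fun n => (c n).1.1)); last first.
  by apply/seteqP; split=> p /=; [move=> ?; split|case].
rewrite -(esum_esum (a := fun n i => ((2 * (c n).2 i) `^ s)%:E))//; last first.
  by move=> n i _ _; rewrite lee_fin powR_ge0.
apply: (@le_trans _ _ (\sum_(n <oo) (S (A n) + (e / (2 ^ n.+1)%:R)%:E))%E); last first.
  by apply: epsilon_trick; [move=> n; exact: spherical_ge0|exact: ltW].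
rewrite nneseries_esumT; last first.
  by move=> n; rewrite adde_ge0 ?spherical_ge0// lee_fin divr_ge0// ltW.
by apply: le_esum => n _; have [_ _] := cP n.
Qed.

(** A ball of diameter less than [e] cannot meet both sets, so a fine cover of the union splits into
    covers of the two. *)
Lemma spherical_separated A B e : 0 < e ->
  (forall x y, A x -> B y -> e <= hdist x y) -> (S A + S B <= S (A `|` B))%E.
Proof.
move=> e0 sep.
have key d : 0 < d -> d <= e -> (P d A + P d B <= S (A `|` B))%E.
  move=> d0 de; apply: le_trans (spherical_ge _ d0); apply: le_premeasure => D x r Dr cov.
  have r0 i : D i -> 0 <= r i by move=> /Dr[/ltW].
  pose DA := [set i | hball (x i) (r i) `&` A !=set0].
  rewrite (esumID DA); last by move=> i _; rewrite lee_fin powR_ge0.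
  apply: leeD; apply: (premeasure_le_cover (x := x)).
  - by move=> i [Di _]; exact: Dr.
  - move=> y Ay; have [i Di yi] := cov y (or_introl Ay); exists i => //.
    by split=> //; exists y.
  - by move=> i [Di _]; exact: Dr.
  move=> y By; have [i Di yi] := cov y (or_intror By); exists i => //.
  split=> // -[z [zi Az]]; have := sep _ _ Az By; rewrite leNgt => /negP; apply.
  have [_ rd] := Dr i Di; apply: lt_le_trans de; apply: le_lt_trans rd.
  by rewrite (le_trans (hdist_triangle (x i) _ _))// hdistC mulr_natl mulr2n lerD.
have [fin|] := ltP (S (A `|` B)) +oo%E; last by rewrite leye_eq => /eqP ->; rewrite leey.
have Afin : S A \is a fin_num.
  rewrite ge0_fin_numE ?spherical_ge0//; apply: le_lt_trans fin.
  exact/spherical_mono/subsetUl.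
have Bfin d : 0 < d -> P d B \is a fin_num.
  move=> d0; rewrite ge0_fin_numE ?premeasure_ge0//; apply: le_lt_trans fin.
  apply: le_trans (spherical_ge _ d0) _; exact/spherical_mono/subsetUr.
have step d2 : 0 < d2 -> (S A + P d2 B <= S (A `|` B))%E.
  move=> d20; rewrite -leeBrDr ?Bfin//; apply: spherical_le => d d0; rewrite leeBrDr ?Bfin//.
  pose m := Num.min d (Num.min d2 e).
  have m0 : 0 < m by rewrite !lt_min d0 d20.
  apply: le_trans (key m m0 _); last by rewrite !ge_min lexx !orbT.
  by apply: leeD; apply: premeasure_nincr; rewrite !ge_min lexx ?orbT.
rewrite addeC -leeBrDr//; apply: spherical_le => d2 d20; rewrite leeBrDr// addeC.
exact: step.
Qed.

Lemma premeasure_image (f : H -> H) (l : R) d A : 0 < l ->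
  (forall x y, hdist (f x) (f y) = l * hdist x y) ->
  (P (l * d) (f @` A) <= (l `^ s)%:E * P d A)%E.
Proof.
move=> l0 fl; rewrite -lee_pdivrMl ?powR_gt0//.
apply: le_premeasure => D x r Dr cov; rewrite lee_pdivrMl ?powR_gt0//.
rewrite -ge0_esumZl ?powR_ge0//; last by move=> i; rewrite lee_fin powR_ge0.
rewrite (eq_esum (b := fun i => ((2 * (l * r i)) `^ s)%:E)); last first.
  move=> i /Dr[r0 _]; rewrite -EFinM -powRM ?(ltW l0) ?mulr_ge0 ?(ltW r0)//.
  by congr ((_ `^ _)%:E); ring.
apply: (premeasure_le_cover (x := fun i => f (x i))).
  by move=> i /Dr[r0 rd]; split; [rewrite mulr_gt0|rewrite mulrCA ltr_pM2l].
move=> _ [y Ay <-]; have [i Di yi] := cov y Ay; exists i => //.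
by rewrite /hball/= fl ler_pM2l.
Qed.

Lemma spherical_image_le (f : H -> H) (l : R) A : 0 < l ->
  (forall x y, hdist (f x) (f y) = l * hdist x y) ->
  (S (f @` A) <= (l `^ s)%:E * S A)%E.
Proof.
move=> l0 fl; apply: spherical_le => d d0.
rewrite (_ : d = l * (d / l)); last by rewrite mulrC divfK// gt_eqF.
apply: (le_trans (premeasure_image _ _ l0 fl)).
by apply: lee_wpmul2l; rewrite ?lee_fin ?powR_ge0//; apply: spherical_ge; rewrite divr_gt0.
Qed.

Lemma spherical_image (f g : H -> H) (l : R) A : 0 < l -> cancel f g -> cancel g f ->
  (forall x y, hdist (f x) (f y) = l * hdist x y) ->
  S (f @` A) = ((l `^ s)%:E * S A)%E.
Proof.
move=> l0 fK gK fl; apply/eqP; rewrite eq_le spherical_image_le//=.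
rewrite -lee_pdivlMl ?powR_gt0//.
have gl x y : hdist (g x) (g y) = l^-1 * hdist x y.
  by rewrite -{2}(gK x) -{2}(gK y) fl mulKf// gt_eqF.
have := spherical_image_le (f @` A) _ gl; rewrite invr_gt0 => /(_ l0).
rewrite (_ : g @` (f @` A) = A); last first.
  rewrite image_comp; apply/seteqP; split=> [_ [x Ax <-]|x Ax]; first by rewrite /= fK.
  by exists x => //=; rewrite fK.
by rewrite -powR_inv1 ?(ltW l0)// -powRrM mulN1r powRN.
Qed.

(** The mass distribution principle: the bound on balls holds at every radius, so covers at the
    fixed scale 1 suffice. *)
Lemma measure_le_spherical (mu : {measure set HB -> \bar R}) (C : R) (A : set HB) : 0 < C ->
  (forall x (r : R), 0 < r -> (mu (hball x r) <= (C * (2 * r) `^ s)%:E)%E) ->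
  measurable A -> (mu A <= C%:E * S A)%E.
Proof.
move=> Cp muC mA; have C0 := ltW Cp.
apply: (@le_trans _ _ (C%:E * P 1 A)%E); last first.
  by apply: lee_wpmul2l; rewrite ?lee_fin//; exact: spherical_ge.
rewrite -lee_pdivrMl//; apply: le_premeasure => D x r Dr cov.
rewrite lee_pdivrMl// -ge0_esumZl//; last by move=> i; rewrite lee_fin powR_ge0.
pose B i : set HB := if i \in D then hball (x i) (r i) else set0.
have mB i : measurable (B i) by rewrite /B; case: ifP => // _; exact: measurable_hball.
have AB : A `<=` \bigcup_i B i.
  by move=> y /cov[i Di yi]; exists i => //; rewrite /B mem_set.
apply: (le_trans (measure_sigma_subadditive mu mB mA AB)).
rewrite nneseries_esumT// [leRHS]esum_mkcond; apply: le_esum => i _; rewrite /B.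
case: ifPn => [|_]; last by rewrite measure0.
by rewrite inE => /Dr[r0 _]; rewrite -EFinM; exact: muC.
Qed.

HB.instance Definition _ := isOuterMeasure.Build R H S spherical0 spherical_ge0
  spherical_mono spherical_sigma_subadditive.

Section OpenCaratheodory.
Variables (U X : set H).
Hypothesis fin : (S X < +oo)%E.

(** The part of [X] at depth more than [1 / (n + 1)] in [U], as in Carathéodory's criterion for
    metric outer measures. Adjacent rings may touch, but the ring between [D p.+1] and [D p.+2]
    keeps a positive distance from [D p]. *)
Let D n : set H := X `&` inner_part U n.+1%:R^-1.

Let D_sep p x z : D p x -> X z -> ~ D p.+1 z -> p.+1%:R^-1 - p.+2%:R^-1 <= hdist x z.
Proof.
move=> [Xx [t pt tU]] Xz Dz; rewrite leNgt; apply/negP => lt; apply: Dz; split=> //.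
exists (t - hdist x z).
  by rewrite ltrBrDr; apply: lt_trans pt; rewrite addrC -ltrBrDr.
move=> y zy; apply: tU; rewrite /hball/= (le_trans (hdist_triangle z _ _))//.
by move: zy; rewrite /hball/= lerBrDl.
Qed.

Let gap_gt0 p : 0 < p.+1%:R^-1 - p.+2%:R^-1 :> R.
Proof. by rewrite subr_gt0 ltf_pV2 ?posrE ?ltr0n// ltr_nat. Qed.

Let D_mono p q : (p <= q)%N -> D p `<=` D q.
Proof.
move=> pq x [Xx [t pt tU]]; split=> //; exists t => //; apply: le_lt_trans pt.
by rewrite lef_pV2 ?posrE ?ltr0n// ler_nat.
Qed.

Let Sfin A : A `<=` X -> S A \is a fin_num.
Proof.
move=> AX; rewrite ge0_fin_numE ?spherical_ge0//; apply: le_lt_trans fin.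
exact: spherical_mono.
Qed.

Let a n := fine (S (D n)).

Let aE n : S (D n) = (a n)%:E.
Proof. by rewrite fineK// Sfin// => x []. Qed.

Let ring_le p : (S (D p.+2 `\` D p.+1) <= (a p.+2 - a p)%:E)%E.
Proof.
have Rfin : S (D p.+2 `\` D p.+1) \is a fin_num by rewrite Sfin// => x [[]].
have : (S (D p) + S (D p.+2 `\` D p.+1) <= S (D p.+2))%E.
  apply: (le_trans (spherical_separated (gap_gt0 p) _)).
    by move=> x z Dx [[Xz _] Dz]; exact: D_sep.
  apply: spherical_mono => x [|[]//]; apply: D_mono; lia.
by rewrite !aE -(fineK Rfin) -!EFinD !lee_fin lerBrDl.
Qed.

Let a_mono p q : (p <= q)%N -> a p <= a q.
Proof. by move=> pq; rewrite -lee_fin -!aE; apply: spherical_mono; exact: D_mono. Qed.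

Let L := sup (range a).

Let a_sup : has_sup (range a).
Proof.
split; first by exists (a 0%N), 0%N.
exists (fine (S X)) => _ [n _ <-]; rewrite -lee_fin -aE fineK ?Sfin//.
by apply: spherical_mono => x [].
Qed.

Let a_le n : a n <= L.
Proof. by apply: sup_upper_bound => //; exists n. Qed.

(** The bounds [a p.+2 - a p] telescope with step two and leave two boundary terms at each end;
    hence the factor 2. The tails tend to 0 together with [L - a p]. *)
Let partial_rings p N :
  (\sum_(0 <= k < N) S (D (p + k).+2 `\` D (p + k).+1) <= (2 * (L - a p))%:E)%E.
Proof.
apply: (@le_trans _ _ (a (p + N).+1 + a (p + N)%N - a p.+1 - a p)%:E).
  elim: N => [|N IH]; first by rewrite big_geq// addn0 lee_fin; lra.
  rewrite big_nat_recr /=; last exact: leq0n.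
  apply: (le_trans (leeD IH (ring_le (p + N)))).
  by rewrite -EFinD lee_fin addnS le_eqVlt; apply/orP; left; apply/eqP; ring.
rewrite lee_fin; have := a_le (p + N).+1; have := a_le (p + N)%N.
by have := a_mono (leqnSn p); set u := a _; set v := a _; set w := a _; set z := a _; lra.
Qed.

Lemma spherical_open_split : open U -> (S (X `&` U) + S (X `&` ~` U) <= S X)%E.
Proof.
move=> oU.
have cov p : X `&` U `<=` D p.+1 `|` \bigcup_k (D (p + k).+2 `\` D (p + k).+1).
  move=> x [Xx Ux]; have [t t0 tU] := open_hball_sub oU Ux.
  have [n Dn] : exists n, D n x.
    exists (Num.bound t^-1); split=> //; exists t; last exact: tU.
    rewrite -[ltRHS]invrK ltf_pV2 ?posrE ?invr_gt0 ?ltr0n//.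
    by rewrite (lt_trans (archi_boundP _)) ?ltr_nat// invr_ge0 ltW.
  have [Dp|Dp] := pselect (D p.+1 x); [by left|right].
  have [k kD kmin] : exists2 k, D (p + k).+2 x & ~ D (p + k).+1 x.
    apply: contrapT => no; have all k : ~ D (p + k).+1 x.
      elim: k => [|k IH]; first by rewrite addn0.
      by move=> Dk; apply: no; exists k => //; rewrite -addnS.
    by apply: (all n); apply: D_mono Dn; lia.
  by exists k.
have LU : (S (X `&` U) <= L%:E)%E.
  apply/lee_addgt0Pr => e e0.
  have e2 : 0 < e / 2 by rewrite divr_gt0.
  have [_ [p _ <-] ap] := sup_adherent e2 a_sup.
  apply: (le_trans (spherical_mono (cov p))).
  apply: (le_trans (outer_measureU2 S _ _)).
  apply: (@le_trans _ _ (L%:E + (2 * (L - a p))%:E)%E).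
    have aL : (S (D p.+1) <= L%:E)%E by rewrite aE lee_fin.
    apply: (leeD aL).
    apply: (le_trans (outer_measure_sigma_subadditive S _)).
    apply: lime_le; first by apply: is_cvg_nneseries => k _ _; exact: spherical_ge0.
    by apply: nearW => N; exact: partial_rings.
  by rewrite -EFinD lee_fin; move: ap; rewrite -/L; lra.
have CX : S (X `&` ~` U) \is a fin_num by rewrite Sfin// => x [].
apply: (le_trans (leeD2r _ LU)); rewrite -leeBrDr//.
rewrite -(fineK CX) -(fineK (Sfin (@subset_refl _ X))) -EFinB lee_fin.
apply: ge_sup; first by exists (a 0%N), 0%N.
move=> _ [n _ <-]; rewrite lerBrDr -lee_fin EFinD -aE !fineK ?Sfin//.
have n0 : (0 : R) < n.+1%:R^-1 by rewrite invr_gt0 ltr0n.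
apply: (le_trans (spherical_separated n0 _)).
  move=> x y [Xx [t nt tU]] [Xy Uy]; rewrite leNgt; apply/negP => xy; apply: Uy; apply: tU.
  by rewrite /hball/= ltW// (lt_trans xy).
by apply: spherical_mono => x [[]|[]].
Qed.

End OpenCaratheodory.

Lemma open_caratheodory (U : set H) : open U -> S.-caratheodory U.
Proof.
move=> oU; apply: le_caratheodory_measurable => X.
have [fin|] := ltP (S X) +oo%E; first exact: spherical_open_split.
move=> inf; have SX : S X = +oo%E by apply/eqP; rewrite -leye_eq.
apply: (@le_trans _ _ +oo%E); first exact: leey.
by rewrite -SX.
Qed.

Lemma borel_caratheodory (A : set HB) : measurable A -> S.-caratheodory (A : set H).
Proof.
apply; split; last by move=> U oU; exact: open_caratheodory.
split; first exact: caratheodory_measurable_set0.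
- by move=> B mB; rewrite setTD; exact: caratheodory_measurable_setC.
- exact: caratheodory_measurable_bigcup.
Qed.

Definition spherical_borel (A : set HB) : \bar R := S A.

Let spherical_borel0 : spherical_borel set0 = 0%E.
Proof. exact: spherical0. Qed.

Let spherical_borel_ge0 A : (0 <= spherical_borel A)%E.
Proof. exact: spherical_ge0. Qed.

Let spherical_borel_sigma_additive : semi_sigma_additive spherical_borel.
Proof.
move=> F mF tF mU.
exact: (@caratheodory_measure_sigma_additive R H (S : {outer_measure set H -> \bar R}) F
  (fun n => borel_caratheodory (mF n)) tF (borel_caratheodory mU)).
Qed.

HB.instance Definition _ := isMeasure.Build _ HB R spherical_borel
  spherical_borel0 spherical_borel_ge0 spherical_borel_sigma_additive.

End SphericalMeasure.

(** * Proportionality to the spherical measure *)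

Section PlaneMeasure.
Context {R : realType}.
Local Notation H := (heis R).
Local Notation HB := (heisBorel R).
Variables (mu : {measure set HB -> \bar R}) (c : R).
Hypotheses (c_gt0 : 0 < c) (mu_neq0 : mu setT <> 0%E).
Hypothesis mu_ball : forall x r, msupport mu x -> 0 < r -> mu (hball x r) = (c * r ^+ 3)%:E.

Lemma packing_bound (p : H) (r0 e : R) (F : seq H) : 0 < r0 -> 0 < e ->
  (forall x, x \in F -> msupport mu x /\ hball p r0 x) ->
  pairwise (fun x y => 2 * e < hdist x y) F ->
  (size F)%:R * e ^+ 3 <= (2 * (r0 + e)) ^+ 3.
Proof.
move=> r00 e0 FP sepF.
pose B (k : 'I_(size F)) : set HB := hball (nth p F k) e.
have Bm k : measurable (B k) by exact: measurable_hball.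
have sep (k l : 'I_(size F)) : (k < l)%N -> 2 * e < hdist (nth p F k) (nth p F l).
  by have /(pairwiseP p) h := sepF; move=> kl; apply: h => //; exact: ltn_ord.
have tB : trivIset setT B.
  move=> k l _ _ [y [yk yl]]; apply/val_inj/eqP; apply: contraT; rewrite neq_ltn => /orP[] h.
    by case: (hball_disjoint (sep _ _ h) yk yl).
  by case: (hball_disjoint (sep _ _ h) yl yk).
have muB k : mu (B k) = (c * e ^+ 3)%:E.
  by apply: mu_ball => //; have [] := FP _ (mem_nth p (ltn_ord k)).
have := measure_bigsetU_ord mu xpredT Bm tB.
rewrite (eq_bigr _ (fun k _ => muB k)) sumEFin sumr_const card_ord => eF.
have : (mu (\big[setU/set0]_(k < size F) B k) <= mu (hball p (r0 + e)))%E.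
  apply: le_measure; rewrite ?inE; [exact: bigsetU_measurable|exact: measurable_hball|].
  elim/big_ind: _ => [//|A A' A1 A2 y [/A1|/A2]//|k _ y yk].
  have [_ pk] := FP _ (mem_nth p (ltn_ord k)).
  by rewrite /hball/= (le_trans (hdist_triangle (nth p F k) _ _))// lerD.
rewrite eF => h; have {h} := le_trans h (mu_hball_le c_gt0 mu_ball p (addr_gt0 r00 e0)).
by rewrite lee_fin -mulrnAr ler_pM2l// -[leLHS]mulr_natl.
Qed.

Lemma spherical_support_lty (p : H) :
  (spherical_hausdorff 3 (msupport mu `&` hball p 1) < +oo)%E.
Proof.
(* A separated subset with the largest number [N] of points satisfies [N * e ^+ 3 <= (2 * 2) ^+ 3]
   by [packing_bound], and the balls of radius [2 * e] about its points cover. Each contributes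
   [(4 * e) ^+ 3 = 64 * e ^+ 3], so the bound does not depend on the scale. *)
apply: (@le_lt_trans _ _ (64 * (2 * 2) ^+ 3)%:E); last exact: ltry.
apply: spherical_le => d d0; pose e := Num.min 1 (d / 8).
have e0 : 0 < e by rewrite lt_min ltr01 divr_gt0.
have e1 : e <= 1 by rewrite ge_min lexx.
have ed : e <= d / 8 by rewrite ge_min lexx orbT.
pose valid (F : seq H) := (forall x, x \in F -> msupport mu x /\ hball p 1 x) /\
  pairwise (fun x y => 2 * e < hdist x y) F.
have vb F : valid F -> (size F)%:R * e ^+ 3 <= (2 * 2) ^+ 3.
  move=> [F1 F2]; apply: (le_trans (packing_bound ltr01 e0 F1 F2)).
  by rewrite lerXn2r ?nnegrE ?mulr_ge0 ?addr_ge0 ?(ltW e0)// ler_pM2l// lerD2l.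
have e3 : 0 < e ^+ 3 by exact: exprn_gt0.
have exF : exists n, `[< exists2 F, valid F & size F = n >].
  by exists 0%N; apply/asboolP; exists [::].
have bF n : `[< exists2 F, valid F & size F = n >] -> (n <= Num.truncn ((2 * 2) ^+ 3 / e ^+ 3 : R))%N.
  move=> /asboolP[F vF <-]; rewrite truncn_ge_nat; last by rewrite divr_ge0// ltW.
  by rewrite ler_pdivlMr//; exact: vb.
case: (ex_maxnP exF bF) => N /asboolP[F vF sF] Nmax.
have cov : msupport mu `&` hball p 1 `<=` \bigcup_(i in `I_N) hball (nth p F i) (2 * e).
  move=> y [sy py]; apply: contrapT => no.
  have : `[< exists2 G, valid G & size G = N.+1 >].
    apply/asboolP; exists (y :: F); last by rewrite /= sF.
    split; first by move=> x; rewrite inE => /orP[/eqP ->//|]; case: vF => h _; exact: h.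
    rewrite pairwise_cons; case: vF => _ ->; rewrite andbT; apply/allP => x xF.
    rewrite ltNge; apply/negP => xy; apply: no.
    exists (index x F); first by rewrite /= -sF index_mem.
    by rewrite /hball/= nth_index// hdistC.
  by move=> /Nmax; rewrite ltnn.
have Dr i : `I_N i -> 0 < 2 * e /\ 2 * (2 * e) < d.
  move=> _; split; first by rewrite mulr_gt0.
  by move: ed e0; lra.
apply: (le_trans (@premeasure_le_cover R 3 d _ `I_N (nth p F) (fun=> 2 * e) Dr cov)).
rewrite esum_fset//; last by move=> i _; rewrite lee_fin powR_ge0.
rewrite -(fsbig_ord _ _ (fun=> ((2 * (2 * e)) `^ 3)%:E)) sumEFin lee_fin sumr_const card_ord.
rewrite powR_mulrn ?mulr_ge0 ?(ltW e0)// -[leLHS]mulr_natl.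
have := vb _ vF; rewrite sF => h.
have -> : N%:R * (2 * (2 * e)) ^+ 3 = 64 * (N%:R * e ^+ 3) by ring.
by rewrite ler_pM2l.
Qed.

Hypothesis plane : forall x y r, msupport mu x -> msupport mu y -> 0 < r ->
  exists f g : H -> H, [/\ cancel f g, cancel g f, f x = y,
    forall z z', hdist (f z) (f z') = r * hdist z z' &
    forall z, msupport mu (f z) <-> msupport mu z].

(** The similarities carry the unit ball about [p] to every ball centered in the support, so the
    spherical measure obeys the cubic law there with constant [K]. Packing makes [K] finite, mass
    distribution makes it positive. After rescaling, both measures have the ball function
    [K * c * r ^+ 3]. *)
Theorem proportional_spherical : exists2 k : R, 0 < k &
  forall A : set HB, measurable A -> mu A = (k%:E * spherical_hausdorff 3 (A `&` msupport mu))%E.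
Proof.
have [p sp] := msupport_neq0 mu_neq0.
pose S := @spherical_hausdorff R 3.
pose K := fine (S (msupport mu `&` hball p 1)).
have KE : S (msupport mu `&` hball p 1) = K%:E.
  rewrite fineK// ge0_fin_numE ?spherical_ge0//; exact: spherical_support_lty.
have mW := measurable_msupport mu.
have lower A : measurable (A : set HB) -> (mu A <= c%:E * S A)%E.
  apply: measure_le_spherical => // x r r0; apply: (le_trans (mu_hball_le c_gt0 mu_ball x r0)).
  by rewrite powR_mulrn// mulr_ge0// ltW.
have K0 : 0 < K.
  have mB : measurable (hball p 1 : set HB) by exact: measurable_hball.
  have := lower _ (measurableI _ _ mW mB).
  rewrite setIC -measure_msupportI// (mu_ball sp ltr01) setIC KE -EFinM lee_fin expr1n mulr1.
  by rewrite -[leLHS]mulr1 ler_pM2l// => /(lt_le_trans ltr01).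
have SB x r : msupport mu x -> 0 < r -> S (hball x r `&` msupport mu) = (K * r ^+ 3)%:E.
  move=> sx r0; have [f [g [fK gK fp fd fW]]] := plane sp sx r0.
  rewrite (_ : _ `&` _ = f @` (msupport mu `&` hball p 1)); last first.
    apply/seteqP; split=> [y [xy sy]|_ [z [sz pz] <-]].
      exists (g y); last by rewrite gK.
      split; first by apply: (proj1 (fW (g y))); rewrite gK.
      by move: xy; rewrite /hball/= -{1}fp -{1}(gK y) fd -[leRHS]mulr1 ler_pM2l.
    split; last exact: (proj2 (fW z) sz).
    by rewrite /hball/= -fp fd -[leRHS]mulr1 ler_pM2l.
  by rewrite /S (@spherical_image R 3 f g r _ r0 fK gK fd) -/S KE -EFinM powR_mulrn ?(ltW r0)// mulrC.
pose nu : {measure set HB -> \bar R} := mrestr (@spherical_borel R 3) mW.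
have nuE A : nu A = S (A `&` msupport mu) by [].
have K0' := ltW K0; have c0' := ltW c_gt0.
pose mu1 : {measure set HB -> \bar R} := mscale (NngNum K0') mu.
pose nu1 : {measure set HB -> \bar R} := mscale (NngNum c0') nu.
have mu1E A : mu1 A = (K%:E * mu A)%E by [].
have nu1E A : nu1 A = (c%:E * S (A `&` msupport mu))%E by [].
have key A : measurable A -> mu1 A = nu1 A.
  apply: (uniform_measure_unique (E := msupport mu) (h := fun r => K * c * r ^+ 3)) => //.
  - by move=> B mB; rewrite !mu1E; congr (_ * _)%E; exact: measure_msupportI.
  - by move=> B mB; rewrite !nu1E -setIA setIid.
  - move=> x r; rewrite mu1E lte_mul_pinfty ?lee_fin//; first [exact: (mu_hball_lty mu_neq0 mu_ball)|exact: (mu_hball_lty mu_neq0 c_gt0 mu_ball)].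
  - move=> x r; rewrite nu1E lte_mul_pinfty ?lee_fin//.
    have t0 : 0 < `|r| + hdist p x + 1 by rewrite ltr_wpDl// addr_ge0// hdist_ge0.
    apply: (@le_lt_trans _ _ (S (hball p (`|r| + hdist p x + 1) `&` msupport mu))).
      apply: spherical_mono => y [xy sy]; split=> //.
      rewrite /hball/= (le_trans (hdist_triangle x _ _))// addrC -addrA lerD//.
        by rewrite (le_trans xy)// ler_norm.
      by rewrite lerDl.
    by rewrite SB// ltry.
  - by move=> r r0; rewrite !mulr_gt0// exprn_gt0.
  - by move=> x r sx r0; rewrite mu1E mu_ball// -EFinM mulrA.
  - by move=> x r sx r0; rewrite nu1E SB// -EFinM mulrA (mulrC c).
exists (c / K); first by rewrite divr_gt0.
move=> A mA; have := key A mA; rewrite mu1E nu1E => e.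
by rewrite mulrC EFinM -muleA -e muleA -EFinM mulVf ?gt_eqF// mul1e.
Qed.

End PlaneMeasure.

(** * Vertically invariant uniform measures *)

Section LebesgueScaling.
Context {R : realType}.

Lemma measurable_id_ocitv : measurable_fun setT ((fun x => x) : measurableTypeR R -> R).
Proof. by move=> _ A mA; rewrite setTI; exact mA. Qed.

Lemma measurable_id_real : measurable_fun setT ((fun x => x) : R -> measurableTypeR R).
Proof. by move=> _ A mA; rewrite setTI; exact mA. Qed.

(* [lebesgue_measure] lives on the copy [measurableTypeR R] of the real line. *)
Definition leb : {measure set R -> \bar R} :=
  image_measure (@lebesgue_measure R) measurable_id_ocitv.

Lemma lebE (A : set R) : leb A = lebesgue_measure A.
Proof. by []. Qed.

Lemma leb_itv (i : interval R) :
  leb [set` i] = (if i.1 < i.2 then (i.2 : \bar R) - i.1 else 0)%E.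
Proof. by rewrite lebE lebesgue_measure_itv. Qed.

Lemma sigma_finite_leb : sigma_finite setT leb.
Proof.
exists (fun n => `[- n%:R, n%:R]%classic).
  apply/seteqP; split=> // x _; exists (Num.bound `|x|) => //=.
  by rewrite in_itv/= -ler_norml ltW// archi_boundP.
move=> n; split; first exact: measurable_itv.
by rewrite leb_itv/=; case: ifP => _; rewrite ?ltry// -EFinB ltry.
Qed.

Lemma lebesgue_integral_dilation (a : R) (f : R -> \bar R) : 0 < a ->
  measurable_fun setT f -> (forall x, 0 <= f x)%E ->
  (\int[leb]_x f (a^-1 * x)%R = a%:E * \int[leb]_x f x)%E.
Proof.
move=> a0 mf f0; have a0' : 0 <= a^-1 by rewrite invr_ge0 ltW.
have mphi : measurable_fun setT (fun x : R => a^-1 * x).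
  by apply: measurable_funM; [exact: measurable_cst|exact: measurable_id].
pose nu : {measure set R -> \bar R} := image_measure leb mphi.
pose m : {measure set R -> \bar R} := mscale (NngNum a0') nu.
have E A : measurable A -> leb A = m A.
  suff h : forall X, ocitv X -> leb X = m X by move=> mA; exact (@lebesgue_measure_unique R (image_measure m measurable_id_real) h A mA).
  move=> _ [[x y] _ <-] /=.
  rewrite /mscale /= /pushforward.
  have -> : (fun t : R => a^-1 * t) @^-1` `]x, y]%classic = `](a * x), (a * y)]%classic.
    apply/seteqP; split=> t /=; rewrite !in_itv/= -(ltr_pM2l a0 x) -(ler_pM2l a0 _ y).
      by rewrite mulVKf ?gt_eqF.
    by rewrite mulVKf ?gt_eqF.
  rewrite !leb_itv/= !lte_fin ltr_pM2l//; case: ifP => _; last by rewrite mule0.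
  by rewrite -!EFinB -EFinM -mulrBr mulKf ?gt_eqF.
have -> : (\int[leb]_x f (a^-1 * x)%R = \int[nu]_x f x)%E.
  by rewrite [RHS](ge0_integral_pushforward mphi).
have -> : (\int[leb]_x f x = \int[m]_x f x)%E.
  by apply: eq_measure_integral => A mA _; exact: E.
rewrite ge0_integral_mscale//= muleA -EFinM divff ?gt_eqF// mul1e//.
Qed.

(** Only positivity and finiteness of the integral matter; its value is never computed. *)
Lemma bump_integral (f : R -> R) (e : R) : measurable_fun setT f -> 0 < e ->
  (forall x, 0 <= f x <= 1) -> (forall x, 1 < `|x| -> f x = 0) ->
  (forall x, 0 <= x <= 2^-1 -> e <= f x) ->
  exists2 k : R, 0 < k & (\int[leb]_x (f x)%:E = k%:E)%E.
Proof.
move=> mf e0 f01 fout fin.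
have up : (\int[leb]_x (f x)%:E <= 2%:E)%E.
  apply: (@le_trans _ _ (\int[leb]_x (\1_(`[-1, 1]%classic : set R) x)%:E)%E).
    apply: ge0_le_integral => //.
    - by move=> x _; rewrite lee_fin; case/andP: (f01 x).
    - by apply/measurable_EFinP.
    - by apply/measurable_EFinP; apply: measurable_indic; exact: measurable_itv.
    move=> x _; rewrite lee_fin indicE; have [xin|xout] := boolP (x \in _).
      by case/andP: (f01 x).
    rewrite fout// ltNge; apply/negP => x1; move: xout; rewrite notin_setE; apply.
    by rewrite /= in_itv/= -ler_norml.
  have e2 : leb `[-1, 1]%classic = 2%:E.
    rewrite leb_itv/= lte_fin ifT; first by rewrite -EFinB; congr (_%:E); ring.
    by rewrite (lt_trans (_ : -1 < 0 :> R)) ?ltr01// oppr_lt0.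
  by rewrite integral_indic// setIT e2.
have lo : ((e / 2)%:E <= \int[leb]_x (f x)%:E)%E.
  apply: (@le_trans _ _ (\int[leb]_x (e%:E * (\1_(`[0, 2^-1]%classic : set R) x)%:E))%E).
    rewrite ge0_integralZl_EFin ?(ltW e0)//; last first.
      by apply/measurable_EFinP; apply: measurable_indic; exact: measurable_itv.
    have e2 : leb `[0, 2^-1]%classic = (2^-1)%:E.
      by rewrite leb_itv/= lte_fin invr_gt0 ltr0n sube0.
    by rewrite integral_indic// setIT e2 -EFinM.
  apply: ge0_le_integral => //.
  - by move=> x _; rewrite -EFinM lee_fin mulr_ge0// ltW.
  - apply: emeasurable_funM; first exact: measurable_cst.
    by apply/measurable_EFinP; apply: measurable_indic; exact: measurable_itv.
  - by apply/measurable_EFinP.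
  move=> x _; rewrite -EFinM lee_fin indicE; have [xin|_] := boolP (x \in _).
    by rewrite mulr1; apply: fin; move: xin; rewrite inE /= in_itv.
  by rewrite mulr0; case/andP: (f01 x).
have fi : (\int[leb]_x (f x)%:E)%E \is a fin_num.
  rewrite fin_numElt (lt_le_trans (ltNyr _) lo)/=.
  exact: le_lt_trans up (ltry _).
exists (fine (\int[leb]_x (f x)%:E)%E); last by rewrite fineK.
by rewrite (lt_le_trans (_ : 0 < e / 2)) ?divr_gt0// -lee_fin fineK.
Qed.

Lemma measurable_sqrtr : measurable_fun setT (@Num.sqrt R).
Proof. by apply: continuous_measurable_fun; exact: sqrt_continuous. Qed.

Let mq (g : R -> R) s : measurable_fun setT g -> measurable_fun setT (fun b : R => g (s - b ^+ 2)).
Proof.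
move=> mg; have mh : measurable_fun setT (fun b : R => s - b ^+ 2).
  apply: measurable_funB; first exact: measurable_cst.
  by apply: measurable_funX; exact: measurable_id.
exact: (measurableT_comp mg mh).
Qed.

Let sqrtr_scale (a x : R) : 0 <= a -> Num.sqrt (a ^+ 2 * x) = a * Num.sqrt x.
Proof. by move=> a0; rewrite sqrtrM ?sqr_ge0// sqrtr_sqr ger0_norm. Qed.

(** Half the area of a disc of radius [Num.sqrt s], obtained by scaling from the case [s = 1]. As
    [Num.sqrt] vanishes on negative numbers, no domain of integration has to be specified. *)
Lemma sqrt_bump : exists2 k : R, 0 < k & forall s,
  (\int[leb]_b (Num.sqrt (s - b ^+ 2))%:E = (k * Num.max s 0)%:E)%E.
Proof.
have [k k0 kE] : exists2 k : R, 0 < k &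
    (\int[leb]_b (Num.sqrt (1 - b ^+ 2))%:E = k%:E)%E.
  apply: (@bump_integral _ (2^-1)) => //; first exact: (mq _ measurable_sqrtr).
  - move=> b; rewrite sqrtr_ge0/= -[leRHS]sqrtr1 ler_wsqrtr// gerBl sqr_ge0//.
  - move=> b b1; apply/eqP; rewrite sqrtr_eq0 subr_le0 -(real_normK (num_real b)).
    by rewrite expr_ge1// ltW.
  - move=> b /andP[b0 b2]; rewrite -[leLHS]ger0_norm// -sqrtr_sqr ler_wsqrtr//.
    have : b ^+ 2 <= 2^-1 ^+ 2 by rewrite lerXn2r ?nnegrE.
    by rewrite !expr2; lra.
exists k => // s; have [s0|s0] := leP s 0.
  rewrite mulr0 integral0_eq// => b _; congr (_%:E); apply/eqP.
  by rewrite sqrtr_eq0 (le_trans _ s0)// gerBl sqr_ge0.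
pose a := Num.sqrt s; have a0 : 0 < a by rewrite sqrtr_gt0.
have sa : s = a ^+ 2 by rewrite sqr_sqrtr// ltW.
have -> : (\int[leb]_b (Num.sqrt (s - b ^+ 2))%:E =
    \int[leb]_b (a%:E * (Num.sqrt (1 - (a^-1 * b) ^+ 2))%:E))%E.
  apply: eq_integral => b _; rewrite -EFinM; congr (_%:E).
  rewrite -sqrtr_scale ?(ltW a0)//.
  by congr Num.sqrt; rewrite sa; move: a0 => /gt_eqF/negbT; generalize a => u u0; field.
have mf := mq 1 measurable_sqrtr.
have ml : measurable_fun setT (fun b : R => a^-1 * b).
  by apply: measurable_funM; [exact: measurable_cst|exact: measurable_id].
have mg : measurable_fun setT (fun b : R => (Num.sqrt (1 - (a^-1 * b) ^+ 2))%:E : \bar R).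
  by apply/measurable_EFinP; exact: (measurableT_comp mf ml).
rewrite (ge0_integralZl_EFin _ _ _ mg) ?(ltW a0)//.
rewrite (@lebesgue_integral_dilation a (fun b => (Num.sqrt (1 - b ^+ 2))%:E))//; last first.
  by apply/measurable_EFinP.
by rewrite kE -!EFinM sa; congr (_%:E); ring.
Qed.

(** The power [q ^ (3/4)] for nonnegative [q] and 0 otherwise: the cube of the radius whose fourth
    power is [q]. *)
Definition root3 (q : R) : R := Num.sqrt (Num.sqrt q) ^+ 3.

Lemma root3_bump : exists2 k : R, 0 < k & forall r, 0 < r ->
  (\int[leb]_b (root3 (r ^+ 4 - b ^+ 2))%:E = (k * r ^+ 5)%:E)%E.
Proof.
have mr : measurable_fun setT root3.
  apply: measurable_funX; exact: (measurableT_comp measurable_sqrtr measurable_sqrtr).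
have r0 q : 0 <= root3 q by rewrite exprn_ge0 ?sqrtr_ge0.
have [k k0 kE] : exists2 k : R, 0 < k & (\int[leb]_b (root3 (1 - b ^+ 2))%:E = k%:E)%E.
  apply: (@bump_integral _ (8^-1)) => //; first exact: (mq _ mr).
  - move=> b; rewrite r0/= exprn_ile1 ?sqrtr_ge0// -[leRHS]sqrtr1 ler_wsqrtr//.
    by rewrite -[leRHS]sqrtr1 ler_wsqrtr// gerBl sqr_ge0.
  - move=> b b1; rewrite /root3; have -> : Num.sqrt (1 - b ^+ 2) = 0.
      apply/eqP; rewrite sqrtr_eq0 subr_le0 -(real_normK (num_real b)).
      by rewrite expr_ge1// ltW.
    by rewrite sqrtr0 expr0n.
  - move=> b /andP[b0 b2].
    have b4 : b ^+ 2 <= 2^-1 ^+ 2 by rewrite lerXn2r ?nnegrE.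
    have h1 : 2^-1 <= Num.sqrt (1 - b ^+ 2).
      by rewrite -[leLHS]ger0_norm// -sqrtr_sqr ler_wsqrtr//; move: b4; rewrite !expr2; lra.
    have h2 : 2^-1 <= Num.sqrt (Num.sqrt (1 - b ^+ 2)).
      rewrite -[leLHS]ger0_norm// -sqrtr_sqr ler_wsqrtr// (le_trans _ h1)//.
      by rewrite expr2; lra.
    rewrite (_ : 8^-1 = 2^-1 ^+ 3); last by field.
    by rewrite lerXn2r ?nnegrE ?sqrtr_ge0.
exists k => // r rp; pose a := r ^+ 2; have a0 : 0 < a by exact: exprn_gt0.
have r30 : 0 <= r ^+ 3 by rewrite exprn_ge0// ltW.
have -> : (\int[leb]_b (root3 (r ^+ 4 - b ^+ 2))%:E =
    \int[leb]_b ((r ^+ 3)%:E * (root3 (1 - (a^-1 * b) ^+ 2))%:E))%E.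
  apply: eq_integral => b _; rewrite -EFinM; congr (_%:E).
  rewrite /root3 -exprMn; congr (_ ^+ 3).
  rewrite -sqrtr_scale ?(ltW rp)// -sqrtr_scale ?(ltW a0)//; congr (Num.sqrt (Num.sqrt _)).
  by rewrite /a; move: rp => /gt_eqF/negbT; generalize r => u u0; field.
have ml : measurable_fun setT (fun b : R => a^-1 * b).
  by apply: measurable_funM; [exact: measurable_cst|exact: measurable_id].
have mg : measurable_fun setT (fun b : R => (root3 (1 - (a^-1 * b) ^+ 2))%:E : \bar R).
  by apply/measurable_EFinP; exact: (measurableT_comp (mq 1 mr) ml).
rewrite (ge0_integralZl_EFin _ _ _ mg)//; last by move=> b _; rewrite lee_fin.
rewrite (@lebesgue_integral_dilation a (fun b => (root3 (1 - b ^+ 2))%:E))//; last 2 first.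
- by apply/measurable_EFinP; exact: (mq _ mr).
- by move=> x; rewrite lee_fin.
by rewrite kE -!EFinM /a; congr (_%:E); ring.
Qed.

End LebesgueScaling.

(** * Mass of a slab above planar discs *)

Section VerticalMeasure.
Context {R : realType}.
Local Notation H := (heis R).
Local Notation HB := (heisBorel R).

Definition vtr (t : R) (x : H) : H := hpoint (hx1 x) (hx2 x) (hx3 x + t).

Lemma hdist_vtr t x y : hdist (vtr t x) (vtr t y) = hdist x y.
Proof. by apply: eq_hdist; rewrite !hdistX4 /vtr !hpointE; ring. Qed.

Lemma vtrK t : cancel (vtr t) (vtr (- t)).
Proof. by move=> x; apply: heisP; rewrite /vtr !hpointE// addrK. Qed.

Lemma vtrNK t : cancel (vtr (- t)) (vtr t).
Proof. by move=> x; apply: heisP; rewrite /vtr !hpointE// subrK. Qed.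

Lemma similarity_continuous (f : H -> H) (l : R) : 0 < l ->
  (forall x y, hdist (f x) (f y) = l * hdist x y) -> continuous f.
Proof.
move=> l0 fl x A /= fxA.
have [r r0 rA] := open_hball_sub (@open_interior _ _) (nbhs_singleton (nbhs_interior fxA)).
apply: filterS (nbhs_hball x (divr_gt0 r0 l0)) => y xy.
have fxy : hball (f x) r (f y) by rewrite /hball/= fl mulrC -ler_pdivlMr.
exact: (interior_subset (rA r (lexx r) _ fxy)).
Qed.

Variables (mu : {measure set HB -> \bar R}) (c : R).
Hypotheses (c_gt0 : 0 < c) (mu_neq0 : mu setT <> 0%E).
Hypothesis mu_ball : forall x r, msupport mu x -> 0 < r -> mu (hball x r) = (c * r ^+ 3)%:E.
Hypothesis vert : forall x t, msupport mu x -> msupport mu (vtr t x).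

Lemma measurable_vtr t : measurable_fun setT (vtr t : HB -> HB).
Proof.
apply: measurable_self_map; apply: (@similarity_continuous _ 1) => // x y.
by rewrite hdist_vtr mul1r.
Qed.

Lemma mu_vtr t (A : set HB) : measurable A -> mu (vtr t @^-1` A) = mu A.
Proof.
pose nu : {measure set HB -> \bar R} := image_measure mu (measurable_vtr t).
have ball x r : vtr t @^-1` hball x r = hball (vtr (- t) x) r.
  apply/seteqP; split=> y; rewrite /hball/=.
    by rewrite -(hdist_vtr t (vtr (- t) x)) vtrNK.
  by rewrite -(hdist_vtr t (vtr (- t) x)) vtrNK.
have mpre B : measurable (B : set HB) -> measurable (vtr t @^-1` B : set HB).
  by move=> mB; rewrite -[X in measurable X]setTI; exact: measurable_vtr.
have nuE B : nu B = mu (vtr t @^-1` B) by [].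
have preW : vtr t @^-1` (msupport mu) = msupport mu.
  apply/seteqP; split=> y /= sy; last exact: vert.
  by rewrite -(vtrK t y); exact: vert.
have lty := mu_hball_lty mu_neq0 mu_ball.
have nu_ball x r : nu (hball x r) = mu (hball (vtr (- t) x) r) by rewrite nuE ball.
move=> mA; rewrite -nuE.
have h0 r : 0 < r -> 0 < c * r ^+ 3 by move=> r0; exact: (mulr_gt0 c_gt0 (exprn_gt0 3 r0)).
have nuW B : measurable B -> nu B = nu (B `&` msupport mu).
  by move=> mB; rewrite !nuE preimage_setI preW; apply: measure_msupportI; exact: mpre.
have nu_lty x r : (nu (hball x r) < +oo)%E by rewrite nu_ball; exact: lty.
have nu_c x r : msupport mu x -> 0 < r -> nu (hball x r) = (c * r ^+ 3)%:E.
  by move=> sx r0; rewrite nu_ball; apply: (@mu_ball _ _ _ r0); exact: vert.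
exact: (uniform_measure_unique (measurable_msupport mu) nuW (@measure_msupportI _ mu)
  nu_lty lty h0 nu_c mu_ball mA).
Qed.

Definition slab : set HB := [set y | 0 <= hx3 y < 1].

Definition hsq (p y : H) : R := (hx1 y - hx1 p) ^+ 2 + (hx2 y - hx2 p) ^+ 2.

Lemma measurable_slab : measurable slab.
Proof.
have := measurable_hx3 measurableT (measurable_itv `[(0 : R), 1[).
rewrite setTI; congr (measurable _); apply/seteqP; split=> y /=; by rewrite in_itv.
Qed.

Lemma measurable_hsq p : measurable_fun setT (hsq p : HB -> R).
Proof.
apply: measurable_funD; apply: measurable_funX; apply: measurable_funB;
  try exact: measurable_cst; [exact: measurable_hx1|exact: measurable_hx2].
Qed.

Let tau (p y : H) : R := hx3 y - hx3 p + 2 * hx1 p * hx2 y - 2 * hx2 p * hx1 y.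

Let measurable_tau p : measurable_fun setT (tau p : HB -> R).
Proof.
apply: measurable_funB; last first.
  by apply: measurable_funM; [exact: measurable_cst|exact: measurable_hx1].
apply: measurable_funD; last first.
  by apply: measurable_funM; [exact: measurable_cst|exact: measurable_hx2].
by apply: measurable_funB; [exact: measurable_hx3|exact: measurable_cst].
Qed.

Let hdist_vtrX4 p t y : hdist p (vtr t y) ^+ 4 = hsq p y ^+ 2 + (tau p y + t) ^+ 2.
Proof. by rewrite hdistX4 /vtr !hpointE /hsq /tau; ring. Qed.

Let leb_sqr_le (a q : R) : leb [set t | (a + t) ^+ 2 <= q] = (2 * Num.sqrt q)%:E.
Proof.
have [q0|q0] := ltP q 0.
  rewrite ltr0_sqrtr// mulr0 (_ : [set t | _] = set0) ?measure0//.
  apply/seteqP; split=> // t /= h; have := le_trans (sqr_ge0 _) h.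
  by rewrite leNgt q0.
have s0 := sqrtr_ge0 q.
have -> : [set t : R | (a + t) ^+ 2 <= q] = `[- a - Num.sqrt q, - a + Num.sqrt q]%classic.
  apply/seteqP; split=> t /=; rewrite in_itv/=.
    move=> h; have : `|a + t| <= Num.sqrt q by rewrite -sqrtr_sqr ler_wsqrtr.
    by rewrite ler_norml => /andP[h1 h2]; apply/andP; split; lra.
  move=> /andP[h1 h2]; have h : `|a + t| <= Num.sqrt q.
    by rewrite ler_norml; apply/andP; split; lra.
  by rewrite -(sqr_sqrtr q0) -(real_normK (num_real (a + t))) lerXn2r ?nnegrE.
rewrite leb_itv/= lte_fin; case: ifPn => [_|]; first by rewrite -EFinB; congr (_%:E); ring.
rewrite -leNgt => h; have -> : Num.sqrt q = 0 by lra.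
by rewrite mulr0.
Qed.

Let leb_unit (a : R) : leb [set t | 0 <= a - t < 1] = 1%E.
Proof.
have -> : [set t : R | 0 <= a - t < 1] = `]a - 1, a]%classic.
  by apply/seteqP; split=> t /=; rewrite in_itv/= => /andP[h1 h2]; apply/andP; split; lra.
by rewrite leb_itv/= lte_fin ifT -?EFinB; [congr (_%:E); ring|lra].
Qed.

Let mu_sf : sigma_finite setT mu := sigma_finite_mu mu_neq0 mu_ball.

Let fub := @sfinite_Fubini _ _ R HB R (sfinite_of sigma_finite_leb) (sfinite_of mu_sf).

(** Fubini on pairs of a height [t] and a point. By invariance, for each [t] the points of the slab
    whose translate by [t] lies in the ball have the same mass as the points of the ball whose
    translate by [- t] lies in the slab. For a fixed point the heights have the length of a vertical
    chord of the ball in the first form and length 1 in the second. *)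
Lemma slab_ball p r : 0 < r -> mu (hball p r) =
  (\int[mu]_y (\1_slab y * (2 * Num.sqrt (r ^+ 4 - hsq p y ^+ 2)))%:E)%E.
Proof.
move=> r0.
pose A := [set z : R * HB | slab z.2] `&`
  [set z : R * HB | hsq p z.2 ^+ 2 + (tau p z.2 + z.1) ^+ 2 <= r ^+ 4].
pose B := [set z : R * HB | 0 <= hx3 z.2 - z.1 < 1] `&` [set z : R * HB | hball p r z.2].
have m1 : measurable_fun setT (fun z : R * HB => z.1) by exact: measurable_fst.
have m2 (f : HB -> R) : measurable_fun setT f -> measurable_fun setT (fun z : R * HB => f z.2).
  by move=> mf; exact: (measurableT_comp mf measurable_snd).
have ms (C : set HB) : measurable C -> measurable [set z : R * HB | C z.2].
  have h : measurable_fun setT (@snd R HB) by exact: measurable_snd.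
  by move=> mC; rewrite -[X in measurable X]setTI; exact: (h measurableT _ mC).
have mA : measurable A.
  apply: measurableI; first exact: (ms _ measurable_slab).
  have mq : measurable_fun setT (fun z : R * HB => hsq p z.2 ^+ 2 + (tau p z.2 + z.1) ^+ 2).
    apply: measurable_funD; apply: measurable_funX; first exact: (m2 _ (measurable_hsq p)).
    by apply: measurable_funD => //; exact: (m2 _ (measurable_tau p)).
  have := mq measurableT _ (measurable_itv `]-oo, r ^+ 4]).
  rewrite setTI; congr (measurable _); apply/seteqP; split=> z /=; by rewrite in_itv.
have mB : measurable B.
  apply: measurableI; last exact: (ms _ (measurable_hball p r)).
  have mq : measurable_fun setT (fun z : R * HB => hx3 z.2 - z.1).
    by apply: measurable_funB => //; exact: (m2 _ measurable_hx3).
  have := mq measurableT _ (measurable_itv `[0, 1[).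
  rewrite setTI; congr (measurable _); apply/seteqP; split=> z /=; by rewrite in_itv.
have f0 (C : set (R * HB)) z : (0 <= (\1_C z)%:E :> \bar R)%E by rewrite lee_fin.
have mi (C : set (R * HB)) : measurable C -> measurable_fun setT (fun z => (\1_C z)%:E : \bar R).
  by move=> mC; apply/measurable_EFinP; exact: measurable_indic.
have fubA : (\int[leb]_t \int[mu]_y (\1_A (t, y))%:E =
  \int[mu]_y \int[leb]_t (\1_A (t, y))%:E)%E := fub (f0 A) (mi _ mA).
have fubB : (\int[leb]_t \int[mu]_y (\1_B (t, y))%:E =
  \int[mu]_y \int[leb]_t (\1_B (t, y))%:E)%E := fub (f0 B) (mi _ mB).
have msT (C : set (R * HB)) (y : HB) : measurable C -> measurable [set t : R | C (t, y)].
  move=> mC; have := measurable_ysection y mC.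
  by congr (measurable _); apply/seteqP; split=> t /=; rewrite /ysection/= inE.
have msY (C : set (R * HB)) (t : R) : measurable C -> measurable [set y : HB | C (t, y)].
  move=> mC; have := measurable_xsection t mC.
  by congr (measurable _); apply/seteqP; split=> y /=; rewrite /xsection/= inE.
have secT (C : set (R * HB)) (y : HB) : measurable C ->
    (\int[leb]_t (\1_C (t, y))%:E = leb [set t | C (t, y)])%E.
  move=> mC; rewrite -[X in leb X]setIT -(integral_indic leb measurableT (msT _ y mC)).
  by apply: eq_integral => t _; rewrite !indicE; congr ((nat_of_bool _)%:R%:E);
    apply/idP/idP; rewrite !inE.
have secY (C : set (R * HB)) (t : R) : measurable C ->
    (\int[mu]_y (\1_C (t, y))%:E = mu [set y | C (t, y)])%E.
  move=> mC; rewrite -[X in mu X]setIT -(integral_indic mu measurableT (msY _ t mC)).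
  by apply: eq_integral => y _; rewrite !indicE; congr ((nat_of_bool _)%:R%:E);
    apply/idP/idP; rewrite !inE.
have AB t : (\int[mu]_y (\1_A (t, y))%:E = \int[mu]_y (\1_B (t, y))%:E)%E.
  rewrite !secY// -[RHS](mu_vtr t (msY _ t mB)).
  congr (mu _); apply/seteqP; split=> y /=; rewrite /A /B /slab /hball/= /vtr !hpointE addrK.
    move=> [sy h]; split=> //; apply: ler_X4; [exact: hdist_ge0|exact: ltW|].
    by rewrite (hdist_vtrX4 p t y).
  move=> [sy h]; split=> //; rewrite -hdist_vtrX4.
  by rewrite lerXn2r ?nnegrE ?hdist_ge0 ?(ltW r0).
have -> : (\int[mu]_y (\1_slab y * (2 * Num.sqrt (r ^+ 4 - hsq p y ^+ 2)))%:E =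
    \int[mu]_y \int[leb]_t (\1_A (t, y))%:E)%E.
  apply: eq_integral => y _; rewrite (secT A y mA) indicE; have [|yS] := boolP (y \in slab).
    rewrite inE => yS; rewrite mul1r -(leb_sqr_le (tau p y)); apply: (congr1 leb).
    apply/seteqP; split=> t /=; first by rewrite lerBrDr addrC => h; split.
    by move=> [_ /=]; rewrite lerBrDr addrC.
  have -> : [set t : R | A (t, y)] = set0.
    by apply/seteqP; split=> t; [case; move: yS; rewrite notin_setE|case].
  by rewrite mul0r measure0.
have fAB : (\int[leb]_t \int[mu]_y (\1_A (t, y))%:E = \int[leb]_t \int[mu]_y (\1_B (t, y))%:E)%E.
  by apply: eq_integral => t _; exact: AB.
rewrite -fubA fAB fubB.
rewrite -[X in mu X](setIT (hball p r)) -(integral_indic mu measurableT (measurable_hball p r)).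
apply: eq_integral => y _; rewrite (secT B y mB) indicE; have [|yB] := boolP (y \in hball p r).
  rewrite inE => yB; rewrite -(leb_unit (hx3 y)); apply: (congr1 leb).
  by apply/seteqP; split=> t /=; [move=> h; split|case].
have -> : [set t : R | B (t, y)] = set0.
  by apply/seteqP; split=> t; [case=> _; move: yB; rewrite notin_setE|case].
by rewrite measure0.
Qed.

Let max0 p (q : R) y : R := \1_slab y * Num.max (q - hsq p y ^+ 2) 0.

Let max0_ge0 p q y : 0 <= max0 p q y.
Proof. by rewrite mulr_ge0// le_max lexx orbT. Qed.

Let measurable_slab1 : measurable_fun setT (\1_slab : HB -> R).
Proof. by apply: measurable_indic; exact: measurable_slab. Qed.

Let measurable_gap p q : measurable_fun setT (fun y : HB => q - hsq p y ^+ 2).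
Proof.
apply: measurable_funB; first exact: measurable_cst.
by apply: measurable_funX; exact: measurable_hsq.
Qed.

Let measurable_max0 p q : measurable_fun setT (max0 p q).
Proof.
apply: measurable_funM; first exact: measurable_slab1.
by apply: measurable_maxr; [exact: measurable_gap|exact: measurable_cst].
Qed.

(* Integrating the mass of the balls of radius [(rho^4 - b^2)^(1/4)] in [b]
   replaces the Abel kernel by a truncated linear one. *)
Let max0_integral : exists2 k : R, 0 < k & forall p rho, msupport mu p -> 0 < rho ->
  (\int[mu]_y (max0 p (rho ^+ 4) y)%:E = (k * rho ^+ 5)%:E)%E.
Proof.
have [k1 k10 k1E] := @sqrt_bump R; have [k2 k20 k2E] := @root3_bump R.
exists (c * k2 / (2 * k1)); first by rewrite divr_gt0 ?mulr_gt0.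
move=> p rho sp rho0.
pose g (z : R * HB) : \bar R :=
  (\1_slab z.2 * (2 * Num.sqrt (rho ^+ 4 - hsq p z.2 ^+ 2 - z.1 ^+ 2)))%:E.
have m2 (f : HB -> R) : measurable_fun setT f -> measurable_fun setT (fun z : R * HB => f z.2).
  by move=> mf; exact: (measurableT_comp mf measurable_snd).
have mg : measurable_fun setT g.
  apply/measurable_EFinP; apply: measurable_funM; first exact: (m2 _ measurable_slab1).
  apply: measurable_funM; first exact: measurable_cst.
  have mi : measurable_fun setT (fun z : R * HB => rho ^+ 4 - hsq p z.2 ^+ 2 - z.1 ^+ 2).
    apply: measurable_funB; first exact: (m2 _ (measurable_gap p _)).
    by apply: measurable_funX; exact: measurable_fst.
  exact: (measurableT_comp (@measurable_sqrtr R) mi).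
have g0 z : (0 <= g z)%E by rewrite lee_fin mulr_ge0// mulr_ge0// sqrtr_ge0.
have fubg : (\int[leb]_b \int[mu]_y g (b, y) = \int[mu]_y \int[leb]_b g (b, y))%E := fub g0 mg.
have left b : (\int[mu]_y g (b, y) = (c * root3 (rho ^+ 4 - b ^+ 2))%:E)%E.
  have [q0|q0] := leP (rho ^+ 4 - b ^+ 2) 0.
    rewrite /root3 (ler0_sqrtr q0) sqrtr0 expr0n/= mulr0 integral0_eq// => y _.
    rewrite /g /= ler0_sqrtr ?mulr0//; apply: le_trans q0.
    by rewrite addrAC gerBl sqr_ge0.
  pose r := Num.sqrt (Num.sqrt (rho ^+ 4 - b ^+ 2)).
  have r0 : 0 < r by rewrite !sqrtr_gt0.
  have r4 : r ^+ 4 = rho ^+ 4 - b ^+ 2.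
    by rewrite (exprM r 2 2) !sqr_sqrtr ?sqrtr_ge0// ltW.
  have := slab_ball p r0; rewrite (mu_ball sp r0) -/(root3 _) => ->.
  by apply: eq_integral => y _; rewrite /g /= r4 addrAC.
have right y : (\int[leb]_b g (b, y) = ((2 * k1) * max0 p (rho ^+ 4) y)%:E)%E.
  have s0 : 0 <= 2 * \1_slab y :> R by rewrite mulr_ge0.
  transitivity (\int[leb]_b ((2 * \1_slab y)%:E * (Num.sqrt ((rho ^+ 4 - hsq p y ^+ 2) - b ^+ 2))%:E))%E.
    by apply: eq_integral => b _; rewrite -EFinM /g /=; congr (_%:E); ring.
  have mb : measurable_fun setT (fun b : R => (Num.sqrt ((rho ^+ 4 - hsq p y ^+ 2) - b ^+ 2))%:E : \bar R).
    apply/measurable_EFinP.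
    have mi : measurable_fun setT (fun b : R => rho ^+ 4 - hsq p y ^+ 2 - b ^+ 2).
      apply: measurable_funB; first exact: measurable_cst.
      by apply: measurable_funX; exact: measurable_id.
    exact: (measurableT_comp (@measurable_sqrtr R) mi).
  rewrite (ge0_integralZl_EFin _ _ _ mb)//.
  by rewrite k1E -EFinM /max0; congr (_%:E); ring.
have L : (\int[leb]_b \int[mu]_y g (b, y) = (c * (k2 * rho ^+ 5))%:E)%E.
  transitivity (\int[leb]_b (c%:E * (root3 (rho ^+ 4 - b ^+ 2))%:E))%E.
    by apply: eq_integral => b _; rewrite left EFinM.
  have mb : measurable_fun setT (fun b : R => (root3 (rho ^+ 4 - b ^+ 2))%:E : \bar R).
    apply/measurable_EFinP.
    have mi : measurable_fun setT (fun b : R => rho ^+ 4 - b ^+ 2).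
      apply: measurable_funB; first exact: measurable_cst.
      by apply: measurable_funX; exact: measurable_id.
    apply: measurable_funX.
    exact: (measurableT_comp (measurableT_comp (@measurable_sqrtr R) (@measurable_sqrtr R)) mi).
  rewrite (ge0_integralZl_EFin _ _ _ mb) ?(ltW c_gt0)//; last first.
    by move=> b _; rewrite lee_fin /root3 exprn_ge0// sqrtr_ge0.
  by rewrite k2E// -EFinM.
have k1' : 0 <= 2 * k1 by rewrite mulr_ge0// ltW.
have mm : measurable_fun setT (fun y : HB => (max0 p (rho ^+ 4) y)%:E : \bar R).
  by apply/measurable_EFinP; exact: measurable_max0.
have Rt : (\int[mu]_y \int[leb]_b g (b, y) =
    (2 * k1)%:E * \int[mu]_y (max0 p (rho ^+ 4) y)%:E)%E.
  transitivity (\int[mu]_y ((2 * k1)%:E * (max0 p (rho ^+ 4) y)%:E))%E.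
    by apply: eq_integral => y _; rewrite right EFinM.
  by rewrite (ge0_integralZl_EFin _ _ _ mm)//; move=> y _; rewrite lee_fin max0_ge0.
have k1n : 2 * k1 != 0 by rewrite gt_eqF// mulr_gt0.
have e : ((2 * k1)%:E * \int[mu]_y (max0 p (rho ^+ 4) y)%:E = (c * (k2 * rho ^+ 5))%:E)%E.
  by rewrite -Rt -fubg L.
move: e; set X := (\int[mu]_y _)%E => e.
have -> : X = ((2 * k1)^-1%:E * ((2 * k1)%:E * X))%E by rewrite muleA -EFinM mulVf// mul1e.
by rewrite e -EFinM; congr (_%:E); ring.
Qed.

(** The limit [t] to 1 from above; the constant 15 comes from [(1 + d) ^ 4 <= 1 + 15 d] for
    [0 <= d <= 1]. *)
Let limit_pow4 (A B : R) : 0 <= B -> (forall t, 1 < t -> A <= B * t ^+ 4) -> A <= B.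
Proof.
move=> B0 h; apply/ler_addgt0Pr => e e0.
pose d := Num.min 1 (e / (15 * B + 1)).
have B1 : 0 < 15 * B + 1 by rewrite ltr_wpDl// mulr_ge0.
have d0 : 0 < d by rewrite lt_min ltr01 divr_gt0.
have d1 : d <= 1 by rewrite ge_min lexx.
have de : d * (15 * B + 1) <= e by rewrite -ler_pdivlMr// ge_min lexx orbT.
apply: (le_trans (h (1 + d) _)); first by rewrite ltrDl.
have p2 : d ^+ 2 <= d by rewrite expr2 ler_piMr// ltW.
have p3 : d ^+ 3 <= d by rewrite exprS ler_piMr ?(ltW d0)// exprn_ile1// ltW.
have p4 : d ^+ 4 <= d by rewrite exprS ler_piMr ?(ltW d0)// exprn_ile1// ltW.
have t4 : (1 + d) ^+ 4 <= 1 + 15 * d.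
  rewrite (_ : (1 + d) ^+ 4 = 1 + 4 * d + 6 * d ^+ 2 + 4 * d ^+ 3 + d ^+ 4); last by ring.
  by move: p2 p3 p4; lra.
apply: (le_trans (ler_wpM2l B0 t4)); rewrite mulrDr mulr1 lerD2l; apply: le_trans de.
by rewrite mulrDr mulr1 (_ : B * (15 * d) = d * (15 * B)); [rewrite lerDl ltW|ring].
Qed.

Lemma measurable_slab_disc p r : measurable (slab `&` [set y : HB | hsq p y <= r ^+ 2]).
Proof.
apply: measurableI; first exact: measurable_slab.
have := measurable_hsq p measurableT (measurable_itv `]-oo, r ^+ 2]).
by rewrite setTI; congr (measurable _); apply/seteqP; split=> y /=; rewrite in_itv.
Qed.

(** As a function of [q = rho ^ 4] the integral of [max0 p q] is convex, its derivative is the mass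
    of the disc, and it equals [C q ^ (5/4)]; hence the mass [5 C rho / 4]. Instead of
    differentiating, difference quotients between [rho] and [rho * t] and between [rho / t] and
    [rho] are compared for [t] close to 1. *)
Lemma slab_disc : exists2 k : R, 0 < k & forall p rho, msupport mu p -> 0 < rho ->
  mu (slab `&` [set y | hsq p y <= rho ^+ 2]) = (k * rho)%:E.
Proof.
have [C C0 CE] := max0_integral; exists (5 * C / 4); first by rewrite divr_gt0// mulr_gt0.
move=> p rho sp rho0.
pose D r : set HB := slab `&` [set y | hsq p y <= r ^+ 2].
have mD r : measurable (D r) := measurable_slab_disc p r.
have h0 y : 0 <= hsq p y by rewrite addr_ge0 ?sqr_ge0.
have mmax q : measurable_fun setT (fun y : HB => (max0 p q y)%:E : \bar R).
  by apply/measurable_EFinP; exact: measurable_max0.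
have e4 r : r ^+ 4 = (r ^+ 2) ^+ 2 :> R by rewrite -exprM.
have mind' q r : measurable_fun setT (fun y : HB => (q * \1_(D r) y)%:E : \bar R).
  apply/measurable_EFinP; apply: measurable_funM; first exact: measurable_cst.
  by apply: measurable_indic; exact: mD.
have intD q r : 0 <= q -> (\int[mu]_y (q * \1_(D r) y)%:E = q%:E * mu (D r))%E.
  move=> q0; transitivity (\int[mu]_y (q%:E * (\1_(D r) y)%:E))%E.
    by apply: eq_integral => y _; rewrite EFinM.
  rewrite ge0_integralZl_EFin//; first by rewrite integral_indic// setIT.
  by apply/measurable_EFinP; apply: measurable_indic; exact: mD.
have gap0 (r r' : R) : 0 < r -> r < r' -> 0 <= r' ^+ 4 - r ^+ 4.
  move=> r0 rr; have r'0 : 0 <= r' by rewrite ltW// (lt_trans r0).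
  by rewrite subr_ge0 lerXn2r ?nnegrE ?(ltW r0) ?(ltW rr).
have upper r r' : 0 < r -> r < r' ->
    ((r' ^+ 4 - r ^+ 4)%:E * mu (D r) + (C * r ^+ 5)%:E <= (C * r' ^+ 5)%:E)%E.
  move=> r0 rr; have r'0 : 0 < r' by rewrite (lt_trans r0).
  have g0 := gap0 _ _ r0 rr.
  rewrite -(CE p r)// -(CE p r')// -intD// -ge0_integralD//; last 2 first.
  - by move=> y _; rewrite lee_fin mulr_ge0.
  - by move=> y _; rewrite lee_fin max0_ge0.
  apply: ge0_le_integral => //.
  - by move=> y _; apply: adde_ge0; rewrite lee_fin; [exact: mulr_ge0|exact: max0_ge0].
  - by apply: emeasurable_funD.
  move=> y _; rewrite -EFinD lee_fin /max0 /D !indicE in_setI.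
  have [_|_] := boolP (y \in slab); last by rewrite /= !mul0r mulr0 addr0.
  rewrite !mul1r andTb; have [|] := boolP (y \in _); rewrite ?notin_setE ?inE/= => hr.
    have h4 : hsq p y ^+ 2 <= r ^+ 4 by rewrite e4 lerXn2r ?nnegrE ?sqr_ge0.
    by rewrite mulr1 !max_l ?subr_ge0//; lra.
  by rewrite mulr0 add0r ge_max le_max lerD2r -subr_ge0 g0 le_max lexx orbT.
have lower r r' : 0 < r -> r < r' ->
    ((C * r' ^+ 5)%:E <= (r' ^+ 4 - r ^+ 4)%:E * mu (D r') + (C * r ^+ 5)%:E)%E.
  move=> r0 rr; have r'0 : 0 < r' by rewrite (lt_trans r0).
  have g0 := gap0 _ _ r0 rr.
  rewrite -(CE p r)// -(CE p r')// -intD// -ge0_integralD//; last 2 first.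
  - by move=> y _; rewrite lee_fin mulr_ge0.
  - by move=> y _; rewrite lee_fin max0_ge0.
  apply: ge0_le_integral => //.
  - by move=> y _; rewrite lee_fin max0_ge0.
  - by apply: emeasurable_funD.
  move=> y _; rewrite -EFinD lee_fin /max0 /D !indicE in_setI.
  have [_|_] := boolP (y \in slab); last by rewrite /= !mul0r mulr0 addr0.
  rewrite !mul1r andTb; have [|] := boolP (y \in _); rewrite ?notin_setE ?inE/= => hr.
    rewrite mulr1 ge_max; apply/andP; split; last by rewrite addr_ge0// le_max lexx orbT.
    have : r ^+ 4 - hsq p y ^+ 2 <= Num.max (r ^+ 4 - hsq p y ^+ 2) 0 by rewrite le_max lexx.
    by move: (Num.max _ _) => m; rewrite -(lerD2l (r' ^+ 4 - r ^+ 4)) addrA subrK.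
  have h4 : r' ^+ 4 <= hsq p y ^+ 2.
    by rewrite e4 lerXn2r ?nnegrE ?sqr_ge0// ltW// ltNge; apply/negP.
  by rewrite mulr0 add0r ge_max !le_max lexx !orbT andbT subr_le0 h4 orbT.
have Dfin r : 0 < r -> mu (D r) \is a fin_num.
  move=> r0; rewrite ge0_fin_numE//; have rr : r < 2 * r by rewrite ltr_pMl// ltr1n.
  rewrite ltey; apply/eqP => Dr; have := upper _ _ r0 rr; rewrite Dr.
  have g1 : 0 < (2 * r) ^+ 4 - r ^+ 4.
    by rewrite (_ : _ - _ = 15 * r ^+ 4); [rewrite mulr_gt0// exprn_gt0|ring].
  by rewrite gt0_muley ?lte_fin// addye.
pose phi r := fine (mu (D r)).
have phiE r : 0 < r -> mu (D r) = (phi r)%:E by move=> r0; rewrite fineK// Dfin.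
have phi0 r : 0 <= phi r by rewrite fine_ge0.
have up r r' : 0 < r -> r < r' -> (r' ^+ 4 - r ^+ 4) * phi r + C * r ^+ 5 <= C * r' ^+ 5.
  by move=> r0 rr; have := upper _ _ r0 rr; rewrite phiE// -EFinM -EFinD lee_fin.
have lo r r' : 0 < r -> r < r' -> C * r' ^+ 5 <= (r' ^+ 4 - r ^+ 4) * phi r' + C * r ^+ 5.
  move=> r0 rr; have := lower _ _ r0 rr.
  by rewrite phiE ?(lt_trans r0)// -EFinM -EFinD lee_fin.
rewrite -/(D rho) phiE//; congr (_%:E); apply/eqP; rewrite eq_le; apply/andP; split.
  rewrite -(ler_pM2l (_ : 0 < 4 :> R))//.
  rewrite (_ : 4 * (5 * C / 4 * rho) = 5 * C * rho); last by field.
  apply: limit_pow4; first by rewrite !mulr_ge0// ltW.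
  move=> t t1; have t0 : 0 < t by rewrite (lt_trans _ t1).
  have rt : rho < rho * t by rewrite ltr_pMr.
  have h := up _ _ rho0 rt.
  have w : 0 < (t - 1) * rho ^+ 4 by rewrite mulr_gt0 ?subr_gt0// exprn_gt0.
  have h2 : (t ^+ 3 + t ^+ 2 + t + 1) * phi rho <= C * rho * (t ^+ 4 + t ^+ 3 + t ^+ 2 + t + 1).
    rewrite -(ler_pM2l w); move: h.
    rewrite -lerBrDr (_ : ((rho * t) ^+ 4 - rho ^+ 4) * phi rho =
      (t - 1) * rho ^+ 4 * ((t ^+ 3 + t ^+ 2 + t + 1) * phi rho)); last by ring.
    by rewrite (_ : C * (rho * t) ^+ 5 - C * rho ^+ 5 = (t - 1) * rho ^+ 4 *
      (C * rho * (t ^+ 4 + t ^+ 3 + t ^+ 2 + t + 1))); last by ring.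
  have p2 : 1 <= t ^+ 2 by rewrite exprn_ege1// ltW.
  have p3 : 1 <= t ^+ 3 by rewrite exprn_ege1// ltW.
  have q3 : t ^+ 3 <= t ^+ 4 by rewrite ler_weXn2l// ltW.
  have q2 : t ^+ 2 <= t ^+ 4 by rewrite ler_weXn2l// ltW.
  have q1 : t <= t ^+ 4 by rewrite -[leLHS]expr1 ler_weXn2l// ltW.
  have q0 : 1 <= t ^+ 4 by rewrite exprn_ege1// ltW.
  have a1 : 4 <= t ^+ 3 + t ^+ 2 + t + 1 by move: p2 p3 t1; lra.
  have a2 : t ^+ 4 + t ^+ 3 + t ^+ 2 + t + 1 <= 5 * t ^+ 4 by move: q3 q2 q1 q0; lra.
  have Cr : 0 <= C * rho by rewrite mulr_ge0// ltW.
  apply: (le_trans (ler_wpM2r (phi0 rho) a1)); apply: (le_trans h2).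
  by apply: (le_trans (ler_wpM2l Cr a2)); rewrite le_eqVlt; apply/orP; left; apply/eqP; ring.
rewrite -(ler_pM2l (_ : 0 < 4 :> R))//.
rewrite (_ : 4 * (5 * C / 4 * rho) = 5 * C * rho); last by field.
apply: limit_pow4; first by rewrite mulr_ge0.
move=> t t1; have t0 : 0 < t by rewrite (lt_trans _ t1).
pose r := rho / t; have r0 : 0 < r by rewrite divr_gt0.
have rE : rho = r * t by rewrite /r divfK// gt_eqF.
have rt : r < rho by rewrite [ltRHS]rE ltr_pMr.
have h := lo _ _ r0 rt.
have w : 0 < (t - 1) * r ^+ 4 by rewrite mulr_gt0 ?subr_gt0// exprn_gt0.
have h2 : C * r * (t ^+ 4 + t ^+ 3 + t ^+ 2 + t + 1) <= (t ^+ 3 + t ^+ 2 + t + 1) * phi rho.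
  have h' : C * (r * t) ^+ 5 <= ((r * t) ^+ 4 - r ^+ 4) * phi rho + C * r ^+ 5 by rewrite -rE.
  rewrite -(ler_pM2l w); move: h'; rewrite -lerBlDr.
  move: (phi rho) => f.
  rewrite (_ : ((r * t) ^+ 4 - r ^+ 4) * f =
    (t - 1) * r ^+ 4 * ((t ^+ 3 + t ^+ 2 + t + 1) * f)); last by ring.
  by rewrite (_ : C * (r * t) ^+ 5 - C * r ^+ 5 = (t - 1) * r ^+ 4 *
    (C * r * (t ^+ 4 + t ^+ 3 + t ^+ 2 + t + 1))); last by ring.
have p1 : 1 <= t ^+ 1 by rewrite expr1 ltW.
have p2 : 1 <= t ^+ 2 by rewrite exprn_ege1// ltW.
have p3 : 1 <= t ^+ 3 by rewrite exprn_ege1// ltW.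
have p4 : 1 <= t ^+ 4 by rewrite exprn_ege1// ltW.
have q2 : t ^+ 2 <= t ^+ 3 by rewrite ler_weXn2l// ltW.
have q1 : t <= t ^+ 3 by rewrite -[leLHS]expr1 ler_weXn2l// ltW.
have a1 : t ^+ 3 + t ^+ 2 + t + 1 <= 4 * t ^+ 3 by move: p3 q2 q1; lra.
have a2 : 5 <= t ^+ 4 + t ^+ 3 + t ^+ 2 + t + 1 by move: p4 p3 p2 t1; lra.
have Cr : 0 <= C * r by rewrite mulr_ge0// ltW.
have b1 : C * r * 5 <= 4 * t ^+ 3 * phi rho.
  apply: (le_trans (ler_wpM2l Cr a2)); apply: (le_trans h2); exact: (ler_wpM2r (phi0 rho) a1).
have := ler_wpM2r (ltW t0) b1.
rewrite (_ : C * r * 5 * t = 5 * C * (r * t)); last by ring.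
by rewrite -rE (_ : 4 * t ^+ 3 * phi rho * t = 4 * phi rho * t ^+ 4); last by ring.
Qed.

End VerticalMeasure.

(** * Flatness of the planar trace *)

Section RealIntervals.
Context {R : realType}.

Lemma lipschitz_within (f : R -> R) (M a b : R) :
  (forall s t, a <= s <= b -> a <= t <= b -> `|f s - f t| <= M * `|s - t|) ->
  {within `[a, b], continuous f}.
Proof.
move=> fM; apply/subspace_continuousP => x /=; rewrite in_itv/= => xab.
apply/cvgrPdist_le => e e0; rewrite near_withinE.
have M1 : 0 < `|M| + 1 by rewrite ltr_pwDr.
exists (e / (`|M| + 1)); first by rewrite /= divr_gt0.
move=> y /= xy; rewrite in_itv/= => yab; apply: (le_trans (fM _ _ xab yab)).
apply: (@le_trans _ _ ((`|M| + 1) * `|x - y|)).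
  by rewrite ler_wpM2r// (le_trans (ler_norm _))// lerDl.
by rewrite mulrC -ler_pdivlMr// ltW.
Qed.

Lemma clopen_real (A : R -> Prop) t0 : A t0 ->
  (forall t, A t -> exists2 d, 0 < d & forall s, `|s - t| < d -> A s) ->
  (forall t, (forall e, 0 < e -> exists2 s, `|s - t| < e & A s) -> A t) ->
  forall t, A t.
Proof.
move=> At0 opA clA t.
have cR : connected [set: R] by apply/connected_intervalP.
suff -> : A = [set: R] by [].
apply: cR; first by exists t0.
- exists A; last by rewrite setTI.
  rewrite openE => s /opA[d d0 dA]; exists d => // u /=; rewrite distrC; exact: dA.
exists A; last by rewrite setTI.
move=> s clAs; apply: clA => e e0.
have [u [Au su]] := clAs _ (nbhsx_ballx s e e0).
by exists u => //; move: su; rewrite /ball /= distrC.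
Qed.

(** From a maximum point step symmetrically until one end of the interval is reached. The value
    there is 0, the other one is at most the maximum, and their sum is twice the maximum. *)
Lemma midpoint_le0 (w : R -> R) (a b : R) : a <= b -> {within `[a, b], continuous w} ->
  w a = 0 -> w b = 0 ->
  (forall s h, 0 < h -> a <= s - h -> s + h <= b -> w (s - h) + w (s + h) = 2 * w s) ->
  forall s, a <= s <= b -> w s <= 0.
Proof.
move=> ab cw wa wb mid s sab.
have [m + mmax] := EVT_max ab cw; rewrite in_itv/= => /andP[am mb].
apply: (le_trans (mmax s _)); first by rewrite in_itv.
pose h := Num.min (m - a) (b - m).
have h0 : 0 <= h by rewrite le_min !subr_ge0 am.
have ha : a <= m - h by rewrite lerBrDl -lerBrDr ge_min lexx.
have hb : m + h <= b by rewrite -lerBrDl ge_min lexx orbT.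
have hend : m - h = a \/ m + h = b.
  by rewrite /h; case: (leP (m - a) (b - m)) => _; [left|right]; ring.
have [h00|h00] := eqVneq h 0.
  by case: hend; rewrite h00 ?subr0 ?addr0 => ->; rewrite ?wa ?wb.
have hp : 0 < h by rewrite lt_neqAle eq_sym h00.
have e := mid _ _ hp ha hb.
have m1 : w (m - h) <= w m.
  by apply: mmax; rewrite in_itv/= ha/= (le_trans _ hb)// lerD2l ge0_cp.
have m2 : w (m + h) <= w m.
  by apply: mmax; rewrite in_itv/= hb andbT (le_trans ha)// lerD2l ge0_cp.
by case: hend => E; move: e m1 m2; rewrite E ?wa ?wb; lra.
Qed.

End RealIntervals.

(** * Disc packings along a planar curve *)

Section PlaneCurve.
Context {R : realType}.
Implicit Types (g : R -> R -> Prop) (a b r s t x y : R).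

Definition dsq a b x y : R := (x - a) ^+ 2 + (y - b) ^+ 2.

Lemma dsq_ge0 a b x y : 0 <= dsq a b x y.
Proof. by rewrite addr_ge0// sqr_ge0. Qed.

Lemma dsqC a b x y : dsq a b x y = dsq x y a b.
Proof. by rewrite /dsq; ring. Qed.

Lemma eq_refl_le (x y : R) : x = y -> x <= y.
Proof. by move=> ->. Qed.

Lemma dsq_triangle x y a b a' b' (r r' : R) : 0 <= r -> 0 <= r' ->
  dsq a b x y <= r ^+ 2 -> dsq x y a' b' <= r' ^+ 2 -> dsq a b a' b' <= (r + r') ^+ 2.
Proof.
move=> r0 r'0 h h'; have := sqr_norm_add r0 r'0 h h'; rewrite /dsq.
by rewrite (_ : x - a + (a' - x) = a' - a) 1?(_ : y - b + (b' - y) = b' - b)//; ring.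
Qed.

Lemma dsq_coord a b x y r : 0 <= r -> dsq a b x y <= r ^+ 2 -> `|x - a| <= r /\ `|y - b| <= r.
Proof.
move=> r0 h; split; rewrite -(ler_pXn2r (ltn0Sn 1)) ?nnegrE// real_normK ?num_real//;
  apply: le_trans h; by rewrite /dsq ?lerDl ?lerDr sqr_ge0.
Qed.

Lemma ler_shrink (q r : R) : 0 < r -> (forall th, 0 < th -> th < 1 -> th * q <= r) -> q <= r.
Proof.
move=> r0 h; rewrite leNgt; apply/negP => rq; have q0 := lt_trans r0 rq.
have := h ((r / q + 1) / 2).
have rq1 : r / q < 1 by rewrite ltr_pdivrMr// mul1r.
have rq0 : 0 < r / q by rewrite divr_gt0.
rewrite (_ : (r / q + 1) / 2 * q = (r + q) / 2); last by field; rewrite gt_eqF.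
have a1 : 0 < (r / q + 1) / 2 by rewrite divr_gt0// addr_gt0.
have a2 : (r / q + 1) / 2 < 1 by rewrite ltr_pdivrMr// mul1r ltrD2r.
move=> /(_ a1 a2); move: rq; lra.
Qed.

Lemma near_interval (a b r q x t : R) : `|a| <= q -> `|b| <= q -> a <= t -> t <= b + r ->
  `|x - t| <= r -> `|x| <= q + 2 * r.
Proof.
rewrite !ler_norml => /andP[? _] /andP[_ ?] ? ? /andP[? ?].
by apply/andP; split; lra.
Qed.

Lemma three_terms (u v w r q : R) : `|u| <= r -> `|v| <= r -> `|w| <= q ->
  `|u + v + w| <= q + 2 * r.
Proof.
move=> hu hv hw; rewrite (le_trans (ler_normD _ _))//; have := ler_normD u v.
by move: hu hv hw; lra.
Qed.

(** Inclusion and disjointness of discs are meant relative to the curve, which is all that a measure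
    on the curve can see; elsewhere the discs may overlap. *)
Definition inside g a' b' r' a b r :=
  forall x y, g x y -> dsq a' b' x y <= r' ^+ 2 -> dsq a b x y <= r ^+ 2.

Definition apart g a b r a' b' r' :=
  forall x y, g x y -> dsq a b x y <= r ^+ 2 -> dsq a' b' x y <= r' ^+ 2 -> False.

(** What a mass proportional to the radius implies. Two discs serve for the straightness of arcs,
    three for the exclusion of points off a line. *)
Definition packing2 g := forall a b r a1 b1 r1 a2 b2 r2,
  g a b -> g a1 b1 -> g a2 b2 -> 0 < r -> 0 < r1 -> 0 < r2 ->
  apart g a1 b1 r1 a2 b2 r2 -> inside g a1 b1 r1 a b r -> inside g a2 b2 r2 a b r ->
  r1 + r2 <= r.

Definition packing3 g := forall a b r a1 b1 r1 a2 b2 r2 a3 b3 r3,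
  g a b -> g a1 b1 -> g a2 b2 -> g a3 b3 -> 0 < r -> 0 < r1 -> 0 < r2 -> 0 < r3 ->
  apart g a1 b1 r1 a2 b2 r2 -> apart g a1 b1 r1 a3 b3 r3 -> apart g a2 b2 r2 a3 b3 r3 ->
  inside g a1 b1 r1 a b r -> inside g a2 b2 r2 a b r -> inside g a3 b3 r3 a b r ->
  r1 + r2 + r3 <= r.

Lemma packing2_translate g a0 b0 : packing2 g -> packing2 (fun x y => g (a0 + x) (b0 + y)).
Proof.
move=> P a b r a1 b1 r1 a2 b2 r2 g0 g1 g2 r0 r10 r20 D I1 I2.
have e c d x y : dsq (a0 + c) (b0 + d) x y = dsq c d (x - a0) (y - b0) by rewrite /dsq; ring.
have k x y : g x y -> g (a0 + (x - a0)) (b0 + (y - b0)) by rewrite !(addrC _ (_ - _)) !subrK.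
apply: (P _ _ _ _ _ _ _ _ _ g0 g1 g2 r0 r10 r20) => x y /k gxy; rewrite !e.
- exact: D.
- exact: I1.
- exact: I2.
Qed.

Lemma packing2_transpose g : packing2 g -> packing2 (fun x y => g y x).
Proof.
move=> P a b r a1 b1 r1 a2 b2 r2 g0 g1 g2 r0 r10 r20 D I1 I2.
have e c d x y : dsq c d x y = dsq d c y x by rewrite /dsq addrC.
apply: (P _ _ _ _ _ _ _ _ _ g0 g1 g2 r0 r10 r20) => x y gxy; rewrite !(e _ _ x y).
- exact: D.
- exact: I1.
- exact: I2.
Qed.

(** A bound on the slopes of chords replaces differentiability. The last clause excludes further
    points of the curve in the square, so that small discs see the graph only. *)
Definition local_graph g (m s0 : R) (z : R -> R) :=
  [/\ 0 < s0,
      forall s, `|s| <= s0 -> g s (z s),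
      forall s t, `|s| <= s0 -> `|t| <= s0 -> `|z s - z t - m * (s - t)| <= 2^-1 * `|s - t| &
      forall s h, g s h -> `|s| <= s0 -> `|h| <= s0 -> h = z s].

Definition local_segment g (v1 v2 d : R) :=
  [/\ (v1, v2) <> (0, 0), 0 < d,
      forall s, `|s| <= d -> g (s * v1) (s * v2) &
      forall x y, g x y -> `|x| <= d -> `|y| <= d -> x * v2 = y * v1].

Section LocalGraph.
Variables (g : R -> R -> Prop) (m s0 : R) (z : R -> R).
Hypotheses (g_pack : packing2 g) (g00 : g 0 0) (gz : local_graph g m s0 z).

Let s0_gt0 : 0 < s0. Proof. by case: gz. Qed.

Let z0 : z 0 = 0.
Proof. by case: gz => s00 _ _ u; rewrite -(u 0 0) ?normr0// ltW. Qed.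

Let K : R := `|m| + 1.

Let K_gt0 : 0 < K. Proof. by rewrite ltr_pwDr. Qed.

Let z_lip s t : `|s| <= s0 -> `|t| <= s0 -> `|z s - z t| <= K * `|s - t|.
Proof.
move=> hs ht; case: gz => _ _ /(_ s t hs ht) h _.
rewrite -(subrK (m * (s - t)) (z s - z t)) (le_trans (ler_normD _ _))// addrC normrM mulrDl.
by rewrite lerD2l (le_trans h)// ler_wpM2r// invf_le1// ler1n.
Qed.

Let z_bound s : `|s| <= s0 -> `|z s| <= K * `|s|.
Proof. by move=> hs; have := z_lip hs (_ : `|0| <= s0); rewrite z0 !subr0 normr0; apply; exact: ltW. Qed.

(* Distances along the graph increase because the slopes stay within 1/2 of m,
   so that the product of two of them exceeds -1. *)
Let dist_mono s t t' : `|s| <= s0 -> `|t| <= s0 -> `|t'| <= s0 ->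
  (s <= t <= t') || (t' <= t <= s) -> dsq s (z s) t (z t) <= dsq s (z s) t' (z t').
Proof.
case: gz => _ _ L _ hs ht ht' ord.
have main (d w e1 e2 : R) : 0 <= d * w -> `|e1| <= 2^-1 * `|d| -> `|e2| <= 2^-1 * `|w| ->
    0 <= d * w + (m * d + e1) * (m * w + e2).
  move=> dw h1 h2.
  have h12 : `|e1 * e2| <= 2^-1 * 2^-1 * (d * w).
    by rewrite normrM -(ger0_norm dw) normrM mulrACA ler_pM.
  have h3 : `|d * e2 + w * e1| <= d * w.
    apply: (le_trans (ler_normD _ _)); rewrite !normrM.
    have a1 := ler_wpM2l (normr_ge0 d) h2; have a2 := ler_wpM2l (normr_ge0 w) h1.
    have dw' : `|d| * `|w| = d * w by rewrite -normrM ger0_norm.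
    by move: a1 a2; rewrite -dw'; lra.
  have h4 : - (`|m| * (d * w)) <= m * (d * e2 + w * e1).
    by rewrite lerNl; apply: (le_trans (ler_norm _)); rewrite normrN normrM ler_wpM2l.
  have h5 : - (2^-1 * 2^-1 * (d * w)) <= e1 * e2.
    by rewrite lerNl; apply: (le_trans (ler_norm _)); rewrite normrN.
  have h6 : 0 <= (`|m| - 2^-1) ^+ 2 * (d * w) by rewrite mulr_ge0// sqr_ge0.
  have h7 : (`|m| - 2^-1) ^+ 2 * (d * w) =
      m ^+ 2 * (d * w) - `|m| * (d * w) + 2^-1 * 2^-1 * (d * w).
    by rewrite -(real_normK (num_real m)); field.
  rewrite (_ : (m * d + e1) * (m * w + e2) =
    m ^+ 2 * (d * w) + m * (d * e2 + w * e1) + e1 * e2); last by ring.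
  by move: h4 h5 h6 dw; rewrite h7; lra.
pose d := t' - t; pose w := t' + t - 2 * s.
pose e1 := z t' - z t - m * (t' - t); pose e2 := z t' + z t - 2 * z s - m * w.
have dw : 0 <= d * w.
  case/orP: ord => /andP[q1 q2]; [apply: mulr_ge0|apply: mulr_le0]; rewrite /d /w; lra.
have wE : `|w| = `|t' - s| + `|t - s|.
  case/orP: ord => /andP[q1 q2].
    by rewrite !ger0_norm /w ?subr_ge0//; [ring|exact: le_trans q2|lra].
  by rewrite !ler0_norm /w ?subr_le0//; [ring|exact: le_trans q2|lra].
have h2 : `|e2| <= 2^-1 * `|w|.
  rewrite (_ : e2 = (z t' - z s - m * (t' - s)) + (z t - z s - m * (t - s))); last by rewrite /e2 /w; ring.
  by rewrite wE [leRHS]mulrDr (le_trans (ler_normD _ _))// lerD// L.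
have := main d w e1 e2 dw (L _ _ ht' ht) h2.
rewrite -(subr_ge0 (dsq s (z s) t (z t))).
by rewrite [X in _ -> 0 <= X](_ : _ = d * w + (m * d + e1) * (m * w + e2)) // /dsq /e1 /e2 /d /w; ring.
Qed.

(** Chords between parameters in [[-s1, s1]] have length at most [4 K s1]; the two smaller discs
    used below then stay in the square of half-width [12 K s1 = s0]. *)
Let s1 : R := s0 / (12 * K).

Let s1_gt0 : 0 < s1. Proof. by rewrite divr_gt0// mulr_gt0. Qed.

Let Ks1 : 12 * (K * s1) = s0.
Proof. by rewrite /s1; field; rewrite gt_eqF. Qed.

Let s1_le : s1 <= K * s1.
Proof. by rewrite ler_peMl ?(ltW s1_gt0)// lerDr. Qed.

(** Let [rho] be the length of the chord, [t1] a point of the arc equidistant from its ends, at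
    distance [rho1], and [t2] a point beyond [ch] at distance [rho / 2] from it. The discs about
    [t1] and [t2] with these radii cut out arcs on the two sides of [ch], both inside the disc of
    radius [rho] about [ch], so [rho1 + rho / 2 <= rho]. As [rho1] is at least half the chord, the
    point at [t1] is the midpoint of the chord. *)
Let midpoint_graph al ch : `|al| <= s1 -> `|ch| <= s1 -> al < ch ->
  z ((al + ch) / 2) = (z al + z ch) / 2.
Proof.
move=> hal hch lt.
have K0 := ltW K_gt0; have s10 := ltW s1_gt0.
have s1s0 : s1 <= s0 by move: s1_le s10; rewrite -Ks1; lra.
have Ks0 : 0 <= K * s1 by exact: mulr_ge0.
have Ks4 : 0 <= 4 * (K * s1) by exact: mulr_ge0.
have Ks2 : 0 <= 2 * (K * s1) by exact: mulr_ge0.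
have hal0 := le_trans hal s1s0; have hch0 := le_trans hch s1s0.
have zal : `|z al| <= K * s1 by rewrite (le_trans (z_bound hal0))// ler_wpM2l.
have zch : `|z ch| <= K * s1 by rewrite (le_trans (z_bound hch0))// ler_wpM2l.
pose rho2 := dsq al (z al) ch (z ch); pose rho := Num.sqrt rho2.
have rho20 : 0 < rho2 by rewrite ltr_pwDl ?sqr_ge0// exprn_gt0// subr_gt0.
have rho0 : 0 < rho by rewrite sqrtr_gt0.
have rhoE : rho ^+ 2 = rho2 by rewrite sqr_sqrtr// ltW.
have rho_le : rho <= 4 * (K * s1).
  rewrite -(ler_pXn2r (ltn0Sn 1)) ?nnegrE ?(ltW rho0)// rhoE.
  have b1 : (ch - al) ^+ 2 <= (2 * (K * s1)) ^+ 2.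
    rewrite -(real_normK (num_real _)) lerXn2r ?nnegrE//.
    by rewrite (le_trans (ler_normB _ _))//; move: hal hch s1_le; lra.
  have b2 : (z ch - z al) ^+ 2 <= (2 * (K * s1)) ^+ 2.
    rewrite -(real_normK (num_real _)) lerXn2r ?nnegrE//.
    by rewrite (le_trans (ler_normB _ _))//; move: zal zch; lra.
  apply: (le_trans (lerD b1 b2)).
  rewrite -subr_ge0 (_ : _ - _ = 8 * (K * s1) ^+ 2); last by ring.
  by apply: mulr_ge0 => //; exact: sqr_ge0.
have wide x : `|x| <= s1 + 2 * rho -> `|x| <= s0.
  by move=> /le_trans; apply; move: s1_le rho_le; rewrite -Ks1; lra.
have in0 s : al <= s <= ch + rho -> `|s| <= s0.
  move: hal hch; rewrite !ler_norml => /andP[? ?] /andP[? ?] /andP[? ?].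
  by apply/andP; split; move: s1_le rho_le; rewrite -Ks1; lra.
have graph s : al <= s <= ch + rho -> g s (z s) by move=> hs; case: gz => _ gr _ _; apply: gr; exact: in0.
have box x y : g x y -> `|x| <= s1 + 2 * rho -> `|y| <= K * s1 + 2 * rho -> y = z x.
  move=> gxy hx hy; case: gz => _ _ _; apply => //.
    by apply: (le_trans hx); move: s1_le rho_le; rewrite -Ks1; lra.
  by apply: (le_trans hy); move: s1_le rho_le; rewrite -Ks1; lra.
have [t1 t1i t1E] : exists2 t, al <= t <= ch & dsq al (z al) t (z t) = dsq ch (z ch) t (z t).
  (* Equidistance from the two ends is a linear condition on the point, [f t = v]; the values of [f]
     at the ends lie [rho2] below and [rho2] above [v]. *)
  pose f t := 2 * (ch - al) * t + 2 * (z ch - z al) * z t.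
  pose v := ch ^+ 2 + z ch ^+ 2 - al ^+ 2 - z al ^+ 2.
  have cf : {within `[al, ch], continuous f}.
    apply: (@lipschitz_within _ _ (`|2 * (ch - al)| + `|2 * (z ch - z al)| * K)) => s t hs ht.
    have ins u : al <= u <= ch -> `|u| <= s0.
      by move=> /andP[u1 u2]; apply: in0; rewrite u1 (le_trans u2)// lerDl ltW.
    rewrite (_ : f s - f t = 2 * (ch - al) * (s - t) + 2 * (z ch - z al) * (z s - z t)); last by rewrite /f; ring.
    rewrite (le_trans (ler_normD _ _))// [leRHS]mulrDl lerD//; first by rewrite normrM.
    by rewrite normrM -mulrA ler_wpM2l// z_lip// ins.
  have fv : Num.min (f al) (f ch) <= v <= Num.max (f al) (f ch).
    have e1 : v - f al = rho2 by rewrite /v /f /rho2 /dsq; ring.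
    have e2 : f ch - v = rho2 by rewrite /v /f /rho2 /dsq; ring.
    rewrite ge_min le_max; apply/andP; split; apply/orP; [left|right].
      by rewrite -subr_ge0 e1 ltW.
    by rewrite -subr_ge0 e2 ltW.
  have [t + ft] := IVT (ltW lt) cf fv; rewrite in_itv/= => ti; exists t => //.
  apply/eqP; rewrite -subr_eq0; apply/eqP.
  by move/eqP: ft; rewrite -subr_eq0 => /eqP <-; rewrite /dsq /f /v; ring.
have [t2 t2i t2E] : exists2 t, ch <= t <= ch + rho / 2 & dsq ch (z ch) t (z t) = (rho / 2) ^+ 2.
  pose f t := dsq ch (z ch) t (z t).
  have r2 : 0 <= rho / 2 by rewrite divr_ge0// ltW.
  have ins u : ch <= u <= ch + rho / 2 -> `|u| <= s0.
    by move=> /andP[u1 u2]; apply: in0; rewrite (le_trans (ltW lt) u1)/= (le_trans u2)// lerD2l ler_pdivrMr// ler_peMr ?ler1n// ltW.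
  have chi : ch <= ch <= ch + rho / 2 by rewrite lexx lerDl.
  have cf : {within `[ch, ch + rho / 2], continuous f}.
    apply: (@lipschitz_within _ _ (4 * s0 + K * (K * (4 * s0)))) => s t hs ht.
    rewrite (_ : f s - f t = (s + t - 2 * ch) * (s - t) + (z s - z t) * ((z s - z ch) + (z t - z ch))); last by rewrite /f /dsq; ring.
    have dd u : ch <= u <= ch + rho / 2 -> `|u - ch| <= 2 * s0.
      move=> hu; rewrite (le_trans (ler_normB _ _))//; move: (ins _ hu) hch0; lra.
    have zz u : ch <= u <= ch + rho / 2 -> `|z u - z ch| <= K * (2 * s0).
      by move=> hu; rewrite (le_trans (z_lip (ins _ hu) hch0))// ler_wpM2l// dd.
    rewrite (le_trans (ler_normD _ _))// [leRHS]mulrDl lerD// normrM.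
      rewrite ler_wpM2r// (_ : s + t - 2 * ch = (s - ch) + (t - ch)); last by ring.
      by rewrite (le_trans (ler_normD _ _))//; move: (dd _ hs) (dd _ ht); lra.
    rewrite (_ : K * (K * (4 * s0)) * `|s - t| = (K * `|s - t|) * (K * (2 * s0) + K * (2 * s0))); last by ring.
    apply: ler_pM => //; first exact: (z_lip (ins _ hs) (ins _ ht)).
    by rewrite (le_trans (ler_normD _ _))// lerD// zz.
  have fv : Num.min (f ch) (f (ch + rho / 2)) <= (rho / 2) ^+ 2 <= Num.max (f ch) (f (ch + rho / 2)).
    rewrite ge_min le_max /f /dsq !subrr expr0n/= addr0 sqr_ge0/=; apply/orP; right.
    by rewrite (addrC ch) addrK lerDl sqr_ge0.
  have chr : ch <= ch + rho / 2 by rewrite lerDl.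
  by have [t + ft] := IVT chr cf fv; rewrite in_itv/= => ti; exists t.
have t1i' : al <= t1 <= ch + rho by case/andP: t1i => -> h; rewrite /= (le_trans h)// lerDl ltW.
have t2i' : al <= t2 <= ch + rho.
  case/andP: t2i => h1 h2; rewrite (le_trans (ltW lt) h1)/= (le_trans h2)// lerD2l.
  by rewrite ler_pdivrMr// ler_peMr ?ler1n// ltW.
have rho2_le : rho / 2 <= rho by rewrite ler_pdivrMr// ler_peMr ?ler1n// ltW.
have [h11 h12] := andP t1i; have [h21 h22] := andP t2i.
have t1s := in0 _ t1i'; have t2s := in0 _ t2i'.
pose rho1 := Num.sqrt (dsq al (z al) t1 (z t1)).
have rho1E : rho1 ^+ 2 = dsq al (z al) t1 (z t1) by rewrite sqr_sqrtr// dsq_ge0.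
have rho1E' : rho1 ^+ 2 = dsq ch (z ch) t1 (z t1) by rewrite rho1E.
(* The median formula in the isosceles triangle over the chord with apex at [t1]. *)
have mid : (t1 - (al + ch) / 2) ^+ 2 + (z t1 - (z al + z ch) / 2) ^+ 2 = rho1 ^+ 2 - (rho / 2) ^+ 2.
  have -> : rho1 ^+ 2 = (dsq al (z al) t1 (z t1) + dsq ch (z ch) t1 (z t1)) / 2 by rewrite -rho1E -rho1E'; field.
  by rewrite expr_div_n rhoE /rho2 /dsq; field.
have rho1_ge0 : 0 <= rho1 by rewrite sqrtr_ge0.
have rho_2 : 0 < rho / 2 by rewrite divr_gt0.
have rho1_ge : rho / 2 <= rho1.
  rewrite -(ler_pXn2r (ltn0Sn 1)) ?nnegrE ?(ltW rho_2)// -subr_ge0 -mid.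
  by rewrite addr_ge0// sqr_ge0.
have rho1_gt0 : 0 < rho1 by rewrite (lt_le_trans rho_2).
have rho1_le : rho1 <= rho.
  rewrite -(ler_pXn2r (ltn0Sn 1)) ?nnegrE ?(ltW rho0)// rhoE rho1E.
  by apply: dist_mono => //; rewrite h11 h12.
(* The two closed discs share the point at [ch]; shrinking by [th < 1] separates them, and
   [ler_shrink] recovers the limit case. *)
have th_pack th : 0 < th -> th < 1 -> th * rho1 + th * (rho / 2) <= rho.
  move=> th0 th1.
  have shrink q : 0 < q -> (th * q) ^+ 2 < q ^+ 2.
    by move=> q0; rewrite ltrXn2r ?nnegrE ?mulr_ge0 ?(ltW q0) ?(ltW th0)// gtr_pMl.
  have sh1 := shrink _ rho1_gt0; have sh2 := shrink _ rho_2.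
  have on1 x y : g x y -> dsq t1 (z t1) x y <= (th * rho1) ^+ 2 ->
      [/\ y = z x, al < x & x < ch].
    move=> gxy h; have [hx hy] := dsq_coord rho1_ge0 (le_trans h (ltW sh1)).
    have [_ hzt] := @dsq_coord al (z al) t1 (z t1) _ rho1_ge0 (eq_refl_le (esym rho1E)).
    have bx : `|x| <= s1 + 2 * rho.
      by apply: (near_interval hal hch h11 _ (le_trans hx rho1_le)); case/andP: t1i'.
    have yz : y = z x.
      apply: box => //; rewrite (_ : y = (y - z t1) + (z t1 - z al) + z al); last by ring.
      exact: (three_terms (le_trans hy rho1_le) (le_trans hzt rho1_le) zal).
    have xs := wide _ bx.
    have lt1 : dsq t1 (z t1) x (z x) < rho1 ^+ 2 by rewrite -yz; exact: le_lt_trans sh1.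
    split=> //; rewrite ltNge; apply/negP => hx'.
      have := dist_mono t1s hal0 xs; rewrite h11 hx' orbT => /(_ isT).
      by rewrite dsqC -rho1E leNgt lt1.
    have := dist_mono t1s hch0 xs; rewrite h12 hx' => /(_ isT).
    by rewrite dsqC -rho1E' leNgt lt1.
  have on2 x y : g x y -> dsq t2 (z t2) x y <= (th * (rho / 2)) ^+ 2 -> ch < x.
    move=> gxy h; have [hx hy] := dsq_coord (ltW rho_2) (le_trans h (ltW sh2)).
    have [_ hzt] := @dsq_coord ch (z ch) t2 (z t2) _ (ltW rho_2) (eq_refl_le t2E).
    have bx : `|x| <= s1 + 2 * rho.
      have [? ?] := andP t2i'; exact: (near_interval hal hch _ _ (le_trans hx rho2_le)).
    have yz : y = z x.
      apply: box => //; rewrite (_ : y = (y - z t2) + (z t2 - z ch) + z ch); last by ring.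
      exact: (three_terms (le_trans hy rho2_le) (le_trans hzt rho2_le) zch).
    have xs := wide _ bx.
    have lt1 : dsq t2 (z t2) x (z x) < (rho / 2) ^+ 2 by rewrite -yz; exact: le_lt_trans sh2.
    rewrite ltNge; apply/negP => hx'.
    have := dist_mono t2s hch0 xs; rewrite h21 hx' orbT => /(_ isT).
    by rewrite dsqC t2E leNgt lt1.
  have gal := graph al; have gch := graph ch.
  apply: (g_pack (graph ch _) (graph t1 t1i') (graph t2 t2i') rho0 (mulr_gt0 th0 rho1_gt0)
    (mulr_gt0 th0 rho_2)).
  - by rewrite (ltW lt) lerDl ltW.
  - move=> x y gxy d1 d2; have [_ _ xch] := on1 _ _ gxy d1.
    by have := lt_trans xch (on2 _ _ gxy d2); rewrite ltxx.
  - move=> x y gxy d1; have [-> alx xch] := on1 _ _ gxy d1.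
    rewrite rhoE /rho2 [leRHS]dsqC; apply: dist_mono => //.
      by apply: in0; rewrite ltW//= ltW// (lt_le_trans xch)// lerDl ltW.
    by rewrite (ltW alx) (ltW xch) orbT.
  - move=> x y gxy d2; rewrite (_ : rho = rho / 2 + rho / 2); last by field.
    apply: (@dsq_triangle t2 (z t2)); rewrite ?(ltW rho_2) ?t2E//.
    exact: (le_trans d2 (ltW sh2)).
have rho1_half : rho1 <= rho / 2.
  have h : rho1 + rho / 2 <= rho by apply: ler_shrink => // th h0 h1; rewrite mulrDr; exact: th_pack.
  by move: h; lra.
have rho1_eq : rho1 = rho / 2 by apply/eqP; rewrite eq_le rho1_half.
move/eqP: mid; rewrite rho1_eq subrr paddr_eq0 ?sqr_ge0// !sqrf_eq0 !subr_eq0.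
by move=> /andP[/eqP <- /eqP <-].
Qed.

(** The deviation [w] from the chord vanishes at both ends and satisfies the midpoint identity, so
    [midpoint_le0] applies to it and to its negative. *)
Lemma graph_segment : exists k d, local_segment g 1 k d.
Proof.
have s10 := ltW s1_gt0; have lt : - s1 < s1 by move: s1_gt0; lra.
have s1s0 : s1 <= s0 by move: s1_le s10; rewrite -Ks1; lra.
pose k := (z s1 - z (- s1)) / (2 * s1).
pose w s := z s - z (- s1) - (s + s1) * k.
have ins s : - s1 <= s <= s1 -> `|s| <= s0 by rewrite -ler_norml => /le_trans; apply.
have wl : w (- s1) = 0 by rewrite /w; ring.
have wr : w s1 = 0 by rewrite /w /k; field; rewrite gt_eqF.
have cw : {within `[(- s1), s1], continuous w}.
  apply: (@lipschitz_within _ _ (K + `|k|)) => s t hs ht.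
  rewrite (_ : w s - w t = (z s - z t) - k * (s - t)); last by rewrite /w; ring.
  by rewrite (le_trans (ler_normB _ _))// normrM mulrDl lerD2r z_lip// ins.
have mid s h : 0 < h -> - s1 <= s - h -> s + h <= s1 -> w (s - h) + w (s + h) = 2 * w s.
  move=> h0 hl hr; have := @midpoint_graph (s - h) (s + h).
  rewrite !ler_norml hl hr (_ : (s - h + (s + h)) / 2 = s); last by field.
  rewrite (_ : s - h <= s1); last by move: hr h0; lra.
  rewrite (_ : - s1 <= s + h); last by move: hl h0; lra.
  rewrite (_ : s - h < s + h); last by move: h0; lra.
  by move=> /(_ isT isT isT) e; rewrite /w e; field.
have w_le s : - s1 <= s <= s1 -> w s <= 0.
  exact: (midpoint_le0 (ltW lt) cw wl wr mid).
have w_ge s : - s1 <= s <= s1 -> 0 <= w s.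
  rewrite -oppr_le0; apply: (@midpoint_le0 _ (fun s => - w s) _ _ (ltW lt)).
  - by move=> x; apply: continuousN; exact: cw.
  - by rewrite wl oppr0.
  - by rewrite wr oppr0.
  - by move=> s' h h0 hl hr; rewrite -opprD mid// mulrN.
have zk s : - s1 <= s <= s1 -> z s = s * k.
  move=> hs; have e1 : w s = 0 by apply/eqP; rewrite eq_le w_le// w_ge.
  have h0 : - s1 <= 0 <= s1 by rewrite s10 oppr_le0 s10.
  have e2 : w 0 = 0 by apply/eqP; rewrite eq_le w_le// w_ge.
  by move: e1 e2; rewrite /w z0; lra.
exists k, s1; split=> //.
- by case=> /eqP; rewrite oner_eq0.
- move=> s hs; rewrite mulr1 -zk -?ler_norml//; case: gz => _ gr _ _; apply: gr.
  exact: le_trans s1s0.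
- move=> x y gxy hx hy; rewrite mulr1 -zk -?ler_norml//.
  by case: gz => _ _ _ u; rewrite (u _ _ gxy)// ?(le_trans hx)// (le_trans hy).
Qed.

End LocalGraph.

Lemma local_segment_transpose g v1 v2 d :
  local_segment (fun x y => g y x) v1 v2 d -> local_segment g v2 v1 d.
Proof.
move=> [v0 d0 gl u]; split=> //.
- by case=> e1 e2; apply: v0; rewrite e1 e2.
- by move=> x y gxy hx hy; rewrite (u y x).
Qed.

Section Global.
Variable g : R -> R -> Prop.
Hypothesis g_closed : forall a b, (forall e, 0 < e ->
  exists x y, [/\ g x y, `|x - a| < e & `|y - b| < e]) -> g a b.
Hypothesis g_pack : packing3 g.
Hypothesis g_loc : forall a b, g a b ->
  exists v1 v2 d, local_segment (fun x y => g (a + x) (b + y)) v1 v2 d.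

Lemma sqr_pair_gt0 (v1 v2 : R) : (v1, v2) <> (0, 0) -> 0 < v1 ^+ 2 + v2 ^+ 2.
Proof.
move=> v0; rewrite lt_neqAle addr_ge0 ?sqr_ge0// andbT eq_sym paddr_eq0 ?sqr_ge0// !sqrf_eq0.
by apply/negP => /andP[/eqP e1 /eqP e2]; apply: v0; rewrite e1 e2.
Qed.

(** The parameters near which the line stays in the curve form an open set. At a limit parameter the
    curve is locally a segment, which contains a nearby second point of the line and therefore has
    the same direction. *)
Lemma segment_line a b v1 v2 d :
  local_segment (fun x y => g (a + x) (b + y)) v1 v2 d ->
  forall t, g (a + t * v1) (b + t * v2).
Proof.
move=> [v0 d0 gl _].
pose B t := exists2 e, 0 < e & forall s, `|s - t| < e -> g (a + s * v1) (b + s * v2).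
suff BT t : B t by move=> t; have [e e0 h] := BT t; apply: h; rewrite subrr normr0.
apply: (@clopen_real _ B 0) t.
- by exists d => // s; rewrite subr0 => sd; apply: gl; exact: ltW.
- move=> t [e e0 h]; exists (e / 2); first by rewrite divr_gt0.
  move=> s st; exists (e / 2); first by rewrite divr_gt0.
  move=> u us; apply: h; rewrite (_ : u - t = (u - s) + (s - t)); last by ring.
  by rewrite (le_lt_trans (ler_normD _ _))//; move: us st; lra.
move=> t cl; pose N := `|v1| + `|v2| + 1.
have N0 : 0 < N by rewrite ltr_pwDr// addr_ge0.
have small (u r v : R) : `|v| <= N -> `|u| < r / N -> `|u * v| < r.
  move=> vN ur; rewrite normrM; apply: (le_lt_trans (ler_wpM2l (normr_ge0 u) vN)).
  by rewrite -ltr_pdivlMr.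
have v1N : `|v1| <= N by rewrite /N -addrA lerDl addr_ge0.
have v2N : `|v2| <= N by rewrite /N addrAC lerDr addr_ge0.
have gt : g (a + t * v1) (b + t * v2).
  apply: g_closed => e e0; have [s st [e' e'0 h]] := cl _ (divr_gt0 e0 N0).
  exists (a + s * v1), (b + s * v2); split; first by apply: h; rewrite subrr normr0.
    by rewrite (_ : _ - _ = (s - t) * v1); [exact: small|ring].
  by rewrite (_ : _ - _ = (s - t) * v2); [exact: small|ring].
have [w1 [w2 [r [w0 r0 wl wu]]]] := g_loc gt.
(* A second point is needed to compare directions; if the parameter found is [t] itself, its
   neighborhood provides another. *)
have [s [s_neq sr gs]] : exists s, [/\ s != t, `|s - t| < r / N & g (a + s * v1) (b + s * v2)].
  have rN : 0 < r / N by rewrite divr_gt0.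
  have [s st [e e0 h]] := cl _ rN.
  have [E|ne] := eqVneq s t; last by exists s; split=> //; apply: h; rewrite subrr normr0.
  pose q := Num.min e (r / N) / 2.
  have m0 : 0 < Num.min e (r / N) by rewrite lt_min e0.
  have q0 : 0 < q by rewrite divr_gt0.
  have qm : q < Num.min e (r / N) by rewrite ltr_pdivrMr// ltr_pMr// ltr1n.
  move: qm; rewrite lt_min => /andP[qe qr].
  exists (t + q); split; first by rewrite gt_eqF// ltrDl.
    by rewrite addrC addKr ger0_norm// ltW.
  by apply: h; rewrite E addrC addKr ger0_norm// ltW.
have st0 : s - t != 0 by rewrite subr_eq0.
have cross : v1 * w2 = v2 * w1.
  apply: (mulfI st0); rewrite !mulrA; apply: wu.
  - by rewrite -!addrA -!mulrDl (addrC t) subrK.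
  - by rewrite ltW// small.
  - by rewrite ltW// small.
have W0 := sqr_pair_gt0 w0.
pose k := (v1 * w1 + v2 * w2) / (w1 ^+ 2 + w2 ^+ 2).
have k1 : v1 = k * w1.
  apply: (mulIf (lt0r_neq0 W0)); rewrite mulrAC /k divfK ?gt_eqF//.
  by rewrite !mulrDr expr2 [v1 * (w2 ^+ 2)](_ : _ = (v1 * w2) * w2); [rewrite cross; ring|ring].
have k2 : v2 = k * w2.
  apply: (mulIf (lt0r_neq0 W0)); rewrite mulrAC /k divfK ?gt_eqF//.
  by rewrite !mulrDr [v2 * (w1 ^+ 2)](_ : _ = (v2 * w1) * w1); [rewrite -cross; ring|ring].
have K0 : 0 < `|k| + 1 by rewrite ltr_pwDr.
exists (r / (`|k| + 1)); first by rewrite divr_gt0.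
move=> u ut.
rewrite (_ : a + u * v1 = a + t * v1 + ((u - t) * k) * w1); last by rewrite k1; ring.
rewrite (_ : b + u * v2 = b + t * v2 + ((u - t) * k) * w2); last by rewrite k2; ring.
apply: wl; rewrite normrM; apply: (@le_trans _ _ (`|u - t| * (`|k| + 1))).
  by rewrite ler_wpM2l// lerDl.
by rewrite -ler_pdivlMr// ltW.
Qed.

(* A point off the line at distance h sees the gap between the two discs of
   radius h whose centers lie at distance h from its foot. *)
Lemma line_only a b v1 v2 : (v1, v2) <> (0, 0) ->
  (forall t, g (a + t * v1) (b + t * v2)) ->
  forall x y, g x y -> (x - a) * v2 = (y - b) * v1.
Proof.
move=> v0 gl x y gxy; apply/eqP; rewrite -subr_eq0; apply/negPn/negP => D0.
have N0 := sqr_pair_gt0 v0; set N := v1 ^+ 2 + v2 ^+ 2 in N0.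
have Nn : N != 0 by rewrite gt_eqF.
pose D := (x - a) * v2 - (y - b) * v1; pose t := ((x - a) * v1 + (y - b) * v2) / N.
pose h := `|D| / Num.sqrt N; pose k := h / Num.sqrt N.
have sN : 0 < Num.sqrt N by rewrite sqrtr_gt0.
have h0 : 0 < h by rewrite divr_gt0// normr_gt0.
have h2 : h ^+ 2 = D ^+ 2 / N by rewrite expr_div_n real_normK ?num_real// sqr_sqrtr// ltW.
have k2 : k ^+ 2 * N = h ^+ 2 by rewrite expr_div_n sqr_sqrtr ?(ltW N0)// divfK.
pose f q := dsq (a + q * v1) (b + q * v2) x y.
have fE q : f q = h ^+ 2 + (q - t) ^+ 2 * N.
  by rewrite h2 /f /dsq /t /D /N; field; rewrite -/N.
have lineE q q' : dsq (a + q * v1) (b + q * v2) (a + q' * v1) (b + q' * v2) = (q' - q) ^+ 2 * N.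
  by rewrite /dsq /N; ring.
(* The centers at distance [h] from the foot are at distance [sqrt 2 * h] from the extra point, more
   than [h + h / 4], so the three discs are disjoint; all lie in the disc of radius [2 * h] about
   the foot. *)
have pk th : 0 < th -> th < 1 -> th * h + th * h + h / 4 <= 2 * h.
  move=> th0 th1; have th_h : 0 < th * h by rewrite mulr_gt0.
  have thh : th * h < h by rewrite gtr_pMl.
  have far x1 y1 r1 x2 y2 r2 : 0 <= r1 -> 0 <= r2 -> (r1 + r2) ^+ 2 < dsq x1 y1 x2 y2 ->
      apart g x1 y1 r1 x2 y2 r2.
    move=> p1 p2 lt' u v _ u1 u2; have := dsq_triangle p1 p2 u1 (_ : dsq u v x2 y2 <= _).
    by rewrite dsqC => /(_ u2); rewrite leNgt lt'.
  have near x1 y1 r1 r r' : 0 <= r1 -> 0 <= r -> r + r1 <= r' ->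
      dsq (a + t * v1) (b + t * v2) x1 y1 <= r ^+ 2 ->
      inside g x1 y1 r1 (a + t * v1) (b + t * v2) r'.
    move=> p1 p2 rr d u v _ u1; apply: (le_trans (dsq_triangle p2 p1 d u1)).
    by rewrite lerXn2r ?nnegrE ?addr_ge0// (le_trans _ rr)// addr_ge0.
  have hh4 : 0 < h / 4 by rewrite divr_gt0.
  have side q : (q - t) ^+ 2 = k ^+ 2 -> apart g (a + q * v1) (b + q * v2) (th * h) x y (h / 4).
    move=> qk; apply: far; [exact: ltW|exact: ltW|].
    rewrite -/(f q) fE qk k2.
    apply: (@le_lt_trans _ _ ((h + h / 4) ^+ 2)).
      by rewrite lerXn2r ?nnegrE ?addr_ge0 ?(ltW hh4) ?(ltW h0) ?(ltW th_h)// lerD2r ltW.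
    rewrite -subr_gt0 (_ : _ - _ = 7 / 16 * h ^+ 2); last by field.
    by rewrite mulr_gt0 ?exprn_gt0// divr_gt0.
  apply: (g_pack (gl t) (gl (t + k)) (gl (t - k)) gxy _ th_h th_h hh4).
  - by rewrite mulr_gt0.
  - apply: far; [exact: ltW|exact: ltW|]; rewrite lineE.
    rewrite (_ : (t - k - (t + k)) ^+ 2 * N = 4 * (k ^+ 2 * N)); last by ring.
    rewrite k2 (_ : (th * h + th * h) ^+ 2 = 4 * (th * h) ^+ 2); last by ring.
    by rewrite ltr_pM2l// ltrXn2r ?nnegrE ?(ltW th_h) ?(ltW h0).
  - by apply: side; rewrite addrC addKr.
  - by apply: side; rewrite addrAC subrr sub0r sqrrN.
  - apply: (@near _ _ _ h); [exact: ltW|exact: ltW| |].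
      by move: thh; lra.
    by rewrite lineE addrC addKr k2.
  - apply: (@near _ _ _ h); [exact: ltW|exact: ltW| |].
      by move: thh; lra.
    by rewrite lineE addrAC subrr sub0r sqrrN k2.
  - apply: (@near _ _ _ h); [exact: ltW|exact: ltW| |].
      by move: h0; lra.
    by rewrite -/(f t) fE subrr expr0n/= mul0r addr0.
(* Any [th] above 7/8 contradicts the packing bound; here [2 * (15 / 16) + 1 / 4 = 17 / 8] exceeds
   2. *)
have th1 : 0 < 15 / 16 :> R by rewrite divr_gt0.
have th2 : 15 / 16 < 1 :> R by rewrite ltr_pdivrMr// mul1r ltr_nat.
by have := pk _ th1 th2; move: h0; lra.
Qed.

Lemma plane_line a b : g a b -> exists v1 v2, (v1, v2) <> (0, 0) /\
  forall x y, g x y <-> (x - a) * v2 = (y - b) * v1.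
Proof.
move=> gab; have [v1 [v2 [d ls]]] := g_loc gab.
have v0 : (v1, v2) <> (0, 0) by case: ls.
have gl := segment_line ls; exists v1, v2; split=> // x y; split; first exact: line_only.
move=> e; have N0 := sqr_pair_gt0 v0.
have := gl (((x - a) * v1 + (y - b) * v2) / (v1 ^+ 2 + v2 ^+ 2)).
congr (g _ _); apply/eqP; rewrite -subr_eq0.
  rewrite (_ : _ - _ = - v2 * ((x - a) * v2 - (y - b) * v1) / (v1 ^+ 2 + v2 ^+ 2)).
    by rewrite e subrr mulr0 mul0r.
  by field; rewrite gt_eqF.
rewrite (_ : _ - _ = v1 * ((x - a) * v2 - (y - b) * v1) / (v1 ^+ 2 + v2 ^+ 2)).
  by rewrite e subrr mulr0 mul0r.
by field; rewrite gt_eqF.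
Qed.

End Global.
End PlaneCurve.

(** * From a defining function to a planar graph *)

Section ImplicitGraph.
Context {R : realType}.

(** Strict differentiability at one point is enough: [F s h / g2] differs from [h - m * s] by a
    small Lipschitz error. The intermediate value theorem gives a zero in [h] for every small [s],
    and any two zeros satisfy the slope bound, which also yields uniqueness. *)
Lemma implicit_graph (G : R -> R -> Prop) (F : R -> R -> R) (g1 g2 eta0 : R) :
  g2 != 0 -> G 0 0 -> 0 < eta0 ->
  (forall s h, `|s| <= eta0 -> `|h| <= eta0 -> (G s h <-> F s h = 0)) ->
  (forall e, 0 < e -> exists2 eta, 0 < eta & forall s h s' h',
    `|s| <= eta -> `|h| <= eta -> `|s'| <= eta -> `|h'| <= eta ->
    `|F s h - F s' h' - (g1 * (s - s') + g2 * (h - h'))| <= e * (`|s - s'| + `|h - h'|)) ->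
  exists m s0 z, local_graph G m s0 z.
Proof.
move=> g20 G0 eta00 GF est; pose m := - (g1 / g2); pose M := `|m| + 1.
have M0 : 0 < M by rewrite ltr_pwDr.
have M1 : 1 <= M by rewrite lerDr.
have ng2 : 0 < `|g2| by rewrite normr_gt0.
(* For two zeros with deviation [q = h - h' - m * (s - s')] this precision gives [4 M |q| <= |s -
   s'| + |h - h'| <= M |s - s'| + |q|], and thus the slope error 1/2. *)
have e0 : 0 < `|g2| / (4 * M) by rewrite divr_gt0// mulr_gt0.
have [eta1 eta10 est1] := est _ e0.
pose eta := Num.min eta0 eta1.
have eta_gt0 : 0 < eta by rewrite lt_min eta00.
have le0 (x : R) : `|x| <= eta -> `|x| <= eta0 by move/le_trans; apply; rewrite ge_min lexx.
have le1 (x : R) : `|x| <= eta -> `|x| <= eta1 by move/le_trans; apply; rewrite ge_min lexx orbT.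
pose f s h := F s h / g2.
have cancel_g2 (Q X : R) : `|g2| * Q <= `|g2| / (4 * M) * X -> 4 * M * Q <= X.
  by rewrite -mulrA ler_pM2l// [leRHS]mulrC ler_pdivlMr ?mulr_gt0// mulrC.
have f_est s h s' h' : `|s| <= eta -> `|h| <= eta -> `|s'| <= eta -> `|h'| <= eta ->
    4 * M * `|f s h - f s' h' - (h - h' - m * (s - s'))| <= `|s - s'| + `|h - h'|.
  move=> hs hh hs' hh'.
  have := est1 _ _ _ _ (le1 _ hs) (le1 _ hh) (le1 _ hs') (le1 _ hh').
  rewrite (_ : F s h - F s' h' - _ = g2 * (f s h - f s' h' - (h - h' - m * (s - s')))); last first.
    by rewrite /f /m; field.
  by rewrite normrM; exact: cancel_g2.
have slope s h s' h' : `|s| <= eta -> `|h| <= eta -> `|s'| <= eta -> `|h'| <= eta ->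
    f s h = 0 -> f s' h' = 0 -> `|h - h' - m * (s - s')| <= 2^-1 * `|s - s'|.
  move=> hs hh hs' hh' f0 f0'; have := f_est _ _ _ _ hs hh hs' hh'.
  rewrite f0 f0' subrr sub0r normrN; set q := h - h' - m * (s - s').
  have hd : `|h - h'| <= `|q| + `|m| * `|s - s'|.
    by rewrite -normrM -{1}(subrK (m * (s - s')) (h - h')) ler_normD.
  move=> h4; have h5 : 2 * M * `|q| <= M * `|s - s'|.
    have qM : `|q| <= M * `|q| by rewrite ler_peMl.
    by move: hd h4 qM; rewrite /M; have := normr_ge0 q; lra.
  by rewrite -(ler_pM2l M0); move: h5; lra.
pose s0 := eta / (4 * M).
have s00 : 0 < s0 by rewrite divr_gt0// mulr_gt0.
have s0E : 4 * M * s0 = eta by rewrite /s0; field; rewrite gt_eqF.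
have s0eta : s0 <= eta.
  have h : s0 <= M * s0 by rewrite ler_peMl// ltW.
  by rewrite -s0E -mulrA; move: h s00; lra.
have f00 : f 0 0 = 0.
  by rewrite /f (proj1 (GF 0 0 _ _) G0) ?mul0r// normr0 ltW.
have n0 : `|0 : R| <= eta by rewrite normr0 ltW.
have ne : `|eta| <= eta by rewrite ger0_norm// ltW.
have nNe : `|- eta| <= eta by rewrite normrN.
have ex s : exists h, `|s| <= s0 -> `|h| <= eta /\ f s h = 0.
  have [hs|hs] := leP `|s| s0; last by exists 0.
  have hs' := le_trans hs s0eta.
  have ms : `|m * s| <= M * s0 by rewrite normrM ler_pM// lerDl.
  have s0M : s0 <= M * s0 by rewrite ler_peMl// ltW.
  have sg h : `|h| = eta -> `|f s h - h| <= 3 * (M * s0).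
    move=> he; have hh : `|h| <= eta by rewrite he.
    have := f_est _ _ _ _ hs' hh n0 n0; rewrite f00 !subr0 => hf.
    have hf' : `|f s h - (h - m * s)| <= 2 * (M * s0).
      have p0 : 0 < 4 * M by rewrite mulr_gt0.
      rewrite -(ler_pM2l p0); apply: (le_trans hf).
      rewrite he -s0E (_ : 4 * M * (2 * (M * s0)) = 4 * M * s0 * M + 4 * M * s0 * M); last by ring.
      have a1 : `|s| <= 4 * M * s0 * M.
        by rewrite s0E (le_trans hs')// ler_peMr// ltW.
      have a2 : 4 * M * s0 <= 4 * M * s0 * M by rewrite ler_peMr// s0E ltW.
      exact: lerD.
    rewrite (_ : f s h - h = (f s h - (h - m * s)) - m * s); last by ring.
    by rewrite (le_trans (ler_normB _ _))//; move: hf' ms; lra.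
  have cf : {within `[- eta, eta], continuous (f s)}.
    apply: (@lipschitz_within _ _ 2) => h h'; rewrite -!ler_norml => hh hh'.
    have := f_est _ _ _ _ hs' hh hs' hh'; rewrite subrr mulr0 subr0 normr0 add0r => hf.
    have := ler_normD (f s h - f s h' - (h - h')) (h - h'); rewrite subrK => hn.
    have h1 : `|f s h - f s h' - (h - h')| <= M * `|f s h - f s h' - (h - h')| by rewrite ler_peMl.
    by move: hf hn h1; rewrite -mulrA; have := normr_ge0 (f s h - f s h' - (h - h')); lra.
  have := sg eta; have := sg (- eta).
  rewrite normrN ger0_norm ?(ltW eta_gt0)// => /(_ erefl) h1 /(_ erefl) h2.
  have eta_ge : - eta <= eta by rewrite (le_trans _ (ltW eta_gt0))// oppr_le0 ltW.
  have [|h + fh] := @IVT _ (f s) (- eta) eta 0 eta_ge cf.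
    have a1 : f s (- eta) <= 0.
      have := le_trans (ler_norm _) h1; rewrite -s0E; have := mulr_gt0 M0 s00; lra.
    have a2 : 0 <= f s eta.
      move: h2; rewrite ler_norml => /andP[+ _]; rewrite -s0E; have := mulr_gt0 M0 s00; lra.
    by rewrite ge_min a1 le_max a2 orbT.
  by rewrite in_itv/= -ler_norml => hh; exists h.
have [z zP] := choice ex.
have ze (s : R) : `|s| <= s0 -> `|s| <= eta by move=> hs; exact: le_trans s0eta.
exists m, s0, z; split=> //.
- move=> s hs; have [zs fz] := zP _ hs; apply/(GF _ _ (le0 _ (ze _ hs)) (le0 _ zs)).
  by move/eqP: fz; rewrite mulf_eq0 invr_eq0 (negPf g20) orbF => /eqP.
- move=> s t hs ht; have [zs fs] := zP _ hs; have [zt ft] := zP _ ht.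
  exact: (slope _ _ _ _ (ze _ hs) zs (ze _ ht) zt fs ft).
move=> s h gsh hs hh; have [zs fs] := zP _ hs.
have fh : f s h = 0.
  by rewrite /f (proj1 (GF s h (le0 _ (ze _ hs)) (le0 _ (ze _ hh))) gsh) mul0r.
have := slope _ _ _ _ (ze _ hs) (ze _ hh) (ze _ hs) zs fh fs.
by rewrite subrr mulr0 subr0 normr0 mulr0 normr_le0 subr_eq0 => /eqP.
Qed.

End ImplicitGraph.

(** * The planar trace of a vertically ruled support *)

Section VerticallyRuled.
Context {R : realType}.
Local Notation H := (heis R).
Local Notation HB := (heisBorel R).

Lemma hpoint_eta (x : H) : x = hpoint (hx1 x) (hx2 x) (hx3 x).
Proof. by apply: heisP; rewrite !hpointE. Qed.

Lemma hpoint_coord (a b c a' b' c' : R) (P : R -> Prop) :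
  P (a - a') -> P (b - b') -> P (c - c') ->
  forall l, P ((hpoint a b c) 0 l - (hpoint a' b' c') 0 l).
Proof. by move=> h1 h2 h3; apply: rV3_forall; rewrite !mxE. Qed.

Lemma nbhs_hpoint (a b c : R) (B : set H) : nbhs (hpoint a b c) B ->
  exists2 e, 0 < e & forall a' b' c',
    `|a' - a| <= e -> `|b' - b| <= e -> `|c' - c| <= e -> B (hpoint a' b' c').
Proof.
move=> /near_boxP[e e0 eB]; exists e => // a' b' c' ha hb hc.
have -> : hpoint a' b' c' = hpoint a b c + (hpoint a' b' c' - hpoint a b c) by rewrite addrC subrK.
by apply: eB; apply: rV3_forall; rewrite !mxE.
Qed.

(** On a vertical line membership in [S] is an open condition, because a local defining function
    takes a single value on the part of the line in its domain, and a closed one; the line is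
    connected. *)
Lemma ruled_vtr (S : set H) : closed S -> vertically_ruled S ->
  forall x t, S x -> S (vtr t x).
Proof.
move=> clS rS x t Sx; apply: (@clopen_real _ (fun t => S (vtr t x)) 0) t.
- by rewrite /vtr addr0 -hpoint_eta.
- move=> t St; have [U [u [[oU Up] _ _ uv MU]]] := rS _ St.
  have [e e0 eU] := nbhs_hpoint (open_nbhs_nbhs (conj oU Up)).
  exists e => // s st.
  have Us : U (vtr s x).
    apply: eU; rewrite ?subrr ?normr0 ?(ltW e0)//.
    by rewrite (_ : _ - _ = s - t); [exact: ltW|ring].
  have u0 : u (vtr t x) = 0.
    by have : (S `&` U) (vtr t x) by []; rewrite MU => -[].
  suff : (S `&` U) (vtr s x) by case.
  rewrite MU; split=> //=; rewrite -u0; apply: uv => //; by rewrite /vtr !hpointE.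
move=> t cl; apply: clS => B /nbhs_hpoint[e e0 eB].
have [s st Ss] := cl _ e0; exists (vtr s x); split=> //.
apply: eB; rewrite ?subrr ?normr0 ?(ltW e0)//.
by rewrite (_ : _ - _ = s - t); [exact: ltW|ring].
Qed.

Lemma ruled_linearization (S : set H) (a b : R) : vertically_ruled S -> S (hpoint a b 0) ->
  exists (F : R -> R -> R) (g1 g2 eta0 : R),
    [/\ (g1, g2) <> (0, 0), 0 < eta0,
        forall s h, `|s| <= eta0 -> `|h| <= eta0 -> (S (hpoint (a + s) (b + h) 0) <-> F s h = 0) &
        forall e, 0 < e -> exists2 eta, 0 < eta & forall s h s' h',
          `|s| <= eta -> `|h| <= eta -> `|s'| <= eta -> `|h'| <= eta ->
          `|F s h - F s' h' - (g1 * (s - s') + g2 * (h - h'))| <= e * (`|s - s'| + `|h - h'|)].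
Proof.
move=> rS Sp; have [U [u [[oU Up] C1 g0 uv MU]]] := rS _ Sp.
set p := hpoint a b 0 in Sp Up *.
have nU : nbhs p U by exact: open_nbhs_nbhs.
have dU i : \forall x \near p, derivable u x (delta_mx 0 i).
  by apply: filterS nU => x Ux; apply: diff_derivable; have [] := C1 _ Ux.
have cU i : {for p, continuous (partial u i)}.
  have [_ cg] := C1 _ Up.
  have -> : partial u i = (fun v : H => v 0 i) \o gradient u by apply/funext => x /=; rewrite mxE.
  by apply: continuous_comp; [exact: cg|exact: coord_continuous].
have sd e e0 := @strictly_differentiable R u p e dU cU e0.
have [eta0 eta00 bU] := nbhs_hpoint nU.
(* [u] takes the same value at [p] and slightly above it. The nonvanishing of the gradient is
   thereby left to the first two components, those seen in the horizontal slice. *)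
have g3 : partial u 2 p = 0.
  apply/eqP; rewrite -normr_le0; apply/ler_addgt0Pl => e e0; rewrite addr0.
  have [eta et0 est] := sd e e0.
  pose d := Num.min eta eta0; have d0 : 0 < d by rewrite lt_min et0.
  have nd : `|d| = d by rewrite ger0_norm// ltW.
  have Uz : U (hpoint a b d).
    by apply: bU; rewrite ?subrr ?normr0 ?(ltW eta00)// subr0 nd ge_min lexx orbT.
  have := est (hpoint a b d) p.
  rewrite (uv _ p Uz Up) ?hpointE// subrr sub0r normrN => /(_ _ _).
  have h1 : forall l, `|(hpoint a b d) 0 l - p 0 l| <= eta.
    apply: (hpoint_coord (P := fun r => `|r| <= eta)); rewrite ?subrr ?normr0 ?(ltW et0)//.
    by rewrite subr0 nd ge_min lexx.
  have h2 : forall l, `|p 0 l - p 0 l| <= eta by move=> l; rewrite subrr normr0 ltW.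
  move=> /(_ h1 h2); rewrite !big_ord_recl big_ord0 /norm1 !mxE /=.
  rewrite (_ : lift ord0 (lift ord0 ord0) = 2); last exact/val_inj.
  rewrite !subrr !mulr0 normr0 !add0r addr0 subr0 normrM nd.
  by rewrite ler_pM2r.
pose F s h := u (hpoint (a + s) (b + h) 0).
exists F, (partial u 0 p), (partial u 1 p), eta0; split=> //.
- case=> e1 e2; apply: (g0 p Up); apply/rowP; apply: rV3_forall; rewrite !mxE //.
- move=> s h hs hh.
  have Us : U (hpoint (a + s) (b + h) 0).
    by apply: bU; rewrite ?subrr ?normr0 ?(ltW eta00)// addrC addKr.
  split=> [Ss|Fs].
    by have : (S `&` U) (hpoint (a + s) (b + h) 0) by []; rewrite MU => -[].
  suff : (S `&` U) (hpoint (a + s) (b + h) 0) by case.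
  by rewrite MU.
move=> e e0; have [eta et0 est] := sd e e0; exists eta => // s h s' h' hs hh hs' hh'.
have bx s1 h1 : `|s1| <= eta -> `|h1| <= eta ->
    forall l, `|(hpoint (a + s1) (b + h1) 0) 0 l - p 0 l| <= eta.
  move=> q1 q2; apply: (hpoint_coord (P := fun r => `|r| <= eta));
    by rewrite ?subrr ?normr0 ?(ltW et0)// addrC addKr.
have := est _ _ (bx _ _ hs hh) (bx _ _ hs' hh').
rewrite !big_ord_recl big_ord0 /norm1 !mxE /= -/(F s h) -/(F s' h').
rewrite (_ : lift ord0 ord0 = 1); last exact/val_inj.
rewrite subrr normr0 mulr0 !addr0.
rewrite (_ : a + s - (a + s') = s - s'); last by ring.
by rewrite (_ : b + h - (b + h') = h - h'); last by ring.
Qed.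

Variables (mu : {measure set HB -> \bar R}) (c : R).
Hypotheses (c_gt0 : 0 < c) (mu_neq0 : mu setT <> 0%E).
Hypothesis mu_ball : forall x r, msupport mu x -> 0 < r -> mu (hball x r) = (c * r ^+ 3)%:E.
Hypothesis ruled : vertically_ruled (msupport mu).

Let vert x t : msupport mu x -> msupport mu (vtr t x).
Proof. by apply: ruled_vtr ruled _ _; exact: closed_msupport. Qed.

Let trace (a b : R) : Prop := msupport mu (hpoint a b 0).

Let support_trace z : msupport mu z <-> trace (hx1 z) (hx2 z).
Proof.
have e1 : vtr (- hx3 z) z = hpoint (hx1 z) (hx2 z) 0.
  by rewrite /vtr subrr.
have e2 : vtr (hx3 z) (hpoint (hx1 z) (hx2 z) 0) = z.
  by rewrite -e1 -{1}(opprK (hx3 z)) vtrK.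
split=> [sz|sz]; first by rewrite /trace -e1; exact: vert.
by rewrite -e2; exact: vert.
Qed.

Let trace_closed a b : (forall e, 0 < e ->
  exists x y, [/\ trace x y, `|x - a| < e & `|y - b| < e]) -> trace a b.
Proof.
move=> cl; apply: (@closed_msupport _ mu) => B /nbhs_hpoint[e e0 eB].
have [x [y [xy hx hy]]] := cl _ e0; exists (hpoint x y 0); split=> //.
by apply: eB; rewrite ?subrr ?normr0 ltW.
Qed.

Let disc a b r : set HB := slab `&` [set y | hsq (hpoint a b 0) y <= r ^+ 2] `&` msupport mu.

Let measurable_disc a b r : measurable (disc a b r).
Proof. by apply: measurableI; [exact: measurable_slab_disc|exact: measurable_msupport]. Qed.

Let disc_mass : exists2 k : R, 0 < k & forall a b r, trace a b -> 0 < r ->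
  mu (disc a b r) = (k * r)%:E.
Proof.
have [k k0 kE] := slab_disc c_gt0 mu_neq0 mu_ball vert; exists k => // a b r ab r0.
by rewrite -(kE _ _ ab r0) (measure_msupportI mu (measurable_slab_disc _ _)).
Qed.

Let hsqE a b (z : H) : hsq (hpoint a b 0) z = dsq a b (hx1 z) (hx2 z).
Proof. by rewrite /hsq /dsq !hpointE. Qed.

Let disc_apart a b r a' b' r' : apart trace a b r a' b' r' -> disc a b r `&` disc a' b' r' = set0.
Proof.
move=> ap; apply/seteqP; split=> // z [[[_ /=]]]; rewrite hsqE => h sz [[_ /=]].
by rewrite hsqE => h' _; exact: (ap _ _ (proj1 (support_trace z) sz) h h').
Qed.

Let disc_inside a b r a' b' r' : inside trace a b r a' b' r' -> disc a b r `<=` disc a' b' r'.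
Proof.
move=> ins z [[sl /=]]; rewrite hsqE => h sz; split=> //; split=> //=; rewrite hsqE.
exact: (ins _ _ (proj1 (support_trace z) sz) h).
Qed.

Let trace_packing2 : packing2 trace.
Proof.
have [k k0 kE] := disc_mass.
move=> a b r a1 b1 r1 a2 b2 r2 g0 g1 g2 r0 r10 r20 ap i1 i2.
have m1 := measurable_disc a1 b1 r1; have m2 := measurable_disc a2 b2 r2.
have : (mu (disc a1 b1 r1 `|` disc a2 b2 r2) <= mu (disc a b r))%E.
  apply: le_measure; rewrite ?inE; [exact: measurableU|exact: measurable_disc|].
  by move=> z [|]; exact: disc_inside.
have e : mu (disc a1 b1 r1 `|` disc a2 b2 r2) = (mu (disc a1 b1 r1) + mu (disc a2 b2 r2))%E.
  by apply: measureU => //; exact: disc_apart.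
rewrite e !kE// -EFinD lee_fin -mulrDr.
by rewrite ler_pM2l.
Qed.

Let trace_packing3 : packing3 trace.
Proof.
have [k k0 kE] := disc_mass.
move=> a b r a1 b1 r1 a2 b2 r2 a3 b3 r3 g0 g1 g2 g3 r0 r10 r20 r30 a12 a13 a23 i1 i2 i3.
have m1 := measurable_disc a1 b1 r1; have m2 := measurable_disc a2 b2 r2.
have m3 := measurable_disc a3 b3 r3; have m12 := measurableU _ _ m1 m2.
have e12 : mu (disc a1 b1 r1 `|` disc a2 b2 r2) = (mu (disc a1 b1 r1) + mu (disc a2 b2 r2))%E.
  by apply: measureU => //; exact: disc_apart.
have d : (disc a1 b1 r1 `|` disc a2 b2 r2) `&` disc a3 b3 r3 = set0.
  by rewrite setIUl (disc_apart a13) (disc_apart a23) setU0.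
have : (mu ((disc a1 b1 r1 `|` disc a2 b2 r2) `|` disc a3 b3 r3) <= mu (disc a b r))%E.
  apply: le_measure; rewrite ?inE; [exact: measurableU|exact: measurable_disc|].
  by move=> z [[|]|]; exact: disc_inside.
have e : mu ((disc a1 b1 r1 `|` disc a2 b2 r2) `|` disc a3 b3 r3) =
    (mu (disc a1 b1 r1 `|` disc a2 b2 r2) + mu (disc a3 b3 r3))%E.
  exact: measureU.
rewrite e e12 !kE// -!EFinD lee_fin -!mulrDr.
by rewrite ler_pM2l.
Qed.

(** The trace is a graph over one of the two axes, according to which partial derivative is nonzero;
    exchanging the coordinates reduces the second case to the first. *)
Let trace_segment a b : trace a b ->
  exists v1 v2 d, local_segment (fun x y => trace (a + x) (b + y)) v1 v2 d.
Proof.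
move=> ab; have [F [g1 [g2 [eta0 [g0 eta00 GF est]]]]] := ruled_linearization ruled ab.
have G00 : trace (a + 0) (b + 0) by rewrite !addr0.
have P : packing2 (fun x y => trace (a + x) (b + y)) by exact: packing2_translate trace_packing2.
have [g2E|g20] := eqVneq g2 0; last first.
  have [m [s0 [z lg]]] := @implicit_graph _ (fun x y => trace (a + x) (b + y)) _ _ _ _ g20 G00 eta00 GF est.
  by have [k [d ls]] := graph_segment P G00 lg; exists 1, k, d.
have g10 : g1 != 0 by apply/eqP => g1E; apply: g0; rewrite g1E g2E.
have est' e : 0 < e -> exists2 eta, 0 < eta & forall s h s' h',
    `|s| <= eta -> `|h| <= eta -> `|s'| <= eta -> `|h'| <= eta ->
    `|F h s - F h' s' - (g2 * (s - s') + g1 * (h - h'))| <= e * (`|s - s'| + `|h - h'|).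
  move=> e0; have [eta et0 h] := est e e0; exists eta => // s t s' t' q1 q2 q3 q4.
  by rewrite [g2 * _ + _]addrC [X in e * X]addrC; exact: h.
have GF' s h : `|s| <= eta0 -> `|h| <= eta0 -> (trace (a + h) (b + s) <-> F h s = 0).
  by move=> hs hh; exact: GF.
have [m [s0 [z lg]]] := @implicit_graph _ (fun y x => trace (a + x) (b + y)) (fun s h => F h s) _ _ _ g10 G00 eta00 GF' est'.
have [k [d ls]] := graph_segment (packing2_transpose P) G00 lg.
by exists k, 1, d; exact: local_segment_transpose.
Qed.

Lemma ruled_support_plane : exists a b q : R, (a, b) <> (0, 0) /\
  msupport mu = [set x | a * hx1 x + b * hx2 x = q].
Proof.
have [x /support_trace sx] := msupport_neq0 mu_neq0.
have [v1 [v2 [v0 vE]]] := plane_line trace_closed trace_packing3 trace_segment sx.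
exists v2, (- v1), (v2 * hx1 x - v1 * hx2 x); split.
  by case=> e1 e2; apply: v0; rewrite e1 -(opprK v1) e2 oppr0.
apply/seteqP; split=> z /=.
  by move=> /support_trace/vE; lra.
by move=> h; apply/support_trace/vE; move: h; lra.
Qed.

End VerticallyRuled.

(** * Similarities of a vertical plane *)

Section PlaneSimilarities.
Context {R : realType}.
Local Notation H := (heis R).

Definition hdil (r : R) (x : H) : H := hpoint (r * hx1 x) (r * hx2 x) (r ^+ 2 * hx3 x).

(** A left translation takes [x] to the origin, a dilation scales distances by [r], and a left
    translation takes the origin to [y]. A vertical plane through both points is preserved for
    nonzero [r], see [hsim_plane]. *)
Definition hsim (x y : H) (r : R) (z : H) : H := hmul y (hdil r (hmul (hinv x) z)).

Lemma hdist_hdil (r : R) (w w' : H) : 0 <= r -> hdist (hdil r w) (hdil r w') = r * hdist w w'.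
Proof.
move=> r0; have e : hdist (hdil r w) (hdil r w') ^+ 4 = (r * hdist w w') ^+ 4.
  rewrite exprMn !hdistX4 /hdil !hpointE.
  by move: (hx1 w) (hx2 w) (hx3 w) (hx1 w') (hx2 w') (hx3 w') => *; ring.
have p1 := hdist_ge0 (hdil r w) (hdil r w'); have p2 := mulr_ge0 r0 (hdist_ge0 w w').
by apply/eqP; rewrite eq_le; apply/andP; split; apply: ler_X4; rewrite // e lexx.
Qed.

Lemma hdist_hsim x y r z z' : 0 <= r -> hdist (hsim x y r z) (hsim x y r z') = r * hdist z z'.
Proof. by move=> r0; rewrite /hsim hdist_mull hdist_hdil// hdist_mull. Qed.

Lemma hsimK x y r : r != 0 -> cancel (hsim x y r) (hsim y x r^-1).
Proof.
move=> r0 z; have dilK w : hdil r^-1 (hdil r w) = w.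
  by apply: heisP; rewrite /hdil !hpointE ?mulKf// exprVn mulKf// expf_neq0.
rewrite /hsim (hmulA _ y) hmulVx hmul1x dilK.
by apply: heisP; rewrite /hmul /hinv !hpointE; ring.
Qed.

Lemma hsim_center x y r : hsim x y r x = y.
Proof. by apply: heisP; rewrite /hsim /hdil /hmul /hinv !hpointE; ring. Qed.

Lemma hsim_plane a b q x y r z : r != 0 ->
  a * hx1 x + b * hx2 x = q -> a * hx1 y + b * hx2 y = q ->
  (a * hx1 (hsim x y r z) + b * hx2 (hsim x y r z) = q <-> a * hx1 z + b * hx2 z = q).
Proof.
move=> r0 ex ey; have -> : a * hx1 (hsim x y r z) + b * hx2 (hsim x y r z) =
    q + r * (a * hx1 z + b * hx2 z - q).
  by rewrite -{1}ey -ex /hsim /hdil /hmul /hinv !hpointE; ring.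
split=> [/eqP|->]; last by rewrite subrr mulr0 addr0.
by rewrite -subr_eq0 (addrC q) addrK mulf_eq0 (negPf r0)/= subr_eq0 => /eqP.
Qed.

End PlaneSimilarities.

Theorem theorem1p5 (R : realType)
    (mu : {measure set (heisBorel R) -> \bar R}) :
  uniform_measure 3 mu ->
  (analytic_variety (msupport mu) /\ variety_dim (msupport mu) 2) /\
  (analytic_surface (msupport mu) -> vertically_ruled (msupport mu) ->
    exists W : set (heis R), affine_vertical_plane W /\
      exists2 c : R, 0 < c &
        forall A : set (heisBorel R), measurable A ->
          mu A = (c%:E * spherical_hausdorff 3 (A `&` W))%E).
Proof.
case=> mu_neq0 [c c_gt0 mu_ball'].
have mu_ball x r : msupport mu x -> 0 < r -> mu (hball x r) = (c * r ^+ 3)%:E.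
  by move=> sx r0; rewrite mu_ball'// powR_mulrn// ltW.
have [x0 sx0] := msupport_neq0 mu_neq0.
split.
  by split; [exact: (support_analytic c_gt0 mu_ball sx0)|exact: (support_variety_dim c_gt0 mu_neq0 mu_ball)].
move=> _ ruled; exists (msupport mu).
have [a [b [q [ab0 WE]]]] := ruled_support_plane c_gt0 mu_neq0 mu_ball ruled.
split; first by apply/affine_vertical_planeP; exists a, b, q.
apply: (proportional_spherical c_gt0 mu_neq0 mu_ball) => x y r sx sy r0.
have rn : r != 0 by rewrite gt_eqF.
exists (hsim x y r), (hsim y x r^-1); split.
- exact: hsimK.
- by have := @hsimK _ y x r^-1; rewrite invrK invr_eq0; apply.
- exact: hsim_center.
- by move=> z z'; rewrite hdist_hsim// ltW.
- by move: sx sy; rewrite WE /= => sx sy z; exact: hsim_plane.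
Qed.
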